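(* Suppose $E\subset \mathbb{R}^2$ is a set of finite perimeter. Then for any $\epsilon>0$ there exists a closed subset $\mathbb{E}\subset E$ with finitely many indecomposable components such that $H^1(\partial^M \mathbb{E}\setminus \partial^M E)=0$ and $$\|\chi_E-\chi_{\mathbb{E}}\|_{BV(\mathbb{R}^2)}<\epsilon .$$
   Context: $\chi_A$ denotes the characteristic function of $A$, $|A|$ Lebesgue measure, $H^1$ one-dimensional Hausdorff measure, $B_r(x)$ the ball of radius $r$ centred at $x$. The norm is $\|u\|_{BV(\mathbb{R}^2)}=\|u\|_{L^1(\mathbb{R}^2)}+|Du|(\mathbb{R}^2)$. A measurable set $E\subset\mathbb{R}^2$ is of finite perimeter if $\mathrm{Per}(E):=\sup\{\int_E \mathrm{div}\,\phi : \phi\in [C^1_c(\mathbb{R}^2)]^2,\ \|\phi\|_\infty\le 1\}<\infty$. The measure theoretic boundary is $$\partial^M E:=\left\{x:\limsup_{r\to 0}\frac{|E\cap B_r(x)|}{|B_r(x)|}>0 \text{ and } \limsup_{r\to 0}\frac{|E^c\cap B_r(x)|}{|B_r(x)|}>0\right\}.$$ A set $E$ of finite perimeter is indecomposable if whenever $A,B\subset E$ are disjoint with $E=A\cup B$ and $\mathrm{Per}(E)=\mathrm{Per}(A)+\mathrm{Per}(B)$, then $|A|=0$ or $|B|=0$. The indecomposable components of a set $E$ of finite perimeter are the members of the (unique up to null sets) at most countable family of pairwise disjoint indecomposable sets $E_i$ with $|E_i|>0$, $|E\,\triangle\,\bigcup_i E_i|=0$, $\mathrm{Per}(E)=\sum_i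 \mathrm{Per}(E_i)$, and such that every indecomposable subset of $E$ is contained, up to a null set, in some $E_i$.
   Formalization: The inclusion of the closed set in E holds only up to a Lebesgue-null set (the pointwise claim fails for an open disc), and in the definition of components the clause on indecomposable subsets concerns only subsets of positive measure (otherwise null sets have no component family). *)

(* Defs.v *)
From HB Require Import structures.
From mathcomp Require Import all_boot all_order all_algebra.
From mathcomp Require Import all_classical all_reals all_analysis.

Set Implicit Arguments.
Unset Strict Implicit.
Unset Printing Implicit Defensive.
Import Order.TTheory GRing.Theory Num.Theory.
Import numFieldNormedType.Exports.

Local Open Scope classical_set_scope.
Local Open Scope ring_scope.

(* The plane is R * R.  Its library norm is the sup norm, which induces the
   usual topology and differential calculus; the Euclidean norm is [enorm]. *)
Section Plane.
Context {R : realType}.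

Definition enorm (x : R * R) : R := Num.sqrt (x.1 ^+ 2 + x.2 ^+ 2).

Definition eball (x : R * R) (r : R) : set (R * R) :=
  [set y | enorm (y - x) < r].

Definition borel_leb2 :
    {measure set (measurableTypeR R * measurableTypeR R) -> \bar R} :=
  (lebesgue_measure \x lebesgue_measure)%E.

(* [R * R] with the sigma-algebra of Lebesgue measurable sets *)
Definition lebplane := caratheodory_type (borel_leb2^*)%mu.

Definition leb2 : {measure set lebplane -> \bar R} :=
  @completed_measure_extension _ _ _ borel_leb2.

Definition lebesgue_measurable (A : set (R * R)) : Prop :=
  measurable (A : set lebplane).

Definition C1c (phi : R * R -> R * R) : Prop :=
  [/\ forall x, differentiable phi x,
      forall v, continuous ('D_v phi) &
      compact (closure [set x | phi x != 0])].

Definition divergence (phi : R * R -> R * R) (x : R * R) : R :=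
  ('D_(1, 0) phi x).1 + ('D_(0, 1) phi x).2.

Definition test_fields : set (R * R -> R * R) :=
  [set phi | C1c phi /\ forall x, enorm (phi x) <= 1].

Local Open Scope ereal_scope.

Definition Per (E : set (R * R)) : \bar R :=
  ereal_sup [set \int[leb2]_(x in E) (divergence phi x)%:E
            | phi in test_fields].

(* |Du|(R^2) *)
Definition total_var (u : R * R -> R) : \bar R :=
  ereal_sup [set \int[leb2]_x (u x * divergence phi x)%:E
            | phi in test_fields].

Definition BVnorm (u : R * R -> R) : \bar R :=
  \int[leb2]_x (`|u x|%R)%:E + total_var u.

Definition finite_perimeter (E : set (R * R)) : Prop :=
  lebesgue_measurable E /\ Per E < +oo.

Definition upper_density (E : set (R * R)) (x : R * R) : \bar R :=
  limf_esup (fun r : R => leb2 (E `&` eball x r) / leb2 (eball x r)) 0^'+.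

Definition mt_boundary (E : set (R * R)) : set (R * R) :=
  [set x | 0 < upper_density E x /\ 0 < upper_density (~` E) x].

(* the maximum with 0 gives the empty set diameter 0 rather than -oo *)
Definition ediam (A : set (R * R)) : \bar R :=
  maxe 0 (ereal_sup [set (enorm (p.1 - p.2)%R)%:E | p in A `*` A]).

Definition hausdorff1_pre (d : R) (A : set (R * R)) : \bar R :=
  ereal_inf [set \sum_(i <oo) ediam (C i)
            | C in [set C : (set (R * R))^nat |
                    A `<=` \bigcup_i C i /\ forall i, ediam (C i) <= d%:E]].

Definition hausdorff1 (A : set (R * R)) : \bar R :=
  ereal_sup [set hausdorff1_pre d A | d in [set d : R | (0 < d)%R]].

Definition indecomposable (E : set (R * R)) : Prop :=
  finite_perimeter E /\
  forall A B : set (R * R),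
    lebesgue_measurable A -> lebesgue_measurable B ->
    A `&` B = set0 -> E = A `|` B -> Per E = Per A + Per B ->
    leb2 A = 0 \/ leb2 B = 0.

(* In the maximality clause, null sets G are excluded: they are vacuously
   indecomposable, and when E is null its family of components is empty. *)
Definition indecomposable_components (E : set (R * R))
    (I : set nat) (C : (set (R * R))^nat) : Prop :=
  finite_perimeter E /\
  [/\ forall i, I i -> indecomposable (C i) /\ 0 < leb2 (C i),
      trivIset I C,
      leb2 (E `+` \bigcup_(i in I) C i) = 0,
      Per E = \esum_(i in I) Per (C i) &
      forall G, indecomposable G -> G `<=` E -> 0 < leb2 G ->
        exists2 i, I i & leb2 (G `\` C i) = 0].

Definition finitely_many_components (E : set (R * R)) : Prop :=
  exists I C, indecomposable_components E I C /\ finite_set I.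

End Plane.

(* Main.v *)
Require Import Defs.
From HB Require Import structures.
From mathcomp Require Import all_boot all_order all_algebra.
From mathcomp Require Import all_classical all_reals all_analysis.
From mathcomp Require Import measurable_realfun ring lra.
Import Order.TTheory GRing.Theory Num.Theory.
Import numFieldNormedType.Exports.
Local Open Scope classical_set_scope.
Local Open Scope ring_scope.

(** Call [A], contained in [E], a piece when [Per A + Per (E \ A) <= Per E].
    Submodularity and lower semicontinuity of the perimeter make pieces a
    family closed under Boolean operations and monotone limits, and the
    isoperimetric inequality bounds from below the perimeter of a piece of
    given area; hence every non-null piece contains an indecomposable one.
    Removing greedily indecomposable pieces of nearly maximal perimeter leaves
    a residue whose area and perimeter tend to [0], so the union [F] of
    finitely many pieces is [BV]-close to [E].

    Indecomposable sets may be taken closed: almost every point outside such a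
    set [C] and off a null neighbourhood lies in a small rectangle whose sides
    almost miss [C], because on almost every line [C] has finite variation;
    cutting [C] along the rectangle costs no perimeter, so the rectangle
    contains almost nothing of [C].

    For the condition on [H^1]: at a boundary point of [F] where the complement
    of [E] has density [0], [F] has variation at least [c r] on small squares of
    side [r]. Replacing a nearly optimal field for [E] on disjoint such squares
    by nearly optimal fields for [F] shows that the sum of the [r] is at most
    the error made, and Vitali's covering lemma concludes. *)

Set Implicit Arguments.
Unset Strict Implicit.
Unset Printing Implicit Defensive.

(** No fine structure of sets of finite perimeter (coarea formula, reduced boundary, rectifiability)
    is used. Perimeter enters only through integrals [J] of an indicator against divergences of test
    fields, and the decisive estimates exhibit a competing field, a convex combination of given
    ones, so that the Euclidean bound survives. Submodularity, usually read off the coarea formula,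
    is such an exchange. Perimeter and area are linked by the translation estimate |{z in A : z + h
    not in A}| <= |h| Per(A): integrated over h it yields a local isoperimetric inequality, and for
    horizontal h it gives almost every slice finite variation. Two obstacles shape the argument. The
    area of E may be infinite, so the isoperimetric inequality is a dichotomy between a set and its
    complement, and an indecomposable piece of a decomposable set is sought in a part of finite
    area. And the measure theoretic boundary is defined by upper densities, so that a set and its
    complement may be seen at different radii; a common radius must be found before the local
    inequality applies. *)

Section PlaneMeasure.
Context {R : realType}.
Local Notation T := (measurableTypeR R).
Local Notation P := (T * T)%type.
Local Notation leb1 := (@lebesgue_measure R).

(** * Planar Lebesgue measure: the Borel product measure and its completion *)

Definition lam2 : set P -> \bar R := (leb1 \x leb1)%E.

Lemma small_inv (e : R) : 0 < e -> exists n : nat, n.+1%:R^-1 < e.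
Proof.
move=> e0; exists (Num.truncn e^-1).
by rewrite invf_plt ?posrE// Num.Theory.truncnS_gt.
Qed.

Lemma lam2_sigma_finite : sigma_finite setT lam2.
Proof.
have /sigma_finiteP[F [TF ndF Foo]] := sigma_finiteT leb1.
exists (fun n => F n `*` F n).
  rewrite -setXTT TF predeqE => -[x y]; split.
    move=> [/= [n _ Fnx] [k _ Gky]]; exists (maxn n k) => //; split.
    - by move: x Fnx; exact/subsetPset/ndF/leq_maxl.
    - by move: y Gky; exact/subsetPset/ndF/leq_maxr.
  by move=> [n _ []/= ? ?]; split; exists n.
move=> k; have [? ?] := Foo k.
split; first exact: measurableX.
by rewrite /lam2 product_measure1E// lte_mul_pinfty// ge0_fin_numE.
Qed.

HB.instance Definition _ := Measure.on lam2.
HB.instance Definition _ := Measure_isSigmaFinite.Build _ _ _ lam2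
  lam2_sigma_finite.

Lemma lam2X (A B : set T) : measurable A -> measurable B ->
  lam2 (A `*` B) = (leb1 A * leb1 B)%E.
Proof. by move=> mA mB; rewrite /lam2 product_measure1E. Qed.

Lemma leb1_translate (t : R) (A : set T) : measurable A ->
  leb1 ((fun x => x + t) @^-1` A) = leb1 A.
Proof.
move=> mA.
have mt : measurable_fun setT ((fun x => x + t) : T -> T).
  exact: measurable_funD.
suff -> : leb1 A = pushforward leb1 ((fun x => x + t) : T -> T) A by [].
apply: lebesgue_measure_unique => // X [[a b] /= ab <-].
rewrite /pushforward.
have -> : ((fun x => x + t) : T -> T) @^-1` `]a, b]%classic =
    `]a - t, b - t]%classic.
  by apply/seteqP; split => x /=; rewrite !in_itv/= ltrBlDr lerBrDr.
rewrite !lebesgue_measure_itv/= !lte_fin ltrD2r.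
by case: ifPn => // _; rewrite -!EFinB; congr (_%:E); ring.
Qed.

Lemma measurable_fun_translate2 (t : R * R) :
  measurable_fun setT ((fun z : P => (z + t : P)) : P -> P).
Proof.
apply/measurable_fun_pairP; split.
  rewrite (_ : fst \o _ = (fun z : P => (z.1 + t.1 : R)))//.
  by apply: measurable_funD => //; exact: measurable_fst.
rewrite (_ : snd \o _ = (fun z : P => (z.2 + t.2 : R)))//.
by apply: measurable_funD => //; exact: measurable_snd.
Qed.

Lemma lam2_translate (t : R * R) (A : set P) : measurable A ->
  lam2 ((fun z : P => (z + t : P)) @^-1` A) = lam2 A.
Proof.
move=> mA; have mt := measurable_fun_translate2 t.
suff -> : lam2 A = pushforward lam2 (fun z : P => (z + t : P)) A by [].
rewrite {1}/lam2; apply: product_measure_unique => // B C mB mC.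
change (lam2 (((fun x : T => x + t.1 : T) @^-1` B) `*`
  ((fun x : T => x + t.2 : T) @^-1` C)) = (leb1 B * leb1 C)%E).
rewrite lam2X ?leb1_translate//.
  by rewrite -[X in measurable X]setTI; exact: (measurable_funD).
by rewrite -[X in measurable X]setTI; exact: (measurable_funD).
Qed.

Lemma measurable_swap_pair : measurable_fun setT (@swap_pair R R : P -> P).
Proof.
by apply/measurable_fun_pairP; split;
  [exact: measurable_snd|exact: measurable_fst].
Qed.

Lemma lam2_swap (A : set P) : measurable A ->
  lam2 ((@swap_pair R R : P -> P) @^-1` A) = lam2 A.
Proof.
move=> mA; have mt := measurable_swap_pair.
suff -> : lam2 A = pushforward lam2 (@swap_pair R R : P -> P) A by [].
rewrite {1}/lam2; apply: product_measure_unique => // B C mB mC.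
rewrite /pushforward.
transitivity (lam2 (C `*` B)); last by rewrite lam2X// muleC.
by congr (lam2 _); apply/seteqP; split => -[x y] [].
Qed.

Lemma leb2_borel (A : set P) : measurable A -> leb2 A = lam2 A.
Proof. by move=> mA; exact: (measurable_mu_extE borel_leb2 mA). Qed.

Lemma borel_lebesgue (A : set P) : measurable A -> lebesgue_measurable A.
Proof. by move=> mA; exact: caratheodory_measurable_mu_ext. Qed.

Lemma le_leb2 (A B : set (R * R)) : A `<=` B -> (leb2 A <= leb2 B)%E.
Proof. by move=> AB; exact: (le_outer_measure (borel_leb2^*)%mu A B AB). Qed.

Lemma leb2U (A B : set (R * R)) : (leb2 (A `|` B) <= leb2 A + leb2 B)%E.
Proof. exact: (outer_measureU2 (borel_leb2^*)%mu A B). Qed.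

Lemma leb2_bigcup0 (A : (set (R * R))^nat) : (forall n, leb2 (A n) = 0)%E ->
  leb2 (\bigcup_n A n) = 0%E.
Proof.
move=> A0; apply/eqP; rewrite eq_le measure_ge0 andbT.
apply: le_trans (outer_measure_sigma_subadditive (borel_leb2^*)%mu A) _.
by rewrite eseries0// => n _ _; exact: A0.
Qed.

Lemma null_lebesgue (A : set (R * R)) : leb2 A = 0%E -> lebesgue_measurable A.
Proof.
move=> A0; apply: le_caratheodory_measurable => /= X.
rewrite (_ : (borel_leb2^*)%mu (X `&` A) = 0%E) ?add0e.
  by apply: le_outer_measure; exact: subIsetl.
apply/eqP; rewrite eq_le outer_measure_ge0 andbT -A0.
by apply: le_outer_measure; exact: subIsetr.
Qed.

(** The outer measure is an infimum over countable Borel covers; intersecting covers that are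
    optimal up to [1/(n+1)] attains it. If it is infinite, the whole plane serves. *)
Lemma borel_cover (A : set (R * R)) :
  exists B : set P, [/\ measurable B, A `<=` B & leb2 B = leb2 A].
Proof.
have [Aoo|Afin] := eqVneq (leb2 A) +oo%E.
  exists setT; split => //; apply/eqP; rewrite Aoo -leye_eq -Aoo; exact: le_leb2.
have {}Afin : (leb2 A \is a fin_num)%E.
  by rewrite ge0_fin_numE ?measure_ge0// ltey.
have H (n : nat) : exists B : set P, [/\ measurable B, A `<=` B &
    (leb2 B <= leb2 A + (n.+1%:R^-1)%:E)%E].
  have n0 : 0 < n.+1%:R^-1 :> R by rewrite invr_gt0.
  have [_ [F [mF AF] <-] lF] := lb_ereal_inf_adherent n0 Afin.
  exists (\bigcup_i F i); split => //.
    by apply: bigcupT_measurable.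
  apply: le_trans (ltW lF).
  rewrite leb2_borel; last exact: bigcupT_measurable.
  apply: le_trans (measure_sigma_subadditive lam2 _ _ (@subset_refl _ _)) _ => //.
  exact: bigcupT_measurable.
pose B n := sval (cid (H n)).
have BP n := svalP (cid (H n)).
exists (\bigcap_n B n); split.
- by apply: bigcapT_measurable => n; case: (BP n).
- by move=> x Ax n _; case: (BP n) => _ + _; exact.
- apply/eqP; rewrite eq_le; apply/andP; split; last first.
    by apply: le_leb2 => x Ax n _; case: (BP n) => _ + _; exact.
  apply/lee_addgt0Pr => e e0.
  have [n hn'] := small_inv e0.
  have [_ _ hn] := BP n.
  have : (leb2 (\bigcap_n B n) <= leb2 (B n))%E by apply: le_leb2 => x; exact.
  move=> /le_trans; apply; apply: (le_trans hn); rewrite leeD2l// lee_fin; exact: ltW.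
Qed.

(** Equal measures give a null difference only when they are finite, so E is first cut by sets of
    finite measure and each part is covered separately. *)
Lemma borel_rep (E : set (R * R)) : lebesgue_measurable E ->
  exists B : set P, [/\ measurable B, E `<=` B & leb2 (B `\` E) = 0%E].
Proof.
move=> mE.
have /sigma_finiteP[F [TF ndF Foo]] := lam2_sigma_finite.
pose B n := sval (cid (borel_cover (E `&` F n))).
have BP n := svalP (cid (borel_cover (E `&` F n))).
exists (\bigcup_n B n); split.
- by apply: bigcupT_measurable => n; case: (BP n).
- move=> x Ex; have : setT x by [].
  by rewrite TF => -[n _ Fn]; exists n => //; case: (BP n) => _ + _; exact.
- apply/eqP; rewrite eq_le measure_ge0 andbT.
  rewrite -(leb2_bigcup0 (A := fun n => B n `\` (E `&` F n))).
    by apply: le_leb2 => x [[n _ Bn] nE]; exists n => //; split => // -[].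
  move=> n; have [mB EB e] := BP n.
  have mEF : measurable (E `&` F n : set lebplane).
    by apply: measurableI => //; apply: borel_lebesgue; case: (Foo n).
  have fin : (leb2 (E `&` F n) < +oo)%E.
    apply: (@le_lt_trans _ _ (leb2 (F n))); first by apply: le_leb2; exact: subIsetr.
    by rewrite leb2_borel; case: (Foo n).
  have mB' : measurable (B n : set lebplane) by exact: borel_lebesgue.
  have e' : leb2 (B n) = leb2 (E `&` F n) := e.
  have lt : (leb2 (B n) < +oo)%E by rewrite e'.
  have h := measureD mB' mEF lt; rewrite [LHS]h (setIidr EB) [X in (X - _)%E]e'.
  by apply: subee; rewrite ge0_fin_numE.
Qed.

End PlaneMeasure.

(** * Integrals of bounded Borel functions with bounded support *)

Section PlaneIntegral.
Context {R : realType}.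
Local Notation T := (measurableTypeR R).
Local Notation P := (T * T)%type.
Local Notation leb1 := (@lebesgue_measure R).
Local Notation lam2 := (@lam2 R).

Definition J (f : P -> R) : R := Rintegral lam2 setT f.

Definition in_box (M : R) (z : R * R) := `|z.1| <= M /\ `|z.2| <= M.

(** One constant bounds both the values and the support. Integrands are kept in this class because
    it is stable under linear combinations, products with bounded measurable functions and
    translations, and makes integrability automatic. *)
Definition bcs (f : P -> R) : Prop := measurable_fun setT f /\
  exists M : R, (forall z, `|f z| <= M) /\ forall z, f z != 0 -> in_box M z.

Lemma integrable_bounded_supp d (X : measurableType d)
    (mu : {measure set X -> \bar R}) (f : X -> R) (A : set X) (M : R) :
  measurable_fun setT f -> measurable A -> (mu A < +oo)%E ->
  (forall z, `|f z| <= M) -> (forall z, f z != 0 -> A z) ->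
  mu.-integrable setT (EFin \o f).
Proof.
move=> mf mA Aoo fM fA.
have M0 (z : X) : 0 <= M by rewrite (le_trans _ (fM z)).
apply: (@le_integrable _ _ _ mu setT measurableT _ (EFin \o (fun z => M * \1_A z))).
- exact/measurable_EFinP.
- move=> z _ /=; rewrite lee_fin [X in _ <= X]ger0_norm ?mulr_ge0 ?(M0 z)//.
  rewrite indicE; have [Az|Az] := boolP (z \in A); first by rewrite mulr1; exact: fM.
  rewrite mulr0 normr_le0; apply: contraNT Az => /fA; exact: mem_set.
- rewrite (_ : _ \o _ = (fun z => M%:E * (\1_A z)%:E)%E); last first.
    by apply/funext => z /=; rewrite EFinM.
  apply: integrableZl => //; apply/integrableP; split.
    exact/measurable_EFinP.
  rewrite (eq_integral (fun x => (\1_A x)%:E)); last first.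
    by move=> t _; rewrite gee0_abs// lee_fin.
  by rewrite integral_indic// setIT.
Qed.

Lemma leb1_itv_lty (a b : R) : (leb1 `[a, b]%classic < +oo)%E.
Proof.
by rewrite lebesgue_measure_itv /=; case: ifPn => // _; rewrite -EFinB ltry.
Qed.

Definition box (M : R) : set P := `[- M, M]%classic `*` `[- M, M]%classic.

Lemma lam2_box (M : R) : (lam2 (box M) < +oo)%E.
Proof.
rewrite lam2X// !lebesgue_measure_itv /=.
by case: ifPn => _; rewrite ?mule0// -EFinB -EFinM ltry.
Qed.

Lemma bcs_integrable f : bcs f -> lam2.-integrable setT (EFin \o f).
Proof.
move=> [mf [M [fM f0]]].
apply: (@integrable_bounded_supp _ _ lam2 f (box M) M) => //.
- exact: measurableX.
- exact: lam2_box.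
- by move=> z /f0[h1 h2]; split; rewrite /= in_itv/= -ler_norml.
Qed.

Lemma in_box_le M N z : M <= N -> in_box M z -> in_box N z.
Proof. by move=> MN [h1 h2]; split; exact: le_trans MN. Qed.

Lemma bcsD f g : bcs f -> bcs g -> bcs (fun z => f z + g z).
Proof.
move=> [mf [M [fM f0]]] [mg [N [gN g0]]]; split; first exact: measurable_funD.
have M0 : 0 <= M by rewrite (le_trans _ (fM (0, 0))).
have N0 : 0 <= N by exact: le_trans (normr_ge0 _) (gN (0, 0)).
exists (M + N); split => [z|z fg].
  by apply: le_trans (ler_normD _ _) _; exact: lerD.
have [fz|fz] := eqVneq (f z) 0; last first.
  by apply: in_box_le (f0 _ fz); rewrite lerDl.
have [gz|gz] := eqVneq (g z) 0; first by rewrite fz gz addr0 eqxx in fg.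
by apply: in_box_le (g0 _ gz); rewrite lerDr.
Qed.

Lemma bcsMl f (g : P -> R) (K : R) : bcs f -> measurable_fun setT g -> (forall z, `|g z| <= K) ->
  bcs (fun z => g z * f z).
Proof.
move=> [mf [M [fM f0]]] mg gK; split; first exact: measurable_funM.
have M0 : 0 <= M by rewrite (le_trans _ (fM (0, 0))).
have K0 : 0 <= K by exact: le_trans (normr_ge0 _) (gK (0, 0)).
exists (M + K * M); split => [z|z].
  rewrite normrM; apply: (@le_trans _ _ (K * M)); last by rewrite lerDr.
  by apply: ler_pM.
rewrite mulf_eq0 negb_or => /andP[_ /f0]; apply: in_box_le.
by rewrite lerDl mulr_ge0.
Qed.

Lemma bcsZ f k : bcs f -> bcs (fun z => k * f z).
Proof. by move=> bf; apply: (@bcsMl _ (fun=> k) `|k|) => //; exact: measurable_cst. Qed.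

Lemma bcsN f : bcs f -> bcs (fun z => - f z).
Proof.
move=> /(@bcsZ _ (-1)); rewrite (_ : (fun z => -1 * f z) = (fun z => - f z))//.
by apply/funext => z; rewrite mulN1r.
Qed.

Lemma bcsB f g : bcs f -> bcs g -> bcs (fun z => f z - g z).
Proof. by move=> bf bg; apply: bcsD => //; exact: bcsN. Qed.

Lemma bcs_norm f : bcs f -> bcs (fun z => `|f z|).
Proof.
move=> [mf [M [fM f0]]]; split; first exact: measurableT_comp.
exists M; split => [z|z]; first by rewrite normr_id.
by rewrite normr_eq0; exact: f0.
Qed.

Lemma bcsI (A : set P) f : measurable A -> bcs f -> bcs (fun z => \1_A z * f z).
Proof.
move=> mA bf; apply: (@bcsMl _ _ 1) => // z.
by rewrite indicE; case: (_ \in _); rewrite ?normr1 ?normr0.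
Qed.

Lemma J0 : J (fun=> 0) = 0.
Proof. by rewrite /J /Rintegral integral0. Qed.

Lemma JD f g : bcs f -> bcs g -> J (fun z => f z + g z) = J f + J g.
Proof. by move=> bf bg; apply: RintegralD => //; exact: bcs_integrable. Qed.

Lemma JZ f k : bcs f -> J (fun z => k * f z) = k * J f.
Proof. by move=> bf; apply: RintegralZl => //; exact: bcs_integrable. Qed.

Lemma JN f : bcs f -> J (fun z => - f z) = - J f.
Proof.
move=> bf; rewrite -mulN1r -JZ//; congr J; apply/funext => z; by rewrite mulN1r.
Qed.

Lemma JB f g : bcs f -> bcs g -> J (fun z => f z - g z) = J f - J g.
Proof. by move=> bf bg; rewrite JD ?JN//; exact: bcsN. Qed.

Lemma le_J f g : bcs f -> bcs g -> (forall z, f z <= g z) -> J f <= J g.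
Proof.
move=> bf bg fg; apply: le_Rintegral => //; exact: bcs_integrable.
Qed.

Lemma J_ge0 f : (forall z, 0 <= f z) -> 0 <= J f.
Proof. by move=> f0; exact: Rintegral_ge0. Qed.

Lemma J_abs f : bcs f -> `|J f| <= J (fun z => `|f z|).
Proof. by move=> bf; apply: le_normr_Rintegral => //; exact: bcs_integrable. Qed.

Lemma EFinJ f : bcs f -> (J f)%:E = (\int[lam2]_z (f z)%:E)%E.
Proof.
move=> bf; rewrite /J /Rintegral fineK//.
by apply: integrable_fin_num => //; exact: bcs_integrable.
Qed.

Lemma J_preserving (phi : P -> P) f : measurable_fun setT phi ->
  (forall A : set P, measurable A -> lam2 (phi @^-1` A) = lam2 A) ->
  bcs f -> J (fun z => f (phi z)) = J f.
Proof.
move=> mt pA bf; congr fine.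
have mf : measurable_fun setT (EFin \o f) by apply/measurable_EFinP; case: bf.
have Ephi (g : P -> \bar R) :
    (\int[pushforward lam2 phi]_z g z = \int[lam2]_z g z)%E.
  by apply: eq_measure_integral => A mA _ /=; exact: pA.
have Eabs : (\int[lam2]_z `|(f (phi z))%:E| = \int[lam2]_z `|(f z)%:E|)%E.
  rewrite -[RHS]Ephi.
  have mabs : measurable_fun setT (fun z => `|(f z)%:E|%E).
    exact: measurableT_comp.
  exact: (esym (ge0_integral_pushforward mt lam2 measurableT mabs
    (fun y _ => abse_ge0 (f y)%:E))).
have ifphi : lam2.-integrable setT ((EFin \o f) \o phi).
  apply/integrableP; split; first exact: (measurableT_comp mf mt).
  by have /integrableP[_] := bcs_integrable bf; rewrite -Eabs.
rewrite -[RHS](Ephi (EFin \o f)).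
exact: (esym (integral_pushforward mt mf ifphi measurableT)).
Qed.

Lemma J_translate f t : bcs f -> J (fun z => f (z + t)) = J f.
Proof.
apply: (@J_preserving (fun z : P => (z + t : P))); first exact: measurable_fun_translate2.
by move=> A; exact: lam2_translate.
Qed.

Lemma J_swap f : bcs f -> J (fun z => f (swap_pair z)) = J f.
Proof.
by apply: J_preserving; [exact: measurable_swap_pair|exact: lam2_swap].
Qed.

Lemma J_fubini f : bcs f ->
  J f = Rintegral leb1 setT (fun y => Rintegral leb1 setT (fun x => f (x, y))).
Proof.
move=> bf; rewrite {1}/J {1}/Rintegral.
rewrite -(@integral21_prod_meas1 _ _ T T R leb1 leb1 (EFin \o f)); last exact: bcs_integrable.
congr fine; apply: eq_integral => y _; rewrite /fubini_G /= /Rintegral fineK//.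
have [mf [M [fM f0]]] := bf.
apply: integrable_fin_num => //.
apply: (@integrable_bounded_supp _ _ leb1 _ `[- M, M]%classic M) => //.
- exact: (measurableT_comp mf (measurable_pair2 y)).
- exact: leb1_itv_lty.
- by move=> x /f0[h1 h2]; rewrite /= in_itv/= -ler_norml.
Qed.

End PlaneIntegral.

(** * Continuously differentiable functions on the plane *)

Section Gradient.
Context {R : realType}.
Local Notation T := (measurableTypeR R).
Local Notation P := (T * T)%type.
Implicit Types (f g p q : R * R -> R).

Definition lin2 (a b : R) (w : R * R) : R := a * w.1 + b * w.2.

Lemma lin2_linear a b : linear (lin2 a b).
Proof. by move=> k u v; rewrite /lin2 /=; rewrite /GRing.scale /=; ring. Qed.

HB.instance Definition _ a b :=
  GRing.isLinear.Build R (R * R)%type R _ (lin2 a b) (lin2_linear a b).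

Lemma normr_pair (z : R * R) : `|z| = Num.max `|z.1| `|z.2|.
Proof. by []. Qed.

Lemma normr_fst (z : R * R) : `|z.1| <= `|z|.
Proof. by rewrite normr_pair le_max lexx. Qed.

Lemma normr_snd (z : R * R) : `|z.2| <= `|z|.
Proof. by rewrite normr_pair le_max lexx orbT. Qed.

Lemma nbhs_lt0 (d : R) : 0 < d -> nbhs (0 : R * R) [set w | `|w| < d].
Proof.
move=> d0; have h := @nbhs_norm0P R (R * R)%type [set w | `|w| < d].
by apply/h; exists d.
Qed.

Lemma continuous_fst : continuous (fst : R * R -> R).
Proof. by move=> z; exact: cvg_fst. Qed.

Lemma continuous_snd : continuous (snd : R * R -> R).
Proof. by move=> z; exact: cvg_snd. Qed.

Lemma continuous_lin2 a b : continuous (lin2 a b).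
Proof.
move=> z; apply: cvgD; apply: cvgM.
- exact: cvg_cst.
- exact: continuous_fst.
- exact: cvg_cst.
- exact: continuous_snd.
Qed.

(** The partial derivatives are carried as data, so that divergences of composite fields are
    explicit expressions which [ring] can compare. *)
Definition grad f p q := [/\ (forall z, is_diff z f (lin2 (p z) (q z))),
  continuous p & continuous q].

Lemma grad_continuous f p q : grad f p q -> continuous f.
Proof. by move=> [df _ _] z; apply: differentiable_continuous; have [] := df z. Qed.

Lemma grad_derive f p q z v : grad f p q -> 'D_v f z = p z * v.1 + q z * v.2.
Proof.
by move=> [/(_ z) [df df'] _ _]; rewrite deriveE// df'.
Qed.

Lemma grad_cst c : grad (fun=> c) (fun=> 0) (fun=> 0).
Proof.
split; [|exact: cst_continuous|exact: cst_continuous].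
move=> z; refine (is_diff_eq (is_diff_cst (c : R) (z : R * R)) _).
by apply/funext => w; rewrite /lin2 !mul0r addr0.
Qed.

Lemma gradD f p q g r s : grad f p q -> grad g r s ->
  grad (fun z => f z + g z) (fun z => p z + r z) (fun z => q z + s z).
Proof.
move=> [df cp cq] [dg cr cs]; split.
- move=> z; refine (is_diff_eq (is_diffD (df z) (dg z)) _).
  by apply/funext => w; rewrite /lin2 !fctE; ring.
- by move=> z; apply: cvgD; [exact: cp|exact: cr].
- by move=> z; apply: cvgD; [exact: cq|exact: cs].
Qed.

Lemma gradM f p q g r s : grad f p q -> grad g r s ->
  grad (fun z => f z * g z) (fun z => p z * g z + f z * r z)
       (fun z => q z * g z + f z * s z).
Proof.
move=> gf gg; have cf := grad_continuous gf; have cg := grad_continuous gg.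
case: gf gg => [df cp cq] [dg cr cs]; split.
- move=> z; refine (is_diff_eq (is_diffM (df z) (dg z)) _).
  by apply/funext => w; rewrite /lin2 !fctE /GRing.scale /=; ring.
- by move=> z; apply: cvgD; apply: cvgM;
    [exact: cp|exact: cg|exact: cf|exact: cr].
- by move=> z; apply: cvgD; apply: cvgM;
    [exact: cq|exact: cg|exact: cf|exact: cs].
Qed.

Lemma gradZ f p q k : grad f p q ->
  grad (fun z => k * f z) (fun z => k * p z) (fun z => k * q z).
Proof.
move=> /(gradM (grad_cst k)).
by congr grad; apply/funext => z /=; rewrite mul0r add0r.
Qed.

Lemma gradN f p q : grad f p q ->
  grad (fun z => - f z) (fun z => - p z) (fun z => - q z).
Proof.
by move=> /(gradZ (-1)); congr grad; apply/funext => z /=; rewrite mulN1r.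
Qed.

Lemma gradB f p q g r s : grad f p q -> grad g r s ->
  grad (fun z => f z - g z) (fun z => p z - r z) (fun z => q z - s z).
Proof. by move=> gf /gradN; exact: gradD. Qed.

Lemma grad_comp (h h' : R -> R) f p q : (forall x : R, is_derive x (1 : R) h (h' x)) ->
  continuous h' -> grad f p q ->
  grad (fun z => h (f z)) (fun z => h' (f z) * p z) (fun z => h' (f z) * q z).
Proof.
move=> dh ch' gf; have cf := grad_continuous gf.
case: gf => [df cp cq]; split.
- move=> z.
  have dh1 : is_diff (f z) h (fun w => w * h' (f z)).
    have [dd dv] := dh (f z); apply: DiffDef; first exact/derivable1_diffP.
    by rewrite deriv1E// derive1E dv.
  refine (is_diff_eq (is_diff_comp (df z) dh1) _).
  by apply/funext => w; rewrite /lin2 /=; ring.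
- by move=> z; apply: cvgM; [apply: continuous_comp; [exact: cf|exact: ch']|exact: cp].
- by move=> z; apply: cvgM; [apply: continuous_comp; [exact: cf|exact: ch']|exact: cq].
Qed.

(* A uniform quadratic Taylor remainder is the way convolutions are shown to
   be continuously differentiable. *)
Lemma grad_quad f p q K : (forall z w, `|w| <= 1 -> `|f (z + w) - f z - lin2 (p z) (q z) w| <= K * `|w| ^+ 2) ->
  continuous p -> continuous q -> grad f p q.
Proof.
move=> fK cp cq; split => // z.
have K0 : 0 <= K.
  have := fK 0 (1, 0); rewrite normr_pair /= normr1 normr0 maxEle ler10 expr1n mulr1.
  by move=> /(_ (lexx 1)); exact: le_trans.
have e : f \o shift z = cst (f z) + lin2 (p z) (q z) +o_ (0 : R * R) id.
  apply/eqaddoP => _/posnumP[e]; near=> w.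
  rewrite !fctE /= opprD addrA [w + z]addrC.
  apply: (le_trans (fK z w _)).
    by apply: ltW; near: w; exact: nbhs_lt0.
  rewrite expr2 mulrA ler_wpM2r//.
  apply: (@le_trans _ _ ((K + 1) * `|w|)); first by rewrite ler_wpM2r// lerDl.
  rewrite -ler_pdivlMl ?ltr_wpDl// ltW//.
  near: w; apply: nbhs_lt0.
  by rewrite mulr_gt0// invr_gt0 ltr_wpDl.
have dE := diff_unique (@continuous_lin2 (p z) (q z)) e.
apply: DiffDef => //; apply/diff_locallyP; rewrite dE; split => //.
exact: continuous_lin2.
Unshelve. all: by end_near. Qed.

End Gradient.

(** * Test fields, and perimeter computed on Borel sets *)

Section Fields.
Context {R : realType}.
Local Notation T := (measurableTypeR R).
Local Notation P := (T * T)%type.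
Local Notation leb1 := (@lebesgue_measure R).
Local Notation lam2 := (@lam2 R).
Implicit Types (f g p q : R * R -> R).

(** A countable base: it makes open sets Borel, and later allows all boxes that almost miss a set to
    be removed at once. *)
Definition ratbox (i : rat * rat * rat) : set (R * R) :=
  [set z | `|z.1 - ratr i.1.1| < ratr i.2 /\ `|z.2 - ratr i.1.2| < ratr i.2].

Lemma measurable_ratbox i : measurable (ratbox i : set P).
Proof.
rewrite (_ : ratbox i = (ball (ratr i.1.1 : R) (ratr i.2) : set T) `*`
  (ball (ratr i.1.2 : R) (ratr i.2) : set T)).
  by apply: measurableX; exact: measurable_ball.
by apply/seteqP; split => z [h1 h2]; split; rewrite /ball/= distrC.
Qed.

Lemma ratbox_mem (z : R * R) (e : R) : 0 < e -> exists i, ratbox i z /\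
  ratbox i `<=` [set w | `|w.1 - z.1| < e /\ `|w.2 - z.2| < e].
Proof.
move=> e0.
have /rat_in_itvoo[r] : e / 4%:R < e / 2%:R by lra.
rewrite in_itv/= => /andP[r1 r2].
have /rat_in_itvoo[a] : z.1 - ratr r < z.1 + ratr r by lra.
rewrite in_itv/= => /andP[a1 a2].
have /rat_in_itvoo[b] : z.2 - ratr r < z.2 + ratr r by lra.
rewrite in_itv/= => /andP[b1 b2].
exists (a, b, r); split; first by split => /=; rewrite ltr_norml; apply/andP; split; lra.
move=> w [/=]; rewrite !ltr_norml => /andP[h1 h2] /andP[h3 h4].
by split; apply/andP; split; lra.
Qed.

Lemma open_measurable2 (U : set (R * R)) : open U -> measurable (U : set P).
Proof.
move=> oU.
rewrite (_ : U = \bigcup_(i in [set i | ratbox i `<=` U]) ratbox i).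
  rewrite bigcup_mkcond; apply: countable_bigcupT_measurable => // i.
  by case: ifP => // _; exact: measurable_ratbox.
apply/seteqP; split => [z Uz|z [i /= iU]]; last exact: iU.
have : nbhs z U by exact: open_nbhs_nbhs.
move=> /nbhs_ballP[e e0 eU].
have [i [iz ie]] := ratbox_mem z e0.
exists i => //= w /ie[h1 h2]; apply: eU; split; rewrite /ball/= distrC//.
Qed.

Lemma continuous_measurable2 f : continuous f -> measurable_fun (setT : set P) f.
Proof.
move=> cf; apply: (measurability _ (RGenOpens.measurableE R)) => _ [_ [a [b ->]] <-].
rewrite setTI; apply: open_measurable2; apply: open_comp; last exact: interval_open.
by move=> x _; exact: cf.
Qed.

Lemma continuous_box_bounded f M : continuous f ->
  exists K, forall z, in_box M z -> `|f z| <= K.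
Proof.
move=> cf.
have cb : compact (`[- M, M]%classic `*` `[- M, M]%classic : set (R * R)).
  by apply: compact_setX; exact: segment_compact.
have : compact (f @` (`[- M, M]%classic `*` `[- M, M]%classic)).
  apply: continuous_compact => //; exact: continuous_subspaceT.
move=> /compact_bounded[K [_ hK]]; exists (K + 1) => z [z1 z2].
apply: hK; first by rewrite ltrDl.
by exists z => //; split; rewrite /= in_itv/= -ler_norml.
Qed.

(** The complement of a closed box is open, so f vanishes near z and not only at z. *)
Lemma grad_out f p q M : grad f p q -> (forall z, f z != 0 -> in_box M z) ->
  forall z, ~ in_box M z -> p z = 0 /\ q z = 0.
Proof.
move=> gf f0 z nz.
have z0 : \forall w \near z, f w = 0.
  have : \forall w \near z, M < `|w.1| \/ M < `|w.2|.
    have [h|h] := ltP M `|z.1|.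
      have : \forall w \near z, M < `|w.1|.
        apply: (@cvgr_gt _ (R * R)%type (nbhs z) _ _ `|z.1|) => //.
        by apply: cvg_norm; exact: continuous_fst.
      by apply: filterS => w; left.
    have [h'|h'] := ltP M `|z.2|; last by exfalso; apply: nz.
    have : \forall w \near z, M < `|w.2|.
      apply: (@cvgr_gt _ (R * R)%type (nbhs z) _ _ `|z.2|) => //.
      by apply: cvg_norm; exact: continuous_snd.
    by apply: filterS => w; right.
  apply: filterS => w hw; apply/eqP; apply: contraT => /f0[h1 h2].
  by case: hw; rewrite ltNge ?h1 ?h2.
have D0 v : 'D_v f z = 0.
  rewrite -(@derive_cst R (R * R)%type R 0 z v).
  by apply: near_eq_derive; apply: filterS z0 => w ->.
split.
  by have := grad_derive z (1, 0) gf; rewrite D0 /= mulr1 mulr0 addr0.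
by have := grad_derive z (0, 1) gf; rewrite D0 /= mulr1 mulr0 add0r.
Qed.

Lemma bcs_continuous f M : continuous f -> (forall z, f z != 0 -> in_box M z) ->
  bcs f.
Proof.
move=> cf f0; split; first exact: continuous_measurable2.
have [K hK] := continuous_box_bounded M cf.
exists (Num.max (Num.max K M) 0); split => z.
  have [->|/f0/hK h] := eqVneq (f z) 0; first by rewrite normr0 le_max lexx orbT.
  by rewrite !le_max h.
by move=> /f0; apply: in_box_le; rewrite !le_max lexx orbT.
Qed.

Lemma is_diff_lin2 (a b : R) z : is_diff z (lin2 a b) (lin2 a b).
Proof.
have [] // := @grad_quad _ (lin2 a b) (fun=> a) (fun=> b) 0.
- by move=> u w _; rewrite /lin2 /= [X in `|X|](_ : _ = 0) ?normr0 ?mul0r//; ring.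
- exact: cst_continuous.
- exact: cst_continuous.
Qed.

(** The field is given by its components and its divergence [d] is a parameter, so that suprema
    range over divergences alone. The norm bound is squared to avoid square roots. *)
Definition test_field f g d := exists p q r s M,
  [/\ grad f p q, grad g r s, d = (fun z => p z + s z),
      (forall z, f z != 0 \/ g z != 0 -> in_box M z) &
      forall z, f z ^+ 2 + g z ^+ 2 <= 1].

Lemma grad_bcs f p q M : grad f p q -> (forall z, f z != 0 -> in_box M z) ->
  [/\ bcs f, bcs p & bcs q].
Proof.
move=> gf f0; have h := grad_out gf f0; split.
- by apply: bcs_continuous f0; exact: grad_continuous gf.
- apply: (@bcs_continuous _ M); first by case: gf.
  by move=> z; apply: contra_neqP => /h[].
- apply: (@bcs_continuous _ M); first by case: gf.
  by move=> z; apply: contra_neqP => /h[].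
Qed.

Lemma test_field_bcs f g d : test_field f g d -> [/\ bcs f, bcs g & bcs d].
Proof.
move=> [p [q [r [s [M [gf gg -> f0 _]]]]]].
have [bf bp _] : [/\ bcs f, bcs p & bcs q].
  by apply: grad_bcs gf _ => z h; apply: f0; left.
have [bg _ bs] : [/\ bcs g, bcs r & bcs s].
  by apply: grad_bcs gg _ => z h; apply: f0; right.
by split => //; exact: bcsD.
Qed.

Lemma test_field_divergence f g d : test_field f g d ->
  test_fields (fun z => (f z, g z)) /\ divergence (fun z => (f z, g z)) = d.
Proof.
move=> [p [q [r [s [M [gf gg -> f0 fg1]]]]]].
have dfg z : is_diff z (fun z => (f z, g z))
    (fun w => (lin2 (p z) (q z) w, lin2 (r z) (s z) w)).
  by case: gf => + _ _; case: gg => + _ _ => /(_ z) h1 /(_ z) h2; exact: is_diff_pair.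
have D v z : 'D_v (fun z => (f z, g z)) z =
    (p z * v.1 + q z * v.2, r z * v.1 + s z * v.2).
  by have [h1 h2] := dfg z; rewrite deriveE// h2.
split; last by apply/funext => z; rewrite /divergence !D /=; ring.
split; last first.
  move=> z; rewrite /enorm /= -[leRHS]sqrtr1; exact: ler_wsqrtr.
split => [z|v|].
- by have [] := dfg z.
- rewrite (_ : 'D_v _ = fun z => (p z * v.1 + q z * v.2, r z * v.1 + s z * v.2)); last first.
    by apply/funext => z; exact: D.
  case: gf => _ cp cq; case: gg => _ cr cs z.
  have cl (a b : R * R -> R) : continuous a -> continuous b ->
      (fun z => a z * v.1 + b z * v.2) @ z --> a z * v.1 + b z * v.2.
    by move=> ca cb; apply: cvgD; apply: cvgM; [exact: ca|exact: cvg_cst|exact: cb|exact: cvg_cst].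
  exact: (cvg_pair (cl _ _ cp cq) (cl _ _ cr cs)).
- have cb : compact (`[- M, M]%classic `*` `[- M, M]%classic : set (R * R)).
    by apply: compact_setX; exact: segment_compact.
  apply: (subclosed_compact _ cb); first exact: closed_closure.
  rewrite closureE; apply: smallest_sub.
    by apply: compact_closed cb; exact: norm_hausdorff.
  move=> z /= /eqP h.
  have [h1 h2] : in_box M z.
    apply: f0; have [f00|] := eqVneq (f z) 0; last by left.
    have [g00|] := eqVneq (g z) 0; last by right.
    by exfalso; apply: h; rewrite f00 g00.
  by split; rewrite /= in_itv/= -ler_norml.
Qed.

Lemma test_fields_test_field phi : test_fields phi ->
  exists f g, test_field f g (divergence phi).
Proof.
move=> [[dphi cphi kphi] phi1].
pose f z := (phi z).1; pose g z := (phi z).2.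
have D z : is_diff z phi (fun w => 'd phi z w) by apply: DiffDef.
have Df z v : 'D_v f z = ('D_v phi z).1 /\ 'D_v g z = ('D_v phi z).2 /\
    differentiable f z /\ differentiable g z.
  have h1 : is_diff (phi z) (fst : R * R -> R) fst.
    rewrite (_ : fst = lin2 1 0 :> (R * R -> R)); first exact: is_diff_lin2.
    by apply/funext => w; rewrite /lin2 mul1r mul0r addr0.
  have h2 : is_diff (phi z) (snd : R * R -> R) snd.
    rewrite (_ : snd = lin2 0 1 :> (R * R -> R)); first exact: is_diff_lin2.
    by apply/funext => w; rewrite /lin2 mul1r mul0r add0r.
  have [k1 k1'] := is_diff_comp (D z) h1.
  have [k2 k2'] := is_diff_comp (D z) h2.
  by rewrite !deriveE// k1' k2'.
have gr (h : R * R -> R) : (forall z, differentiable h z) ->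
    (forall v, continuous ('D_v h)) -> grad h ('D_(1, 0) h) ('D_(0, 1) h).
  move=> dh ch; split; [move=> z|exact: ch|exact: ch].
  apply: DiffDef => //; apply/funext => -[a b].
  rewrite /lin2 /= !deriveE//.
  have -> : (a, b) = a *: (1, 0) + b *: (0, 1) :> R * R.
    by rewrite /GRing.scale /= /GRing.add /= /add_pair /=; congr pair; rewrite /GRing.scale /=; ring.
  by rewrite linearD !linearZ /= /GRing.scale /=; ring.
have [M [_ hM]] := compact_bounded kphi.
exists f, g, ('D_(1, 0) f), ('D_(0, 1) f), ('D_(1, 0) g), ('D_(0, 1) g), (M + 1); split.
- apply: gr => [z|v]; first by have [_ [_ []]] := Df z 0.
  rewrite (_ : 'D_v f = (fun z => ('D_v phi z).1)); last first.
    by apply/funext => z; have [] := Df z v.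
  by move=> z; apply: (@continuous_comp _ _ _ ('D_v phi) fst);
    [exact: cphi|exact: continuous_fst].
- apply: gr => [z|v]; first by have [_ [_ []]] := Df z 0.
  rewrite (_ : 'D_v g = (fun z => ('D_v phi z).2)); last first.
    by apply/funext => z; have [_ []] := Df z v.
  by move=> z; apply: (@continuous_comp _ _ _ ('D_v phi) snd);
    [exact: cphi|exact: continuous_snd].
- apply/funext => z; rewrite /divergence.
  by have [-> _] := Df z (1, 0); have [_ [-> _]] := Df z (0, 1).
- move=> z fg; have : `|z| <= M + 1.
    apply: hM; first by rewrite ltrDl.
    apply: subset_closure => /=; apply/eqP => z0; rewrite /f /g z0 /= in fg.
    by case: fg; rewrite eqxx.
  by move=> h; split; apply: le_trans h; [exact: normr_fst|exact: normr_snd].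
- move=> z; have := phi1 z; rewrite /enorm -[leRHS]sqrtr1.
  by rewrite ler_psqrt ?nnegrE ?addr_ge0 ?sqr_ge0.
Qed.

(** The identity is measurable from the completed sigma-algebra to the Borel one and pushes [leb2]
    to [lam2]; a null modification does not change the integral. *)
Lemma integral_leb2 (h k : R * R -> R) : bcs k ->
  leb2 [set z | h z <> k z] = 0%E ->
  (\int[leb2]_z (h z)%:E = (J k)%:E)%E.
Proof.
move=> bk N0; have mN := null_lebesgue N0.
have [mk _] := bk.
have mid : measurable_fun (setT : set (@lebplane R)) (id : @lebplane R -> P).
  by move=> _ Y mY; rewrite setTI; exact: borel_lebesgue.
have mk' : measurable_fun (setT : set (@lebplane R)) k.
  exact: (measurableT_comp mk mid).
have mh : measurable_fun (setT : set (@lebplane R)) h.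
  move=> _ Y mY; rewrite setTI.
  rewrite (_ : h @^-1` Y = ((k @^-1` Y) `\` [set z | h z <> k z]) `|`
     (h @^-1` Y `&` [set z | h z <> k z])).
    apply: measurableU.
      by apply: measurableD => //; rewrite -[X in measurable X]setTI; exact: mk'.
    apply: null_lebesgue; apply/eqP; rewrite eq_le measure_ge0 andbT -N0.
    exact: le_leb2.
  apply/seteqP; split => [z Yh|z [[Yk hk]|[]//]].
    by have [e|e] := pselect (h z = k z); [left; split => //=; rewrite -e|right].
  by rewrite /preimage /= (_ : h z = k z)//; apply: contrapT.
transitivity (\int[leb2]_z (k z)%:E)%E.
  have mh' : measurable_fun (setT : set (@lebplane R)) (EFin \o h) by exact/measurable_EFinP.
  have mk'' : measurable_fun (setT : set (@lebplane R)) (EFin \o k) by exact/measurable_EFinP.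
  apply: (@ae_eq_integral _ (@lebplane R) R leb2 setT _ _ measurableT mh' mk'').
  exists [set z | h z <> k z]; split => // z /=; apply: contra_not => e _.
  by rewrite e.
rewrite EFinJ//.
have pfE (A : set P) : measurable A -> pushforward leb2 (id : @lebplane R -> P) A = lam2 A.
  exact: leb2_borel.
have Ephi (u : P -> \bar R) :
    (\int[pushforward leb2 (id : @lebplane R -> P)]_z u z = \int[lam2]_z u z)%E.
  by apply: eq_measure_integral => A mA _ /=; exact: pfE.
have mkE : measurable_fun setT (EFin \o k) by exact/measurable_EFinP.
have mabs : measurable_fun setT (fun z => `|(k z)%:E|%E).
  exact: measurableT_comp.
have Eabs : (\int[leb2]_z `|(k z)%:E| = \int[lam2]_z `|(k z)%:E|)%E.
  rewrite -[RHS]Ephi.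
  exact: (esym (ge0_integral_pushforward mid leb2 measurableT mabs
    (fun y _ => abse_ge0 (k y)%:E))).
have ik : leb2.-integrable setT ((EFin \o k) \o (id : @lebplane R -> P)).
  apply/integrableP; split; first exact: (measurableT_comp mkE mid).
  by have /integrableP[_] := bcs_integrable bk; rewrite -Eabs.
rewrite -[RHS](Ephi (EFin \o k)).
exact: (esym (integral_pushforward mid mkE ik measurableT)).
Qed.

(** A null change of the set affects none of the tested integrals, so the analysis of the perimeter
    can be done on a Borel representative with the product measure. *)
Lemma Per_borel (E : set (R * R)) (B : set P) : measurable B ->
  leb2 ((E `\` B) `|` (B `\` E)) = 0%E ->
  Per E = ereal_sup [set (J (fun z => \1_B z * d z))%:E |
                     d in [set d | exists f g, test_field f g d]].
Proof.
move=> mB EB.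
have key f g d : test_field f g d ->
    (\int[leb2]_(z in E) (d z)%:E = (J (fun z => \1_B z * d z))%:E)%E.
  move=> tf; have [_ _ bd] := test_field_bcs tf.
  rewrite integral_mkcond.
  rewrite (_ : (fun z => (d z)%:E) \_ E = (fun z => (\1_E z * d z)%:E)).
    apply: integral_leb2; first exact: bcsI.
    apply/eqP; rewrite eq_le measure_ge0 andbT -EB; apply: le_leb2.
    move=> z /=; rewrite !indicE.
    case: (boolP (z \in E)) => [/set_mem Ez|Ez]; case: (boolP (z \in B)) => [/set_mem Bz|Bz]//.
    - by left; split => // /mem_set; rewrite (negbTE Bz).
    - by right; split => // /mem_set; rewrite (negbTE Ez).
  apply/funext => z; rewrite patchE indicE; case: ifP => _; by rewrite ?mul1r ?mul0r.
rewrite /Per; congr ereal_sup; apply/seteqP; split => x /=.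
  move=> [phi tphi <-].
  have [f [g tf]] := test_fields_test_field tphi.
  exists (divergence phi); first by exists f, g.
  by rewrite -(key _ _ _ tf).
move=> [d [f [g tf]] <-].
have [h1 h2] := test_field_divergence tf.
by exists (fun z => (f z, g z)) => //; rewrite h2 (key _ _ _ tf).
Qed.

(** The same reduction for the total variation: when u is a difference of nested indicators, it
    identifies the BV seminorm with a perimeter. *)
Lemma total_var_ind (u : R * R -> R) (B : set P) : measurable B ->
  leb2 [set z | u z <> \1_B z] = 0%E ->
  total_var u = ereal_sup [set (J (fun z => \1_B z * d z))%:E |
                     d in [set d | exists f g, test_field f g d]].
Proof.
move=> mB EB.
have key f g d : test_field f g d ->
    (\int[leb2]_z (u z * d z)%:E = (J (fun z => \1_B z * d z))%:E)%E.
  move=> tf; have [_ _ bd] := test_field_bcs tf.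
  apply: integral_leb2; first exact: bcsI.
  apply/eqP; rewrite eq_le measure_ge0 andbT -EB; apply: le_leb2.
  by move=> z /=; apply: contra_not => ->.
rewrite /total_var; congr ereal_sup; apply/seteqP; split => x /=.
  move=> [phi tphi <-].
  have [f [g tf]] := test_fields_test_field tphi.
  exists (divergence phi); first by exists f, g.
  by rewrite -(key _ _ _ tf).
move=> [d [f [g tf]] <-].
have [h1 h2] := test_field_divergence tf.
by exists (fun z => (f z, g z)) => //; rewrite h2 (key _ _ _ tf).
Qed.

End Fields.

(** * The divergence theorem and operations on test fields *)

Section FieldCalculus.
Context {R : realType}.
Local Notation T := (measurableTypeR R).
Local Notation P := (T * T)%type.
Local Notation leb1 := (@lebesgue_measure R).
Local Notation lam2 := (@lam2 R).
Local Notation J := (@J R).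
Implicit Types (f g p q d : R * R -> R).

Lemma grad_translate f p q (t : R * R) : grad f p q ->
  grad (fun z => f (z + t)) (fun z => p (z + t)) (fun z => q (z + t)).
Proof.
have ct : continuous (fun z : R * R => z + t).
  by move=> z; apply: cvgD; [exact: cvg_id|exact: cvg_cst].
move=> [df cp cq]; split.
- move=> z.
  have dt : is_diff z (fun z : R * R => z + t) id.
    refine (is_diff_eq (is_diffD (is_diff_id z) (is_diff_cst (t : R * R) z)) _).
    by apply/funext => w; rewrite !fctE addr0.
  exact: (is_diff_comp dt (df (z + t))).
- by move=> z; apply: (@continuous_comp _ _ _ (fun z : R * R => z + t) p); [exact: ct|exact: cp].
- by move=> z; apply: (@continuous_comp _ _ _ (fun z : R * R => z + t) q); [exact: ct|exact: cq].
Qed.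

Lemma continuous_swap_pair : continuous (@swap_pair R R).
Proof. by move=> z; exact: (cvg_pair (@continuous_snd R z) (@continuous_fst R z)). Qed.

Lemma continuous_line (y : R) : continuous (fun s : R => (s, y)).
Proof.
move=> s; have h1 : (fun s : R => s) @ s --> s by exact: cvg_id.
have h2 : (fun=> y) @ s --> y by exact: cvg_cst.
exact: (cvg_pair h1 h2).
Qed.

Lemma grad_swap f p q : grad f p q ->
  grad (fun z => f (swap_pair z)) (fun z => q (swap_pair z)) (fun z => p (swap_pair z)).
Proof.
move=> [df cp cq]; split.
- move=> z.
  have dt : is_diff z (@swap_pair R R) (@swap_pair R R).
    have h := is_diff_pair (is_diff_lin2 0 1 z) (is_diff_lin2 1 0 z).
    have e : (fun y : R * R => (lin2 0 1 y, lin2 1 0 y)) = @swap_pair R R.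
      by apply/funext => y; rewrite /lin2 /swap_pair; congr pair; ring.
    by rewrite e in h.
  refine (is_diff_eq (is_diff_comp dt (df (swap_pair z))) _).
  by apply/funext => w; rewrite /lin2 /swap_pair /= addrC.
- by move=> z; apply: (@continuous_comp _ _ _ (@swap_pair R R) q); [exact: continuous_swap_pair|exact: cq].
- by move=> z; apply: (@continuous_comp _ _ _ (@swap_pair R R) p); [exact: continuous_swap_pair|exact: cp].
Qed.

Lemma grad_line f p q (x y : R) : grad f p q ->
  is_derive x (1 : R) (fun s => f (s, y)) (p (x, y)).
Proof.
move=> [df _ _].
have dl : is_diff x (fun s : R => (s, y)) (fun h : R => (h, 0 : R)).
  exact: (is_diff_pair (is_diff_id x) (is_diff_cst (y : R) x)).
have [h1 h2] := is_diff_comp dl (df (x, y)).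
apply: DeriveDef; first exact/derivable1_diffP.
by rewrite (deriveE _ h1) h2 /= /lin2 /=; ring.
Qed.

Lemma Rintegral_supp (f : R -> R) M : (forall x, f x != 0 -> `|x| <= M) ->
  Rintegral leb1 setT f = Rintegral leb1 `[- M, M]%classic f.
Proof.
move=> f0; rewrite [RHS]Rintegral_mkcond; apply: eq_Rintegral => x _.
rewrite patchE; case: ifPn => // hx; apply/eqP; apply: contraNT hx => /f0.
by rewrite ler_norml => h; rewrite inE/= in_itv/=.
Qed.

Lemma Rintegral_derive (f p : R -> R) M : 0 < M -> (forall x, is_derive x (1 : R) f (p x)) ->
  continuous p -> Rintegral leb1 `[- M, M]%classic p = f M - f (- M).
Proof.
move=> M0 df cp.
have cf : continuous f.
  by move=> x; apply: differentiable_continuous; apply/derivable1_diffP; have [] := df x.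
rewrite /Rintegral (@continuous_FTC2 _ p f)//; first lra.
- exact: continuous_subspaceT.
- split; first by move=> x _; have [] := df x.
  + by apply: cvg_at_right_filter; exact: cf.
  + by apply: cvg_at_left_filter; exact: cf.
- by move=> x _; rewrite derive1E; have [_ ->] := df x.
Qed.

(** Fubini reduces the first claim to the fundamental theorem of calculus on horizontal lines; the
    second follows by exchanging the coordinates. *)
Lemma J_grad f p q M : grad f p q -> (forall z, f z != 0 -> in_box M z) ->
  J p = 0 /\ J q = 0.
Proof.
move=> gf f0.
have [bf bp bq] := grad_bcs gf f0.
have key f' p' q' N : grad f' p' q' -> (forall z, f' z != 0 -> in_box N z) -> bcs p' -> J p' = 0.
  move=> gf' f0' bp'; rewrite J_fubini//.
  rewrite -[RHS](_ : Rintegral leb1 setT (fun=> 0) = 0); last by rewrite /Rintegral integral0.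
  apply: eq_Rintegral => y _.
  (* Beyond N the function vanishes, so both boundary terms are 0; the 1 keeps the interval
     nondegenerate whatever the sign of N. *)
  pose K := Num.max (N + 1) 1.
  have K1 : 1 <= K by rewrite le_max lexx orbT.
  have KN : N < K by rewrite lt_max ltrDl ltr01.
  rewrite (@Rintegral_supp _ K); last first.
    move=> x; apply: contraNT; rewrite -ltNge => Kx; apply/eqP.
    have [] // := grad_out gf' f0' (z := (x, y)).
    by move=> [/= h _]; move: (lt_trans KN Kx); rewrite ltNge h.
  have dd x : is_derive x (1 : R) (fun s => f' (s, y)) (p' (x, y)) := grad_line x y gf'.
  have K0 : 0 < K by exact: lt_le_trans K1.
  have cpy : continuous (fun s => p' (s, y)).
    have [_ cp _] := gf'; move=> x.
    apply: (@continuous_comp _ _ _ (fun s : R => (s, y)) p'); last exact: cp.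
    exact: continuous_line.
  rewrite (Rintegral_derive K0 dd cpy).
  have -> : f' (K, y) = 0.
    apply/eqP; apply: contraT => /f0'[/= h _].
    by move: KN; rewrite ltNge (le_trans _ h)// ler_norm.
  have -> : f' (- K, y) = 0.
    apply/eqP; apply: contraT => /f0'[/= h _].
    by move: KN; rewrite ltNge (le_trans _ h)// normrN ler_norm.
  by rewrite subrr.
split; first exact: key gf f0 bp.
have [mq [K [qK q0]]] := bq.
have sw N z : in_box N (swap_pair z) -> @in_box R N z by case.
rewrite -J_swap//; apply: key (grad_swap gf) _ _.
  by move=> z /f0; exact: sw.
split; first exact: (measurableT_comp mq measurable_swap_pair).
by exists K; split => [z|z /q0]; [exact: qK|exact: sw].
Qed.

(** The divergence theorem. It trades an integral over a set for one over its complement, both for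
    perimeters of complements and for error terms. *)
Lemma J_test_field f g d : test_field f g d -> J d = 0.
Proof.
move=> [p [q [r [s [M [gf gg -> f0 _]]]]]].
have f0' z : f z != 0 -> in_box M z by move=> h; apply: f0; left.
have g0' z : g z != 0 -> in_box M z by move=> h; apply: f0; right.
have [_ bp _] := grad_bcs gf f0'; have [_ _ bs] := grad_bcs gg g0'.
have [p0 _] := J_grad gf f0'; have [_ s0] := J_grad gg g0'.
by rewrite JD// p0 s0 addr0.
Qed.

Lemma test_field0 : test_field (fun=> 0) (fun=> 0) (fun=> 0 : R).
Proof.
exists (fun=> 0), (fun=> 0), (fun=> 0), (fun=> 0), 0; split.
- exact: grad_cst.
- exact: grad_cst.
- by apply/funext => z; rewrite addr0.
- by move=> z; rewrite eqxx; case.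
- by move=> z; rewrite expr0n addr0.
Qed.

Lemma test_fieldN f g d : test_field f g d ->
  test_field (fun z => - f z) (fun z => - g z) (fun z => - d z).
Proof.
move=> [p [q [r [s [M [gf gg -> f0 fg1]]]]]].
exists (fun z => - p z), (fun z => - q z), (fun z => - r z), (fun z => - s z), M.
split; [exact: gradN|exact: gradN|by apply/funext => z; rewrite opprD| |].
  by move=> z; rewrite !oppr_eq0; exact: f0.
by move=> z; rewrite !sqrrN.
Qed.

Lemma test_field_translate f g d (t : R * R) : test_field f g d ->
  test_field (fun z => f (z + t)) (fun z => g (z + t)) (fun z => d (z + t)).
Proof.
move=> [p [q [r [s [M [gf gg -> f0 fg1]]]]]].
exists (fun z => p (z + t)), (fun z => q (z + t)), (fun z => r (z + t)),
  (fun z => s (z + t)), (M + `|t|).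
split; [exact: grad_translate|exact: grad_translate|by []| |by move=> z; exact: fg1].
move=> z /f0[h1 h2]; split.
  rewrite (_ : z.1 = (z + t).1 - t.1); last by rewrite /= addrK.
  apply: (le_trans (ler_normB _ _)); apply: lerD => //; exact: normr_fst.
rewrite (_ : z.2 = (z + t).2 - t.2); last by rewrite /= addrK.
apply: (le_trans (ler_normB _ _)); apply: lerD => //; exact: normr_snd.
Qed.

Lemma test_field_swap f g d : test_field f g d ->
  test_field (fun z => g (swap_pair z)) (fun z => f (swap_pair z)) (fun z => d (swap_pair z)).
Proof.
move=> [p [q [r [s [M [gf gg -> f0 fg1]]]]]].
exists (fun z => s (swap_pair z)), (fun z => r (swap_pair z)),
  (fun z => q (swap_pair z)), (fun z => p (swap_pair z)), M.
split; [exact: grad_swap|exact: grad_swap|by apply/funext => z; rewrite addrC| |].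
  by move=> z h; have [] : in_box M (swap_pair z) by apply: f0; case: h; [right|left].
by move=> z; rewrite addrC; exact: fg1.
Qed.

(* Every cut-and-paste of fields is an instance of this convex
   combination. *)
Lemma test_field_mix f g d f' g' d' th a b : test_field f g d -> test_field f' g' d' ->
  grad th a b -> (forall z, 0 <= th z <= 1) ->
  test_field (fun z => th z * f z + (1 - th z) * f' z)
             (fun z => th z * g z + (1 - th z) * g' z)
             (fun z => th z * d z + (1 - th z) * d' z +
                       (a z * (f z - f' z) + b z * (g z - g' z))).
Proof.
move=> [p [q [r [s [M [gf gg -> f0 fg1]]]]]].
move=> [p' [q' [r' [s' [M' [gf' gg' -> f0' fg1']]]]]] gth th01.
have gth' := gradB (grad_cst 1) gth.
have g1 := gradD (gradM gth gf) (gradM gth' gf').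
have g2 := gradD (gradM gth gg) (gradM gth' gg').
do 4 eexists; exists (Num.max M M'); split; [exact: g1|exact: g2| | |].
- by apply/funext => z /=; ring.
- move=> z h.
  have : (f z != 0 \/ g z != 0) \/ (f' z != 0 \/ g' z != 0).
    have [e1|] := eqVneq (f z) 0; last by left; left.
    have [e2|] := eqVneq (g z) 0; last by left; right.
    have [e3|] := eqVneq (f' z) 0; last by right; left.
    have [e4|] := eqVneq (g' z) 0; last by right; right.
    by exfalso; move: h; rewrite e1 e2 e3 e4 !mulr0 addr0 eqxx; case.
  case=> [/f0|/f0']; apply: in_box_le; rewrite le_max lexx ?orbT//.
- move=> z; have /andP[t0 t1] := th01 z.
  have := fg1 z; have := fg1' z; set t := th z in t0 t1 *.
  move: (f z) (g z) (f' z) (g' z) => x y x' y' h h'.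
  (* This and the next two nonnegative terms add up to one minus the squared norm of the
     combination. *)
  have : 0 <= t * (1 - t) * ((x - x') ^+ 2 + (y - y') ^+ 2).
    by rewrite mulr_ge0 ?addr_ge0 ?sqr_ge0// mulr_ge0// subr_ge0.
  have : 0 <= t * (1 - (x ^+ 2 + y ^+ 2)) by rewrite mulr_ge0// subr_ge0.
  have : 0 <= (1 - t) * (1 - (x' ^+ 2 + y' ^+ 2)) by rewrite mulr_ge0 ?subr_ge0.
  by nra.
Qed.

End FieldCalculus.

(** * A one-dimensional smoothing kernel *)

Section Kernel.
Context {R : realType}.
Local Notation T := (measurableTypeR R).
Local Notation P := (T * T)%type.
Local Notation leb1 := (@lebesgue_measure R).

Lemma leb1_cc (a b : R) : a <= b -> leb1 `[a, b]%classic = (b - a)%:E.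
Proof.
move=> ab; rewrite lebesgue_measure_itv /= lte_fin.
case: ltP => // ba; congr EFin; have -> : a = b by apply: le_anti; rewrite ab ba.
by rewrite subrr.
Qed.

Definition ppart (x : R) : R := Num.max x 0.

Lemma ppart_rem (x s : R) :
  - s ^+ 2 <= ppart (x + s) ^+ 2 - ppart x ^+ 2 - 2 * ppart x * s <= s ^+ 2.
Proof. by rewrite /ppart; case: (lerP x 0) => h1; case: (lerP (x + s) 0) => h2; apply/andP; split; nra. Qed.

Lemma ppart_lip (x s : R) : - `|s| <= ppart (x + s) - ppart x <= `|s|.
Proof.
have := ler_norm s; have := ler_norm (- s); rewrite normrN.
by rewrite /ppart; case: (lerP x 0) => h1; case: (lerP (x + s) 0) => h2 h3 h4; apply/andP; split; lra.
Qed.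

(** The quadratic B-spline with knots 0, 1, 2, 3. It is piecewise quadratic with Lipschitz
    derivative, which is just enough for a quadratic Taylor remainder, and it lets every property be
    checked by case analysis. The constants 12 below are crude. *)
Definition spline (x : R) : R := 2^-1 * (ppart x ^+ 2 - 3 * ppart (x - 1) ^+ 2
  + 3 * ppart (x - 2) ^+ 2 - ppart (x - 3) ^+ 2).

Definition dspline (x : R) : R := ppart x - 3 * ppart (x - 1)
  + 3 * ppart (x - 2) - ppart (x - 3).

Lemma spline_bound (x : R) : 0 <= spline x <= 12.
Proof.
rewrite /spline /ppart; case: (lerP x 0) => h0; case: (lerP (x - 1) 0) => h1;
  case: (lerP (x - 2) 0) => h2; case: (lerP (x - 3) 0) => h3; apply/andP; split; nra.
Qed.

Lemma spline_half (x : R) : 1 <= x <= 2 -> 2^-1 <= spline x.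
Proof.
rewrite /spline /ppart => /andP[h h']; case: (lerP x 0) => h0; case: (lerP (x - 1) 0) => h1;
  case: (lerP (x - 2) 0) => h2; case: (lerP (x - 3) 0) => h3; nra.
Qed.

Lemma dspline_bound (x : R) : - 12 <= dspline x <= 12.
Proof.
rewrite /dspline /ppart; case: (lerP x 0) => h0; case: (lerP (x - 1) 0) => h1;
  case: (lerP (x - 2) 0) => h2; case: (lerP (x - 3) 0) => h3; apply/andP; split; lra.
Qed.

Lemma spline_out (x : R) : x < 0 \/ 3 < x -> spline x = 0 /\ dspline x = 0.
Proof.
rewrite /spline /dspline /ppart => h.
case: (lerP x 0) => h0; case: (lerP (x - 1) 0) => h1;
  case: (lerP (x - 2) 0) => h2; case: (lerP (x - 3) 0) => h3; split;
  first [nra | by ring | by exfalso; case: h; lra].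
Qed.

Lemma spline_rem (x s : R) :
  `|spline (x + s) - spline x - dspline x * s| <= 12 * s ^+ 2.
Proof.
have e (a : R) : x + s - a = (x - a) + s by ring.
rewrite ler_norml /spline /dspline !e.
have /andP[a1 a2] := ppart_rem x s; have /andP[b1 b2] := ppart_rem (x - 1) s.
have /andP[c1 c2] := ppart_rem (x - 2) s; have /andP[d1 d2] := ppart_rem (x - 3) s.
have : 0 <= s ^+ 2 by exact: sqr_ge0.
by move=> h; apply/andP; split; lra.
Qed.

Lemma dspline_lip (x s : R) : `|dspline (x + s) - dspline x| <= 12 * `|s|.
Proof.
have e (a : R) : x + s - a = (x - a) + s by ring.
rewrite ler_norml /dspline !e.
have /andP[a1 a2] := ppart_lip x s; have /andP[b1 b2] := ppart_lip (x - 1) s.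
have /andP[c1 c2] := ppart_lip (x - 2) s; have /andP[d1 d2] := ppart_lip (x - 3) s.
have : 0 <= `|s| by [].
by move=> h; apply/andP; split; lra.
Qed.

(** The profile of a product kernel. A single constant serves all the bounds, and [be'] is tied to
    [be] through the remainder estimate, which is what [grad_quad] consumes after integration. *)
Definition is_kernel (del K : R) (be be' : R -> R) :=
  [/\ (forall x, 0 <= be x <= K) /\ (forall x, `|be' x| <= K),
      (forall x, be x != 0 \/ be' x != 0 -> 0 <= x <= del),
      (forall x s, `|be (x + s) - be x - be' x * s| <= K * s ^+ 2),
      (forall x s, `|be' (x + s) - be' x| <= K * `|s|) &
      Rintegral leb1 setT be = 1].

Lemma lipschitz_continuous (g : R -> R) K :
  (forall x s, `|s| <= 1 -> `|g (x + s) - g x| <= K * `|s|) -> continuous g.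
Proof.
move=> gK x.
have K0 : 0 <= K.
  have := gK 0 1; rewrite normr1 lexx mulr1 => /(_ isT); exact: le_trans.
apply/cvgrPdist_le => e e0; near=> y.
rewrite distrC -[y](subrK x) [y - x + x]addrC.
have hy : `|y - x| < Num.min 1 (e / (K + 1)).
  rewrite distrC; near: y; apply/nbhs_ballP; exists (Num.min 1 (e / (K + 1))) => //=.
  by rewrite lt_min ltr01 divr_gt0// ltr_wpDl.
move: hy; rewrite lt_min => /andP[y1 y2].
apply: (le_trans (gK _ _ (ltW y1))).
apply: (@le_trans _ _ ((K + 1) * `|y - x|)); first by rewrite ler_wpM2r// lerDl.
by rewrite mulrC -ler_pdivlMr ?ltr_wpDl// ltW.
Unshelve. all: by end_near. Qed.

Lemma spline_continuous : continuous spline.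
Proof.
apply: (@lipschitz_continuous _ 24) => x s s1.
have h := spline_rem x s; have d := dspline_bound x.
have s0 : 0 <= `|s| by [].
have s2 : s ^+ 2 <= `|s| by rewrite -real_normK ?num_real// expr2 ler_piMr.
have ds : `|dspline x * s| <= 12 * `|s| by rewrite normrM ler_wpM2r// ler_norml.
have -> : spline (x + s) - spline x = (spline (x + s) - spline x - dspline x * s) + dspline x * s by ring.
by apply: (le_trans (ler_normD _ _)); lra.
Qed.

Lemma kernel_exists (del : R) : 0 < del -> exists K be be', is_kernel del K be be'.
Proof.
move=> d0; pose h := del / 3; have h0 : 0 < h by rewrite /h; lra.
pose g x := spline (x / h).
have cg : continuous g.
  have cd : continuous (fun x : R => x / h).
    by move=> x; apply: cvgM; [exact: cvg_id|exact: cvg_cst].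
  by move=> x; exact: (continuous_comp (cd x) (@spline_continuous (x / h))).
have mg : measurable_fun (setT : set T) (g : T -> R) by exact: continuous_measurable_fun.
have g0 x : g x != 0 -> 0 <= x <= del.
  apply: contraNT; rewrite negb_and -!ltNge => /orP hx; apply/eqP.
  have [] // : spline (x / h) = 0 /\ dspline (x / h) = 0.
  apply: spline_out; case: hx => hx; [left|right].
    by rewrite ltr_pdivrMr// mul0r.
  by rewrite ltr_pdivlMr// /h; lra.
have gb x : `|g x| <= 12 by rewrite ger0_norm; have /andP[] := spline_bound (x / h).
have ig : leb1.-integrable setT (EFin \o g).
  apply: (@integrable_bounded_supp _ _ _ leb1 _ `[0, del]%classic 12) => //.
  exact: leb1_itv_lty.
pose N := Rintegral leb1 setT g.
(* The spline is at least 1/2 on the middle third of its support, here [[h, 2 h]]. *)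
have N0 : 0 < N.
  have mI : measurable (`[h, 2 * h]%classic : set T) by [].
  have iI : leb1.-integrable setT (EFin \o (fun x : T => 2^-1 * \1_(`[h, 2 * h]%classic) x : R)).
    apply: (@integrable_bounded_supp _ _ _ leb1 _ `[h, 2 * h]%classic 1) => //.
    - by apply: measurable_funM => //; exact: measurable_indic.
    - exact: leb1_itv_lty.
    - by move=> x; rewrite normrM indicE ger0_norm//; case: (_ \in _); rewrite ?normr1 ?normr0; lra.
    - move=> x; rewrite indicE; case: (boolP (x \in _)) => [/set_mem//|_].
      by rewrite mulr0 eqxx.
  apply: (@lt_le_trans _ _ (Rintegral leb1 setT (fun x : T => 2^-1 * \1_(`[h, 2 * h]%classic) x : R))).
    rewrite RintegralZl//; last first.
      apply: (@integrable_bounded_supp _ _ _ leb1 _ `[h, 2 * h]%classic 1) => //.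
      - exact: leb1_itv_lty.
      - by move=> x; rewrite indicE; case: (_ \in _); rewrite ?normr1 ?normr0.
      - by move=> x; rewrite indicE; case: (boolP (x \in _)) => [/set_mem//|_]; rewrite eqxx.
    apply: mulr_gt0; first lra.
    rewrite /Rintegral integral_indic// setIT.
    rewrite [X in fine X](_ : _ = (2 * h - h)%:E) /=; first lra.
    by apply: leb1_cc; lra.
  apply: le_Rintegral => // x _; rewrite indicE.
  have [/set_mem /=|_] := boolP (x \in _).
    rewrite in_itv /= mulr1 => /andP[x1 x2]; apply: spline_half.
    by rewrite ler_pdivlMr// mul1r x1/= ler_pdivrMr.
  by rewrite mulr0; have /andP[] := spline_bound (x / h).
have hi : 0 <= h^-1 by rewrite invr_ge0 ltW.
have hi2 : 0 <= h^-1 ^+ 2 by exact: sqr_ge0.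
have Ni : 0 <= N^-1 by rewrite invr_ge0 ltW.
pose K := 12 * N^-1 * (1 + h^-1 + h^-1 ^+ 2).
have KE1 : 12 * N^-1 <= K by rewrite /K ler_peMr ?mulr_ge0//; lra.
have KE2 : 12 * N^-1 * h^-1 <= K by rewrite /K ler_wpM2l ?mulr_ge0//; lra.
have KE3 : 12 * N^-1 * h^-1 ^+ 2 <= K by rewrite /K ler_wpM2l ?mulr_ge0//; lra.
exists K, (fun x => N^-1 * g x), (fun x => N^-1 * h^-1 * dspline (x / h)); split.
- split => x.
    have /andP[a1 a2] := spline_bound (x / h); rewrite mulr_ge0//=.
    by apply: le_trans KE1; rewrite mulrC ler_wpM2r.
  apply: le_trans KE2; rewrite normrM ger0_norm ?mulr_ge0//.
  have -> : 12 * N^-1 * h^-1 = N^-1 * h^-1 * 12 by ring.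
  by apply: ler_wpM2l; rewrite ?mulr_ge0// ler_norml dspline_bound.
- move=> x hx; have : g x != 0 \/ dspline (x / h) != 0.
    by case: hx; rewrite mulf_eq0 negb_or => /andP[_ ?]; [left|right].
  case=> [/g0//|]; apply: contraNT; rewrite negb_and -!ltNge => /orP hx'; apply/eqP.
  have [] // : spline (x / h) = 0 /\ dspline (x / h) = 0.
  apply: spline_out; case: hx' => hx'; [left|right].
    by rewrite ltr_pdivrMr// mul0r.
  by rewrite ltr_pdivlMr// /h; lra.
- move=> x s; rewrite /g mulrDl.
  have -> : N^-1 * spline (x / h + s / h) - N^-1 * spline (x / h) - N^-1 * h^-1 * dspline (x / h) * s
    = N^-1 * (spline (x / h + s / h) - spline (x / h) - dspline (x / h) * (s / h)) by ring.
  rewrite normrM (ger0_norm Ni).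
  apply: (le_trans (ler_wpM2l Ni (spline_rem _ _))).
  have -> : N^-1 * (12 * (s / h) ^+ 2) = (12 * N^-1 * h^-1 ^+ 2) * s ^+ 2 by rewrite exprMn; ring.
  by apply: ler_wpM2r => //; exact: sqr_ge0.
- move=> x s; rewrite mulrDl -mulrBr normrM ger0_norm ?mulr_ge0//.
  apply: (le_trans (ler_wpM2l _ (dspline_lip _ _))); first by rewrite mulr_ge0.
  rewrite normrM (ger0_norm hi).
  have -> : N^-1 * h^-1 * (12 * (`|s| * h^-1)) = (12 * N^-1 * h^-1 ^+ 2) * `|s| by ring.
  exact: ler_wpM2r.
- by rewrite RintegralZl// mulVf// gt_eqF.
Qed.

End Kernel.

(** * Smoothing of bounded measurable functions on the plane *)

Section Convolution.
Context {R : realType}.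
Local Notation T := (measurableTypeR R).
Local Notation P := (T * T)%type.
Local Notation leb1 := (@lebesgue_measure R).
Local Notation lam2 := (@lam2 R).
Local Notation J := (@J R).

Lemma lipschitz_continuous2 (g : R * R -> R) K :
  (forall z w, `|w| <= 1 -> `|g (z + w) - g z| <= K * `|w|) -> continuous g.
Proof.
move=> gK z.
have K0 : 0 <= K.
  have := gK 0 (1, 0); rewrite normr_pair /= normr1 normr0 maxEle ler10 mulr1.
  by move=> /(_ (lexx 1)); exact: le_trans.
apply/cvgrPdist_le => e e0.
have d0 : 0 < Num.min 1 (e / (K + 1)) by rewrite lt_min ltr01 divr_gt0// ltr_wpDl.
have : nbhs z (ball z (Num.min 1 (e / (K + 1)))) by exact: nbhsx_ballx.
apply: filterS => w [/=].
rewrite /ball /= !lt_min => /andP[a1 a2] /andP[b1 b2].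
have n1 : `|w - z| <= 1 by rewrite normr_pair ge_max distrC ltW//= distrC ltW.
have n2 : `|w - z| <= e / (K + 1) by rewrite normr_pair ge_max distrC ltW//= distrC ltW.
rewrite distrC -[w](subrK z) [w - z + z]addrC.
apply: (le_trans (gK _ _ n1)).
apply: (@le_trans _ _ ((K + 1) * `|w - z|)); first by rewrite ler_wpM2r// lerDl.
by rewrite mulrC -ler_pdivlMr ?ltr_wpDl.
Qed.

Lemma bcs_box (M : R) : bcs (\1_(box M) : P -> R).
Proof.
split; first by apply: measurable_indic; exact: measurableX.
exists (Num.max M 1); split => z.
  by rewrite indicE; case: (_ \in _); rewrite ?normr1 ?normr0 le_max ?lexx ?ler01 orbT.
rewrite indicE; case: (boolP (z \in _)) => [/set_mem [] /=|]; last by rewrite eqxx.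
by rewrite !in_itv/= -!ler_norml => h1 h2 _; split; rewrite le_max ?h1 ?h2.
Qed.

Lemma mem_box (M : R) z : in_box M z -> box M z.
Proof. by move=> [h1 h2]; split; rewrite /= in_itv/= -ler_norml. Qed.

(** Translating to a box centred at the origin makes the bound independent of the centre z. *)
Lemma J_le_box (g : P -> R) z N M : bcs g ->
  (forall w, in_box N w -> `|g (w + z)| <= M) ->
  (forall w, ~ in_box N w -> g (w + z) = 0) ->
  `|J g| <= M * J (\1_(box N)).
Proof.
move=> bg gM g0; rewrite -(J_translate z bg).
have bgz : bcs (fun w => g (w + z)).
  have [mg [K [gK gs]]] := bg; split.
    exact: (measurableT_comp mg (measurable_fun_translate2 z)).
  exists (K + `|z|); split => [w|w /gs[h1 h2]].
    by apply: (le_trans (gK _)); rewrite lerDl.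
  split.
    rewrite (_ : w.1 = (w + z).1 - z.1); last by rewrite /= addrK.
    apply: (le_trans (ler_normB _ _)); apply: lerD => //; exact: normr_fst.
  rewrite (_ : w.2 = (w + z).2 - z.2); last by rewrite /= addrK.
  apply: (le_trans (ler_normB _ _)); apply: lerD => //; exact: normr_snd.
apply: (le_trans (J_abs bgz)); rewrite -JZ; last exact: bcs_box.
apply: le_J; first exact: bcs_norm.
  by apply: bcsZ; exact: bcs_box.
move=> w; have [h|h] := pselect (in_box N w).
  by rewrite indicE mem_set ?mulr1; [exact: gM|exact: mem_box].
rewrite g0// normr0 indicE.
case: (boolP (w \in _)) => [/set_mem [] /=|]; last by rewrite mulr0.
by rewrite !in_itv/= -!ler_norml => h1 h2; case: h.
Qed.

Lemma measurable_sub_add2 :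
  measurable_fun setT (fun x : P * P => (x.1 + x.2 : P)).
Proof.
apply/measurable_fun_pairP; split.
  rewrite (_ : fst \o _ = (fun x : P * P => (x.1.1 + x.2.1 : R)))//.
  apply: measurable_funD.
    exact: (measurableT_comp measurable_fst measurable_fst).
  exact: (measurableT_comp measurable_fst measurable_snd).
rewrite (_ : snd \o _ = (fun x : P * P => (x.1.2 + x.2.2 : R)))//.
apply: measurable_funD.
  exact: (measurableT_comp measurable_snd measurable_fst).
exact: (measurableT_comp measurable_snd measurable_snd).
Qed.

Lemma lam22_box (M : R) : ((lam2 \x lam2) (box M `*` box M) < +oo)%E.
Proof.
have mb : measurable (box M : set P) by exact: measurableX.
have e := product_measure1E lam2 lam2 mb mb.
by rewrite [X in (X < _)%E]e lte_mul_pinfty// ?ge0_fin_numE// lam2_box.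
Qed.

Lemma J_fubini2 (F : P -> P -> R) M :
  measurable_fun setT (fun x : P * P => F x.1 x.2) ->
  (forall z w, `|F z w| <= M) ->
  (forall z w, F z w != 0 -> in_box M z /\ in_box M w) ->
  J (fun z => J (F z)) = J (fun w => J (fun z => F z w)).
Proof.
move=> mF FM F0.
have bF1 z : bcs (F z).
  split; first exact: (measurableT_comp mF (measurable_pair1 z)).
  by exists M; split => // w /F0[].
have bF2 w : bcs (F ^~ w).
  split; first exact: (measurableT_comp mF (measurable_pair2 w)).
  by exists M; split => // z /F0[].
have iF : (lam2 \x lam2)%E.-integrable setT (fun x : P * P => (F x.1 x.2)%:E).
  apply: (@integrable_bounded_supp _ _ _ (lam2 \x lam2)%E _ (box M `*` box M) M) => //.
  - by apply: measurableX; exact: measurableX.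
  - exact: lam22_box.
  - by move=> x /F0[h1 h2]; split; exact: mem_box.
rewrite /J {1}/Rintegral [RHS]/Rintegral; congr fine.
have e1 : (\int[lam2]_z (Rintegral lam2 setT (F z))%:E = \int[lam2]_z \int[lam2]_w (F z w)%:E)%E.
  by apply: eq_integral => z _; exact: (EFinJ (bF1 z)).
have e2 : (\int[lam2]_w (Rintegral lam2 setT (F ^~ w))%:E = \int[lam2]_w \int[lam2]_z (F z w)%:E)%E.
  by apply: eq_integral => w _; exact: (EFinJ (bF2 w)).
by rewrite e1 e2; exact: (Fubini iF).
Qed.

Lemma bcs_J (F : P -> P -> R) M :
  measurable_fun setT (fun x : P * P => F x.1 x.2) ->
  (forall z w, `|F z w| <= M) ->
  (forall z w, F z w != 0 -> in_box M z /\ in_box M w) ->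
  bcs (fun w => J (fun z => F z w)).
Proof.
move=> mF FM F0.
have bF2 w : bcs (F ^~ w).
  split; first exact: (measurableT_comp mF (measurable_pair2 w)).
  by exists M; split => // z /F0[].
have M0 : 0 <= M by exact: le_trans (normr_ge0 _) (FM 0 0).
have iF : (lam2 \x lam2)%E.-integrable setT (fun x : P * P => (F x.1 x.2)%:E).
  apply: (@integrable_bounded_supp _ _ _ (lam2 \x lam2)%E _ (box M `*` box M) M) => //.
  - by apply: measurableX; exact: measurableX.
  - exact: lam22_box.
  - by move=> x /F0[h1 h2]; split; exact: mem_box.
split.
  have := measurable_fubini_G iF; rewrite /fubini_G /= => h.
  exact: (measurableT_comp (fine_measurable measurableT) h).
have J0' : 0 <= J (\1_(box M)) by apply: J_ge0.
exists (M * J (\1_(box M)) + M); split => [w|w h].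
  rewrite (@le_trans _ _ (M * J (\1_(box M))))// ?lerDl//.
  apply: (@J_le_box _ 0) => // z nz.
  by apply/eqP; apply: contraT => /F0[]; rewrite addr0.
apply: (@in_box_le _ M); first by rewrite lerDr mulr_ge0.
apply: contrapT => nb; move/eqP: h; apply.
rewrite -[RHS](@J0 R); congr J; apply/funext => z.
by apply/eqP; apply: contraT => /F0[].
Qed.

Section kernel.
Variables (del K : R) (be be' : R -> R).
Hypothesis ker : is_kernel del K be be'.

Definition rho (w : R * R) : R := be w.1 * be w.2.

(** An average of translates of f, that is a correlation with [rho]; hence the minus signs in its
    partial derivatives. *)
Definition smear (f : P -> R) (z : R * R) : R := J (fun w => f (w + z) * rho w).

Let be0 x : 0 <= be x. Proof. by case: ker => -[/(_ x)/andP[]]. Qed.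
Let beK x : be x <= K. Proof. by case: ker => -[/(_ x)/andP[]]. Qed.
Let K0 : 0 <= K. Proof. exact: le_trans (be0 0) (beK 0). Qed.

Lemma kernel_lip x s : `|s| <= 1 -> `|be (x + s) - be x| <= 2 * K * `|s|.
Proof.
move=> s1; have [[_ b'K] _ rem _ _] := ker.
have h := rem x s.
have s2 : s ^+ 2 <= `|s| by rewrite -real_normK ?num_real// expr2 ler_piMr.
have ds : `|be' x * s| <= K * `|s| by rewrite normrM ler_wpM2r// b'K.
have -> : be (x + s) - be x = (be (x + s) - be x - be' x * s) + be' x * s by ring.
apply: (le_trans (ler_normD _ _)).
have : K * s ^+ 2 <= K * `|s| by rewrite ler_wpM2l.
by lra.
Qed.

Lemma kernel_continuous : continuous be.
Proof. exact: lipschitz_continuous kernel_lip. Qed.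

Lemma kernel_continuous' : continuous be'.
Proof. by have [_ _ _ h _] := ker; apply: (@lipschitz_continuous _ _ K). Qed.

Let prod_continuous (a b : R -> R) : continuous a -> continuous b ->
  continuous (fun w : R * R => a w.1 * b w.2).
Proof.
move=> ca cb w; apply: cvgM.
  exact: (continuous_comp (@continuous_fst R w) (ca w.1)).
exact: (continuous_comp (@continuous_snd R w) (cb w.2)).
Qed.

Lemma rho_ge0 w : 0 <= rho w. Proof. by rewrite mulr_ge0. Qed.

Lemma rho_supp w : rho w != 0 -> 0 <= w.1 <= del /\ 0 <= w.2 <= del.
Proof.
have [_ h _ _ _] := ker.
by rewrite /rho mulf_eq0 negb_or => /andP[h1 h2]; split; apply: h; left.
Qed.

Let box_del (w : R * R) : 0 <= w.1 <= del -> 0 <= w.2 <= del -> in_box del w.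
Proof. by move=> /andP[a b] /andP[c d]; split; rewrite ger0_norm. Qed.

Lemma rho_bcs : bcs rho.
Proof.
apply: (@bcs_continuous _ _ del); first exact: prod_continuous kernel_continuous kernel_continuous.
by move=> z /rho_supp[]; exact: box_del.
Qed.

Lemma J_rho : J rho = 1.
Proof.
have [_ supp _ _ be1] := ker.
have ib : leb1.-integrable setT (EFin \o be).
  apply: (@integrable_bounded_supp _ _ _ leb1 _ `[0, del]%classic K) => //.
  - by apply: continuous_measurable_fun; exact: kernel_continuous.
  - exact: leb1_itv_lty.
  - by move=> x; rewrite ger0_norm.
  - by move=> x bx; rewrite /= in_itv/=; apply: supp; left.
rewrite J_fubini; last exact: rho_bcs.
rewrite -be1; apply: eq_Rintegral => y _.
by rewrite /rho /= RintegralZr// be1 mul1r.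
Qed.

Section f.
Variable f : P -> R.
Hypothesis mf : measurable_fun setT f.
Hypothesis f1 : forall z, `|f z| <= 1.

Let bcs_ker (k : R * R -> R) z : continuous k -> (forall w, k w != 0 -> in_box del w) ->
  bcs (fun w => f (w + z) * k w).
Proof.
move=> ck k0; apply: (@bcsMl _ k (fun w => f (w + z)) 1) => //.
  exact: bcs_continuous k0.
exact: (measurableT_comp mf (measurable_fun_translate2 z)).
Qed.

Let sub_continuous (k : R * R -> R) (z : R * R) : continuous k -> continuous (fun w : R * R => k (w - z)).
Proof.
move=> ck w; apply: (@continuous_comp _ _ _ (fun w : R * R => w - z) k); last exact: ck.
by apply: cvgB; [exact: cvg_id|exact: cvg_cst].
Qed.

Let sub_box (k : R * R -> R) (z : R * R) : (forall w, k w != 0 -> in_box del w) ->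
  forall w, k (w - z) != 0 -> in_box (del + `|z|) w.
Proof.
move=> k0 w /k0[h1 h2]; split.
  rewrite (_ : w.1 = (w - z).1 + z.1); last by rewrite /= subrK.
  apply: (le_trans (ler_normD _ _)); apply: lerD => //; exact: normr_fst.
rewrite (_ : w.2 = (w - z).2 + z.2); last by rewrite /= subrK.
apply: (le_trans (ler_normD _ _)); apply: lerD => //; exact: normr_snd.
Qed.

Let bcs_ker' (k : R * R -> R) (z : R * R) : continuous k -> (forall w, k w != 0 -> in_box del w) ->
  bcs (fun w : R * R => f w * k (w - z)).
Proof.
move=> ck k0; apply: (@bcsMl _ (fun w => k (w - z)) f 1) => //.
by apply: bcs_continuous (sub_box k0); exact: sub_continuous.
Qed.

Let shift (k : R * R -> R) (z : R * R) : continuous k -> (forall w, k w != 0 -> in_box del w) ->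
  J (fun w : R * R => f (w + z) * k w) = J (fun w : R * R => f w * k (w - z)).
Proof.
move=> ck k0; rewrite -(J_translate (- z) (bcs_ker z ck k0)).
by congr J; apply/funext => w; rewrite subrK.
Qed.

Lemma smear_bound z : `|smear f z| <= 1.
Proof.
have b : bcs (fun w => f (w + z) * rho w).
  apply: bcs_ker; first exact: prod_continuous kernel_continuous kernel_continuous.
  by move=> w /rho_supp[]; exact: box_del.
apply: (le_trans (J_abs b)); rewrite -J_rho; apply: le_J.
- exact: bcs_norm.
- exact: rho_bcs.
- by move=> w; rewrite normrM (ger0_norm (rho_ge0 w)) ler_piMl// rho_ge0.
Qed.

Lemma smear_ge0 z : (forall z, 0 <= f z) -> 0 <= smear f z.
Proof. by move=> f0; apply: J_ge0 => w; rewrite mulr_ge0// rho_ge0. Qed.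

Lemma smear_supp z : smear f z != 0 ->
  exists w : R * R, [/\ 0 <= w.1 <= del, 0 <= w.2 <= del & f (w + z) != 0].
Proof.
move=> h; apply: contrapT => H; move/eqP: h; apply.
rewrite /smear -[RHS](@J0 R); congr J; apply/funext => w.
have [->|r0] := eqVneq (rho w) 0; first by rewrite mulr0.
have [w1 w2] := rho_supp r0.
have [->|f0] := eqVneq (f (w + z)) 0; first by rewrite mul0r.
by exfalso; apply: H; exists w.
Qed.

Let rho1 (w : R * R) := be' w.1 * be w.2.
Let rho2 (w : R * R) := be w.1 * be' w.2.

Let rho1_supp w : rho1 w != 0 -> in_box del w.
Proof.
have [_ h _ _ _] := ker.
by rewrite mulf_eq0 negb_or => /andP[h1 h2]; apply: box_del; apply: h; [right|left].
Qed.

Let rho2_supp w : rho2 w != 0 -> in_box del w.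
Proof.
have [_ h _ _ _] := ker.
by rewrite mulf_eq0 negb_or => /andP[h1 h2]; apply: box_del; apply: h; [left|right].
Qed.

Let rho'_supp w : rho w != 0 -> in_box del w.
Proof. by move=> /rho_supp[]; exact: box_del. Qed.

Let c0 : continuous rho := prod_continuous kernel_continuous kernel_continuous.
Let c1 : continuous rho1 := prod_continuous kernel_continuous' kernel_continuous.
Let c2 : continuous rho2 := prod_continuous kernel_continuous kernel_continuous'.

Let J_small (g : P -> R) M (z : R * R) : bcs g -> 0 <= M ->
  (forall w, `|g w| <= M) -> (forall w, g w != 0 -> in_box (del + 1) (w - z)) ->
  `|J g| <= M * J (\1_(box (del + 1))).
Proof.
move=> bg M0 gM g0; apply: (@J_le_box _ z) => //.
move=> w nw; apply/eqP; apply: contraT => /g0.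
by rewrite addrK => /nw.
Qed.

Let supp_shift (k : R * R -> R) (z v w : R * R) : `|v| <= 1 -> (forall w, k w != 0 -> in_box del w) ->
  k (w - (z + v)) != 0 -> in_box (del + 1) (w - z).
Proof.
move=> v1 k0 /k0[h1 h2]; split.
  rewrite (_ : (w - z).1 = (w - (z + v)).1 + v.1); last by rewrite /=; ring.
  apply: (le_trans (ler_normD _ _)); apply: lerD => //.
  exact: le_trans (normr_fst _) v1.
rewrite (_ : (w - z).2 = (w - (z + v)).2 + v.2); last by rewrite /=; ring.
apply: (le_trans (ler_normD _ _)); apply: lerD => //.
exact: le_trans (normr_snd _) v1.
Qed.

Let supp_0 (k : R * R -> R) (z w : R * R) : (forall w, k w != 0 -> in_box del w) ->
  k (w - z) != 0 -> in_box (del + 1) (w - z).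
Proof. by move=> k0 /k0; apply: in_box_le; rewrite lerDl. Qed.

Let lip_conv (k : R * R -> R) L : continuous k -> (forall w, k w != 0 -> in_box del w) -> 0 <= L ->
  (forall w v, `|v| <= 1 -> `|k (w + v) - k w| <= L * `|v|) ->
  continuous (fun z : R * R => J (fun w : R * R => f w * k (w - z))).
Proof.
move=> ck k0 L0 kL; apply: (@lipschitz_continuous2 _ (L * J (\1_(box (del + 1))))) => z v v1.
rewrite -JB; [|exact: bcs_ker'|exact: bcs_ker'].
rewrite mulrAC; apply: (@J_small _ _ z).
- by apply: bcsB; exact: bcs_ker'.
- by rewrite mulr_ge0.
- move=> w; rewrite -mulrBr normrM.
  apply: (@le_trans _ _ (1 * `|k (w - (z + v)) - k (w - z)|)); first exact: ler_wpM2r.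
  rewrite mul1r.
  have -> : w - (z + v) = (w - z) + (- v) by rewrite opprD addrA.
  by rewrite -(normrN v); apply: kL; rewrite normrN.
- move=> w; have [e1|] := eqVneq (k (w - (z + v))) 0; last by move=> h _; exact: supp_shift h.
  have [e2|] := eqVneq (k (w - z)) 0; last by move=> h _; exact: supp_0 h.
  by rewrite e1 e2 !mulr0 subrr eqxx.
Qed.

Let be'_bound x : `|be' x| <= K. Proof. by case: ker => -[_]. Qed.
Let be_bound x : `|be x| <= K. Proof. by rewrite ger0_norm. Qed.

Let prod_lip (a b : R -> R) : (forall x, `|a x| <= K) -> (forall x, `|b x| <= K) ->
  (forall x s, `|s| <= 1 -> `|a (x + s) - a x| <= 2 * K * `|s|) ->
  (forall x s, `|s| <= 1 -> `|b (x + s) - b x| <= 2 * K * `|s|) ->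
  forall w v : R * R, `|v| <= 1 ->
  `|a (w + v).1 * b (w + v).2 - a w.1 * b w.2| <= (4 * K * K) * `|v|.
Proof.
move=> aK bK aL bL w v v1 /=.
have h1 := le_trans (normr_fst v) v1; have h2 := le_trans (normr_snd v) v1.
have -> : a (w.1 + v.1) * b (w.2 + v.2) - a w.1 * b w.2 =
  (a (w.1 + v.1) - a w.1) * b (w.2 + v.2) + a w.1 * (b (w.2 + v.2) - b w.2) by ring.
apply: (le_trans (ler_normD _ _)); rewrite !normrM.
have i1 : `|a (w.1 + v.1) - a w.1| * `|b (w.2 + v.2)| <= (2 * K * `|v|) * K.
  apply: ler_pM => //; apply: (le_trans (aL _ _ h1)).
  by rewrite ler_wpM2l ?mulr_ge0//; exact: normr_fst.
have i2 : `|a w.1| * `|b (w.2 + v.2) - b w.2| <= K * (2 * K * `|v|).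
  apply: ler_pM => //; apply: (le_trans (bL _ _ h2)).
  by rewrite ler_wpM2l ?mulr_ge0//; exact: normr_snd.
have -> : 4 * K * K * `|v| = 2 * K * `|v| * K + K * (2 * K * `|v|) by ring.
exact: lerD.
Qed.

Let be'_lip x s : `|s| <= 1 -> `|be' (x + s) - be' x| <= 2 * K * `|s|.
Proof.
move=> _; have [_ _ _ h _] := ker; apply: (le_trans (h x s)).
rewrite ler_wpM2r//; have := K0; lra.
Qed.

(** Translation invariance moves z onto the kernel, so the regularity is that of [rho] and f need
    only be bounded and measurable. The remainder is exported because [shift_smooth] needs it
    uniformly. *)
Lemma smear_grad : exists p q C, grad (smear f) p q /\
  forall z v, `|v| <= 1 -> `|smear f (z + v) - smear f z - lin2 (p z) (q z) v| <= C * `|v| ^+ 2.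
Proof.
exists (fun z => - J (fun w => f w * rho1 (w - z))), (fun z => - J (fun w => f w * rho2 (w - z))).
exists ((4 * K * K) * J (\1_(box (del + 1)))).
have K4 : 0 <= 4 * K * K by rewrite !mulr_ge0.
have rlip1 := prod_lip be'_bound be_bound be'_lip kernel_lip.
have rlip2 := prod_lip be_bound be'_bound kernel_lip be'_lip.
suff H z v : `|v| <= 1 -> `|smear f (z + v) - smear f z -
    lin2 (- J (fun w => f w * rho1 (w - z))) (- J (fun w => f w * rho2 (w - z))) v| <=
    ((4 * K * K) * J (\1_(box (del + 1)))) * `|v| ^+ 2.
  split => //; apply: grad_quad H _ _ => z; apply: cvgN.
    exact: (@lip_conv rho1 _ c1 rho1_supp K4 rlip1).
  exact: (@lip_conv rho2 _ c2 rho2_supp K4 rlip2).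
move=> v1; rewrite /smear !(shift _ c0 rho'_supp) /lin2.
rewrite -JB; [|exact: bcs_ker'|exact: bcs_ker'].
have eq3 (X a b : R) : X - (- a * v.1 + - b * v.2) = X + (v.1 * a + v.2 * b) by ring.
rewrite eq3.
rewrite -(JZ v.1 (bcs_ker' z c1 rho1_supp)) -(JZ v.2 (bcs_ker' z c2 rho2_supp)).
have b1 : bcs (fun w => v.1 * (f w * rho1 (w - z))) by apply: bcsZ; exact: bcs_ker'.
have b2 : bcs (fun w => v.2 * (f w * rho2 (w - z))) by apply: bcsZ; exact: bcs_ker'.
have b3 : bcs (fun w => f w * rho (w - (z + v)) - f w * rho (w - z)).
  by apply: bcsB; exact: bcs_ker'.
rewrite -JD// -JD//; last exact: bcsD.
rewrite mulrAC; apply: (@J_small _ _ z).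
- by apply: bcsD => //; exact: bcsD.
- by rewrite mulr_ge0// sqr_ge0.
- move=> w.
  have -> : f w * rho (w - (z + v)) - f w * rho (w - z) +
     (v.1 * (f w * rho1 (w - z)) + v.2 * (f w * rho2 (w - z))) =
     f w * (rho (w - (z + v)) - rho (w - z) + (v.1 * rho1 (w - z) + v.2 * rho2 (w - z))) by ring.
  rewrite normrM; apply: (@le_trans _ _ (1 * `|rho (w - (z + v)) - rho (w - z) +
      (v.1 * rho1 (w - z) + v.2 * rho2 (w - z))|)); first exact: ler_wpM2r.
  rewrite mul1r /rho /rho1 /rho2 /=.
  have -> : w.1 - (z.1 + v.1) = (w.1 - z.1) + (- v.1) by ring.
  have -> : w.2 - (z.2 + v.2) = (w.2 - z.2) + (- v.2) by ring.
  set x := w.1 - z.1; set y := w.2 - z.2.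
  have [_ _ rem _ _] := ker.
  have r1 := rem x (- v.1); have r2 := rem y (- v.2).
  have h1 : `|v.1| <= `|v| := normr_fst v; have h2 : `|v.2| <= `|v| := normr_snd v.
  have l2 : `|be (y + - v.2) - be y| <= 2 * K * `|v.2|.
    by rewrite -(normrN v.2); apply: kernel_lip; rewrite normrN (le_trans h2).
  (* Two one-variable remainders and a cross term; they contribute [K^2], [K^2] and [2 K^2], whence
     the constant [4 * K * K]. *)
  have -> : be (x + - v.1) * be (y + - v.2) - be x * be y + (v.1 * (be' x * be y) + v.2 * (be x * be' y)) =
    (be (x + - v.1) - be x - be' x * (- v.1)) * be (y + - v.2) +
    be x * (be (y + - v.2) - be y - be' y * (- v.2)) -
    (be' x * v.1) * (be (y + - v.2) - be y) by ring.
  apply: (le_trans (ler_normB _ _)).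
  apply: (@le_trans _ _ (K * `|v| ^+ 2 * K + K * (K * `|v| ^+ 2) + K * `|v| * (2 * K * `|v|))); last first.
    by rewrite le_eqVlt; apply/orP; left; apply/eqP; ring.
  have sq (a : R) : `|a| <= `|v| -> a ^+ 2 <= `|v| ^+ 2.
    by move=> h; rewrite -[a ^+ 2]real_normK ?num_real// ler_sqr ?nnegrE.
  apply: lerD; last first.
    rewrite normrM; apply: ler_pM => //; first by rewrite normrM; apply: ler_pM.
    by apply: (le_trans l2); rewrite ler_wpM2l ?mulr_ge0.
  apply: (le_trans (ler_normD _ _)); rewrite !normrM; apply: lerD; apply: ler_pM => //.
    by apply: (le_trans r1); rewrite sqrrN; apply: ler_wpM2l => //; exact: sq.
  by apply: (le_trans r2); rewrite sqrrN; apply: ler_wpM2l => //; exact: sq.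
- move=> w; have [e1|] := eqVneq (rho (w - (z + v))) 0; last by move=> h _; exact: supp_shift h.
  have [e2|] := eqVneq (rho (w - z)) 0; last by move=> h _; exact: supp_0 h.
  have [e3|] := eqVneq (rho1 (w - z)) 0; last by move=> h _; exact: supp_0 h.
  have [e4|] := eqVneq (rho2 (w - z)) 0; last by move=> h _; exact: supp_0 h.
  by rewrite e1 e2 e3 e4 !mulr0 !addr0 subrr eqxx.
Qed.

(** By Fubini the integral is a [rho]-average of the integrals of translates, and [rho] has mass 1.
    This is why smoothing does not increase perimeter. *)
Lemma smear_test d c : bcs d ->
  (forall w, J (fun z => f (w + z) * d z) <= c) -> J (fun z => smear f z * d z) <= c.
Proof.
move=> bd hc; have [md [M [dM d0]]] := bd.
have M0 : 0 <= M by exact: le_trans (normr_ge0 _) (dM 0).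
have -> : (fun z => smear f z * d z) = (fun z => J (fun w => f (w + z) * rho w * d z)).
  apply/funext => z; rewrite /smear mulrC -JZ; last exact: bcs_ker c0 rho'_supp.
  by congr J; apply/funext => w; ring.
pose N := Num.max M (Num.max (K * K * M) del).
have MN : M <= N by rewrite le_max lexx.
have H1 : measurable_fun setT (fun x : P * P => f (x.2 + x.1) * rho x.2 * d x.1).
  apply: measurable_funM; last exact: (measurableT_comp md measurable_fst).
  apply: measurable_funM; last first.
    by have [mr _] := rho_bcs; exact: (measurableT_comp mr measurable_snd).
  rewrite (_ : (fun x : P * P => f (x.2 + x.1)) = f \o (fun x : P * P => (x.1 + x.2 : P))).
    exact: (measurableT_comp mf measurable_sub_add2).
  by apply/funext => x /=; rewrite addrC.
have H2 z w : `|f (w + z) * rho w * d z| <= N.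
  apply: (@le_trans _ _ (K * K * M)); last by rewrite !le_max lexx orbT.
  rewrite normrM; apply: ler_pM => //; rewrite normrM (ger0_norm (rho_ge0 _)).
  apply: (@le_trans _ _ (1 * rho w)); first by rewrite ler_wpM2r// rho_ge0.
  by rewrite mul1r; apply: ler_pM.
have H3 z w : f (w + z) * rho w * d z != 0 -> in_box N z /\ in_box N w.
  rewrite mulf_eq0 negb_or mulf_eq0 negb_or => /andP[/andP[_ h1] h2]; split.
    by apply: in_box_le MN _; exact: d0.
  by apply: in_box_le (rho'_supp h1); rewrite !le_max lexx !orbT.
rewrite (J_fubini2 H1 H2 H3).
have bfd w : bcs (fun z => f (w + z) * d z).
  apply: (@bcsMl _ d (fun z => f (w + z)) 1) => //.
  rewrite (_ : (fun z => f (w + z)) = f \o (fun z : P => (z + w : P))).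
    exact: (measurableT_comp mf (measurable_fun_translate2 w)).
  by apply/funext => z /=; rewrite addrC.
rewrite -[leRHS]mulr1 -J_rho -JZ; last exact: rho_bcs.
have e w : J (fun z => f (w + z) * rho w * d z) = rho w * J (fun z => f (w + z) * d z).
  by rewrite -JZ//; congr J; apply/funext => z; ring.
apply: le_J.
- exact: bcs_J H1 H2 H3.
- by apply: bcsZ; exact: rho_bcs.
- by move=> w; rewrite e mulrC ler_wpM2r// rho_ge0.
Qed.

End f.
End kernel.
End Convolution.

(** * Continuity of translations in L1, along one axis *)

Section Translation.
Context {R : realType}.
Local Notation T := (measurableTypeR R).
Local Notation P := (T * T)%type.
Local Notation leb1 := (@lebesgue_measure R).
Local Notation lam2 := (@lam2 R).
Local Notation J := (@J R).

Definition tr (s : R) (S : set T) : set T := [set x | S (x + s)].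

Lemma measurable_tr (S : set T) (s : R) : measurable S -> measurable (tr s S).
Proof.
move=> mS; rewrite -[X in measurable X]setTI.
exact: (measurable_funD (@measurable_id _ _ setT) (measurable_cst s)).
Qed.

Lemma leb1_tr (S : set T) (s : R) : measurable S -> leb1 (tr s S) = leb1 S.
Proof. exact: leb1_translate. Qed.

Lemma compact_translate (V U : set R) : compact V -> open U -> V `<=` U ->
  exists2 d : R, 0 < d & forall s x, `|s| < d -> V x -> U (x + s).
Proof.
move=> cV oU VU.
have /(_ R (nbhs (0 : R)) (fun s x => U (x + s))) := (compact_near_coveringP V).1 cV.
move=> /(_ _ _)[].
  move=> x Vx.
  have : (fun p : R * R => p.1 + p.2) @ (x, 0 : R) --> x + 0.
    by apply: cvgD; [exact: cvg_fst|exact: cvg_snd].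
  rewrite addr0 => /(_ U); apply.
  by apply: open_nbhs_nbhs; split => //; exact: VU.
move=> d d0 h; exists d => // s x sd Vx; apply: h => //=.
by rewrite /ball/= sub0r normrN.
Qed.

(** Squeeze S between a compact V and an open U. If [x + s] lies in V then x lies in U for small s,
    so a point x outside S with [x + s] in S lies either in a translate of the small set [S \ V] or
    in [U \ S]. *)
Lemma leb1_shift_diff (S : set T) : measurable S -> (leb1 S < +oo)%E ->
  forall e : R, 0 < e -> exists2 d : R, 0 < d & forall s, `|s| < d ->
   (leb1 (tr s S `\` S) <= e%:E)%E.
Proof.
move=> mS Soo e e0.
have e2 : 0 < e / 2 by rewrite divr_gt0.
have [V [cV VS lV]] := lebesgue_regularity_inner mS Soo e2.
have [U [oU SU lU]] := lebesgue_regularity_outer mS Soo e2.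
have [d d0 hd] := compact_translate cV oU (subset_trans VS SU).
exists d => // s sd.
have mV : measurable (V : set T) by exact: compact_measurable.
have mU : measurable (U : set T) by exact: open_measurable.
apply: (@le_trans _ _ (leb1 (tr s (S `\` V) `|` (U `\` S)))).
  apply: le_measure; rewrite ?inE.
  - by apply: measurableD => //; exact: measurable_tr.
  - apply: measurableU; last exact: measurableD.
    by apply: measurable_tr; exact: measurableD.
  - move=> x /= [xS nS]; have [xV|xV] := pselect (V (x + s)); last by left.
    right; split => //; have := hd (- s) _ _ xV.
    by rewrite normrN addrK; exact.
have mSV : measurable (S `\` V : set T) by exact: measurableD.
have mUS : measurable (U `\` S : set T) by exact: measurableD.
apply: (le_trans (measureU2 _ (measurable_tr s mSV) mUS)).
have -> : e = e / 2 + e / 2 by field.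
rewrite EFinD; apply: leeD; last exact: ltW.
by have e1 := leb1_tr s mSV; rewrite [X in (X <= _)%E]e1 ltW.
Qed.

Lemma line_integrable (f : P -> R) y : bcs f -> leb1.-integrable setT (EFin \o (fun x => f (x, y))).
Proof.
move=> [mf [M [fM f0]]].
apply: (@integrable_bounded_supp _ _ _ leb1 _ `[- M, M]%classic M) => //.
- exact: (measurableT_comp mf (measurable_pair2 y)).
- exact: leb1_itv_lty.
- by move=> x /f0[h1 h2]; rewrite /= in_itv/= -ler_norml.
Qed.

Lemma measurable_line_integral (f : P -> R) : bcs f ->
  measurable_fun (setT : set T) (fun y => Rintegral leb1 setT (fun x => f (x, y))).
Proof.
move=> bf; have := @measurable_fubini_G _ _ T T R leb1 leb1 _ (bcs_integrable bf).
by move=> h; exact: (measurableT_comp (fine_measurable measurableT) h).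
Qed.

Lemma bcs_indic (A : set P) M : measurable A -> (forall z, A z -> in_box M z) -> bcs (\1_A : P -> R).
Proof.
move=> mA AM; split; first exact: measurable_indic.
exists (Num.max M 1); split => z.
  by rewrite indicE; case: (_ \in _); rewrite ?normr1 ?normr0 le_max ?lexx ?ler01 orbT.
rewrite indicE; case: (boolP (z \in _)) => [/set_mem /AM h _|]; last by rewrite eqxx.
by apply: in_box_le h; rewrite le_max lexx.
Qed.

Lemma bcs_translate (f : P -> R) (t : R * R) : bcs f -> bcs (fun z => f (z + t)).
Proof.
move=> [mf [M [fM f0]]]; split.
  exact: (measurableT_comp mf (measurable_fun_translate2 t)).
exists (M + `|t|); split => [w|w /f0[h1 h2]].
  by apply: (le_trans (fM _)); rewrite lerDl.
split.
  rewrite (_ : w.1 = (w + t).1 - t.1); last by rewrite /= addrK.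
  apply: (le_trans (ler_normB _ _)); apply: lerD => //; exact: normr_fst.
rewrite (_ : w.2 = (w + t).2 - t.2); last by rewrite /= addrK.
apply: (le_trans (ler_normB _ _)); apply: lerD => //; exact: normr_snd.
Qed.

Definition shift_dist (A : set P) (t : R * R) : R := J (fun z => `|\1_A (z + t) - \1_A z|).

Lemma shift_dist_bcs (A : set P) M t : measurable A -> (forall z, A z -> in_box M z) ->
  bcs (fun z => `|\1_A (z + t) - \1_A z| : R).
Proof.
move=> mA AM; apply: bcs_norm; apply: bcsB; last exact: bcs_indic AM.
exact: (bcs_translate t (bcs_indic mA AM)).
Qed.

(** A sequence of displacements violating the claim is contradicted by dominated convergence: on
    each line the measure of the difference tends to 0. *)
Lemma shift_dist_line (A : set P) M : measurable A -> (forall z, A z -> in_box M z) ->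
  forall e : R, 0 < e -> exists2 d : R, 0 < d & forall s, `|s| < d ->
    shift_dist A (s, 0) <= e.
Proof.
move=> mA AM e e0; apply: contrapT => H.
have {}H n : exists s : R, `|s| < n.+1%:R^-1 /\ e < shift_dist A (s, 0).
  apply: contrapT => K; apply: H; exists n.+1%:R^-1; first by rewrite invr_gt0.
  by move=> s sn; rewrite leNgt; apply/negP => es; apply: K; exists s.
pose s n := sval (cid (H n)).
have sP n : `|s n| < n.+1%:R^-1 /\ e < shift_dist A (s n, 0) := svalP (cid (H n)).
pose g n (z : P) : R := `|\1_A (z + (s n, 0)) - \1_A z|.
have bg n : bcs (g n) by exact: shift_dist_bcs AM.
pose G n y := Rintegral leb1 setT (fun x => g n (x, y)).
have M0 : 0 <= `|M| by [].
(* The length of an interval containing the supports of all [g n] on a line, since [|s n| <= 1]. *)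
pose C := 2 * (`|M| + 1).
have sn1 n : `|s n| <= 1.
  by have [h _] := sP n; rewrite (le_trans (ltW h))// invf_le1// ler1n.
have g01 n z : 0 <= g n z <= 1.
  rewrite /g !indicE normr_ge0/=.
  by case: (_ \in _); case: (_ \in _); rewrite ?subrr ?subr0 ?sub0r ?normrN ?normr0 ?normr1.
have gsupp n x y : g n (x, y) != 0 -> `|x| <= `|M| + 1 /\ `|y| <= `|M|.
  rewrite /g !indicE => h.
  have : A ((x, y) + (s n, 0)) \/ A (x, y).
    move: h; case: (boolP ((x, y) + (s n, 0) \in A)) => [/set_mem|_]; first by left.
    case: (boolP ((x, y) \in A)) => [/set_mem|_]; first by right.
    by rewrite subrr normr0 eqxx.
  have MM := ler_norm M; case=> /AM[/= h1 h2].
    rewrite addr0 in h2; split; last exact: le_trans MM.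
    have -> : x = x + s n - s n by ring.
    by apply: (le_trans (ler_normB _ _)); apply: lerD => //; exact: le_trans MM.
  by split; [apply: (le_trans h1); rewrite (le_trans MM)// lerDl|exact: le_trans MM].
have G0 n y : 0 <= G n y by apply: Rintegral_ge0 => x _; have /andP[] := g01 n (x, y).
have GC n y : G n y <= C * \1_(`[- `|M|, `|M|]%classic) y.
  have [hy|hy] := leP `|y| `|M|; last first.
    rewrite indicE memNset; last first.
      by rewrite /= in_itv/= -ler_norml => h; move: hy; rewrite ltNge h.
    rewrite mulr0 /G (_ : (fun x => _) = fun=> 0) /Rintegral ?integral0//.
    apply/funext => x; apply/eqP; apply: contraT => /gsupp[_].
    by rewrite leNgt hy.
  rewrite indicE mem_set; last by rewrite /= in_itv/= -ler_norml.
  rewrite mulr1 /G (@Rintegral_supp _ _ (`|M| + 1)); last by move=> x /gsupp[].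
  apply: (@le_trans _ _ (Rintegral leb1 `[- (`|M| + 1), `|M| + 1]%classic (cst 1))).
    apply: le_Rintegral => //.
    - by apply: integrableS (line_integrable y (bg n)).
    - apply/integrableP; split; first exact/measurable_EFinP.
      rewrite (eq_integral (cst 1%E)); last by move=> x _; rewrite /= normr1.
      by rewrite integral_cst// mul1e; exact: leb1_itv_lty.
    - by move=> x _; have /andP[] := g01 n (x, y).
  rewrite Rintegral_cst// mul1r.
  rewrite [X in fine X](_ : _ = (`|M| + 1 - (- (`|M| + 1)))%:E).
    by rewrite /= /C; lra.
  by apply: leb1_cc; lra.
have Gcvg y : (G n y)%:E @[n --> \oo] --> 0%:E.
  have mS : measurable (ysection A y : set T) by exact: measurable_ysection.
  have Soo : (leb1 (ysection A y) < +oo)%E.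
    apply: le_lt_trans (leb1_itv_lty (- `|M|) `|M|); apply: le_measure; rewrite ?inE//.
    move=> x; rewrite /ysection /= inE => /AM[/= h _].
    by rewrite in_itv/= -ler_norml (le_trans h)// ler_norm.
  apply/cvg_EFin; first by apply: nearW.
  apply/cvgrPdist_le => k k0.
  have [d d0 hd] := leb1_shift_diff mS Soo (divr_gt0 k0 (ltr0n R 2)).
  have [N hN] := small_inv d0.
  near=> n; rewrite sub0r normrN ger0_norm//=.
  have sd : `|s n| < d.
    have [h _] := sP n; apply: lt_trans hN; apply: (lt_le_trans h).
    by rewrite lef_pV2 ?posrE// ler_nat ltnS; near: n; exact: nbhs_infty_ge.
  rewrite /G /Rintegral -[k]/(fine k%:E) fine_le//.
    by apply: integrable_fin_num => //; exact: line_integrable.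
  pose D1 := tr (s n) (ysection A y) `\` ysection A y.
  pose D2 := ysection A y `\` tr (s n) (ysection A y).
  have mSt := measurable_tr (s n) mS.
  have mD1 : measurable D1 by exact: measurableD.
  have mD2 : measurable D2 by exact: measurableD.
  have -> : (\int[leb1]_x (g n (x, y))%:E = \int[leb1]_x (\1_(D1 `|` D2) x)%:E)%E.
    apply: eq_integral => x _; congr EFin; rewrite /g !indicE.
    have e1 : ((x, y) + (s n, 0) \in A) = (x + s n \in ysection A y).
      by rewrite mem_ysection -[(x, y) + _]/(x + s n, y + 0) addr0.
    have e2 : ((x, y) \in A) = (x \in ysection A y) by rewrite mem_ysection.
    rewrite e1 e2; rewrite in_setU /D1 /D2 !in_setD.
    have -> : (x \in tr (s n) (ysection A y)) = (x + s n \in ysection A y).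
      by apply/idP/idP; rewrite !inE.
    by case: (_ \in _); case: (_ \in _); rewrite ?subrr ?subr0 ?sub0r ?normrN ?normr0 ?normr1.
  rewrite integral_indic//; last exact: measurableU.
  rewrite setIT; apply: (le_trans (measureU2 _ mD1 mD2)).
  have -> : k = k / 2 + k / 2 by field.
  rewrite EFinD; apply: leeD; first exact: hd.
  (* Translating back by [- s n] turns the second half of the difference into one of the form
     treated by [hd]. *)
  have e3 := leb1_tr (- s n) mD2; rewrite -[X in (X <= _)%E]e3.
  rewrite [X in (leb1 X <= _)%E](_ : _ =
     tr (- s n) (ysection A y) `\` ysection A y).
    by apply: hd; rewrite normrN.
  by apply/seteqP; split => x; rewrite /D2 /tr /= subrK.
pose bnd (y : T) : R := C * \1_(`[- `|M|, `|M|]%classic) y.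
have ig : leb1.-integrable (setT : set T) (EFin \o bnd).
  apply: (@integrable_bounded_supp _ _ _ leb1 _ `[- `|M|, `|M|]%classic `|C|) => //.
  - by apply: measurable_funM => //; exact: measurable_indic.
  - exact: leb1_itv_lty.
  - by move=> x; rewrite /bnd normrM indicE; case: (_ \in _); rewrite ?normr1 ?normr0 ?mulr1// mulr0.
  - move=> x; rewrite /bnd indicE; case: (boolP (x \in _)) => [/set_mem//|_].
    by rewrite mulr0 eqxx.
have mG n : measurable_fun (setT : set T) (fun y => (G n y)%:E).
  by apply/measurable_EFinP; exact: measurable_line_integral.
have := @dominated_cvg _ _ R leb1 setT measurableT (fun n y => (G n y)%:E) (fun=> 0%:E)
  (EFin \o bnd) mG (fun y _ => Gcvg y) (fun _ _ => erefl) ig.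
have GCE n x : setT x -> (`|(G n x)%:E| <= (EFin \o bnd) x)%E.
  by move=> _; rewrite /= lee_fin ger0_norm// GC.
move=> /(_ GCE); rewrite integral0 => cv.
have : (e%:E <= limn (fun n => \int[leb1]_x (G n x)%:E))%E.
  apply: lime_ge; first by apply/cvg_ex; exists 0%:E.
  apply: nearW => n; have [_] := sP n; rewrite /shift_dist J_fubini; last exact: bg.
  rewrite -/(g n) => h1.
  rewrite leNgt; apply/negP => h2; move: h1; rewrite ltNge => /negP; apply.
  rewrite /Rintegral -[e]/(fine e%:E) fine_le//; last exact: ltW.
  apply: integrable_fin_num => //.
  apply: (@le_integrable _ _ _ leb1 setT measurableT _ _ (mG n) _ ig) => y _.
  by rewrite /= lee_fin [X in _ <= X]ger0_norm ?(le_trans (G0 n y))// ?ger0_norm// /bnd GC.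
by rewrite (cvg_lim _ cv)// lee_fin leNgt e0.
Unshelve. all: by end_near. Qed.

End Translation.

(** * Mollification of indicators *)

Section Mollification.
Context {R : realType}.
Local Notation T := (measurableTypeR R).
Local Notation P := (T * T)%type.
Local Notation leb1 := (@lebesgue_measure R).
Local Notation lam2 := (@lam2 R).
Local Notation J := (@J R).

Definition flip (A : set (R * R)) : set (R * R) := [set z | A (swap_pair z)].

Lemma measurable_flip (A : set P) : measurable A -> measurable (flip A : set P).
Proof. by move=> mA; rewrite -[X in measurable X]setTI; exact: measurable_swap_pair. Qed.

Lemma indic_flip (A : set P) (z : R * R) : \1_(flip A : set P) z = \1_A (swap_pair z : P) :> R.
Proof. by rewrite !indicE; congr (nat_of_bool _)%:R; apply/idP/idP; rewrite !inE. Qed.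

Lemma shift_dist_flip (A : set P) M s : measurable A -> (forall z, A z -> in_box M z) ->
  shift_dist A (0, s) = shift_dist (flip A : set P) (s, 0).
Proof.
move=> mA AM; rewrite /shift_dist -(J_swap (shift_dist_bcs _ mA AM)).
by congr J; apply/funext => z; rewrite !indic_flip.
Qed.

Lemma shift_dist_triangle (A : set P) M s t : measurable A -> (forall z, A z -> in_box M z) ->
  shift_dist A (s, t) <= shift_dist A (s, 0) + shift_dist A (0, t).
Proof.
move=> mA AM.
have b u := shift_dist_bcs u mA AM.
rewrite {2}/shift_dist -(J_translate (0, t) (b (s, 0))) -JD//; last exact: (bcs_translate (0, t) (b (s, 0))).
apply: le_J => //; first by apply: bcsD => //; exact: (bcs_translate (0, t) (b (s, 0))).
move=> z.
have -> : z + (s, t) = z + (0, t) + (s, 0).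
  by rewrite -addrA; congr (_ + _); rewrite /GRing.add /= /add_pair /= add0r addr0.
exact: (ler_distD (\1_A (z + (0, t)))).
Qed.

Lemma shift_dist_small (A : set P) M : measurable A -> (forall z, A z -> in_box M z) ->
  forall e : R, 0 < e -> exists2 d : R, 0 < d & forall t : R * R, `|t| < d ->
    shift_dist A t <= e.
Proof.
move=> mA AM e e0.
have e2 : 0 < e / 2 by rewrite divr_gt0.
have mfA := measurable_flip mA.
have fAM z : flip A z -> in_box M z by move=> /AM[].
have [d1 d10 h1] := shift_dist_line mA AM e2.
have [d2 d20 h2] := shift_dist_line mfA fAM e2.
exists (Num.min d1 d2); first by rewrite lt_min d10.
move=> [s t] st; apply: (le_trans (shift_dist_triangle s t mA AM)).
have -> : e = e / 2 + e / 2 by field.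
move: st; rewrite lt_min => /andP[st1 st2]; apply: lerD.
  by apply: h1; exact: le_lt_trans (normr_fst (s, t)) st1.
rewrite (shift_dist_flip _ mA AM); apply: h2.
exact: le_lt_trans (normr_snd (s, t)) st2.
Qed.

(** Minkowski's integral inequality: the error is at most the [rho]-average over w of the L1
    distance from f to its translate by w. *)
Lemma smear_L1 del K be be' (f : P -> R) e : is_kernel del K be be' ->
  bcs f -> (forall z, `|f z| <= 1) ->
  (forall w : R * R, 0 <= w.1 <= del -> 0 <= w.2 <= del -> J (fun z => `|f (w + z) - f z|) <= e) ->
  J (fun z => `|smear be f z - f z|) <= e.
Proof.
move=> ker bf f1 fe; have [mf [M [fM f0]]] := bf.
have M0 : 0 <= M by exact: le_trans (normr_ge0 _) (fM 0).
(* A negative [del] would force the profile to vanish, against its integral 1. *)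
have d0 : 0 <= del.
  have : Rintegral leb1 setT be != 0 by have [_ _ _ _ ->] := ker; rewrite oner_eq0.
  apply: contraNT; rewrite -ltNge => d0; apply/eqP.
  rewrite (_ : be = fun=> 0) /Rintegral ?integral0//; apply/funext => x.
  apply/eqP; apply: contraT => bx; have [_ h _ _ _] := ker.
  by have /andP[h1 h2] := h x (or_introl bx); move: (le_trans h1 h2); rewrite leNgt d0.
have brho := rho_bcs ker; have [mr [L [rL r0]]] := brho.
have L0 : 0 <= L by exact: le_trans (normr_ge0 _) (rL 0).
have rge := rho_ge0 ker.
have bfw z : bcs (fun w => f (w + z) * rho be w).
  apply: (@bcsMl _ (rho be) (fun w => f (w + z)) 1) => //.
  exact: (measurableT_comp mf (measurable_fun_translate2 z)).
pose F (z w : P) : R := `|f (w + z) - f z| * rho be w.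
have mfwz : measurable_fun setT (fun x : P * P => f (x.2 + x.1)).
  rewrite (_ : (fun x : P * P => f (x.2 + x.1)) = f \o (fun x : P * P => (x.1 + x.2 : P))).
    exact: (measurableT_comp mf measurable_sub_add2).
  by apply/funext => x /=; rewrite addrC.
have mF : measurable_fun setT (fun x : P * P => F x.1 x.2).
  apply: measurable_funM; last exact: (measurableT_comp mr measurable_snd).
  apply: measurableT_comp => //; apply: measurable_funB => //.
  exact: (measurableT_comp mf measurable_fst).
pose N := Num.max (M + del + del) (2 * L).
have FN z w : `|F z w| <= N.
  rewrite /F normrM normr_id; apply: (@le_trans _ _ (2 * L)); last by rewrite le_max lexx orbT.
  apply: ler_pM => //; apply: (le_trans (ler_normB _ _)).
  by rewrite (_ : 2 = 1 + 1)//; apply: lerD.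
have FS z w : F z w != 0 -> in_box N z /\ in_box N w.
  rewrite mulf_eq0 negb_or normr_eq0 => /andP[h1 h2].
  have [w1 w2] := rho_supp ker h2; have /andP[w10 w1d] := w1; have /andP[w20 w2d] := w2.
  have N1 : M + del + del <= N by rewrite le_max lexx.
  split; last by split; rewrite ger0_norm// (le_trans _ N1)//; lra.
  have [fz|fz] := eqVneq (f z) 0; last first.
    by apply: in_box_le (f0 _ fz); rewrite (le_trans _ N1)//; lra.
  have [fwz|/f0[/= k1 k2]] := eqVneq (f (w + z)) 0; first by rewrite fwz fz subrr eqxx in h1.
  split; rewrite (le_trans _ N1)//.
    have -> : z.1 = (w.1 + z.1) - w.1 by ring.
    by apply: (le_trans (ler_normB _ _)); rewrite (ger0_norm w10); lra.
  have -> : z.2 = (w.2 + z.2) - w.2 by ring.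
  by apply: (le_trans (ler_normB _ _)); rewrite (ger0_norm w20); lra.
have bF z : bcs (F z).
  split; first exact: (measurableT_comp mF (measurable_pair1 z)).
  by exists N; split => // w /FS[].
have FN' w z : `|F z w| <= N by exact: FN.
apply: (@le_trans _ _ (J (fun z => J (F z)))).
  apply: le_J.
  - apply: bcs_norm; apply: bcsB => //.
    have [p [q [_ [gc _]]]] := smear_grad ker mf f1.
    apply: (@bcs_continuous _ _ (M + del)); first exact: grad_continuous gc.
    move=> z /(smear_supp ker)[w [/andP[w10 w1d] /andP[w20 w2d] /f0[/= k1 k2]]]; split.
      have -> : z.1 = (w.1 + z.1) - w.1 by ring.
      by apply: (le_trans (ler_normB _ _)); rewrite (ger0_norm w10); lra.
    have -> : z.2 = (w.2 + z.2) - w.2 by ring.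
    by apply: (le_trans (ler_normB _ _)); rewrite (ger0_norm w20); lra.
  - apply: (@bcs_J _ (fun w z => F z w) N) => //.
    + exact: (measurableT_comp mF (measurable_fun_pair measurable_snd measurable_fst)).
    + by move=> w z /FS[].
  - move=> z; rewrite /smear.
    have -> : J (fun w => f (w + z) * rho be w) - f z = J (fun w => (f (w + z) - f z) * rho be w).
      rewrite -[f z in LHS]mulr1 -(J_rho ker) -JZ// -JB//; last exact: bcsZ.
      by congr J; apply/funext => w; ring.
    apply: (le_trans (J_abs _)).
      rewrite (_ : (fun w => _) = (fun w => f (w + z) * rho be w - f z * rho be w)).
        by apply: bcsB => //; exact: bcsZ.
      by apply/funext => w; ring.
    rewrite le_eqVlt; apply/orP; left; apply/eqP; congr J; apply/funext => w.
    by rewrite /F normrM (ger0_norm (rge w)).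
rewrite (J_fubini2 mF FN FS).
apply: (@le_trans _ _ (J (fun w => e * rho be w))); last first.
  by rewrite JZ// (J_rho ker) mulr1.
apply: le_J; [exact: bcs_J mF FN FS|exact: bcsZ|move=> w].
have [r00|rn0] := eqVneq (rho be w) 0.
  rewrite r00 mulr0 /F (_ : (fun z => _) = fun=> 0) ?J0//.
  by apply/funext => z; rewrite r00 mulr0.
have [w1 w2] := rho_supp ker rn0.
have -> : J (fun z => F z w) = rho be w * J (fun z => `|f (w + z) - f z|).
  rewrite -JZ; first by congr J; apply/funext => z; rewrite /F mulrC.
  apply: bcs_norm; apply: bcsB => //.
  rewrite (_ : (fun z => f (w + z)) = (fun z => f (z + w))); first exact: bcs_translate.
  by apply/funext => z; rewrite addrC.
by rewrite mulrC ler_wpM2r//; exact: fe.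
Qed.

(** Packages what submodularity needs of a mollified indicator. The area of A may be infinite, so L1
    closeness is asked only on a box. *)
Lemma mollify (A : set P) N e : measurable A -> 0 < e ->
  exists u p q, [/\ grad u p q, (forall z, 0 <= u z <= 1),
   (forall d c, bcs d -> (forall w, J (fun z => \1_A (w + z) * d z) <= c) ->
     J (fun z => u z * d z) <= c) &
   J (fun z => \1_(box N) z * `|u z - \1_A z|) <= e].
Proof.
move=> mA e0.
(* The kernel reaches at most 1, so on the box of size N only this bounded part of A is seen. *)
pose A' : set P := A `&` box (N + 1).
have mA' : measurable A' by apply: measurableI => //; exact: measurableX.
have AM z : A' z -> in_box (N + 1) z.
  by move=> [_ []] /=; rewrite !in_itv/= -!ler_norml.
have [d d0 hd] := shift_dist_small mA' AM e0.
pose del := Num.min 1 (d / 2).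
have del0 : 0 < del by rewrite lt_min ltr01 divr_gt0.
have del1 : del <= 1 by rewrite ge_min lexx.
have deld : del < d by rewrite gt_min; apply/orP; right; lra.
have [K [be [be' ker]]] := kernel_exists del0.
have i1 (B : set P) z : `|\1_B z| <= 1 :> R.
  by rewrite indicE; case: (_ \in _); rewrite ?normr1 ?normr0.
have mi (B : set P) : measurable B -> measurable_fun setT (\1_B : P -> R).
  by move=> mB; exact: measurable_indic.
have [p [q [_ [gc _]]]] := smear_grad ker (mi _ mA) (i1 A).
exists (smear be \1_A), p, q; split => //.
- move=> z; rewrite (smear_ge0 ker)/=; last by move=> w; rewrite indicE.
  by apply: le_trans (smear_bound ker (mi _ mA) (i1 A) z); exact: ler_norm.
- by move=> dd c bd; exact: (smear_test ker (mi _ mA) (i1 A) bd).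
have bA' := bcs_indic mA' AM.
have : J (fun z => `|smear be \1_A' z - \1_A' z|) <= e.
  apply: (smear_L1 ker bA' (i1 A')) => w /andP[w1 w1'] /andP[w2 w2'].
  rewrite (_ : (fun z => _) = (fun z => `|\1_A' (z + w) - \1_A' z|)); last first.
    by apply/funext => z; rewrite [w + z]addrC.
  apply: hd; apply: le_lt_trans deld; rewrite normr_pair ge_max.
  by rewrite !ger0_norm// w1' w2'.
apply: le_trans.
have [p' [q' [_ [gc' _]]]] := smear_grad ker (mi _ mA') (i1 A').
have mc f' p1 q1 : grad f' p1 q1 -> measurable_fun (setT : set P) f'.
  by move=> g'; apply: continuous_measurable2; exact: grad_continuous g'.
apply: le_J.
- rewrite (_ : (fun z => _) = (fun z => `|smear be \1_A z - \1_A z| * \1_(box N) z)); last first.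
    by apply/funext => z; rewrite mulrC.
  apply: (@bcsMl _ _ _ 2); first exact: bcs_box.
    apply: measurableT_comp => //; apply: measurable_funB; last exact: mi.
    exact: mc gc.
  move=> z; rewrite normr_id; apply: (le_trans (ler_normB _ _)).
  rewrite (_ : 2 = 1 + 1)//; apply: lerD; last exact: i1.
  exact: (smear_bound ker (mi _ mA) (i1 A)).
- apply: bcs_norm; apply: bcsB => //.
  apply: (@bcs_continuous _ _ (N + 1 + del)); first exact: grad_continuous gc'.
  move=> z /(smear_supp ker)[w [/andP[w10 w1d] /andP[w20 w2d]]].
  rewrite indicE; case: (boolP (_ \in _)) => [/set_mem /AM [/= k1 k2] _|]; last by rewrite eqxx.
  split.
    have -> : z.1 = (w.1 + z.1) - w.1 by ring.
    by apply: (le_trans (ler_normB _ _)); rewrite (ger0_norm w10); lra.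
  have -> : z.2 = (w.2 + z.2) - w.2 by ring.
  by apply: (le_trans (ler_normB _ _)); rewrite (ger0_norm w20); lra.
- move=> z; rewrite [\1_(box N) z]indicE.
  case: (boolP (z \in _)) => [/set_mem zN|_]; last by rewrite mul0r.
  have [z1 z2] : in_box N z by move: zN => [] /=; rewrite !in_itv/= -!ler_norml.
  rewrite mul1r.
  have AA' (x : R * R) : in_box (N + 1) x -> \1_A x = \1_A' x :> R.
    move=> xN; rewrite !indicE; congr (nat_of_bool _)%:R; apply/idP/idP; rewrite !inE.
      by move=> Ax; split => //; exact: mem_box.
    by case.
  have -> : smear be \1_A z = smear be \1_A' z.
    rewrite /smear; congr J; apply/funext => w.
    have [->|rn0] := eqVneq (rho be w) 0; first by rewrite !mulr0.
    have [/andP[w10 w1d] /andP[w20 w2d]] := rho_supp ker rn0.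
    rewrite AA'//; split; apply: (le_trans (ler_normD _ _)).
      by rewrite (ger0_norm w10); lra.
    by rewrite (ger0_norm w20); lra.
  rewrite AA'//; split; lra.
Qed.

End Mollification.

(** * Submodularity of the perimeter *)

Section Submodularity.
Context {R : realType}.
Local Notation T := (measurableTypeR R).
Local Notation P := (T * T)%type.
Local Notation leb1 := (@lebesgue_measure R).
Local Notation lam2 := (@lam2 R).
Local Notation J := (@J R).

(** A real-valued form of a perimeter bound, so that estimates avoid suprema and infinite values. *)
Definition per_le (B : set P) (c : R) := forall f g d, test_field f g d ->
  J (fun z => \1_B z * d z) <= c.

Lemma per_le_ge0 B c : per_le B c -> 0 <= c.
Proof.
move=> /(_ _ _ _ (@test_field0 R)); rewrite (_ : (fun z => _) = fun=> 0) ?J0//.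
by apply/funext => z; rewrite mulr0.
Qed.

Lemma bcs_common (f g : P -> R) : bcs f -> bcs g ->
  exists M, [/\ 0 <= M, forall z, `|f z| <= M /\ `|g z| <= M &
    forall z, f z != 0 \/ g z != 0 -> in_box M z].
Proof.
move=> [_ [M [fM f0]]] [_ [N [gN g0]]]; exists (Num.max M N); split.
- by rewrite le_max (le_trans (normr_ge0 _) (fM 0)).
- by move=> z; rewrite !le_max fM gN orbT.
- by move=> z [/f0|/g0]; apply: in_box_le; rewrite le_max lexx ?orbT.
Qed.

Section soft.
Variable dl : R.
Hypothesis dl0 : 0 < dl.

Definition soft_norm (t : R) : R := Num.sqrt (t ^+ 2 + dl ^+ 2).

Lemma soft_norm_sq t : soft_norm t ^+ 2 = t ^+ 2 + dl ^+ 2.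
Proof. by rewrite sqr_sqrtr// addr_ge0// sqr_ge0. Qed.

Lemma soft_norm_arg_gt0 t : 0 < t ^+ 2 + dl ^+ 2.
Proof. by rewrite ltr_wpDl ?sqr_ge0// exprn_gt0. Qed.

Lemma soft_norm_gt0 t : 0 < soft_norm t.
Proof. by rewrite sqrtr_gt0 soft_norm_arg_gt0. Qed.

Lemma soft_norm_ge t : `|t| <= soft_norm t /\ dl <= soft_norm t /\ soft_norm t <= `|t| + dl.
Proof.
have s0 := ltW (soft_norm_gt0 t); have dl0' := ltW dl0.
have e := soft_norm_sq t; have t2 : `|t| ^+ 2 = t ^+ 2 by rewrite real_normK ?num_real.
have n0 := normr_ge0 t.
have d2 : 0 <= dl ^+ 2 by exact: sqr_ge0.
have tt : 0 <= t ^+ 2 by exact: sqr_ge0.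
split; [|split].
- by rewrite -ler_sqr ?nnegrE// e t2 lerDl.
- by rewrite -ler_sqr ?nnegrE// e lerDr.
- rewrite -ler_sqr ?nnegrE ?addr_ge0// e sqrrD t2.
  by have : 0 <= `|t| * dl by [rewrite mulr_ge0]; rewrite -mulr_natr; lra.
Qed.

Lemma is_derive_soft_inv t :
  is_derive t (1 : R) (fun t => (soft_norm t)^-1) (- t * (soft_norm t)^-1 ^+ 3).
Proof.
have h1 : is_derive t (1 : R) (fun t : R => t ^+ 2 + dl ^+ 2) (2 * t).
  apply: is_derive_eq; rewrite addr0 /GRing.scale /=; ring.
have h2 := is_derive1_sqrt (soft_norm_arg_gt0 t).
have h3 : is_derive t (1 : R) soft_norm (t * (soft_norm t)^-1).
  have h := @is_derive1_comp R _ _ t _ _ h2 h1.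
  rewrite /soft_norm; apply: (is_derive_eq h).
  rewrite invfM; field.
  by rewrite gt_eqF// soft_norm_gt0.
have h4 : soft_norm t != 0 by rewrite gt_eqF// soft_norm_gt0.
have [d3 v3] := h3.
apply: DeriveDef; first exact: (derivableV h4).
rewrite (deriveV h4)// v3 /GRing.scale /=; field.
exact: h4.
Qed.

Lemma soft_norm_continuous : continuous soft_norm.
Proof.
move=> t; apply: (@continuous_comp _ _ _ (fun t : R => t ^+ 2 + dl ^+ 2) Num.sqrt).
  by apply: cvgD; [exact: exprn_continuous|exact: cvg_cst].
exact: sqrt_continuous.
Qed.

Lemma soft_inv_continuous : continuous (fun t => (soft_norm t)^-1).
Proof.
move=> t; apply: cvgV; last exact: soft_norm_continuous.
by rewrite gt_eqF// soft_norm_gt0.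
Qed.

(** A smooth Heaviside function. The derivative of [soft_bump] is [- t] times that of [soft_step],
    so t times the gradient of the step is, up to sign, the gradient of a function of size at most
    [dl]. *)
Definition soft_step (t : R) : R := 2^-1 * (1 + t * (soft_norm t)^-1).
Definition dsoft_step (t : R) : R := 2^-1 * dl ^+ 2 * (soft_norm t)^-1 ^+ 3.
Definition soft_bump (t : R) : R := 2^-1 * dl ^+ 2 * (soft_norm t)^-1.

Lemma is_derive_soft_step t : is_derive t (1 : R) soft_step (dsoft_step t).
Proof.
have h := is_derive_soft_inv t.
have s0 : soft_norm t != 0 by rewrite gt_eqF// soft_norm_gt0.
apply: is_derive_eq; rewrite /dsoft_step /GRing.scale /=.
have -> : dl ^+ 2 = soft_norm t ^+ 2 - t ^+ 2 by rewrite soft_norm_sq; ring.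
by field.
Qed.

Lemma is_derive_soft_bump t : is_derive t (1 : R) soft_bump (- t * dsoft_step t).
Proof.
have h := is_derive_soft_inv t.
apply: is_derive_eq; rewrite /dsoft_step /GRing.scale /=; ring.
Qed.

Lemma dsoft_step_continuous : continuous dsoft_step.
Proof.
move=> t; apply: cvgM; first exact: cvg_cst.
apply: (@continuous_comp _ _ _ (fun t => (soft_norm t)^-1) (fun x => x ^+ 3)).
  exact: soft_inv_continuous.
exact: exprn_continuous.
Qed.

Lemma soft_step01 t : 0 <= soft_step t <= 1.
Proof.
have [h1 _] := soft_norm_ge t; have s0 := soft_norm_gt0 t.
have : `|t * (soft_norm t)^-1| <= 1.
  have si : 0 <= (soft_norm t)^-1 by rewrite invr_ge0 ltW.
  by rewrite normrM (ger0_norm si) ler_pdivrMr// mul1r.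
by rewrite ler_norml /soft_step => /andP[a b]; apply/andP; split; lra.
Qed.

Lemma soft_bump_bound t : 0 <= soft_bump t <= dl.
Proof.
have [_ [h2 _]] := soft_norm_ge t; have s0 := soft_norm_gt0 t.
have d0 := dl0; rewrite /soft_bump; apply/andP; split.
  by rewrite !mulr_ge0 ?invr_ge0 ?sqr_ge0// ltW.
rewrite ler_pdivrMr//.
have : dl * dl <= dl * soft_norm t by rewrite ler_wpM2l// ltW.
have : 0 <= dl * dl by rewrite mulr_ge0 ?ltW.
by rewrite expr2; lra.
Qed.

(** Replacing the sign of t by a smooth one changes the absolute value by at most [dl]; this makes
    mixtures by [soft_step] close to minima and maxima. *)
Lemma soft_abs t : `| `|t| - t * (t * (soft_norm t)^-1) | <= dl.
Proof.
have [h1 [h2 h3]] := soft_norm_ge t; have s0 := soft_norm_gt0 t.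
have n0 := normr_ge0 t.
have -> : t * (t * (soft_norm t)^-1) = `|t| * (`|t| * (soft_norm t)^-1).
  by rewrite !mulrA -!expr2 real_normK ?num_real.
set a := `|t| in h1 h3 n0 *; set s := soft_norm t in h1 h2 h3 s0 *.
have -> : a - a * (a * s^-1) = (a * s^-1) * (s - a) by field; rewrite gt_eqF//.
have k0 : 0 <= a * s^-1 by rewrite mulr_ge0// invr_ge0 ltW.
have k1 : a * s^-1 <= 1 by rewrite ler_pdivrMr// mul1r.
have sa : 0 <= s - a by rewrite subr_ge0.
rewrite ger0_norm; last exact: mulr_ge0.
apply: (@le_trans _ _ (1 * (s - a))); first exact: ler_wpM2r.
by rewrite mul1r; lra.
Qed.

End soft.

(* The fields testing the intersection and the union are exchanged along the
   level set {u = v} of mollifications of the two indicators. *)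
Lemma per_submod (A B : set P) a b f1 g1 d1 f2 g2 d2 : measurable A -> measurable B ->
  per_le A a -> per_le B b -> test_field f1 g1 d1 -> test_field f2 g2 d2 ->
  J (fun z => \1_(A `&` B) z * d1 z) + J (fun z => \1_(A `|` B) z * d2 z) <= a + b.
Proof.
move=> mA mB pA pB t1 t2.
have [bf1 bg1 bd1] := test_field_bcs t1.
have [bf2 bg2 bd2] := test_field_bcs t2.
have [M [M0 dM ds]] := bcs_common bd1 bd2.
have bbox := @bcs_box R M.
pose C := J (\1_(box M)).
have C0 : 0 <= C by apply: J_ge0.
(* The error budget: each of two comparisons costs [M * (2 * dl + dl * C)], and the integral of
   [G * (d1 - d2)] costs [2 * M * C * dl]. *)
suff key dl : 0 < dl -> J (fun z => \1_(A `&` B) z * d1 z) + J (fun z => \1_(A `|` B) z * d2 z)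
    <= a + b + (4 * M * C + 4 * M) * dl.
  apply/ler_addgt0Pr => e e0.
  have K0 : 0 < 4 * M * C + 4 * M + 1 by rewrite ltr_wpDl// addr_ge0 ?mulr_ge0.
  apply: (le_trans (key (e / (4 * M * C + 4 * M + 1)) _)); first by rewrite divr_gt0.
  rewrite lerD2l mulrA ler_pdivrMr// mulrC ler_wpM2l ?ltW//; lra.
move=> dl0.
have [u [pu [qu [gu u01 uT uL]]]] := mollify M mA dl0.
have [v [pv [qv [gv v01 vT vL]]]] := mollify M mB dl0.
pose t z := v z - u z.
have gt := gradB gv gu.
pose th z := soft_step dl (t z).
have gth := grad_comp (is_derive_soft_step dl0) (dsoft_step_continuous dl0) gt.
pose G z := soft_bump dl (t z).
have cb' : continuous (fun t : R => - t * dsoft_step dl t).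
  move=> x; apply: cvgM; first by apply: cvgN; exact: cvg_id.
  exact: dsoft_step_continuous.
have gG := grad_comp (is_derive_soft_bump dl0) cb' gt.
have th01 z : 0 <= th z <= 1 by exact: soft_step01.
have gth' := gradB (grad_cst 1) gth.
have th01' z : 0 <= 1 - th z <= 1.
  by have /andP[h1 h2] := th01 z; apply/andP; split; lra.
(* The mixture testing u is nearly the first field where u < v and the second where u > v, and v
   gets the opposite mixture. Summing, the first field tests nearly the minimum and the second
   nearly the maximum, up to [u - v] times the gradient of [th], which is the gradient of [G]. *)
have m1 := test_field_mix t1 t2 gth th01.
have m2 := test_field_mix t1 t2 gth' th01'.
have [_ _ bm1] := test_field_bcs m1.
have [_ _ bm2] := test_field_bcs m2.
have Ju : J (fun z => u z * (th z * d1 z + (1 - th z) * d2 z +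
   (dsoft_step dl (t z) * (pv z - pu z) * (f1 z - f2 z) +
    dsoft_step dl (t z) * (qv z - qu z) * (g1 z - g2 z)))) <= a.
  apply: uT => // w; have := pA _ _ _ (test_field_translate (- w) m1).
  apply: le_trans; rewrite le_eqVlt; apply/orP; left; apply/eqP.
  rewrite -[RHS](J_translate w).
    by congr J; apply/funext => z; rewrite addrK [z + w]addrC.
  apply: bcsI => //; exact: (bcs_translate (- w) bm1).
have Jv : J (fun z => v z * ((1 - th z) * d1 z + (1 - (1 - th z)) * d2 z +
   ((0 - dsoft_step dl (t z) * (pv z - pu z)) * (f1 z - f2 z) +
    (0 - dsoft_step dl (t z) * (qv z - qu z)) * (g1 z - g2 z)))) <= b.
  apply: vT => // w; have := pB _ _ _ (test_field_translate (- w) m2).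
  apply: le_trans; rewrite le_eqVlt; apply/orP; left; apply/eqP.
  rewrite -[RHS](J_translate w).
    by congr J; apply/funext => z; rewrite addrK [z + w]addrC.
  apply: bcsI => //; exact: (bcs_translate (- w) bm2).
have cm (h p q : R * R -> R) : grad h p q -> measurable_fun (setT : set P) h.
  by move=> g'; apply: continuous_measurable2; exact: grad_continuous g'.
have n01 (h : R * R -> R) : (forall z, 0 <= h z <= 1) -> forall z, `|h z| <= 1.
  by move=> h01 z; have /andP[h1 h2] := h01 z; rewrite ger0_norm.
pose Phi1 z := u z * th z + v z * (1 - th z).
pose Phi2 z := u z * (1 - th z) + v z * th z.
have mth : measurable_fun (setT : set P) th by exact: cm gth.
have mu : measurable_fun (setT : set P) u by exact: cm gu.
have mv : measurable_fun (setT : set P) v by exact: cm gv.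
have mth' : measurable_fun (setT : set P) (fun z => 1 - th z) by exact: cm gth'.
have mG : measurable_fun (setT : set P) G by exact: cm gG.
have mP1 : measurable_fun (setT : set P) Phi1.
  by apply: measurable_funD; apply: measurable_funM.
have mP2 : measurable_fun (setT : set P) Phi2.
  by apply: measurable_funD; apply: measurable_funM.
have hm (x y : R) : `|x| <= 1 -> `|y| <= 1 -> `|x * y| <= 1.
  by move=> hx hy; rewrite normrM mulr_ile1.
have P1b z : `|Phi1 z| <= 2.
  rewrite /Phi1; apply: (le_trans (ler_normD _ _)); rewrite (_ : 2 = 1 + 1)//.
  have nu := n01 _ u01 z; have nv := n01 _ v01 z; have nt := n01 _ th01 z; have nt' := n01 _ th01' z.
  by apply: lerD; apply: hm.
have P2b z : `|Phi2 z| <= 2.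
  rewrite /Phi2; apply: (le_trans (ler_normD _ _)); rewrite (_ : 2 = 1 + 1)//.
  have nu := n01 _ u01 z; have nv := n01 _ v01 z; have nt := n01 _ th01 z; have nt' := n01 _ th01' z.
  by apply: lerD; apply: hm.
have bP1 : bcs (fun z => Phi1 z * d1 z) by exact: bcsMl P1b.
have bP2 : bcs (fun z => Phi2 z * d2 z) by exact: bcsMl P2b.
have Gb z : `|G z| <= dl.
  by have /andP[h1 h2] := soft_bump_bound dl0 (t z); rewrite ger0_norm.
have bGd : bcs (fun z => G z * (d1 z - d2 z)) by apply: (bcsMl _ mG Gb); exact: bcsB.
(* the error term is the divergence of [G (phi1 - phi2)] up to [G div] *)
have errJ : J (fun z => (- t z * dsoft_step dl (t z) * (pv z - pu z)) * (f1 z - f2 z) +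
    (- t z * dsoft_step dl (t z) * (qv z - qu z)) * (g1 z - g2 z) + G z * (d1 z - d2 z)) = 0.
  have [p1 [q1 [r1 [s1 [N1 [gf1 gg1 e1 f10 _]]]]]] := t1.
  have [p2 [q2 [r2 [s2 [N2 [gf2 gg2 e2 f20 _]]]]]] := t2.
  have gF := gradM gG (gradB gf1 gf2).
  have gH := gradM gG (gradB gg1 gg2).
  have F0 z : G z * (f1 z - f2 z) != 0 -> in_box (Num.max N1 N2) z.
    rewrite mulf_eq0 negb_or => /andP[_ h].
    have [h1|h1] := eqVneq (f1 z) 0; last by apply: in_box_le (f10 z (or_introl h1)); rewrite le_max lexx.
    have [h2|h2] := eqVneq (f2 z) 0; last by apply: in_box_le (f20 z (or_introl h2)); rewrite le_max lexx orbT.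
    by rewrite h1 h2 subrr eqxx in h.
  have H0 z : G z * (g1 z - g2 z) != 0 -> in_box (Num.max N1 N2) z.
    rewrite mulf_eq0 negb_or => /andP[_ h].
    have [h1|h1] := eqVneq (g1 z) 0; last by apply: in_box_le (f10 z (or_intror h1)); rewrite le_max lexx.
    have [h2|h2] := eqVneq (g2 z) 0; last by apply: in_box_le (f20 z (or_intror h2)); rewrite le_max lexx orbT.
    by rewrite h1 h2 subrr eqxx in h.
  have [jF _] := J_grad gF F0; have [_ jH] := J_grad gH H0.
  have [_ bF _] := grad_bcs gF F0; have [_ _ bH] := grad_bcs gH H0.
  rewrite -[RHS]addr0 -{1}jF -jH -JD//; congr J; apply/funext => z.
  by rewrite e1 e2 /G /t /=; ring.
have split_sum : J (fun z => Phi1 z * d1 z) + J (fun z => Phi2 z * d2 z) - J (fun z => G z * (d1 z - d2 z)) <= a + b.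
  apply: le_trans (lerD Ju Jv).
  have bu1 := bcsMl bm1 mu (n01 _ u01); have bv2 := bcsMl bm2 mv (n01 _ v01).
  rewrite -[leLHS]addr0 -[X in _ + X <= _]errJ -JD// -JB//; last exact: bcsD.
  have berr : bcs (fun z => (- t z * dsoft_step dl (t z) * (pv z - pu z)) * (f1 z - f2 z) +
    (- t z * dsoft_step dl (t z) * (qv z - qu z)) * (g1 z - g2 z) + G z * (d1 z - d2 z)).
    rewrite (_ : (fun z => _) = (fun z => u z * (th z * d1 z + (1 - th z) * d2 z +
       (dsoft_step dl (t z) * (pv z - pu z) * (f1 z - f2 z) +
        dsoft_step dl (t z) * (qv z - qu z) * (g1 z - g2 z))) +
      v z * ((1 - th z) * d1 z + (1 - (1 - th z)) * d2 z +
       ((0 - dsoft_step dl (t z) * (pv z - pu z)) * (f1 z - f2 z) +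
        (0 - dsoft_step dl (t z) * (qv z - qu z)) * (g1 z - g2 z))) -
      (Phi1 z * d1 z + Phi2 z * d2 z) + G z * (d1 z - d2 z))).
      by apply: bcsD => //; apply: bcsB; apply: bcsD.
    by apply/funext => z; rewrite /t /Phi1 /Phi2; ring.
  rewrite -JD//; last by apply: bcsB => //; exact: bcsD.
  have e3 := JD bu1 bv2; rewrite -[leRHS]e3 le_eqVlt; apply/orP; left; apply/eqP; congr J.
  by apply/funext => z; rewrite /Phi1 /Phi2 /th /t; ring.
have GJ : `|J (fun z => G z * (d1 z - d2 z))| <= dl * (2 * M) * C.
  apply: (@J_le_box _ _ 0) => //.
    move=> w _; rewrite addr0 normrM; apply: ler_pM => //.
    have [h1 h2] := dM w; apply: (le_trans (ler_normB _ _)); lra.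
  move=> w nw; rewrite addr0; have [h|h] := eqVneq (d1 w) 0; last by case: nw; apply: ds; left.
  have [h'|h'] := eqVneq (d2 w) 0; last by case: nw; apply: ds; right.
  by rewrite h h' subrr mulr0.
have tE z : t z * (t z * (soft_norm dl (t z))^-1) = 2 * (t z * th z) - t z.
  by rewrite /th /soft_step; field; rewrite gt_eqF// soft_norm_gt0.
have indI z : \1_(A `&` B) z = Num.min (\1_A z) (\1_B z) :> R.
  rewrite !indicE in_setI; case: (z \in A); case: (z \in B) => /=; rewrite ?minxx//.
    by rewrite min_r.
  by rewrite min_l.
have indU z : \1_(A `|` B) z = Num.max (\1_A z) (\1_B z) :> R.
  rewrite !indicE in_setU; case: (z \in A); case: (z \in B) => /=; rewrite ?maxxx//.
    by rewrite max_l.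
  by rewrite max_r.
have close1 z : `|\1_(A `&` B) z - Phi1 z| <= `|u z - \1_A z| + `|v z - \1_B z| + dl.
  have h := soft_abs dl0 (t z); rewrite tE in h.
  rewrite indI /Phi1; move: h; rewrite /t; move: (u z) (v z) (th z) => x y k.
  rewrite minElt !ler_norml.
  set X : R := \1_A z; set Y : R := \1_B z.
  have a1 := ler_norm (x - X); have a3 := ler_norm (-(x - X)).
  have b1 := ler_norm (y - Y); have b3 := ler_norm (-(y - Y)).
  rewrite !normrN in a3 b3.
  clear - a1 a3 b1 b3; case: (ger0P (y - x)) => t0; case: ltP => XY /andP[h1 h2]; apply/andP; split; lra.
have close2 z : `|\1_(A `|` B) z - Phi2 z| <= `|u z - \1_A z| + `|v z - \1_B z| + dl.
  have h := soft_abs dl0 (t z); rewrite tE in h.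
  rewrite indU /Phi2; move: h; rewrite /t; move: (u z) (v z) (th z) => x y k.
  rewrite maxElt !ler_norml.
  set X : R := \1_A z; set Y : R := \1_B z.
  have a1 := ler_norm (x - X); have a3 := ler_norm (-(x - X)).
  have b1 := ler_norm (y - Y); have b3 := ler_norm (-(y - Y)).
  rewrite !normrN in a3 b3.
  clear - a1 a3 b1 b3; case: (ger0P (y - x)) => t0; case: ltP => XY /andP[h1 h2]; apply/andP; split; lra.
have bdu : bcs (fun z => \1_(box M) z * `|u z - \1_A z|).
  rewrite (_ : (fun z => _) = (fun z => `|u z - \1_A z| * \1_(box M) z)); last first.
    by apply/funext => z; rewrite mulrC.
  apply: (@bcsMl _ _ _ 2) => //.
    by apply: measurableT_comp => //; apply: measurable_funB => //; exact: measurable_indic.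
  move=> z; rewrite normr_id; apply: (le_trans (ler_normB _ _)).
  rewrite (_ : 2 = 1 + 1)//; apply: lerD; first exact: n01.
  by rewrite indicE; case: (_ \in _); rewrite ?normr1 ?normr0.
have bdv : bcs (fun z => \1_(box M) z * `|v z - \1_B z|).
  rewrite (_ : (fun z => _) = (fun z => `|v z - \1_B z| * \1_(box M) z)); last first.
    by apply/funext => z; rewrite mulrC.
  apply: (@bcsMl _ _ _ 2) => //.
    by apply: measurableT_comp => //; apply: measurable_funB => //; exact: measurable_indic.
  move=> z; rewrite normr_id; apply: (le_trans (ler_normB _ _)).
  rewrite (_ : 2 = 1 + 1)//; apply: lerD; first exact: n01.
  by rewrite indicE; case: (_ \in _); rewrite ?normr1 ?normr0.
have compare (X : set P) (Phi d : R * R -> R) : measurable X -> bcs d -> bcs (fun z => Phi z * d z) ->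
    (forall z, `|d z| <= M) -> (forall z, d z != 0 -> in_box M z) ->
    (forall z, `|\1_X z - Phi z| <= `|u z - \1_A z| + `|v z - \1_B z| + dl) ->
    J (fun z => \1_X z * d z) <= J (fun z => Phi z * d z) + M * (2 * dl + dl * C).
  move=> mX bd bPhi dM' ds' cl.
  rewrite -lerBlDl -JB//; last exact: bcsI.
  apply: (@le_trans _ _ (J (fun z => M * (\1_(box M) z * `|u z - \1_A z| +
       \1_(box M) z * `|v z - \1_B z| + dl * \1_(box M) z)))).
    apply: le_J.
    - by apply: bcsB => //; exact: bcsI.
    - by apply: bcsZ; apply: bcsD; [exact: bcsD|exact: bcsZ].
    move=> z; rewrite -mulrBl; apply: (le_trans (ler_norm _)); rewrite normrM.
    have [->|dz] := eqVneq (d z) 0.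
      by rewrite normr0 mulr0 mulr_ge0// !addr_ge0// mulr_ge0// ltW.
    have zb : \1_(box M) z = 1 :> R by rewrite indicE mem_set//; apply: mem_box; exact: ds'.
    by rewrite zb !mul1r mulr1 [leRHS]mulrC; apply: ler_pM.
  rewrite JZ; last by apply: bcsD; [exact: bcsD|exact: bcsZ].
  rewrite ler_wpM2l// JD; [|exact: bcsD|exact: bcsZ].
  by rewrite JD// JZ// -/C; lra.
have c1 := compare _ _ _ (measurableI _ _ mA mB) bd1 bP1 (fun z => (dM z).1) (fun z h => ds z (or_introl h)) close1.
have c2 := compare _ _ _ (measurableU _ _ mA mB) bd2 bP2 (fun z => (dM z).2) (fun z h => ds z (or_intror h)) close2.
have := ler_norm (J (fun z => G z * (d1 z - d2 z))).
set I1 := J _ in c1 *; set I2 := J _ in c2 *.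
have -> : (4 * M * C + 4 * M) * dl = 2 * (M * (2 * dl + dl * C)) + dl * (2 * M) * C by ring.
by lra.
Qed.

End Submodularity.

(** * Perimeter modulo null sets *)

Section Perimeter.
Context {R : realType}.
Local Notation T := (measurableTypeR R).
Local Notation P := (T * T)%type.
Local Notation leb1 := (@lebesgue_measure R).
Local Notation lam2 := (@lam2 R).
Local Notation J := (@J R).
Local Notation lebm := (@lebesgue_measurable R).
Implicit Types (A B E F : set (R * R)).

Definition null_eq A B := leb2 ((A `\` B) `|` (B `\` A)) = 0%E.

Lemma leb2_sub0 A B : A `<=` B -> leb2 B = 0%E -> leb2 A = 0%E.
Proof. by move=> AB B0; apply/eqP; rewrite eq_le measure_ge0 andbT -B0; exact: le_leb2. Qed.

Lemma leb2U0 A B : leb2 A = 0%E -> leb2 B = 0%E -> leb2 (A `|` B) = 0%E.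
Proof.
move=> A0 B0; apply/eqP; rewrite eq_le measure_ge0 andbT.
by apply: (le_trans (leb2U A B)); rewrite A0 B0 adde0.
Qed.

Lemma null_eq_refl A : null_eq A A.
Proof. by rewrite /null_eq setDv setU0 measure0. Qed.

Lemma null_eq_sym A B : null_eq A B -> null_eq B A.
Proof. by rewrite /null_eq setUC. Qed.

Lemma null_eq_trans A B E : null_eq A B -> null_eq B E -> null_eq A E.
Proof.
move=> h1 h2; apply: leb2_sub0 (leb2U0 h1 h2) => z [[Az Ez]|[Ez Az]].
  by have [Bz|Bz] := pselect (B z); [right; left|left; left].
by have [Bz|Bz] := pselect (B z); [left; right|right; right].
Qed.

Lemma null_eqC A B : null_eq A B -> null_eq (~` A) (~` B).
Proof.
by move=> h; apply: leb2_sub0 h => z [[/= h1 /contrapT h2]|[/= h1 /contrapT h2]]; [right|left].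
Qed.

Lemma null_eq_bigcup (A B : (set (R * R))^nat) : (forall n, null_eq (A n) (B n)) ->
  null_eq (\bigcup_n A n) (\bigcup_n B n).
Proof.
move=> h; apply: leb2_sub0 (leb2_bigcup0 h) => z [[[n _ An] nB]|[[n _ Bn] nA]]; exists n => //.
  by left; split => // Bn; apply: nB; exists n.
by right; split => // An; apply: nA; exists n.
Qed.

Lemma null_eq_bigcap (A B : (set (R * R))^nat) : (forall n, null_eq (A n) (B n)) ->
  null_eq (\bigcap_n A n) (\bigcap_n B n).
Proof.
move=> h; rewrite -[X in null_eq X _]setCK -[X in null_eq _ X]setCK !setC_bigcap.
by apply: null_eqC; apply: null_eq_bigcup => n; exact: null_eqC.
Qed.

Lemma null_eqU A A' B B' : null_eq A A' -> null_eq B B' -> null_eq (A `|` B) (A' `|` B').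
Proof.
move=> h1 h2; apply: leb2_sub0 (leb2U0 h1 h2) => z; rewrite /setU /setD /mkset.
by have [?|?] := pselect (A' z); have [?|?] := pselect (B' z);
  have [?|?] := pselect (A z); have [?|?] := pselect (B z); tauto.
Qed.

Lemma null_eqI A A' B B' : null_eq A A' -> null_eq B B' -> null_eq (A `&` B) (A' `&` B').
Proof.
move=> h1 h2; apply: leb2_sub0 (leb2U0 h1 h2) => z; rewrite /setU /setI /setD /mkset.
by have [?|?] := pselect (A' z); have [?|?] := pselect (B' z);
  have [?|?] := pselect (A z); have [?|?] := pselect (B z); tauto.
Qed.

Lemma null_eqD A A' B B' : null_eq A A' -> null_eq B B' -> null_eq (A `\` B) (A' `\` B').
Proof. by move=> h1 h2; rewrite !setDE; apply: null_eqI => //; exact: null_eqC. Qed.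

Lemma lebmU A B : lebm A -> lebm B -> lebm (A `|` B).
Proof. by move=> a b; exact: measurableU a b. Qed.

Lemma lebmI A B : lebm A -> lebm B -> lebm (A `&` B).
Proof. by move=> a b; exact: measurableI a b. Qed.

Lemma lebmD A B : lebm A -> lebm B -> lebm (A `\` B).
Proof. by move=> a b; exact: measurableD a b. Qed.

Lemma lebmC A : lebm A -> lebm (~` A).
Proof. by move=> a; exact: measurableC a. Qed.

Lemma lebm_bigcup (A : (set (R * R))^nat) : (forall n, lebm (A n)) -> lebm (\bigcup_n A n).
Proof. by move=> h; exact: (@bigcupT_measurable _ (@lebplane R) A h). Qed.

Lemma lebm_bigcap (A : (set (R * R))^nat) : (forall n, lebm (A n)) -> lebm (\bigcap_n A n).
Proof. by move=> h; exact: (@bigcapT_measurable _ (@lebplane R) A h). Qed.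

Lemma lebm_null_eq A B : null_eq A B -> lebm A -> lebm B.
Proof.
move=> h mA; rewrite (_ : B = (A `\` (A `\` B)) `|` (B `\` A)).
  apply: lebmU; last by apply: null_lebesgue; apply: leb2_sub0 h; exact: subsetUr.
  by apply: lebmD => //; apply: null_lebesgue; apply: leb2_sub0 h; exact: subsetUl.
apply/seteqP; split => z; rewrite /setU /setD /mkset;
  by have [?|?] := pselect (A z); have [?|?] := pselect (B z); tauto.
Qed.

Lemma leb2_null_eq A B : null_eq A B -> leb2 A = leb2 B.
Proof.
have key X Y : null_eq X Y -> (leb2 X <= leb2 Y)%E.
  move=> h; apply: (@le_trans _ _ (leb2 (Y `|` (X `\` Y)))).
    apply: le_leb2 => z; rewrite /setU /setD /mkset.
    by have [?|?] := pselect (Y z); tauto.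
  apply: (le_trans (leb2U _ _)); rewrite (_ : leb2 (X `\` Y) = 0%E) ?adde0//.
  by apply: leb2_sub0 h; exact: subsetUl.
move=> h; apply/eqP; rewrite eq_le key//=; apply: key; exact: null_eq_sym.
Qed.

Lemma ex_borel E : lebm E -> exists B : set P, measurable B /\ null_eq E B.
Proof.
move=> /borel_rep[B [mB EB h]]; exists B; split => //; apply: leb2_sub0 h => z [[/EB]|]//.
Qed.

Lemma Per_leP E (B : set P) c : measurable B -> null_eq E B ->
  (Per E <= c%:E)%E <-> per_le B c.
Proof.
move=> mB EB; rewrite (Per_borel mB EB); split => [h f g d tf|h].
  rewrite -lee_fin; apply: le_trans h; apply: ereal_sup_ubound.
  by exists d => //; exists f, g.
by apply: ge_ereal_sup => _ [d [f [g tf]] <-]; rewrite lee_fin; exact: h tf.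
Qed.

Lemma Per_null_eq E F : lebm E -> null_eq E F -> Per E = Per F.
Proof.
move=> /ex_borel[B [mB EB]] EF; rewrite (Per_borel mB EB) (Per_borel mB)//.
exact: null_eq_trans (null_eq_sym EF) EB.
Qed.

Lemma Per_ge0 E : lebm E -> (0 <= Per E)%E.
Proof.
move=> /ex_borel[B [mB EB]]; rewrite (Per_borel mB EB).
apply: ereal_sup_ubound; exists (fun=> 0); first by exists (fun=> 0), (fun=> 0); exact: test_field0.
by rewrite (_ : (fun z => _) = fun=> 0) ?J0//; apply/funext => z; rewrite mulr0.
Qed.

End Perimeter.

(* Locked, since conversion between two instances of the measure-theoretic
   definitions is very slow. *)
HB.lock Definition per (R : realType) (E : set (R * R)) : R := fine (Per E).
HB.lock Definition fp (R : realType) (E : set (R * R)) : Prop := finite_perimeter E.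

(** * Subadditivity, submodularity and lower semicontinuity for sets of finite perimeter *)

Section FinitePerimeter.
Context {R : realType}.
Local Notation T := (measurableTypeR R).
Local Notation P := (T * T)%type.
Local Notation lam2 := (@lam2 R).
Local Notation J := (@J R).
Local Notation lebm := (@lebesgue_measurable R).
Implicit Types (A B E F : set (R * R)).

Lemma fpP E : fp E <-> finite_perimeter E.
Proof. by rewrite fp.unlock. Qed.

Lemma fp_lebm E : fp E -> lebm E.
Proof. by rewrite fp.unlock => -[]. Qed.

Lemma Per_fin E : fp E -> Per E = (per E)%:E.
Proof.
rewrite fp.unlock => -[mE Eoo].
by rewrite per.unlock fineK// ge0_fin_numE ?Per_ge0.
Qed.

Lemma per_ge0 E : lebm E -> 0 <= per E.
Proof. by move=> mE; rewrite per.unlock fine_ge0// Per_ge0. Qed.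

Lemma fp_le E c : lebm E -> (Per E <= c%:E)%E -> fp E /\ per E <= c.
Proof.
move=> mE h; have fE : fp E by apply/fpP; split => //; exact: le_lt_trans (ltry c).
by split => //; rewrite -lee_fin -Per_fin.
Qed.

Lemma per_null_eq E F : lebm E -> null_eq E F -> per E = per F.
Proof. by move=> mE EF; rewrite per.unlock (Per_null_eq mE EF). Qed.

Lemma fp_null_eq E F : null_eq E F -> fp E -> fp F.
Proof. move=> EF /fpP[mE Eoo]; apply/fpP; split; first by exact: lebm_null_eq EF mE.
by rewrite -(Per_null_eq mE EF). Qed.

Lemma fp_null E : leb2 E = 0%E -> fp E /\ per E = 0.
Proof.
move=> E0.
have h : null_eq E (set0 : set P).
  by rewrite /null_eq setD0 set0D setU0.
have [f p] : fp E /\ per E <= 0.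
  apply: fp_le; first exact: null_lebesgue.
  apply/(Per_leP _ measurable0 h) => f g d tf.
  by rewrite (_ : (fun z => _) = fun=> 0) ?J0//; apply/funext => z; rewrite indic0 mul0r.
by split => //; apply/le_anti; rewrite p per_ge0//; exact: fp_lebm.
Qed.

Lemma fpU E F : fp E -> fp F -> leb2 (E `&` F) = 0%E ->
  fp (E `|` F) /\ per (E `|` F) <= per E + per F.
Proof.
move=> fE fF EF; have mE := fp_lebm fE; have mF := fp_lebm fF.
have [A [mA EA]] := ex_borel mE; have [B [mB FB]] := ex_borel mF.
(* Making the second representative disjoint from the first lets the indicators add exactly. *)
have mBA : measurable (B `\` A : set P) by exact: measurableD.
have FBA : null_eq F (B `\` A : set P).
  apply: null_eq_trans (null_eqD FB EA).
  apply: leb2_sub0 EF => z; rewrite /setU /setD /setI /mkset.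
  by have [?|?] := pselect (E z); tauto.
apply: fp_le; first exact: lebmU.
apply/(@Per_leP R _ (A `|` (B `\` A) : set P)); first exact: measurableU.
  exact: null_eqU.
move=> f g d tf.
have hA : per_le A (per E) by apply/(Per_leP _ mA EA); rewrite -Per_fin.
have hB : per_le (B `\` A : set P) (per F) by apply/(Per_leP _ mBA FBA); rewrite -Per_fin.
have [_ _ bd] := test_field_bcs tf.
apply: le_trans (lerD (hA _ _ _ tf) (hB _ _ _ tf)).
rewrite -JD; [|exact: bcsI|exact: bcsI].
rewrite le_eqVlt; apply/orP; left; apply/eqP; congr J; apply/funext => z.
rewrite -mulrDl !indicE in_setU in_setD.
by case: (z \in A); case: (z \in B); rewrite ?addr0 ?add0r.
Qed.

(** [per_submod] bounds a sum for two independent fields: the zero field in one slot gives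
    finiteness of the other term, after which the suprema are taken one at a time. *)
Lemma fp_submod A B : fp A -> fp B ->
  [/\ fp (A `&` B), fp (A `|` B) &
      per (A `&` B) + per (A `|` B) <= per A + per B].
Proof.
move=> fA fB; have mA := fp_lebm fA; have mB := fp_lebm fB.
have [A' [mA' AA]] := ex_borel mA; have [B' [mB' BB]] := ex_borel mB.
have mI : measurable (A' `&` B' : set P) by exact: measurableI.
have mU : measurable (A' `|` B' : set P) by exact: measurableU.
have hA : per_le A' (per A) by apply/(Per_leP _ mA' AA); rewrite -Per_fin.
have hB : per_le B' (per B) by apply/(Per_leP _ mB' BB); rewrite -Per_fin.
have hI := null_eqI AA BB; have hU := null_eqU AA BB.
have key f1 g1 d1 f2 g2 d2 : test_field f1 g1 d1 -> test_field f2 g2 d2 ->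
   J (fun z => \1_(A' `&` B') z * d1 z) + J (fun z => \1_(A' `|` B') z * d2 z) <= per A + per B.
  by move=> t1 t2; exact: (per_submod mA' mB' hA hB t1 t2).
have z0 (X : set P) : J (fun z => \1_X z * 0) = 0.
  by rewrite (_ : (fun z => _) = fun=> 0) ?J0//; apply/funext => z; rewrite mulr0.
have [fI _] : fp (A `&` B) /\ per (A `&` B) <= per A + per B.
  apply: fp_le; first exact: lebmI.
  apply/(Per_leP _ mI hI) => f g d tf.
  by have := key _ _ _ _ _ _ tf (@test_field0 R); rewrite z0 addr0.
have [fU _] : fp (A `|` B) /\ per (A `|` B) <= per A + per B.
  apply: fp_le; first exact: lebmU.
  apply/(Per_leP _ mU hU) => f g d tf.
  by have := key _ _ _ _ _ _ (@test_field0 R) tf; rewrite z0 add0r.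
split => //.
have step f g d : test_field f g d -> J (fun z => \1_(A' `|` B') z * d z) <= per A + per B - per (A `&` B).
  move=> t2; rewrite lerBrDr addrC -lerBrDr -lee_fin -Per_fin//.
  apply/(Per_leP _ mI hI) => f1 g1 d1 t1.
  by rewrite lerBrDr; exact: key t1 t2.
by rewrite addrC -lerBrDr -lee_fin -Per_fin//; apply/(Per_leP _ mU hU).
Qed.

(** Lower semicontinuity: for a fixed field the integrals converge, dominated by [|d|], and the
    bound passes to the limit field by field. *)
Lemma per_le_lim (A_ : (set P)^nat) (A : set P) c : measurable A ->
  (forall n, measurable (A_ n)) ->
  (forall z, \forall n \near \oo, A_ n z <-> A z) ->
  (forall n, per_le (A_ n) c) -> per_le A c.
Proof.
move=> mA' mA cA hA f g d tf.
have [_ _ bd] := test_field_bcs tf.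
have bn n : bcs (fun z => \1_(A_ n) z * d z) by exact: bcsI.
have mn n : measurable_fun (setT : set P) (fun z => (\1_(A_ n) z * d z)%:E).
  by apply/measurable_EFinP; case: (bn n).
have cn z : (\1_(A_ n) z * d z)%:E @[n --> \oo] --> (\1_A z * d z)%:E.
  apply: cvg_near_cst; apply: filterS (cA z) => n hn; congr EFin; congr (_ * _).
  by rewrite !indicE; congr (nat_of_bool _)%:R; apply/idP/idP; rewrite !inE => /hn.
have ib := integrable_abse (bcs_integrable bd).
have le n z : (setT : set P) z -> (`|(\1_(A_ n) z * d z)%:E| <= (abse \o (EFin \o d)) z)%E.
  move=> _; rewrite /= lee_fin normrM ler_piMl// indicE.
  by case: (_ \in _); rewrite ?normr1 ?normr0.
have fin z : (setT : set P) z -> (abse \o (EFin \o d)) z \is a fin_num by [].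
have cv := @dominated_cvg _ _ R lam2 setT measurableT _ _ _ mn (fun z _ => cn z) fin ib le.
have lim_eq := cvg_lim (@ereal_hausdorff R) cv.
have iA : lam2.-integrable setT (fun z => (\1_A z * d z)%:E).
  exact: bcs_integrable (bcsI mA' bd).
have bfin : (\int[lam2]_z (\1_A z * d z)%:E \is a fin_num)%E by exact: integrable_fin_num.
rewrite -lee_fin /J /Rintegral fineK// -lim_eq//.
apply: lime_le.
  apply/cvg_ex; exists (\int[lam2]_z (\1_A z * d z)%:E)%E.
  exact: cv.
by apply: nearW => n; rewrite -EFinJ// lee_fin; exact: hA tf.
Qed.

Lemma fp_bigcup (A : (set (R * R))^nat) c : (forall n, A n `<=` A n.+1) ->
  (forall n, fp (A n) /\ per (A n) <= c) ->
  fp (\bigcup_n A n) /\ per (\bigcup_n A n) <= c.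
Proof.
move=> ndA hA.
have mA n : lebm (A n) by have [/fp_lebm] := hA n.
pose B n := sval (cid (ex_borel (mA n))).
have BP n : measurable (B n) /\ null_eq (A n) (B n) := svalP (cid (ex_borel (mA n))).
have ndA' n k : (k <= n)%N -> A k `<=` A n.
  elim: n => [|n ih]; first by rewrite leqn0 => /eqP ->.
  by rewrite leq_eqVlt => /predU1P[->//|/ih h]; exact: subset_trans (ndA n).
(* Representatives of increasing sets need not increase; their partial unions do, and differ from
   [A n] by a null set. *)
pose D n := \bigcup_(k in [set k | (k <= n)%N]) B k.
have mD n : measurable (D n) by apply: bigcup_measurable => k _; case: (BP k).
have AD n : null_eq (A n) (D n).
  apply: leb2_sub0 (leb2_bigcup0 (fun k => (BP k).2)) => z [[Az nD]|[[k /= kn Bk] nA]].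
    by exists n => //; left; split => // Bz; apply: nD; exists n => /=.
  by exists k => //; right; split => // Az; apply: nA; exact: ndA' Az.
apply: fp_le; first exact: lebm_bigcup.
apply/(@Per_leP R _ (\bigcup_n D n)); first exact: bigcupT_measurable.
  exact: null_eq_bigcup.
apply: (@per_le_lim D) => //.
- exact: bigcupT_measurable.
- move=> z; have [[N _ DN]|nD] := pselect ((\bigcup_n D n) z).
    exists N => // n /= Nn; split => [h|_]; first by exists n.
    by move: DN => [k /= kN Bk]; exists k => //=; exact: leq_trans Nn.
  by apply: nearW => n; split => // h; exists n.
- move=> n; apply/(Per_leP _ (mD n) (AD n)).
  by have [fA le] := hA n; rewrite Per_fin// lee_fin.
Qed.

Lemma fp_bigcap (A : (set (R * R))^nat) c : (forall n, A n.+1 `<=` A n) ->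
  (forall n, fp (A n) /\ per (A n) <= c) ->
  fp (\bigcap_n A n) /\ per (\bigcap_n A n) <= c.
Proof.
move=> ndA hA.
have mA n : lebm (A n) by have [/fp_lebm] := hA n.
pose B n := sval (cid (ex_borel (mA n))).
have BP n : measurable (B n) /\ null_eq (A n) (B n) := svalP (cid (ex_borel (mA n))).
have ndA' n k : (k <= n)%N -> A n `<=` A k.
  elim: n => [|n ih]; first by rewrite leqn0 => /eqP ->.
  by rewrite leq_eqVlt => /predU1P[->//|/ih h]; exact: subset_trans h.
pose D n := \bigcap_(k in [set k | (k <= n)%N]) B k.
have mD n : measurable (D n) by apply: bigcap_measurable => [|k _]; [exists 0%N|case: (BP k)].
have AD n : null_eq (A n) (D n).
  apply: leb2_sub0 (leb2_bigcup0 (fun k => (BP k).2)) => z [[Az nD]|[Dz nA]].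
    have /existsNP[k /not_implyP[/= kn nB]] : ~ forall k, (k <= n)%N -> B k z.
      by move=> h; apply: nD => k /=; exact: h.
    by exists k => //; left; split => //; exact: ndA' Az.
  by exists n => //; right; split => //; exact: (Dz n (leqnn n)).
apply: fp_le; first exact: lebm_bigcap.
apply/(@Per_leP R _ (\bigcap_n D n)); first exact: bigcapT_measurable.
  exact: null_eq_bigcap.
apply: (@per_le_lim D) => //.
- exact: bigcapT_measurable.
- move=> z; have [h|/existsNP[N /not_implyP[_ nD]]] := pselect ((\bigcap_n D n) z).
    by apply: nearW => n; split => // _; exact: h.
  exists N => // n /= Nn; split => [h|h]; last by exfalso; apply: nD; exact: h.
  exfalso; apply: nD => k /= kN; apply: h => /=; exact: leq_trans Nn.
- move=> n; apply/(Per_leP _ (mD n) (AD n)).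
  by have [fA le] := hA n; rewrite Per_fin// lee_fin.
Qed.

End FinitePerimeter.

(** * The translation estimate *)

Section Shift.
Context {R : realType}.
Local Notation T := (measurableTypeR R).
Local Notation P := (T * T)%type.
Local Notation lam2 := (@lam2 R).
Local Notation J := (@J R).

(** Variation inside Q. The covering argument needs this local form: its negation on a small square
    yields a field vanishing off that square. *)
Definition per_le_on (Q A : set P) c := forall f g d, test_field f g d ->
  (forall z, ~ Q z -> f z = 0 /\ g z = 0) -> J (fun z => \1_A z * d z) <= c.

Lemma per_le_onT (A : set P) c : per_le A c -> per_le_on setT A c.
Proof. by move=> h f g d tf _; exact: h tf. Qed.

Lemma le_inv_nat (x y K : R) n0 : (forall n, (n0 <= n)%N -> x <= y + K / n.+1%:R) -> x <= y.
Proof.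
move=> h; rewrite leNgt; apply/negP => yx.
pose K' := Num.max K 1.
have K0 : 0 < K' by rewrite lt_max ltr01 orbT.
have [m mP] : exists m : nat, K' / (x - y) < m%:R.
  exists (Num.Def.archi_bound (K' / (x - y))); apply: archi_boundP.
  by rewrite divr_ge0// ?ltW// subr_gt0.
have := h (maxn n0 m) (leq_maxl _ _).
rewrite leNgt => /negP; apply; rewrite -ltrBrDl.
apply: (@le_lt_trans _ _ (K' / (maxn n0 m).+1%:R)).
  by rewrite ler_wpM2r ?invr_ge0// le_max lexx.
rewrite ltr_pdivrMr// mulrC -ltr_pdivrMr ?subr_gt0//.
by apply: (lt_le_trans mP); rewrite ler_nat leqW// leq_maxr.
Qed.

Definition scal (s : R) (h : R * R) : R * R := (s * h.1, s * h.2).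

Lemma enorm_ge0 (h : R * R) : 0 <= enorm h.
Proof. exact: sqrtr_ge0. Qed.

Lemma enorm_sq (h : R * R) : enorm h ^+ 2 = h.1 ^+ 2 + h.2 ^+ 2.
Proof. by rewrite sqr_sqrtr// addr_ge0// sqr_ge0. Qed.

Lemma enorm_le (h : R * R) : enorm h <= 2 * `|h|.
Proof.
rewrite -ler_sqr ?nnegrE ?enorm_ge0 ?mulr_ge0// enorm_sq.
have h1 := normr_fst h; have h2 := normr_snd h.
rewrite -[h.1 ^+ 2]real_normK ?num_real// -[h.2 ^+ 2]real_normK ?num_real//.
have := normr_ge0 h.1; have := normr_ge0 h.2; nra.
Qed.

Lemma le_enorm (h : R * R) : `|h| <= enorm h.
Proof.
rewrite -ler_sqr ?nnegrE ?enorm_ge0// enorm_sq normr_pair maxEle.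
by case: ifP => _; rewrite real_normK ?num_real// ?lerDl ?lerDr sqr_ge0.
Qed.

Lemma enorm_eq0 (h : R * R) : enorm h = 0 -> h = 0.
Proof. by move=> e; apply/eqP; rewrite -normr_le0 -e; exact: le_enorm. Qed.

(** Up to sign, the derivative in s of the integral over A of f translated by s h is [enorm h] times
    the integral of the divergence of a field along the direction of h. Finite differences with a
    quadratic remainder replace differentiation under the integral. *)
Lemma shift_smooth (A Q : set P) c (h : R * R) f p q C M :
  measurable A -> per_le_on Q A c -> grad f p q ->
  (forall z v, `|v| <= 1 -> `|f (z + v) - f z - lin2 (p z) (q z) v| <= C * `|v| ^+ 2) ->
  (forall z, f z != 0 -> in_box M z) -> (forall z, `|f z| <= 1) ->
  (forall z s, 0 <= s <= 1 -> f (z - scal s h) != 0 -> Q z) ->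
  J (fun z => \1_A z * f z) - J (fun z => \1_A z * f (z - h)) <= enorm h * c.
Proof.
move=> mA hA gf rem f0 f1 fQ.
pose L := enorm h; have L0 : 0 <= L := enorm_ge0 h.
have [/enorm_eq0 -> {f1 fQ L L0}|Ln0] := eqVneq L 0.
  have -> : enorm (0 : R * R) = 0 by rewrite /enorm /= expr0n/= addr0 sqrtr0.
  rewrite mul0r; under [X in _ - J X]eq_fun do rewrite subr0.
  by rewrite subrr.
have Lp : 0 < L by rewrite lt_neqAle eq_sym Ln0.
pose a := h.1 / L; pose b := h.2 / L.
have ab : a ^+ 2 + b ^+ 2 = 1.
  rewrite /a /b !exprMn exprVn -mulrDl -enorm_sq -/L divff// expf_eq0/=.
  by rewrite (negPf Ln0).
have [bf bp bq] := grad_bcs gf f0.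
pose G s := J (fun z => \1_A z * f (z - scal s h)).
have bG s : bcs (fun z => \1_A z * f (z - scal s h)) by apply: bcsI => //; exact: bcs_translate.
pose d z := p z * a + q z * b.
have bd : bcs d.
  by apply: bcsD; [under eq_fun do rewrite mulrC|under eq_fun do rewrite mulrC]; exact: bcsZ.
have tf s : test_field (fun z => a * f (z - scal s h)) (fun z => b * f (z - scal s h))
                       (fun z => d (z - scal s h)).
  have h1 := test_field_translate (- scal s h).
  apply: (h1 (fun z => a * f z) (fun z => b * f z) d).
  exists (fun z => a * p z), (fun z => a * q z), (fun z => b * p z), (fun z => b * q z), M.
  split; [exact: gradZ|exact: gradZ| | |].
  - by apply/funext => z; rewrite /d; ring.
  - by move=> z hz; apply: f0; apply: contraPneq hz => ->; rewrite !mulr0 eqxx => -[].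
  - move=> z; rewrite [(a * _) ^+ 2]exprMn [(b * _) ^+ 2]exprMn -mulrDl ab mul1r -real_normK ?num_real//.
    by rewrite expr_le1.
have hd s : 0 <= s <= 1 -> J (fun z => \1_A z * d (z - scal s h)) <= c.
  move=> s01; apply: (hA _ _ _ (tf s)) => z nQ.
  have -> : f (z - scal s h) = 0 by apply/eqP; apply: contraPT nQ => /(fQ _ _ s01) ? [].
  by rewrite !mulr0.
pose K := C * `|h| ^+ 2 * J (\1_(box (M + 1))).
have step s w : 0 <= s <= 1 -> 0 <= w -> w * `|h| <= 1 -> G s - G (s + w) <= w * L * c + K * w ^+ 2.
  move=> s01 w0 w1.
  have wh : `|- scal w h| = w * `|h|.
    rewrite normrN !normr_pair /scal /= !normrM (ger0_norm w0).
    by rewrite maxr_pMr.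
  have bdw : bcs (fun z => \1_A z * d (z - scal s h)).
    by apply: bcsI => //; exact: bcs_translate.
  have -> : G s - G (s + w) = w * L * J (fun z => \1_A z * d (z - scal s h)) +
     J (fun z => (\1_A z * f (z - scal s h) - \1_A z * f (z - scal (s + w) h)) -
                 w * L * (\1_A z * d (z - scal s h))).
    rewrite JB; [|exact: bcsB|exact: bcsZ].
    by rewrite JB// JZ// /G; ring.
  apply: lerD; first by rewrite ler_wpM2l ?mulr_ge0// hd.
  have -> : K * w ^+ 2 = C * (w * `|h|) ^+ 2 * J (\1_(box (M + 1))) by rewrite /K; ring.
  apply: (le_trans (ler_norm _)).
  have key y : `|f y - f (y - scal w h) - w * L * d y| <= C * (w * `|h|) ^+ 2.
    have := rem y (- scal w h); rewrite wh => /(_ w1).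
    rewrite -[`|f y - _ - _|]normrN; congr (_ <= _); congr `|_|.
    rewrite /lin2 /d /a /b /scal /=.
    have e1 : w * L * (p y * (h.1 / L) + q y * (h.2 / L)) = w * (p y * h.1 + q y * h.2).
      by field.
    by rewrite e1; ring.
  have ys y : y + scal s h - scal (s + w) h = y - scal w h.
    rewrite /scal; apply/pair_eqP; rewrite /pair_eq /=; apply/andP; split; apply/eqP; ring.
  apply: (@J_le_box _ _ (scal s h)).
  - by apply: bcsB; [exact: bcsB|exact: bcsZ].
  - move=> y _; rewrite addrK ys.
    have -> : \1_A (y + scal s h) * f y - \1_A (y + scal s h) * f (y - scal w h) -
       w * L * (\1_A (y + scal s h) * d y) =
       \1_A (y + scal s h) * (f y - f (y - scal w h) - w * L * d y) by ring.
    rewrite normrM; apply: le_trans (key y).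
    by rewrite ler_piMl// indicE; case: (_ \in _); rewrite ?normr1 ?normr0.
  - move=> y nb; rewrite addrK ys.
    have nb' : ~ in_box M y by apply: contra_not nb; apply: in_box_le; rewrite lerDl.
    have [py0 qy0] := grad_out gf f0 nb'.
    have -> : f y = 0 by apply/eqP; apply: contraPT nb' => /f0 ? [].
    have -> : f (y - scal w h) = 0.
      apply/eqP; apply: contraPT nb => /f0[h1 h2]; apply; split.
        have -> : y.1 = (y - scal w h).1 + (scal w h).1 by rewrite /= subrK.
        apply: (le_trans (ler_normD _ _)); apply: lerD => //.
        by apply: (le_trans (normr_fst _)); rewrite -normrN wh.
      have -> : y.2 = (y - scal w h).2 + (scal w h).2 by rewrite /= subrK.
      apply: (le_trans (ler_normD _ _)); apply: lerD => //.
      by apply: (le_trans (normr_snd _)); rewrite -normrN wh.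
    by rewrite /d py0 qy0; ring.
(* Each of the [n + 1] steps costs its share of [L * c] plus [K / (n+1)^2], so the accumulated error
   is [K / (n+1)]. The condition on n keeps each displacement within the range of the Taylor
   bound. *)
have tele n : (`|h| <= n.+1%:R) -> forall k, (k <= n.+1)%N ->
    G 0 - G (k%:R / n.+1%:R) <= k%:R * (n.+1%:R^-1 * L * c + K * n.+1%:R^-1 ^+ 2).
  move=> hn; elim=> [|k ih] kn; first by rewrite !mul0r subrr.
  have n0 : (0 : R) < n.+1%:R by rewrite ltr0n.
  have := step (k%:R / n.+1%:R) n.+1%:R^-1.
  rewrite divr_ge0//= ler_pdivrMr// mul1r ler_nat (ltnW kn) => /(_ isT).
  rewrite invr_ge0 ler0n => /(_ isT).
  rewrite ler_pdivrMl// mulr1 => /(_ hn).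
  have -> : k%:R / n.+1%:R + n.+1%:R^-1 = (k%:R + 1) / n.+1%:R :> R by rewrite mulrDl mul1r.
  have := ih (ltnW kn); rewrite -[k.+1%:R]natr1 [(k%:R + 1) * (_ + _)]mulrDl mul1r.
  by move=> a1 a2; apply: le_trans (lerD a1 a2); rewrite addrA subrK.
have -> : J (fun z => \1_A z * f z) = G 0.
  by congr J; apply/funext => z; congr (_ * f _); rewrite /scal !mul0r subr0.
have -> : J (fun z => \1_A z * f (z - h)) = G 1.
  by congr J; apply/funext => z; congr (_ * f (_ - _)); rewrite /scal !mul1r; case: (h).
pose n0 := Num.Def.archi_bound `|h|.
apply: (@le_inv_nat _ _ K n0) => n n0n.
have hn : `|h| <= n.+1%:R.
  apply: ltW; apply: lt_le_trans (archi_boundP (normr_ge0 h)) _.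
  by rewrite ler_nat; exact: leqW.
have := tele n hn n.+1 (leqnn _).
rewrite divff ?pnatr_eq0//; congr (_ <= _).
have N0 : n.+1%:R != 0 :> R by rewrite pnatr_eq0.
by move: N0; rewrite -/L; set N := n.+1%:R => N0; field.
Qed.

(** Apply [shift_smooth] to a mollified indicator of the points of X sent into Y by h: these lie in
    A and their images do not, so the difference of integrals is nearly their area. The margin [dl]
    leaves room for the mollification. *)
Lemma shift_le (A Q X Y : set P) c (h : R * R) M dl : measurable A -> per_le_on Q A c ->
  measurable X -> measurable Y -> X `<=` A -> Y `&` A = set0 ->
  (forall z, X z -> in_box M z) -> 0 < dl ->
  (forall (x : R * R) s (v : R * R), X x -> 0 <= s <= 1 -> `|v| <= dl -> Q (x + scal s h + v)) ->
  J (fun z => \1_X z * \1_Y (z + h)) <= enorm h * c.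
Proof.
move=> mA hA mX mY XA YA XM dl0 XQ.
pose U : set P := X `&` [set z | Y (z + h)].
have mU : measurable U.
  apply: measurableI => //.
  by have := @measurable_fun_translate2 R h measurableT Y mY; rewrite setTI.
have UM z : U z -> in_box M z by move=> [/XM].
have uE : (fun z => \1_X z * \1_Y (z + h)) = (\1_U : P -> R).
  apply/funext => z; rewrite -[\1_Y (z + h)]/(\1_[set z | Y (z + h)] z).
  by rewrite /U indicI.
rewrite uE; apply/ler_addgt0Pl => e e0.
have [d d0 hd] := shift_dist_small mU UM e0.
pose del := Num.min dl (d / 2).
have del0 : 0 < del by rewrite lt_min dl0 divr_gt0.
have deldl : del <= dl by rewrite ge_min lexx.
have deld : del < d by rewrite gt_min; apply/orP; right; lra.
have [K [be [be' ker]]] := kernel_exists del0.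
have i1 (B : set P) z : `|\1_B z| <= 1 :> R.
  by rewrite indicE; case: (_ \in _); rewrite ?normr1 ?normr0.
have mi (B : set P) : measurable B -> measurable_fun setT (\1_B : P -> R).
  by move=> mB; exact: measurable_indic.
have [p [q [C [gf rem]]]] := smear_grad ker (mi _ mU) (i1 U).
set f := smear be \1_U in gf rem.
have fsupp z : f z != 0 -> exists w : R * R, [/\ `|w| <= del & U (w + z)].
  move=> /(smear_supp ker)[w [/andP[w1 w1'] /andP[w2 w2'] h0]]; exists w; split.
    by rewrite normr_pair ge_max !ger0_norm// w1' w2'.
  by move: h0; rewrite indicE; case: (boolP (_ \in _)) => [/set_mem//|_]; rewrite eqxx.
have fM z : f z != 0 -> in_box (M + del) z.
  move=> /fsupp[w [wd /UM[h1 h2]]]; split.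
    have -> : z.1 = (w + z).1 - w.1 by rewrite /= addrC addKr.
    apply: (le_trans (ler_normB _ _)); apply: lerD => //.
    exact: le_trans (normr_fst _) wd.
  have -> : z.2 = (w + z).2 - w.2 by rewrite /= addrC addKr.
  apply: (le_trans (ler_normB _ _)); apply: lerD => //.
  exact: le_trans (normr_snd _) wd.
have key : J (fun z => \1_A z * f z) - J (fun z => \1_A z * f (z - h)) <= enorm h * c.
  apply: (shift_smooth mA hA gf rem fM (smear_bound ker (mi _ mU) (i1 U))).
  move=> z s s01 /fsupp[w [wd [Xw _]]].
  have -> : z = (w + (z - scal s h)) + scal s h + (- w).
    by apply/pair_eqP; rewrite /pair_eq /=; apply/andP; split; apply/eqP; ring.
  by apply: XQ => //; rewrite normrN; exact: le_trans wd deldl.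
have bU := bcs_indic mU UM.
have [bf _ _] := grad_bcs gf fM.
have l1 : J (fun z => `|f z - \1_U z|) <= e.
  apply: (smear_L1 ker bU (i1 U)) => w /andP[w1 w1'] /andP[w2 w2'].
  rewrite (_ : (fun z => _) = (fun z => `|\1_U (z + w) - \1_U z|)); last first.
    by apply/funext => z; rewrite [w + z]addrC.
  apply: hd; apply: le_lt_trans deld; rewrite normr_pair ge_max.
  by rewrite !ger0_norm// w1' w2'.
have mAh : measurable [set z : P | A (z + h)].
  by have := @measurable_fun_translate2 R h measurableT A mA; rewrite setTI.
have bfh : bcs (fun z => \1_A z * f (z - h)) by apply: bcsI => //; exact: bcs_translate.
have bfA : bcs (fun z => \1_A (z + h) * f z).
  rewrite (_ : (fun z => _) = (fun z => \1_[set z : P | A (z + h)] z * f z))//; exact: bcsI.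
have eh : J (fun z => \1_A z * f (z - h)) = J (fun z => \1_A (z + h) * f z).
  by rewrite -(J_translate h bfh); congr J; apply/funext => z; rewrite addrK.
have bAf := bcsI mA bf; have bdif := bcsB bAf bfA.
have bno := bcs_norm (bcsB bf bU).
rewrite eh -(JB bAf bfA) in key.
apply: le_trans (lerD l1 key); rewrite -(JD bno bdif).
apply: (le_J bU (bcsD bno bdif)).
(* On [U] the difference of indicators is 1, and [f + |f - 1|] is at least 1; off [U] the difference
   is at least -1, which the error term [f] compensates. *)
move=> z; have [[Xz Yz]|nU] := pselect (U z).
  have -> : \1_U z = 1 :> R by rewrite indicE (mem_set (conj Xz Yz : U z)).
  have -> : \1_A z = 1 :> R by rewrite indicE (mem_set (XA z Xz)).
  have nAh : ~ A (z + h).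
    by move=> Ah; have := conj Yz Ah : (Y `&` A) (z + h); rewrite YA.
  have -> : \1_A (z + h) = 0 :> R by rewrite indicE (memNset nAh).
  move: (f z) => y; clear; have := ler_norm (- (y - 1)); rewrite normrN; lra.
have -> : \1_U z = 0 :> R by rewrite indicE (memNset nU).
rewrite subr0 -mulrBl.
have f0 : 0 <= f z by apply: (smear_ge0 ker) => w; rewrite indicE.
rewrite (ger0_norm f0).
rewrite !indicE; move: (z \in A) (z + h \in A) (f z) f0 => s1 s2 y y0; clear - y0.
by case: s1; case: s2; rewrite /= ?mulr1n ?mulr0n; lra.
Qed.

End Shift.

Ltac pair_ring := apply/pair_eqP; rewrite /pair_eq /=; apply/andP; split; apply/eqP; ring.

(** * Relative and global isoperimetric inequalities *)

Section Isoperimetric.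
Context {R : realType}.
Local Notation T := (measurableTypeR R).
Local Notation P := (T * T)%type.
Local Notation leb1 := (@lebesgue_measure R).
Local Notation lam2 := (@lam2 R).
Local Notation J := (@J R).

Definition sq (x : R * R) (r : R) : set P :=
  `[x.1 - r, x.1 + r]%classic `*` `[x.2 - r, x.2 + r]%classic.

Lemma sqP x r (z : R * R) : sq x r z <-> `|z - x| <= r.
Proof.
rewrite normr_pair ge_max /sq /=; split.
  by move=> [] /=; rewrite !in_itv/= !ler_distl => -> ->.
by move=> /andP[]; rewrite !ler_distl => h1 h2; split; rewrite /= in_itv.
Qed.

Lemma measurable_sq x r : measurable (sq x r).
Proof. exact: measurableX. Qed.

Lemma sq_in_box x r z : sq x r z -> in_box (`|x| + r) z.
Proof.
move=> /sqP h; have e : z = (z - x) + x by rewrite subrK.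
by split; rewrite e addrC; [apply: le_trans (normr_fst _) _|apply: le_trans (normr_snd _) _];
  apply: (le_trans (ler_normD _ _)); rewrite lerD2l.
Qed.

Lemma leb2_J (S : set P) M : measurable S -> (forall z, S z -> in_box M z) ->
  leb2 S = (J \1_S)%:E.
Proof.
move=> mS SM; rewrite leb2_borel// (EFinJ (bcs_indic mS SM)).
by have := @integral_indic _ _ R lam2 setT measurableT S mS; rewrite setIT => ->.
Qed.

Lemma J_sq x r : 0 <= r -> J \1_(sq x r) = 4 * r ^+ 2.
Proof.
move=> r0; apply: EFin_inj; rewrite -(leb2_J (measurable_sq x r) (@sq_in_box x r)).
rewrite leb2_borel; last exact: measurable_sq.
rewrite lam2X// !leb1_cc; [|lra|lra].
rewrite -EFinM; congr EFin; ring.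
Qed.

Lemma indic_bound (S : set P) z : `|\1_S z| <= 1 :> R.
Proof. by rewrite indicE; case: (_ \in _); rewrite ?normr1 ?normr0. Qed.

(** Integrates the translation estimate over the displacements in H and exchanges the two
    integrals. *)
Lemma poincare (A Q X Y H : set P) c M dl L : measurable A -> per_le_on Q A c ->
  measurable X -> measurable Y -> measurable H -> X `<=` A -> Y `&` A = set0 ->
  (forall z, X z -> in_box M z) -> (forall z, H z -> in_box M z) -> 0 < dl -> 0 <= c ->
  (forall (x h v : R * R) s, X x -> H h -> 0 <= s <= 1 -> `|v| <= dl -> Q (x + scal s h + v)) ->
  (forall h : R * R, H h -> enorm h <= L) ->
  J (fun z => \1_X z * J (fun h => \1_H h * \1_Y (z + h))) <= L * c * J \1_H.
Proof.
move=> mA hA mX mY mH XA YA XM HM dl0 c0 XQ HL.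
pose F (z h : P) : R := \1_X z * (\1_H h * \1_Y (z + h)).
pose N := Num.max M 1.
have mF : measurable_fun setT (fun x : P * P => F x.1 x.2).
  apply: measurable_funM; first exact: (measurableT_comp (measurable_indic mX) measurable_fst).
  apply: measurable_funM; first exact: (measurableT_comp (measurable_indic mH) measurable_snd).
  exact: (measurableT_comp (measurable_indic mY) measurable_sub_add2).
have FN z h : `|F z h| <= N.
  apply: (@le_trans _ _ 1); last by rewrite le_max lexx orbT.
  rewrite !normrM; apply: mulr_ile1 => //; first exact: indic_bound.
  by apply: mulr_ile1 => //; exact: indic_bound.
have ind0 (S : set P) z : \1_S z != 0 :> R -> S z.
  by rewrite indicE; case: (boolP (_ \in _)) => [/set_mem//|_]; rewrite eqxx.
have F0 z h : F z h != 0 -> in_box N z /\ in_box N h.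
  rewrite /F !mulf_eq0 !negb_or => /and3P[/ind0/XM h1 /ind0/HM h2 _].
  by split; [apply: in_box_le h1|apply: in_box_le h2]; rewrite le_max lexx.
have bY (z : R * R) : bcs (fun h => \1_H h * \1_Y (z + h)).
  have bH := bcs_indic mH HM.
  under eq_fun do rewrite mulrC.
  apply: (@bcsMl _ _ (fun h => \1_Y (z + h)) 1 bH); last by move=> h; exact: indic_bound.
  rewrite (_ : (fun h => _) = \1_Y \o (fun h : P => (h + z : P))).
    exact: (measurableT_comp (measurable_indic mY) (measurable_fun_translate2 z)).
  by apply/funext => h /=; rewrite addrC.
have -> : J (fun z => \1_X z * J (fun h => \1_H h * \1_Y (z + h))) = J (fun z => J (F z)).
  by congr J; apply/funext => z; rewrite -JZ.
rewrite (J_fubini2 mF FN F0) -JZ; last exact: bcs_indic mH HM.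
apply: le_J.
- exact: bcs_J mF FN F0.
- by apply: bcsZ; exact: bcs_indic mH HM.
move=> h; have [Hh|nH] := pselect (H h).
  have -> : \1_H h = 1 :> R by rewrite indicE mem_set.
  rewrite mulr1; apply: (@le_trans _ _ (enorm h * c)); last by rewrite ler_wpM2r// HL.
  have -> : (fun z => F z h) = (fun z => \1_X z * \1_Y (z + h)).
    by apply/funext => z; rewrite /F [\1_H h]indicE mem_set// mul1r.
  by apply: (shift_le mA hA mX mY XA YA XM dl0) => x s v Xx s01 vd; exact: XQ.
have -> : \1_H h = 0 :> R by rewrite indicE memNset.
rewrite mulr0 (_ : (fun z => F z h) = fun=> 0) ?J0//.
by apply/funext => z; rewrite /F [\1_H h]indicE memNset// mul0r mulr0.
Qed.

(** Two points of the square differ by an element of [sq 0 (2 * r)], so the inner integral of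
    [poincare] is the area of the square outside A. The constant is the length [4 r] of a
    displacement times the area [16 r^2] of all of them; segments thickened by r stay in
    [sq x (4 * r)]. *)
Lemma rel_poincare (A Q : set P) c x r : measurable A -> per_le_on Q A c -> 0 < r ->
  0 <= c -> sq x (4 * r) `<=` Q ->
  J \1_(A `&` sq x r) * J \1_(sq x r `\` A) <= 64 * r ^+ 3 * c.
Proof.
move=> mA hA r0 c0 sQ.
have mX : measurable (A `&` sq x r) by apply: measurableI => //; exact: measurable_sq.
have mY : measurable (sq x r `\` A) by apply: measurableD => //; exact: measurable_sq.
have Y0 : (sq x r `\` A) `&` A = set0 by rewrite setDE -setIA setICl setI0.
have XM z : (A `&` sq x r) z -> in_box (`|x| + 2 * r) z.
  by move=> [_ /sq_in_box]; apply: in_box_le; rewrite lerD2l; lra.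
have HM z : sq 0 (2 * r) z -> in_box (`|x| + 2 * r) z.
  by move=> /sq_in_box; apply: in_box_le; rewrite normr0 add0r lerDr.
have key := @poincare A Q _ _ (sq 0 (2 * r)) c _ r (4 * r) mA hA mX mY (measurable_sq _ _)
  (@subIsetl _ _ _) Y0 XM HM r0 c0.
have YM z : (sq x r `\` A) z -> in_box (`|x| + r) z by move=> [/sq_in_box].
have bY := bcs_indic mY YM.
have e (z : R * R) : \1_(A `&` sq x r) z * J (fun h => \1_(sq 0 (2 * r)) h * \1_(sq x r `\` A) (z + h)) =
   J \1_(sq x r `\` A) * \1_(A `&` sq x r) z.
  rewrite mulrC [\1_(A `&` _) z]indicE.
  case: (boolP (z \in _)) => [/set_mem [_ /sqP zx]|_]; last by rewrite !mulr0.
  rewrite !mulr1 -[RHS](J_translate z bY); congr J; apply/funext => h.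
  rewrite [h + z]addrC [\1_(sq x r `\` A) _]indicE.
  case: (boolP (_ \in _)) => [/set_mem [/sqP zhx _]|_]; last by rewrite !mulr0.
  rewrite mulr1 indicE mem_set//; apply/sqP; rewrite subr0.
  have -> : h = (z + h - x) - (z - x) by pair_ring.
  by apply: (le_trans (ler_normB _ _)); lra.
have bX := bcs_indic mX XM.
rewrite (_ : (fun z => _) = (fun z => J \1_(sq x r `\` A) * \1_(A `&` sq x r) z)) in key; last first.
  by apply/funext => z; rewrite e.
rewrite (JZ _ bX) J_sq in key; last by rewrite mulr_ge0// ltW.
rewrite mulrC; apply: (le_trans (key _ _)).
- move=> u h v s [_ /sqP ux] /sqP h2 /andP[s0 s1] v1; apply: sQ; apply/sqP.
  have -> : u + scal s h + v - x = (u - x) + scal s h + v by pair_ring.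
  apply: (le_trans (ler_normD _ _)).
  have sh : `|scal s h| <= 2 * r.
    rewrite subr0 in h2; apply: le_trans h2.
    rewrite !normr_pair /scal /= !normrM (ger0_norm s0) -maxr_pMr//.
    by rewrite ler_piMl// le_max normr_ge0.
  by have := ler_normD (u - x) (scal s h); lra.
- by move=> h /sqP; rewrite subr0 => hr; apply: (le_trans (enorm_le h)); lra.
- by rewrite le_eqVlt; apply/orP; left; apply/eqP; ring.
Qed.

(** Test A with the opposite field; a divergence has total integral 0. *)
Lemma per_leC (A : set P) c : measurable A -> per_le A c -> per_le (~` A) c.
Proof.
move=> mA hA f g d tf; have [_ _ bd] := test_field_bcs tf.
have := hA _ _ _ (test_fieldN tf).
have -> : (fun z => \1_A z * - d z) = (fun z => - (\1_A z * d z)) by apply/funext => z; rewrite mulrN.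
rewrite JN; last exact: bcsI.
have -> // : J (fun z => \1_(~` A) z * d z) = - J (fun z => \1_A z * d z).
have bA : bcs (fun z => \1_A z * d z) by exact: bcsI.
rewrite -[RHS]add0r -(J_test_field tf) -(JB bd bA); congr J; apply/funext => z.
by rewrite !indicE in_setC; case: (_ \in _) => /=; ring.
Qed.

Definition ar (A : set P) (s : R) (z : R * R) : R := J \1_(A `&` sq z s).

Lemma ar_bcs (A : set P) s z : measurable A -> bcs (\1_(A `&` sq z s) : P -> R).
Proof.
move=> mA; apply: (@bcs_indic _ _ (`|z| + s)).
  by apply: measurableI => //; exact: measurable_sq.
by move=> w [_ /sq_in_box].
Qed.

Lemma ar_C (A : set P) s z : measurable A -> 0 <= s -> J \1_(sq z s `\` A) = 4 * s ^+ 2 - ar A s z.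
Proof.
move=> mA s0; rewrite -(J_sq z s0) /ar -JB; last 2 first.
- by apply: bcs_indic (@sq_in_box z s); exact: measurable_sq.
- exact: ar_bcs.
congr J; apply/funext => w; rewrite !indicE in_setD in_setI.
by case: (_ \in A); case: (_ \in _); rewrite /=; ring.
Qed.

Lemma ar_small (A : set P) s : measurable A -> 0 <= s -> forall e : R, 0 < e ->
  exists2 d : R, 0 < d & forall z w : R * R, `|w - z| < d -> `|ar A s z - ar A s w| <= e.
Proof.
move=> mA s0 e e0.
have [d d0 hd] := shift_dist_small (measurable_sq 0 s) (@sq_in_box 0 s) e0.
exists d => // z w wz; apply: le_trans (hd _ wz); rewrite /ar -JB; [|exact: ar_bcs|exact: ar_bcs].
have bs := shift_dist_bcs (w - z) (measurable_sq 0 s) (@sq_in_box 0 s).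
rewrite /shift_dist -(J_translate (- w) bs).
have b1 : bcs (fun u => \1_(A `&` sq z s) u - \1_(A `&` sq w s) u) by apply: bcsB; exact: ar_bcs.
apply: (le_trans (J_abs b1)); apply: le_J.
- exact: bcs_norm.
- exact: bcs_translate bs.
move=> u; have tr (x y : R * R) : \1_(sq 0 s) (y - x) = \1_(sq x s) y :> R.
  rewrite !indicE; congr (nat_of_bool _)%:R; apply/idP/idP; rewrite !inE => /sqP h; apply/sqP.
    by move: h; rewrite subr0.
  by rewrite subr0.
have -> : u - w + (w - z) = u - z by rewrite addrA subrK.
rewrite !tr !indicE !in_setI.
by case: (_ \in A); rewrite //= subrr normr0.
Qed.

Lemma ar_continuous (A : set P) s : measurable A -> 0 <= s -> continuous (ar A s : R * R -> R).
Proof.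
move=> mA s0 z; apply/cvgrPdist_le => e e0.
have [d d0 hd] := ar_small mA s0 e0.
have : nbhs z (ball z d) by exact: nbhsx_ballx.
apply: filterS => w [/= h1 h2]; apply: hd.
by rewrite normr_pair gt_max distrC h1 distrC h2.
Qed.

(** The area varies continuously as the square moves along a segment, so it cannot jump over the gap
    between [s^2] and [3 s^2]. *)
Lemma ar_ivt (A : set P) s : measurable A -> 0 <= s ->
  (forall z, ar A s z < s ^+ 2 \/ 3 * s ^+ 2 < ar A s z) ->
  (forall z, ar A s z < s ^+ 2) \/ (forall z, 3 * s ^+ 2 < ar A s z).
Proof.
move=> mA s0 h; apply: contrapT => /not_orP[/existsNP[z0 h0] /existsNP[z1 h1]].
have {}h0 : 3 * s ^+ 2 < ar A s z0 by case: (h z0).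
have {}h1 : ar A s z1 < s ^+ 2 by case: (h z1).
pose f (t : R) := ar A s (z0 + scal t (z1 - z0)).
have cf : continuous f.
  move=> t; apply/cvgrPdist_le => e e0.
  have [d d0 hd] := ar_small mA s0 e0.
  pose K := `|z1 - z0| + 1; have K0 : 0 < K by rewrite ltr_wpDl.
  near=> u; apply: hd.
  have -> : z0 + scal u (z1 - z0) - (z0 + scal t (z1 - z0)) = scal (u - t) (z1 - z0).
    by pair_ring.
  have -> : `|scal (u - t) (z1 - z0)| = `|u - t| * `|z1 - z0|.
    by rewrite !normr_pair /scal /= !normrM maxr_pMr.
  apply: (@le_lt_trans _ _ (`|u - t| * K)); first by rewrite ler_wpM2l// lerDl.
  rewrite -ltr_pdivlMr// distrC; near: u.
  by apply: (@cvgr_dist_lt _ _ _ (nbhs t) _ id t) => //; rewrite divr_gt0.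
have [t _ ft] : exists2 t, t \in `[0, 1] & f t = 2 * s ^+ 2.
  apply: (@IVT R f 0 1 _ ler01); first exact: continuous_subspaceT.
  have -> : f 0 = ar A s z0 by congr ar; rewrite /scal !mul0r addr0.
  have -> : f 1 = ar A s z1.
    by congr ar; apply/pair_eqP; rewrite /pair_eq /=; apply/andP; split; apply/eqP; ring.
  have s2 := sqr_ge0 s.
  by rewrite ge_min le_max; apply/andP; split; apply/orP; [right|left]; lra.
have s2 := sqr_ge0 s.
have := h (z0 + scal t (z1 - z0)); rewrite -/(f t) ft => -[]; lra.
Unshelve. all: by end_near. Qed.

(** From every point of A, displacements of area at least [3 s^2] lead out of A. By [poincare],
    [3 s^2 |A|] is at most [2 s c * 4 s^2], and 8/3 is rounded up to 3. Truncation to bounded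
    squares gives meaning to the integrals before A is known to have finite area. *)
Lemma small_density_measure (A : set P) c s : measurable A -> per_le A c -> 0 < s ->
  (forall z, ar A s z < s ^+ 2) -> (leb2 A <= (3 * s * c)%:E)%E.
Proof.
move=> mA hA s0 hs; have c0 := per_le_ge0 hA.
pose An n : set P := A `&` sq 0 n%:R.
have mAn n : measurable (An n) by apply: measurableI => //; exact: measurable_sq.
have leN n : (leb2 (An n) <= (3 * s * c)%:E)%E.
  have XM z : An n z -> in_box (n%:R + s) z.
    by move=> [_ /sq_in_box]; apply: in_box_le; rewrite normr0 add0r lerDl ltW.
  have HM z : sq 0 s z -> in_box (n%:R + s) z.
    by move=> /sq_in_box; apply: in_box_le; rewrite normr0 add0r lerDr.
  rewrite (leb2_J (mAn n) XM) lee_fin.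
  have := @poincare A setT _ (~` A) (sq 0 s) c _ 1 (2 * s) mA (per_le_onT hA) (mAn n)
    (measurableC mA) (measurable_sq _ _) (@subIsetl _ _ _) (setICl A) XM HM ltr01 c0.
  move=> /(_ (fun _ _ _ _ _ _ _ _ => I)); rewrite (J_sq _ (ltW s0)) => key.
  have s2 : 0 < 3 * s ^+ 2 by rewrite mulr_gt0// exprn_gt0.
  rewrite -(ler_pM2l s2); apply: (@le_trans _ _ (2 * s * c * (4 * s ^+ 2))); last first.
    have : 0 <= s ^+ 3 * c by rewrite mulr_ge0// exprn_ge0// ltW.
    by nra.
  apply: le_trans (key _); last first.
    by move=> h /sqP; rewrite subr0 => hr; apply: (le_trans (enorm_le h)); lra.
  have bX := bcs_indic (mAn n) XM.
  have e (z : R * R) : J (fun h => \1_(sq 0 s) h * \1_(~` A) (z + h)) = 4 * s ^+ 2 - ar A s z.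
    rewrite -(ar_C _ mA (ltW s0)).
    have mY : measurable (sq z s `\` A) by apply: measurableD => //; exact: measurable_sq.
    have YM w : (sq z s `\` A) w -> in_box (`|z| + s) w by move=> [/sq_in_box].
    rewrite -(J_translate z (bcs_indic mY YM)); congr J; apply/funext => h.
    rewrite !indicE in_setD in_setC [z + h]addrC mulrC -natrM mulnb andbC.
    congr (nat_of_bool (_ && _))%:R; apply/idP/idP; rewrite !inE => /sqP hh; apply/sqP.
      by move: hh; rewrite subr0 addrK.
    by move: hh; rewrite subr0 addrK.
  have -> : (fun z => \1_(An n) z * J (fun h => \1_(sq 0 s) h * \1_(~` A) (z + h))) =
            (fun z => (4 * s ^+ 2 - ar A s z) * \1_(An n) z).
    by apply/funext => z; rewrite e mulrC.
  have a0 z : 0 <= ar A s z by apply: J_ge0 => w; rewrite indicE.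
  rewrite -(JZ _ bX); apply: le_J; first exact: bcsZ.
    apply: (@bcsMl _ _ _ (4 * s ^+ 2) bX).
      apply: measurable_funB; first exact: measurable_cst.
      by apply: continuous_measurable2; exact: ar_continuous (ltW s0).
    move=> z; rewrite ger0_norm; have := a0 z; have := hs z; have := sqr_ge0 s; lra.
  move=> z; rewrite ler_wpM2r//.
  by have := hs z; lra.
have nd : nondecreasing_seq An.
  move=> k n kn; apply/subsetPset => z [Az /sqP h]; split => //; apply/sqP.
  by apply: (le_trans h); rewrite ler_nat.
have mL n : measurable (An n : set (@lebplane R)) by apply: borel_lebesgue; exact: mAn.
have eA : \bigcup_n An n = A.
  apply/seteqP; split => [z [n _ []]//|z Az].
  exists (Num.Def.archi_bound `|z|) => //; split => //; apply/sqP; rewrite subr0 ltW//.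
  exact: archi_boundP.
have mU : measurable (\bigcup_n An n : set (@lebplane R)) by exact: bigcupT_measurable.
have cv := @nondecreasing_cvg_mu _ (@lebplane R) R leb2 _ mL mU nd.
rewrite -[X in leb2 X]eA -(cvg_lim _ cv)//; apply: lime_le.
  by apply/cvg_ex; eexists; exact: cv.
by apply: nearW => n; exact: leN.
Qed.

Lemma isoperimetric (A : set (R * R)) : fp A ->
  (leb2 A <= (100 * per A ^+ 2)%:E)%E \/ (leb2 (~` A) <= (100 * per A ^+ 2)%:E)%E.
Proof.
move=> fA; have [B [mB AB]] := ex_borel (fp_lebm fA).
rewrite (leb2_null_eq AB) (leb2_null_eq (null_eqC AB)).
set c := per A; have hB : per_le B c by apply/(Per_leP _ mB AB); rewrite -Per_fin.
have c0 : 0 <= c := per_le_ge0 hB.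
(* With [s >= 32 c] the bound [64 s^3 c] is at most [2 s^4], whereas an intermediate density would
   need [3 s^4]. Then [3 s c] is at most [96 c^2]. For [c = 0] any positive scale works. *)
pose s := if c == 0 then 1 else 32 * c.
have s0 : 0 < s by rewrite /s; case: eqP => // /eqP cn; rewrite mulr_gt0// lt_neqAle eq_sym cn.
have sc : 32 * c <= s by rewrite /s; case: eqP => // ->; rewrite mulr0.
have fin : 3 * s * c <= 100 * c ^+ 2.
  rewrite /s; case: eqP => [->|_]; first by rewrite !mulr0 expr0n/= mulr0.
  by have := sqr_ge0 c; nra.
have dich z : ar B s z < s ^+ 2 \/ 3 * s ^+ 2 < ar B s z.
  apply: contrapT => /not_orP[/negP h1 /negP h2]; move: h1 h2; rewrite -!leNgt => h1 h2.
  have := @rel_poincare B setT c z s mB (per_le_onT hB) s0 c0 (@subsetT _ _).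
  rewrite (ar_C _ mB (ltW s0)) -/(ar B s z); set a := ar B s z in h1 h2 *.
  have s2 : 0 < s ^+ 2 by rewrite exprn_gt0.
  have h3 : 3 * s ^+ 2 * s ^+ 2 <= a * (4 * s ^+ 2 - a) by nra.
  have h4 : 64 * s ^+ 3 * c <= 2 * s ^+ 2 * s ^+ 2.
    have -> : 2 * s ^+ 2 * s ^+ 2 = 2 * s ^+ 3 * s by ring.
    have s3 : 0 <= 2 * s ^+ 3 by rewrite mulr_ge0// exprn_ge0// ltW.
    have := ler_wpM2l s3 sc; lra.
  have : 0 < s ^+ 2 * s ^+ 2 by rewrite mulr_gt0.
  lra.
have [h|h] := ar_ivt mB (ltW s0) dich.
  by left; apply: (le_trans (small_density_measure mB hB s0 h)); rewrite lee_fin.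
right; apply: (le_trans (small_density_measure (measurableC mB) (per_leC mB hB) s0 _)).
  move=> z; rewrite /ar setIC -setDE (ar_C _ mB (ltW s0)); have := h z; lra.
by rewrite lee_fin.
Qed.

End Isoperimetric.

(** * Calculus of pieces and existence of indecomposable ones *)

Section Pieces.
Context {R : realType}.
Local Notation lebm := (@lebesgue_measurable R).
Implicit Types (A B C D E F G : set (R * R)).

Definition piece E A := [/\ fp A, fp (E `\` A), A `<=` E & per A + per (E `\` A) <= per E].

Lemma setDDsub E A : A `<=` E -> E `\` (E `\` A) = A.
Proof. by move=> AE; rewrite setDD setIC; exact: setIidl. Qed.

Lemma setUDsub E A : A `<=` E -> A `|` (E `\` A) = E.
Proof. by move=> AE; exact: setDUK. Qed.

Lemma piece_fp E A : piece E A -> fp E.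
Proof.
move=> [fA fA' AE _]; rewrite -(setUDsub AE).
by have [] // := fpU fA fA'; rewrite setDE setICA setICr setI0 measure0.
Qed.

Lemma per_subadd E A : fp A -> fp (E `\` A) -> A `<=` E -> per E <= per A + per (E `\` A).
Proof.
move=> fA fA' AE; rewrite -{1}(setUDsub AE).
by have [] // := fpU fA fA'; rewrite setDE setICA setICr setI0 measure0.
Qed.

Lemma piece_eq E A : piece E A -> per A + per (E `\` A) = per E.
Proof.
by move=> [fA fA' AE h]; apply/le_anti; rewrite h per_subadd.
Qed.

Lemma pieceC E A : piece E A -> piece E (E `\` A).
Proof.
move=> [fA fA' AE h]; split => //; rewrite ?setDDsub//.
by rewrite addrC.
Qed.

Lemma leb20 : leb2 (set0 : set (R * R)) = 0%E.
Proof. exact: (@measure0 _ _ _ (@leb2 R)). Qed.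

Lemma fp0 : fp (set0 : set (R * R)). Proof. by have [] := fp_null leb20. Qed.

Lemma per0 : per (set0 : set (R * R)) = 0. Proof. by have [] := fp_null leb20. Qed.

Lemma piece0 E : fp E -> piece E set0.
Proof. by move=> fE; split; rewrite ?setD0 ?per0 ?add0r//; exact: fp0. Qed.

Lemma piece_refl E : fp E -> piece E E.
Proof. by move=> /piece0/pieceC; rewrite setD0. Qed.

(** Sum submodularity over the four pairs formed by A or its complement in E and B or its
    complement: the right sides total [4 per E]. The four intersections and four unions form four
    complementary pairs in E, each of total at least [per E] by subadditivity. So all the
    inequalities are equalities. *)
Lemma pieceI_eq E A B : piece E A -> piece E B ->
  piece E (A `&` B) /\ per (A `&` B) + per (A `|` B) = per A + per B.
Proof.
move=> pA pB; have [fA fA' AE _] := pA; have [fB fB' BE _] := pB.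
have eA := piece_eq pA; have eB := piece_eq pB.
have [i1 u1 s1] := fp_submod fA fB.
have [i2 u2 s2] := fp_submod fA fB'.
have [i3 u3 s3] := fp_submod fA' fB.
have [i4 u4 s4] := fp_submod fA' fB'.
have D1 : E `\` (A `&` B) = (E `\` A) `|` (E `\` B) by rewrite setDIr.
have D2 : E `\` (A `&` (E `\` B)) = (E `\` A) `|` B by rewrite setDIr (setDDsub BE).
have D3 : E `\` ((E `\` A) `&` B) = A `|` (E `\` B) by rewrite setDIr (setDDsub AE).
have D4 : E `\` ((E `\` A) `&` (E `\` B)) = A `|` B by rewrite setDIr (setDDsub AE) (setDDsub BE).
have h1 : per E <= per (A `&` B) + per ((E `\` A) `|` (E `\` B)).
  by rewrite -D1; apply: per_subadd; rewrite ?D1//; exact: subIset (or_introl AE).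
have h2 : per E <= per (A `&` (E `\` B)) + per ((E `\` A) `|` B).
  by rewrite -D2; apply: per_subadd; rewrite ?D2//; exact: subIset (or_introl AE).
have h3 : per E <= per ((E `\` A) `&` B) + per (A `|` (E `\` B)).
  by rewrite -D3; apply: per_subadd; rewrite ?D3//; exact: subIset (or_intror BE).
have h4 : per E <= per ((E `\` A) `&` (E `\` B)) + per (A `|` B).
  by rewrite -D4; apply: per_subadd; rewrite ?D4//; apply: subIset; left; exact: subDsetl.
split; last lra.
by split; rewrite ?D1//; [exact: subIset (or_introl AE)|lra].
Qed.

Lemma pieceI E A B : piece E A -> piece E B -> piece E (A `&` B).
Proof. by move=> pA pB; have [] := pieceI_eq pA pB. Qed.

Lemma pieceD E A B : piece E A -> piece E B -> piece E (A `\` B).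
Proof.
move=> pA pB; have [_ _ AE _] := pA.
rewrite (_ : A `\` B = A `&` (E `\` B)); first exact: pieceI (pieceC pB).
by rewrite setIDA; congr (_ `\` _); rewrite setIidl.
Qed.

Lemma pieceU E A B : piece E A -> piece E B -> piece E (A `|` B).
Proof.
move=> pA pB; have [_ _ AE _] := pA; have [_ _ BE _] := pB.
have := pieceC (pieceI (pieceC pA) (pieceC pB)).
by rewrite setDIr (setDDsub AE) (setDDsub BE).
Qed.

Lemma per_piece_add E A B : piece E A -> piece E B -> A `&` B = set0 ->
  per (A `|` B) = per A + per B.
Proof.
by move=> pA pB AB; have [_] := pieceI_eq pA pB; rewrite AB per0 add0r.
Qed.

Lemma per_pieceD E A B : piece E A -> piece E B -> B `<=` A -> per A = per B + per (A `\` B).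
Proof.
move=> pA pB BA; rewrite -{1}(setUDsub BA) (per_piece_add pB (pieceD pA pB))//.
by rewrite setDE setICA setICr setI0.
Qed.

Lemma per_piece_le E A B : piece E A -> piece E B -> B `<=` A -> per B <= per A.
Proof.
move=> pA pB BA; rewrite (per_pieceD pA pB BA) lerDl per_ge0//.
by apply: fp_lebm; have [] := pieceD pA pB.
Qed.

Lemma piece_sub E A B : piece E A -> piece E B -> B `<=` A -> piece A B.
Proof.
move=> pA pB BA; have [fB _ _ _] := pB; have [fD _ _ _] := pieceD pA pB.
by split => //; rewrite (per_pieceD pA pB BA).
Qed.

Lemma piece_trans E A B : piece E A -> piece A B -> piece E B.
Proof.
move=> pA pB; have [fA fA' AE hA] := pA; have [fB fB' BA hB] := pB.
have e : E `\` B = (A `\` B) `|` (E `\` A).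
  apply/seteqP; split => z; rewrite /setU /setD /mkset.
    by have [?|?] := pselect (A z); tauto.
  by have := BA z; have := AE z; tauto.
have d : leb2 ((A `\` B) `&` (E `\` A)) = 0%E.
  rewrite (_ : _ `&` _ = set0) ?measure0//; apply/seteqP; split => z //.
  by rewrite /setI /setD /mkset; tauto.
have [f h] := fpU fB' fA' d.
split; rewrite ?e//; first exact: subset_trans AE.
by move: h hA hB; lra.
Qed.

(** Perimeters of nested pieces increase to a supremum. Lower semicontinuity bounds the union by
    that supremum and the rest of E by [per E] minus it. *)
Lemma piece_bigcup E (A : (set (R * R))^nat) : (forall n, piece E (A n)) ->
  (forall n, A n `<=` A n.+1) -> piece E (\bigcup_n A n).
Proof.
move=> pA ndA.
have fE := piece_fp (pA 0%N).
have ndp n k : (k <= n)%N -> per (A k) <= per (A n).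
  elim: n => [|n ih]; first by rewrite leqn0 => /eqP ->.
  rewrite leq_eqVlt => /predU1P[->//|/ih h]; apply: (le_trans h).
  exact: per_piece_le (pA _) (pA _) (ndA n).
have ub n : per (A n) <= per E.
  by apply: (per_piece_le (piece_refl fE)) => //; have [] := pA n.
pose S := [set per (A n) | n in setT].
have supS : has_sup S by split; [exists (per (A 0%N)), 0%N|exists (per E) => _ [n _ <-]].
have [fU hU] : fp (\bigcup_n A n) /\ per (\bigcup_n A n) <= sup S.
  apply: fp_bigcup => // n; split; first by have [] := pA n.
  by apply: sup_upper_bound => //; exists n.
have DE : E `\` \bigcup_n A n = \bigcap_n (E `\` A n).
  apply/seteqP; split => z.
    by move=> [Ez h] n _; split => // An; apply: h; exists n.
  by move=> h; split; [have [] := h 0%N I|move=> [n _ An]; have [_ /(_ An)] := h n I].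
(* The sets decrease, so the intersection may start at m, where all perimeters are already at most
   [per E - per (A m)]. *)
have key m : fp (\bigcap_n (E `\` A n)) /\ per (\bigcap_n (E `\` A n)) <= per E - per (A m).
  have -> : \bigcap_n (E `\` A n) = \bigcap_n (E `\` A (n + m)%N).
    apply/seteqP; split => z h n _; first exact: h.
    have [Ez nA] := h n I; split => // An; apply: nA.
    elim: m {h} => [|m ih]; first by rewrite addn0.
    by rewrite addnS; apply: ndA.
  apply: fp_bigcap => n.
    by apply: setDS; rewrite addSn; exact: ndA.
  have [_ f _ _] := pA (n + m)%N; split => //.
  by have := piece_eq (pA (n + m)%N); have := ndp (n + m)%N m (leq_addl _ _); lra.
split => //.
- by rewrite DE; have [] := key 0%N.
- by move=> z [n _ An]; have [_ _ AE _] := pA n; exact: AE.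
rewrite DE; apply: (@le_trans _ _ (sup S + per (\bigcap_n (E `\` A n)))); first by rewrite lerD2r.
rewrite -lerBrDr; apply: ge_sup; first by case: supS.
by move=> _ [m _ <-]; have [_] := key m; lra.
Qed.

Lemma piece_bigcap E (A : (set (R * R))^nat) : (forall n, piece E (A n)) ->
  (forall n, A n.+1 `<=` A n) -> piece E (\bigcap_n A n).
Proof.
move=> pA ndA.
have := pieceC (@piece_bigcup E (fun n => E `\` A n) (fun n => pieceC (pA n))
  (fun n => setDS (ndA n))).
rewrite (_ : E `\` _ = \bigcap_n A n)//; apply/seteqP; split => z.
  by move=> [Ez h] n _; apply: contrapT => nA; apply: h; exists n.
move=> h; split; first by have [_ _ AE _] := pA 0%N; apply: AE; exact: h.
by move=> [n _ [_]]; apply; exact: h.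
Qed.

Lemma indecomposableP A : fp A ->
  indecomposable A <-> forall B, piece A B -> leb2 B = 0%E \/ leb2 (A `\` B) = 0%E.
Proof.
move=> fA; split => [[_ h] B pB|h].
  have [/fp_lebm mB /fp_lebm mB' BA _] := pB; apply: h => //.
  - by rewrite setDE setICA setICr setI0.
  - by rewrite setUDsub.
  - have [fB fB' _ _] := pB; rewrite !Per_fin// -EFinD; congr EFin.
    by rewrite (piece_eq pB).
split; first exact/fpP.
move=> B B' mB mB' BB' AE hP.
have fin (X Y : set (R * R)) : lebm X -> lebm Y -> Per A = (Per X + Per Y)%E -> fp X.
  move=> mX mY e; apply/fpP; split => //; have /fpP[_] := fA; rewrite e; apply: le_lt_trans.
  by rewrite leeDl// Per_ge0.
have fB : fp B by exact: fin hP.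
have fB' : fp B' by apply: fin mB' mB _; rewrite addeC.
have e : A `\` B = B'.
  rewrite AE; apply/seteqP; split => z; rewrite /setU /setD /mkset; first tauto.
  by move=> B'z; split; [right|move=> Bz; have : (B `&` B') z by []; rewrite BB'].
have := h B; rewrite e; apply; split; rewrite ?e//; first by rewrite AE; exact: subsetUl.
by rewrite -lee_fin EFinD -!Per_fin// hP.
Qed.

(* Two applications of submodularity inside [E], one to [G] and one to the
   pair [G `|` A], [G `|` (E `\` A)]. *)
Lemma piece_restrict E A G : piece E A -> fp G -> leb2 (G `\` E) = 0%E ->
  piece G (G `&` A).
Proof.
move=> pA fG GE; have fE := piece_fp pA; have [fA fA' AE _] := pA.
have eA := piece_eq pA.
pose G1 := G `&` E.
have [fG1 _ _] := fp_submod fG fE.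
have eqG : null_eq G G1.
  by apply: leb2_sub0 GE => z; rewrite /G1 /setU /setD /setI /mkset; tauto.
have [i1 u1 s1] := fp_submod fG1 fA.
have [i2 u2 s2] := fp_submod fG1 fA'.
have [i3 u3 s3] := fp_submod u1 u2.
have e1 : (G1 `|` A) `&` (G1 `|` (E `\` A)) = G1.
  by rewrite -setUIr setDE setICA setICr setI0 setU0.
have e2 : (G1 `|` A) `|` (G1 `|` (E `\` A)) = E.
  by rewrite setUACA setUid setUDsub// setUidr//; exact: subIsetr.
rewrite e1 e2 in s3.
have n1 : null_eq (G1 `&` A) (G `&` A).
  by apply: null_eqI; [exact: null_eq_sym|exact: null_eq_refl].
have e3 : G1 `&` (E `\` A) = G1 `\` A.
  apply/seteqP; split => z; rewrite /G1 /setI /setD /mkset; tauto.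
have n2 : null_eq (G1 `&` (E `\` A)) (G `\` A).
  by rewrite e3; apply: null_eqD; [exact: null_eq_sym|exact: null_eq_refl].
have mG := fp_lebm fG; have mi1 := fp_lebm i1; have mi2 := fp_lebm i2.
have e4 : G `\` (G `&` A) = G `\` A by rewrite setDIr setDv set0U.
split; rewrite ?e4.
- exact: fp_null_eq n1 i1.
- exact: fp_null_eq n2 i2.
- exact: subIsetl.
- rewrite -(per_null_eq mi1 n1) -(per_null_eq mi2 n2) (per_null_eq mG eqG).
  by move: s1 s2 s3 eA; lra.
Qed.

(** Suprema need not be attained, and a factor 2 suffices for every greedy choice. If the supremum
    is 0 any element works. *)
Lemma near_max (X : Type) (Q : X -> Prop) (w : X -> R) M : (exists x, Q x) ->
  (forall x, Q x -> 0 <= w x <= M) -> exists x, Q x /\ forall y, Q y -> w y <= 2 * w x.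
Proof.
move=> [x0 Q0] wM; pose S := [set w x | x in Q].
have supS : has_sup S by split; [exists (w x0), x0|exists M => _ [x Qx <-]; have /andP[] := wM _ Qx].
have s0 : 0 <= sup S.
  have /andP[h _] := wM _ Q0; apply: (le_trans h).
  by apply: sup_upper_bound => //; exists x0.
have [s00|sn0] := eqVneq (sup S) 0.
  exists x0; split => // y Qy; apply: (@le_trans _ _ 0).
    by rewrite -s00; apply: sup_upper_bound => //; exists y.
  by rewrite mulr_ge0//; have /andP[] := wM _ Q0.
have sp : 0 < sup S / 2 by rewrite divr_gt0// lt_neqAle eq_sym sn0.
have [_ [x Qx <-] hx] := sup_adherent sp supS.
exists x; split => // y Qy.
have : w y <= sup S by apply: sup_upper_bound => //; exists y.
by lra.
Qed.

Lemma leb2_setT : leb2 (setT : set (R * R)) = +oo%E.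
Proof.
rewrite leb2_borel// -(setXTT) lam2X//.
rewrite (_ : (@lebesgue_measure R) setT = +oo%E) ?mulyy//.
by have := @lebesgue_measure_itv R `]-oo, +oo[; rewrite set_itvNyy.
Qed.

Lemma iso_finite A : fp A -> (leb2 A < +oo)%E -> (leb2 A <= (100 * per A ^+ 2)%:E)%E.
Proof.
move=> fA Aoo; have [//|h] := isoperimetric fA; exfalso.
have : (leb2 (A `|` ~` A) < +oo)%E.
  apply: (le_lt_trans (leb2U _ _)); apply: lte_add_pinfty => //.
  exact: le_lt_trans h (ltry _).
by rewrite setUv leb2_setT ltxx.
Qed.

Lemma cvg_cauchy_diff (u : R^nat) (l : R) : u @ \oo --> l ->
  (fun n => u n - u n.+1) @ \oo --> (0 : R).
Proof.
move=> ul; rewrite -(subrr l); apply: cvgB => //.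
by rewrite (cvg_shiftS u).
Qed.

(** Among non-null pieces whose ratio of perimeter to area is at most that of A, one of minimal area
    is obtained as a limit of nearly optimal choices. If it split into two non-null parts, one of
    them would again have ratio at most [K], with smaller area. *)
Lemma atom_finite A : fp A -> (0 < leb2 A)%E -> (leb2 A < +oo)%E ->
  exists B, [/\ piece A B, indecomposable B & (0 < leb2 B)%E].
Proof.
move=> fA A0 Aoo.
have fin B : B `<=` A -> (leb2 B \is a fin_num)%E.
  move=> BA; rewrite ge0_fin_numE ?measure_ge0//; apply: le_lt_trans Aoo; exact: le_leb2.
pose m B := fine (leb2 B).
have mE B : B `<=` A -> leb2 B = (m B)%:E by move=> /fin h; rewrite /m fineK.
have m0 B : 0 <= m B by rewrite fine_ge0// measure_ge0.
have mA0 : 0 < m A by rewrite -lte_fin -mE.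
have mle B C : B `<=` C -> C `<=` A -> m B <= m C.
  by move=> BC CA; rewrite -lee_fin -!mE//; [exact: le_leb2|exact: subset_trans CA].
pose K := per A / m A.
pose Q B := [/\ piece A B, (0 < leb2 B)%E & per B <= K * m B].
have QA : Q A.
  by split => //; [exact: piece_refl|rewrite /K divfK// gt_eqF].
(* The isoperimetric inequality gives [m B <= 100 K^2 (m B)^2]: areas in [Q] are bounded below, so
   the limit is not null. *)
have lowb B : Q B -> 1 <= 100 * K ^+ 2 * m B.
  move=> [pB B0 hB]; have [fB _ BA _] := pB.
  have mB0 : 0 < m B by rewrite -lte_fin -mE.
  have : m B <= 100 * per B ^+ 2.
    by rewrite -lee_fin -mE//; apply: iso_finite => //; apply: le_lt_trans Aoo; exact: le_leb2.
  have p0 : 0 <= per B by exact: per_ge0 (fp_lebm fB).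
  have : per B ^+ 2 <= (K * m B) ^+ 2 by rewrite ler_sqr ?nnegrE// (le_trans p0).
  rewrite exprMn => h1 h2; have h3 : m B <= 100 * (K ^+ 2 * m B ^+ 2) by lra.
  by rewrite -(ler_pM2r mB0) mul1r; move: h3; rewrite !expr2; lra.
(* Each step achieves at least half of the largest loss of area possible within [Q]. *)
have step (B : {B | Q B}) : {B' : {B | Q B} | sval B' `<=` sval B /\
    forall C, Q C -> C `<=` sval B -> m (sval B) - m C <= 2 * (m (sval B) - m (sval B'))}.
  apply: cid; have [[fB _ BA _] _ _] := svalP B.
  have [|C QC|B' [[QB' B'B] h]] := @near_max (set (R * R)) (fun C => Q C /\ C `<=` sval B) (fun C => m (sval B) - m C) (m (sval B)).
  - by exists (sval B); split => //; exact: svalP B.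
  - case: QC => _ CB; rewrite subr_ge0 mle//= lerBlDr lerDl; exact: m0.
  - by exists (exist _ B' QB'); split => //= C QC CB; apply: h.
pose sq n := iter n (fun (B : {B | Q B}) => sval (step B)) (exist _ A QA).
pose B n := sval (sq n).
have BQ n : Q (B n) := svalP (sq n).
have Bnd n : B n.+1 `<=` B n by have [] := svalP (step (sq n)).
have Bgr n C : Q C -> C `<=` B n -> m (B n) - m C <= 2 * (m (B n) - m (B n.+1)).
  by move=> QC CB; have [_ h] := svalP (step (sq n)); exact: h.
have pB n : piece A (B n) by have [] := BQ n.
have BA n : B n `<=` A by have [] := pB n.
pose Bi := \bigcap_n B n.
have pBi : piece A Bi by apply: piece_bigcap.
have [fBi _ BiA _] := pBi.
have ndB n k : (k <= n)%N -> B n `<=` B k.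
  elim: n => [|n ih]; first by rewrite leqn0 => /eqP ->.
  by rewrite leq_eqVlt => /predU1P[->//|/ih h]; exact: subset_trans h.
have mcv : m (B n) @[n --> \oo] --> m Bi.
  have mBn n : measurable (B n : set (@lebplane R)) by have [/fp_lebm] := pB n.
  have h0 : (leb2 (B 0%N) < +oo)%E by rewrite mE// ltry.
  have hcap : measurable (\bigcap_n B n : set (@lebplane R)) by exact: bigcapT_measurable.
  have hnd : nonincreasing_seq B by move=> k n kn; apply/subsetPset; exact: ndB.
  have h := @nonincreasing_cvg_mu _ (@lebplane R) R leb2 B h0 mBn hcap hnd.
  by apply/fine_cvg; rewrite -mE.
have low : 1 <= 100 * K ^+ 2 * m Bi.
  have cv : (100 * K ^+ 2 * m (B n)) @[n --> \oo] --> 100 * K ^+ 2 * m Bi by apply: cvgM => //; exact: cvg_cst.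
  rewrite -(cvg_lim _ cv)//; apply: limr_ge; first by apply/cvg_ex; exists (100 * K ^+ 2 * m Bi).
  by apply: nearW => n; exact: lowb.
have mBi0 : 0 < m Bi.
  rewrite lt_neqAle m0 andbT eq_sym; apply/eqP => h; move: low.
  by rewrite h mulr0 ler10.
have perBi : per Bi <= K * m Bi.
  have cv : (K * m (B n)) @[n --> \oo] --> K * m Bi by apply: cvgM => //; exact: cvg_cst.
  rewrite -(cvg_lim _ cv)//; apply: limr_ge; first by apply/cvg_ex; exists (K * m Bi).
  apply: nearW => n; have [_ _ h] := BQ n; apply: le_trans h.
  by apply: (per_piece_le (pB n) pBi) => z; apply.
have Bi_sub n : Bi `<=` B n by move=> z; apply.
exists Bi; split => //; last by rewrite mE// lte_fin.
apply/indecomposableP => // C pC; apply: contrapT => /not_orP[C0 D0].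
have [fC fD CB hC] := pC.
pose D := Bi `\` C.
have pD := pieceC pC; rewrite -/D in pD D0 fD hC.
have DB : D `<=` Bi by exact: subDsetl.
have CA := subset_trans CB BiA; have DA := subset_trans DB BiA.
have mC0 : 0 < m C by rewrite -lte_fin -mE// lt_neqAle measure_ge0 andbT eq_sym; exact/eqP.
have mD0 : 0 < m D by rewrite -lte_fin -mE// lt_neqAle measure_ge0 andbT eq_sym; exact/eqP.
have mCD : m Bi = m C + m D.
  apply: EFin_inj; rewrite EFinD -!mE//.
  have CD : C `&` D = set0 by rewrite /D setDE setICA setICr setI0.
  have := measureU (@leb2 R) (fp_lebm fC) (fp_lebm fD) CD.
  by rewrite (setUDsub CB).
(* The losses along the sequence tend to 0, so no member of [Q] inside the limit can have smaller
   area. *)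
have noQ X : piece Bi X -> 0 < m X -> per X <= K * m X -> m Bi <= m X.
  move=> pX mX0 hX; have [_ _ XB _] := pX.
  have XA := subset_trans XB BiA.
  have QX : Q X by split => //; [exact: piece_trans pBi pX|rewrite mE// lte_fin].
  have cv1 : (m (B n) - m X) @[n --> \oo] --> m Bi - m X by apply: cvgB => //; exact: cvg_cst.
  have cv2 : (2 * (m (B n) - m (B n.+1))) @[n --> \oo] --> (2 * 0 : R).
    by apply: cvgM; [exact: cvg_cst|exact: cvg_cauchy_diff mcv].
  rewrite mulr0 in cv2; rewrite -subr_le0 -(cvg_lim _ cv1)// -(cvg_lim _ cv2)//.
  apply: ler_lim; [by apply/cvg_ex; eexists; exact: cv1|by apply/cvg_ex; eexists; exact: cv2|].
  by apply: nearW => n; apply: Bgr => //; exact: subset_trans (Bi_sub n).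
(* Perimeters and areas both add, so the two ratios cannot both exceed [K]. *)
have [hc|hc] := leP (per C) (K * m C).
  by have := noQ C pC mC0 hc; rewrite mCD gerDl leNgt mD0.
have hd : per D <= K * m D.
  by move: hC perBi hc; rewrite mCD mulrDr; clear; lra.
by have := noQ D pD mD0 hd; rewrite mCD gerDr leNgt mC0.
Qed.

(** If A has infinite area and is decomposable, it splits into two non-null pieces; the
    isoperimetric dichotomy for one of them shows that it or the other has finite area. *)
Lemma atom A : fp A -> (0 < leb2 A)%E ->
  exists B, [/\ piece A B, indecomposable B & (0 < leb2 B)%E].
Proof.
move=> fA A0; have [Aoo|Aoo] := ltP (leb2 A) +oo%E; first exact: atom_finite.
have [iA|niA] := pselect (indecomposable A).
  by exists A; split => //; exact: piece_refl.
have : exists B, [/\ piece A B, (0 < leb2 B)%E & (0 < leb2 (A `\` B))%E].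
  apply: contrapT => H; apply: niA; apply/indecomposableP => // B pB.
  apply: contrapT => /not_orP[B0 D0]; apply: H; exists B; split => //.
    by rewrite lt_neqAle measure_ge0 andbT eq_sym; exact/eqP.
  by rewrite lt_neqAle measure_ge0 andbT eq_sym; exact/eqP.
move=> [B [pB B0 D0]]; have [fB fD BA _] := pB; have pD := pieceC pB.
have [h|h] := isoperimetric fB.
  have [|C [pC iC C0]] := atom_finite fB B0; first exact: le_lt_trans h (ltry _).
  by exists C; split => //; exact: piece_trans pC.
have [|C [pC iC C0]] := atom_finite fD D0.
  apply: le_lt_trans (ltry (100 * per B ^+ 2)); apply: le_trans h; apply: le_leb2.
  by move=> z [].
by exists C; split => //; exact: piece_trans pC.
Qed.

Definition atom_of A C := [/\ piece A C, indecomposable C & (0 < leb2 C)%E].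

(** The empty set is the default when no atom is left, so the iteration never stops. *)
Lemma greedy_step A : fp A -> exists C, [/\ piece A C,
  (forall B, atom_of A B -> atom_of A C /\ per B <= 2 * per C) &
  C = set0 \/ atom_of A C].
Proof.
move=> fA; have [ex|nex] := pselect (exists B, atom_of A B).
  have [|C [aC hC]] := @near_max _ (atom_of A) (@per R) (per A) ex.
    move=> B [pB _ _]; have [/fp_lebm/per_ge0 h /fp_lebm/per_ge0 h' _ _] := pB.
    by rewrite h -(piece_eq pB) lerDl.
  exists C; split; [by case: aC|by move=> B /hC|by right].
exists set0; split; [exact: piece0|by move=> B aB; exfalso; apply: nex; exists B|by left].
Qed.

Lemma greedy E delta : fp E -> 0 < delta ->
  exists (C : (set (R * R))^nat) N,
  [/\ forall i, piece E (C i) /\ (C i = set0 \/ (indecomposable (C i) /\ (0 < leb2 (C i))%E)),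
      trivIset setT C, forall i, (N <= i)%N -> C i = set0,
      per (E `\` \bigcup_i C i) < delta &
      (leb2 (E `\` \bigcup_i C i) <= (100 * per (E `\` \bigcup_i C i) ^+ 2)%:E)%E].
Proof.
move=> fE d0.
pose St := {A : set (R * R) | piece E A}.
have sfp (A : St) : fp (sval A) by have [] := svalP A.
pose g (A : St) := sval (cid (greedy_step (sfp A))).
have gP (A : St) := svalP (cid (greedy_step (sfp A))).
have next (A : St) : piece E (sval A `\` g A).
  by apply: piece_trans (svalP A) _; apply: pieceC; have [] := gP A.
pose st n := iter n (fun A : St => exist _ _ (next A) : St) (exist _ E (piece_refl fE)).
pose Rs n := sval (st n).
pose C n := g (st n).
have pR n : piece E (Rs n) := svalP (st n).
have RS n : Rs n.+1 = Rs n `\` C n by [].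
have CP n : [/\ piece (Rs n) (C n),
  (forall B, atom_of (Rs n) B -> atom_of (Rs n) (C n) /\ per B <= 2 * per (C n)) &
  C n = set0 \/ atom_of (Rs n) (C n)] := gP (st n).
have CR n : C n `<=` Rs n by have [[]] := CP n.
have ndR n k : (k <= n)%N -> Rs n `<=` Rs k.
  elim: n => [|n ih]; first by rewrite leqn0 => /eqP ->.
  rewrite leq_eqVlt => /predU1P[->//|/ih h]; apply: subset_trans h.
  by rewrite RS; exact: subDsetl.
have perR n : per (Rs n) = per (C n) + per (Rs n.+1).
  by rewrite RS; have [p _ _] := CP n; rewrite (piece_eq p).
have perC0 n : 0 <= per (C n) by have [[/fp_lebm/per_ge0]] := CP n.
have perR0 n : 0 <= per (Rs n) by have [/fp_lebm/per_ge0] := pR n.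
have per_ndR n k : (k <= n)%N -> per (Rs n) <= per (Rs k).
  by move=> kn; apply: per_piece_le (pR k) (pR n) _; exact: ndR.
pose Ri := \bigcap_n Rs n.
have pRi : piece E Ri by apply: piece_bigcap => // n; exact: ndR.
have RiR n : Ri `<=` Rs n by move=> z; exact.
have fRi : fp Ri by case: pRi.
have smallC e : 0 < e -> exists n, per (C n) < e.
  move=> e0; apply: contrapT => H.
  have hC n : e <= per (C n) by rewrite leNgt; apply/negP => h; apply: H; exists n.
  have sumC n : n%:R * e <= per E - per (Rs n).
    elim: n => [|n ih]; first by rewrite mul0r subrr.
    by rewrite -natr1 mulrDl mul1r; move: ih (perR n) (hC n); lra.
  pose n := Num.Def.archi_bound (per E / e).
  have hn : per E / e < n%:R by rewrite archi_boundP// divr_ge0 ?(ltW e0)// per_ge0//; exact: fp_lebm.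
  by move: hn; rewrite ltr_pdivrMr//; move: (sumC n) (perR0 n); lra.
(* An atom of the limit residue competes at every stage, so its perimeter is 0, the chosen
   perimeters being arbitrarily small. Being non-null, it would then have null complement, yet it
   misses the non-null [C 0]. *)
have Ri0 : leb2 Ri = 0%E.
  apply/eqP; rewrite eq_le measure_ge0 andbT leNgt; apply/negP => Rip.
  have [B [pB iB B0]] := atom fRi Rip; have [fB _ BRi _] := pB.
  have aB n : atom_of (Rs n) B.
    by split => //; apply: piece_trans pB; exact: piece_sub (pR n) pRi (RiR n).
  have perB : per B <= 0.
    rewrite leNgt; apply/negP => pB0.
    have [|n hn] := smallC (per B / 2); first by rewrite divr_gt0.
    by have [_ /(_ _ (aB n))[_ h] _] := CP n; move: h hn; lra.
  have pB0 : per B = 0 by apply/le_anti; rewrite perB per_ge0//; exact: fp_lebm.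
  have := isoperimetric fB; rewrite pB0 expr0n/= mulr0 => -[]h; first by move: B0; rewrite ltNge h.
  have [_ /(_ _ (aB 0%N))[[_ _ c0] _] _] := CP 0%N.
  move: c0; rewrite ltNge => /negP; apply; apply: le_trans h; apply: le_leb2 => z Cz Bz.
  by have := RiR 1%N _ (BRi _ Bz); rewrite RS => -[].
(* Otherwise the removed parts, which exhaust E up to a null set, have perimeter at most
   [per E - delta], against lower semicontinuity. *)
have smallR : exists n, per (Rs n) < delta.
  apply: contrapT => H.
  have hR n : delta <= per (Rs n) by rewrite leNgt; apply/negP => h; apply: H; exists n.
  have [_ h] : fp (\bigcup_n (E `\` Rs n)) /\ per (\bigcup_n (E `\` Rs n)) <= per E - delta.
    apply: fp_bigcup => n; first by apply: setDS; exact: ndR.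
    have pRn := pieceC (pR n); split; first by case: pRn.
    by move: (hR n) (piece_eq (pR n)); lra.
  have e : null_eq E (\bigcup_n (E `\` Rs n)).
    apply: leb2_sub0 Ri0 => z [[Ez nU]|[[n _ [Ez _]] /(_ Ez)//]] n _.
    by apply: contrapT => nR; apply: nU; exists n.
  by move: h; rewrite -(per_null_eq (fp_lebm fE) e); move: d0; lra.
(* The complements of the residues fill the plane up to a null set. Once their area exceeds the
   isoperimetric bound, the dichotomy must bound the area of the residue itself, even if E has
   infinite area. *)
have bigR : exists n, ((100 * per E ^+ 2)%:E < leb2 (~` Rs n))%E.
  apply: contrapT => H.
  have hR n : (leb2 (~` Rs n) <= (100 * per E ^+ 2)%:E)%E.
    by rewrite leNgt; apply/negP => h; apply: H; exists n.
  have m1 n : measurable (~` Rs n : set (@lebplane R)).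
    by apply: lebmC; have [/fp_lebm] := pR n.
  have m2 : measurable (\bigcup_n (~` Rs n) : set (@lebplane R)) by exact: bigcupT_measurable.
  have nd : nondecreasing_seq (fun n => ~` Rs n).
    by move=> k n kn; apply/subsetPset; apply: subsetC; exact: ndR.
  have cv := @nondecreasing_cvg_mu _ (@lebplane R) R leb2 _ m1 m2 nd.
  have le1 : (leb2 (\bigcup_n (~` Rs n)) <= (100 * per E ^+ 2)%:E)%E.
    rewrite -(cvg_lim _ cv)//; apply: lime_le; first by apply/cvg_ex; eexists; exact: cv.
    by apply: nearW => n; exact: hR.
  have : (leb2 (Ri `|` \bigcup_n (~` Rs n)) < +oo)%E.
    apply: (le_lt_trans (leb2U _ _)); rewrite Ri0 add0e; exact: le_lt_trans le1 (ltry _).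
  rewrite (_ : _ `|` _ = setT) ?leb2_setT ?ltxx//.
  by rewrite /Ri -setC_bigcap setUv.
have [n1 h1] := smallR; have [n2 h2] := bigR.
pose N := maxn n1 n2.
pose C' i := if (i < N)%N then C i else set0.
have UC : \bigcup_i C' i = E `\` Rs N.
  have key n : E `\` Rs n = \bigcup_(i in [set i | (i < n)%N]) C i.
    elim: n => [|n ih].
      by rewrite setDv; apply/seteqP; split => // z [].
    rewrite RS; have [_ _ RE _] := pR n.
    apply/seteqP; split => z.
      move=> [Ez h]; have [Rz|nRz] := pselect (Rs n z).
        by exists n => //=; apply: contrapT => nC; exact: h.
      have : (E `\` Rs n) z by []. rewrite ih => -[i /= lin Ciz]; exists i => //=.
      exact: ltnW.
    move=> [i /=]; rewrite ltnS leq_eqVlt => /predU1P[->|lin] Ciz.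
      by split; [apply: RE; exact: CR|case].
    have : (E `\` Rs n) z by rewrite ih; exists i.
    by move=> [Ez nR]; split => // -[].
  rewrite key; apply/seteqP; split => z.
    by move=> [i _]; rewrite /C'; case: ifPn => // lin Ciz; exists i.
  by move=> [i /= lin Ciz]; exists i => //; rewrite /C' lin.
have [_ _ RE _] := pR N.
have EU : E `\` \bigcup_i C' i = Rs N by rewrite UC setDDsub.
have pC i : piece E (C i) by have [p _ _] := CP i; exact: piece_trans (pR i) p.
exists C', N; rewrite EU; split.
- move=> i; rewrite /C'; case: ifPn => _; last by split; [exact: piece0|left].
  split => //; have [_ _ [->|[_ h1' h2']]] := CP i; [by left|by right].
- apply/trivIsetP => i j _ _; rewrite /C'.
  wlog ij : i j / (i < j)%N.
    move=> H; rewrite neq_lt => /orP[ij|ji]; first by apply: H => //; rewrite neq_lt ij.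
    by rewrite setIC; apply: H => //; rewrite neq_lt ji.
  move=> _; case: ifPn => // _; last by rewrite set0I.
  case: ifPn => // _; last by rewrite setI0.
  apply/seteqP; split => // z [Ci Cj].
  by have := ndR _ _ ij _ (CR _ _ Cj); rewrite RS => -[].
- by move=> i; rewrite /C' ltnNge => ->.
- by apply: le_lt_trans h1; apply: per_ndR; exact: leq_maxl.
- have fR : fp (Rs N) by case: (pR N).
  have [//|h] := isoperimetric fR; exfalso.
  have : ((100 * per E ^+ 2)%:E < (100 * per E ^+ 2)%:E)%E.
    apply: (lt_le_trans h2); apply: le_trans (_ : leb2 (~` Rs N) <= _)%E.
      by apply: le_leb2; apply: subsetC; apply: ndR; exact: leq_maxr.
    apply: (le_trans h); rewrite lee_fin ler_pM2l// ler_sqr ?nnegrE ?perR0//.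
      exact: (per_ndR N 0%N).
    exact: (perR0 0%N).
  by rewrite ltxx.
Qed.

End Pieces.

(** * Finitely many pieces as indecomposable components *)

Section Components.
Context {R : realType}.
Local Notation lebm := (@lebesgue_measurable R).
Implicit Types (E F G : set (R * R)).

Lemma piece_sum E (C : (set (R * R))^nat) n : fp E -> (forall i, piece E (C i)) ->
  trivIset setT C ->
  piece E (\bigcup_(i in `I_n) C i) /\
  per (\bigcup_(i in `I_n) C i) = \sum_(i < n) per (C i).
Proof.
move=> fE pC tC; elim: n => [|n [pU eU]].
  by rewrite II0 bigcup_set0 big_ord0 per0; split => //; exact: piece0.
rewrite IIS bigcup_setU bigcup_set1 big_ord_recr/= -eU; split; first exact: pieceU.
apply: (per_piece_add pU (pC n)).
apply/seteqP; split => // z [[i /= lin Ciz] Cnz].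
by have := tC i n I I (ex_intro _ z (conj Ciz Cnz)) => e; rewrite e ltnn in lin.
Qed.

(** For maximality, [piece_restrict] makes each [C i] cut an indecomposable G in a piece of G, which
    is null or full. If none were full, G would be covered by finitely many null sets and the null
    set outside the union. *)
Lemma finite_components E F (C : (set (R * R))^nat) N : fp E ->
  (forall i, piece E (C i) /\ (C i = set0 \/ (indecomposable (C i) /\ (0 < leb2 (C i))%E))) ->
  trivIset setT C -> (forall i, (N <= i)%N -> C i = set0) ->
  lebm F -> null_eq F (\bigcup_i C i) ->
  finitely_many_components F.
Proof.
move=> fE hC tC C0 mF eF.
have pC i : piece E (C i) by have [] := hC i.
have [pU eU] := piece_sum N fE pC tC.
have UN : \bigcup_i C i = \bigcup_(i in `I_N) C i.
  apply/seteqP; split => z [i _ Ciz]; exists i => //=.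
  by apply: contrapT => /negP; rewrite -leqNgt => /C0 Ci0; rewrite Ci0 in Ciz.
rewrite UN in eF; set U := \bigcup_(i in `I_N) C i in pU eU eF.
have [fU _ _ _] := pU.
have fF : fp F by exact: fp_null_eq (null_eq_sym eF) fU.
pose I := [set i | (i < N)%N /\ (0 < leb2 (C i))%E].
have CI0 i : (i < N)%N -> ~ I i -> C i = set0.
  by move=> iN nI; have [_ [//|[_ c0]]] := hC i; exfalso; exact: nI.
have IU : \bigcup_(i in I) C i = U.
  apply/seteqP; split => z [i]; first by move=> [iN _] Ciz; exists i.
  move=> /= iN Ciz; exists i => //; apply: contrapT => /(CI0 _ iN) Ci0.
  by rewrite Ci0 in Ciz.
exists I, C; split; last first.
  by apply: (@sub_finite_set _ _ `I_N); [move=> i []|exact: finite_II].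
split; first exact/fpP.
split.
- by move=> i [iN c0]; have [_ [ci0|//]] := hC i; rewrite ci0 leb20 ltxx in c0.
- by move=> i j _ _; apply: tC.
- by rewrite IU; exact: eF.
- have fC i : fp (C i) by have [] := pC i.
  rewrite (Per_fin fF) (per_null_eq mF eF) eU.
  have -> : \esum_(i in I) Per (C i) = \esum_(i in `I_N) (per (C i))%:E.
    rewrite esum_mkcond [RHS]esum_mkcond; apply: eq_esum => i _.
    have [/set_mem Ii|/negP nI] := boolP (i \in I).
      by rewrite mem_set ?Per_fin//; case: Ii.
    case: ifPn => // /set_mem /= iN; rewrite CI0 ?per0// => Ii.
    by apply: nI; exact/mem_set.
  rewrite esum_fset; [|exact: finite_II|]; last first.
    by move=> i _; rewrite lee_fin per_ge0//; exact: fp_lebm.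
  by rewrite -fsbig_ord sumEFin.
- move=> G /[dup] iG [/fpP fG _] GF G0.
  have GU : leb2 (G `\` U) = 0%E.
    by apply: leb2_sub0 eF => z [Gz nU]; left; split => //; exact: GF.
  apply: contrapT => H.
  have cut i : (i < N)%N -> leb2 (G `&` C i) = 0%E.
    move=> iN; have [Ii|nI] := pselect (I i); last by rewrite CI0// setI0 leb20.
    have pUC : piece U (C i).
      by apply: piece_sub pU (pC i) _ => z Ciz; exists i.
    have /(indecomposableP fG)/(_ _ (piece_restrict pUC fG GU)) [//|h] := iG.
    by exfalso; apply: H; exists i => //; rewrite setDIr setDv set0U in h.
  move: G0; rewrite lt_neqAle => /andP[/eqP + _]; apply; apply/esym.
  have G1 : leb2 (\bigcup_i (if (i < N)%N then G `&` C i else set0)) = 0%E.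
    by apply: leb2_bigcup0 => i; case: ifPn => [/cut//|_]; rewrite leb20.
  apply: leb2_sub0 (leb2U0 GU G1) => z Gz.
  have [Uz|] := pselect (U z); last by left.
  by right; have [i /= iN Ciz] := Uz; exists i => //; rewrite iN.
Qed.

End Components.

(** * Cutoff functions of rectangles *)

Section Cutoff.
Context {R : realType}.

(** A piecewise quadratic transition from 0 to 1 on [[a, a + dl]]; its derivative [dstep] is a tent
    of height [2 / dl]. *)
Definition step (a dl x : R) : R :=
  (dl ^- 2) * (2 * ppart (x - a) ^+ 2 - 4 * ppart (x - a - dl / 2) ^+ 2 + 2 * ppart (x - a - dl) ^+ 2).

Definition dstep (a dl x : R) : R :=
  (dl ^- 2) * (4 * ppart (x - a) - 8 * ppart (x - a - dl / 2) + 4 * ppart (x - a - dl)).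

Lemma ppart_continuous : continuous (@ppart R).
Proof.
apply: (@lipschitz_continuous _ _ 1) => x s _; rewrite mul1r ler_norml.
by have := ppart_lip x s.
Qed.

Lemma grad_ppart (c : R) : grad (fun z : R * R => ppart (z.1 - c) ^+ 2) (fun z => 2 * ppart (z.1 - c)) (fun=> 0).
Proof.
apply: (@grad_quad _ _ _ _ 1); last 2 first.
- move=> z; apply: cvgM; first exact: cvg_cst.
  apply: (@continuous_comp _ _ _ (fun z : R * R => z.1 - c) (@ppart R)); last exact: ppart_continuous.
  by apply: cvgB; [exact: continuous_fst|exact: cvg_cst].
- exact: cst_continuous.
move=> z w _; rewrite mul1r /lin2 mul0r addr0 /= (_ : z.1 + w.1 - c = z.1 - c + w.1); last by ring.
apply: (@le_trans _ _ (w.1 ^+ 2)); first by rewrite ler_norml; exact: ppart_rem.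
by rewrite -real_normK ?num_real// ler_sqr ?nnegrE//; exact: normr_fst.
Qed.

Lemma grad_step a dl : grad (fun z : R * R => step a dl z.1) (fun z => dstep a dl z.1) (fun=> 0).
Proof.
have g (c : R) k := gradZ k (grad_ppart c).
have := gradZ (dl ^- 2) (gradD (gradB (g a 2) (g (a + dl / 2) 4)) (g (a + dl) 2)).
congr grad; apply/funext => z; rewrite /step /dstep ?mulr0 ?subrr ?addr0 ?mulr0//;
  rewrite !opprD !addrA; ring.
Qed.

Lemma step_prop a dl x : 0 < dl -> [/\ 0 <= step a dl x <= 1, `|dstep a dl x| <= 2 / dl,
  (x <= a -> step a dl x = 0 /\ dstep a dl x = 0) &
  (a + dl <= x -> step a dl x = 1 /\ dstep a dl x = 0)].
Proof.
move=> d0; have dn : dl != 0 by rewrite gt_eqF.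
have e2 : step a dl x * dl ^+ 2 = 2 * ppart (x - a) ^+ 2 - 4 * ppart (x - a - dl / 2) ^+ 2 + 2 * ppart (x - a - dl) ^+ 2.
  by rewrite /step; field.
have e1 : dstep a dl x * dl ^+ 2 = 4 * ppart (x - a) - 8 * ppart (x - a - dl / 2) + 4 * ppart (x - a - dl).
  by rewrite /dstep; field.
have d2 : 0 < dl ^+ 2 by rewrite exprn_gt0.
have nz : dl ^+ 2 != 0 by rewrite gt_eqF.
split.
- rewrite -(pmulr_lge0 _ d2) -[X in _ && X](ler_pM2r d2) e2 mul1r.
  clear - d0; rewrite /ppart; case: (lerP (x - a) 0) => h1; case: (lerP (x - a - dl / 2) 0) => h2;
   case: (lerP (x - a - dl) 0) => h3; apply/andP; split; nra.
- rewrite -(ler_pM2r d2) -[X in `|_| * X]gtr0_norm// -normrM e1.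
  rewrite (_ : 2 / dl * dl ^+ 2 = 2 * dl); last by field.
  clear - d0; rewrite ler_norml /ppart; case: (lerP (x - a) 0) => h1; case: (lerP (x - a - dl / 2) 0) => h2;
   case: (lerP (x - a - dl) 0) => h3; apply/andP; split; lra.
- move=> xa; clear e1 e2; rewrite /step /dstep /ppart !max_r; [|lra|lra|lra].
  by rewrite !expr0n/= !mulr0 subrr addr0 mulr0.
- move=> xa; split; apply: (mulIf nz); rewrite ?mul0r ?mul1r ?e1 ?e2 /ppart !max_l; clear - d0 xa;
    by [ring|lra].
Qed.

Lemma cutoff_line (a b dl : R) : a <= b -> 0 < dl -> exists al al' : R -> R,
  [/\ grad (fun z : R * R => al z.1) (fun z => al' z.1) (fun=> 0),
      forall x, 0 <= al x <= 1 /\ `|al' x| <= 4 / dl,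
      forall x, a <= x <= b -> al x = 1 /\ al' x = 0,
      forall x, x <= a - dl \/ b + dl <= x -> al x = 0 /\ al' x = 0 &
      forall x, al' x != 0 -> a - dl <= x <= a \/ b <= x <= b + dl].
Proof.
move=> ab d0.
pose u x := step (a - dl) dl x; pose v x := 1 - step b dl x.
pose u' x := dstep (a - dl) dl x; pose v' x := - dstep b dl x.
have hu x := step_prop (a - dl) x d0; have hv x := step_prop b x d0.
have u01 x : 0 <= u x <= 1 by case: (hu x).
have v01 x : 0 <= v x <= 1 by have [/andP[h1 h2] _ _ _] := hv x; rewrite /v; apply/andP; split; lra.
have du x : `|u' x| <= 2 / dl by case: (hu x).
have dv x : `|v' x| <= 2 / dl by rewrite normrN; case: (hv x).
exists (fun x => u x * v x), (fun x => u' x * v x + u x * v' x); split.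
- have := gradM (grad_step (a - dl) dl) (gradB (grad_cst 1) (grad_step b dl)).
  by congr grad; apply/funext => z; rewrite /u /v /u' /v'; ring.
- move=> x; have /andP[a1 a2] := u01 x; have /andP[b1 b2] := v01 x; split.
    by rewrite mulr_ge0//= mulr_ile1.
  apply: (le_trans (ler_normD _ _)); rewrite [`|u' x * _|]normrM [`|u x * _|]normrM (ger0_norm a1) (ger0_norm b1).
  rewrite (_ : 4 / dl = 2 / dl * 1 + 1 * (2 / dl)); last by ring.
  by apply: lerD; apply: ler_pM.
- move=> x /andP[ax xb]; have [_ _ _ h1] := hu x; have [_ _ h2 _] := hv x.
  have [|e1 e2] := h1; first by rewrite subrK.
  have [e3 e4] := h2 xb.
  by rewrite /u /v /u' /v' e1 e2 e3 e4; split; ring.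
- move=> x [h|h].
    by have [_ _ /(_ h)[e1 e2] _] := hu x; rewrite /u /u' e1 e2; split; ring.
  by have [_ _ _ /(_ h)[e1 e2]] := hv x; rewrite /v /v' e1 e2; split; ring.
- move=> x; have [h1|h1] := lerP x (a - dl).
    by have [_ _ /(_ h1)[e1 e2] _] := hu x; rewrite /u /u' e1 e2 !mul0r addr0 eqxx.
  have [h2|h2] := lerP (b + dl) x.
    by have [_ _ _ /(_ h2)[e1 e2]] := hv x; rewrite /v /v' e1 e2 subrr oppr0 !mulr0 addr0 eqxx.
  have [h3|h3] := lerP x a; first by left; rewrite (ltW h1).
  have [h4|h4] := lerP b x; first by right; rewrite (ltW h2).
  have [_ _ _ k1] := hu x; have [_ _ k2 _] := hv x.
  have [|e1 e2] := k1; first by rewrite subrK ltW.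
  have [e3 e4] := k2 (ltW h4).
  by rewrite /u /v /u' /v' e2 e4 oppr0 mul0r mulr0 addr0 eqxx.
Qed.

Lemma cutoff_rect (a b c d dl : R) : a <= b -> c <= d -> 0 < dl ->
  exists eta p q : R * R -> R,
  [/\ grad eta p q, forall z, 0 <= eta z <= 1 /\ `|p z| <= 4 / dl /\ `|q z| <= 4 / dl,
      forall z, a <= z.1 <= b -> c <= z.2 <= d -> [/\ eta z = 1, p z = 0 & q z = 0],
      forall z, eta z != 0 \/ p z != 0 \/ q z != 0 ->
        (a - dl <= z.1 <= b + dl) /\ (c - dl <= z.2 <= d + dl) &
      (forall z, p z != 0 -> a - dl <= z.1 <= a \/ b <= z.1 <= b + dl) /\
      (forall z, q z != 0 -> c - dl <= z.2 <= c \/ d <= z.2 <= d + dl)].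
Proof.
move=> ab cd d0.
have [al [al' [g1 b1 i1 o1 s1]]] := cutoff_line ab d0.
have [be [be' [g2 b2 i2 o2 s2]]] := cutoff_line cd d0.
have g2' := grad_swap g2.
exists (fun z => al z.1 * be z.2), (fun z => al' z.1 * be z.2), (fun z => al z.1 * be' z.2); split.
- have := gradM g1 g2'.
  by congr grad; apply/funext => z; rewrite /= ?mulr0 ?mul0r ?addr0 ?add0r.
- move=> z; have [/andP[x1 x2] x3] := b1 z.1; have [/andP[y1 y2] y3] := b2 z.2.
  split; first by rewrite mulr_ge0//= mulr_ile1.
  rewrite !normrM (ger0_norm x1) (ger0_norm y1); split.
    by rewrite -[leRHS]mulr1 ler_pM.
  by rewrite -[leRHS]mul1r ler_pM.
- move=> z h1 h2; have [e1 e2] := i1 _ h1; have [e3 e4] := i2 _ h2.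
  by rewrite e1 e2 e3 e4 mulr1 mul0r mulr0.
- move=> z h.
  have [n1 n2] : ~ (z.1 <= a - dl \/ b + dl <= z.1) /\ ~ (z.2 <= c - dl \/ d + dl <= z.2).
    by split => [/o1[e1 e2]|/o2[e1 e2]]; move: h; rewrite e1 e2 ?mul0r ?mulr0 eqxx => -[|[]].
  split; apply/andP; split.
  + by rewrite leNgt; apply/negP => hh; apply: n1; left; exact: ltW.
  + by rewrite leNgt; apply/negP => hh; apply: n1; right; exact: ltW.
  + by rewrite leNgt; apply/negP => hh; apply: n2; left; exact: ltW.
  + by rewrite leNgt; apply/negP => hh; apply: n2; right; exact: ltW.
- by split => z; rewrite mulf_eq0 negb_or => /andP[h1 h2]; [exact: s1|exact: s2].
Qed.

End Cutoff.

(** * Exchange of fields on disjoint squares, and Vitali covering *)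

Section Vitali.
Context {R : realType}.
Local Notation T := (measurableTypeR R).
Local Notation P := (T * T)%type.
Local Notation J := (@J R).

Lemma test_field_out f g d (x : R * R) r : test_field f g d ->
  (forall z, ~ sq x r z -> f z = 0 /\ g z = 0) -> forall z, ~ sq x r z -> d z = 0.
Proof.
move=> tf fg0 z nz.
have [p [q [t [s [M [gp gr e _ _]]]]]] := test_field_translate x tf.
have sqb w : sq x r (w + x) <-> in_box r w.
  rewrite sqP addrK normr_pair ge_max; split; first by move=> /andP[].
  by move=> [-> ->].
have nb : ~ in_box r (z - x) by move=> /sqb; rewrite subrK.
have [p0 _] : p (z - x) = 0 /\ q (z - x) = 0.
  apply: (grad_out gp) nb => w h; apply/sqb; apply: contrapT => /fg0[e1 _].
  by move: h; rewrite e1 eqxx.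
have [_ s0] : t (z - x) = 0 /\ s (z - x) = 0.
  apply: (grad_out gr) nb => w h; apply/sqb; apply: contrapT => /fg0[_ e1].
  by move: h; rewrite e1 eqxx.
have := congr1 (fun F => F (z - x)) e; rewrite /= subrK => ->.
by rewrite p0 s0 addr0.
Qed.

Definition same_on (S : set (R * R)) (f g d f' g' d' : R * R -> R) :=
  forall z, S z -> [/\ f z = f' z, g z = g' z & d z = d' z].

(** On the double square both current fields equal the nearly optimal field for E. A cutoff removes
    it from both and inserts [(u, v)] in the first. The gain is the integral of [w] over F; the
    losses over F and over E minus F recombine into one integral over E. *)
Lemma replace_step (E F : set P) (x : R * R) r k tau M f g d f1 g1 d1 f2 g2 d2 u v w :
  measurable E -> measurable F -> F `<=` E -> 0 < r -> 0 <= M ->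
  test_field f g d -> test_field f1 g1 d1 -> test_field f2 g2 d2 -> test_field u v w ->
  same_on (sq x (2 * r)) f1 g1 d1 f g d -> same_on (sq x (2 * r)) f2 g2 d2 f g d ->
  (forall z, `|d z| <= M) ->
  (forall z, ~ sq x r z -> u z = 0 /\ v z = 0) ->
  k * r <= J (fun z => \1_F z * w z) -> J \1_(sq x (2 * r) `\` E) <= tau * r ^+ 2 ->
  exists f1' g1' d1' f2' g2' d2',
    [/\ test_field f1' g1' d1', test_field f2' g2' d2',
     same_on (~` sq x (2 * r)) f1' g1' d1' f1 g1 d1,
     same_on (~` sq x (2 * r)) f2' g2' d2' f2 g2 d2 &
     J (fun z => \1_F z * d1 z) + J (fun z => \1_(E `\` F) z * d2 z) +
       (k * r - (M * r + 16) * (tau * r)) <=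
     J (fun z => \1_F z * d1' z) + J (fun z => \1_(E `\` F) z * d2' z)].
Proof.
move=> mE mF FE r0 M0 tf tf1 tf2 tu s1 s2 dM uv0 hk ht.
have r2 : 0 < r / 2 by rewrite divr_gt0.
have [||eta [p [q [ge b i o _]]]] := @cutoff_rect R (x.1 - r) (x.1 + r) (x.2 - r) (x.2 + r) (r / 2) _ _ r2.
- by lra.
- by lra.
have e01 z : 0 <= eta z <= 1 by case: (b z).
have w0 := test_field_out tu uv0.
have in1 z : sq x r z -> [/\ eta z = 1, p z = 0 & q z = 0].
  by move=> [h1 h2]; apply: i; [move: h1|move: h2]; rewrite /= in_itv.
have out z : ~ sq x (2 * r) z -> [/\ eta z = 0, p z = 0 & q z = 0].
  move=> nz; have [//|h] := pselect ([/\ eta z = 0, p z = 0 & q z = 0]).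
  exfalso; apply: nz; have [|h1 h2] := o z.
    have [e1|] := eqVneq (eta z) 0; last by left.
    have [e2|] := eqVneq (p z) 0; last by right; left.
    have [e3|] := eqVneq (q z) 0; last by right; right.
    by exfalso; apply: h.
  by split; rewrite /= in_itv/=; move: h1 h2 => /andP[? ?] /andP[? ?]; apply/andP; split; lra.
have t1 := test_field_mix tu tf1 ge e01.
have t2 := test_field_mix (@test_field0 R) tf2 ge e01.
have t3 := test_field_mix tf (@test_field0 R) ge e01.
set d1' := (X in test_field _ _ X) in t1.
set d2' := (X in test_field _ _ X) in t2.
set e := (X in test_field _ _ X) in t3.
have [_ _ bw] := test_field_bcs tu; have [_ _ bd1] := test_field_bcs tf1.
have [_ _ bd2] := test_field_bcs tf2; have [_ _ be] := test_field_bcs t3.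
have [_ _ bd1'] := test_field_bcs t1; have [_ _ bd2'] := test_field_bcs t2.
have E1 z : d1' z = d1 z + w z - e z.
  rewrite /d1' /e; have [h|h] := pselect (sq x (2 * r) z); last first.
    have [-> -> ->] := out z h.
    have -> : w z = 0 by apply: w0; apply: contra_not h => /sqP hh; apply/sqP; lra.
    by ring.
  have [-> -> ->] := s1 z h; have [h'|h'] := pselect (sq x r z).
    by have [-> -> ->] := in1 z h'; ring.
  by have [-> ->] := uv0 z h'; rewrite (w0 z h'); ring.
have E2 z : d2' z = d2 z - e z.
  rewrite /d2' /e; have [h|h] := pselect (sq x (2 * r) z); last first.
    by have [-> -> ->] := out z h; ring.
  by have [-> -> ->] := s2 z h; ring.
have mG : measurable (E `\` F) by exact: measurableD.
have mC : measurable (sq x (2 * r) `\` E) by apply: measurableD => //; exact: measurable_sq.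
have CM z : (sq x (2 * r) `\` E) z -> in_box (`|x| + 2 * r) z by move=> [/sq_in_box].
have bC := bcs_indic mC CM.
have bE := bcsI mE be; have bFd := bcsI mF bd1; have bGd := bcsI mG bd2; have bFw := bcsI mF bw.
(* The removed divergence [e] has integral 0, so its integral over E is minus the one over the
   double square outside E, a set of small area. There it is at most [M + 16 / r], the cutoff having
   slope [8 / r] in each direction. *)
have key : J (fun z => \1_E z * e z) <= (M * r + 16) * (tau * r).
  have L0 : 0 <= M + 16 / r by rewrite addr_ge0// divr_ge0// ltW.
  apply: (@le_trans _ _ ((M + 16 / r) * J \1_(sq x (2 * r) `\` E))); last first.
    apply: (@le_trans _ _ ((M + 16 / r) * (tau * r ^+ 2))); first by rewrite ler_wpM2l.
    by rewrite le_eqVlt; apply/orP; left; apply/eqP; field; exact: lt0r_neq0.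
  have bLC := bcsZ (M + 16 / r) bC.
  rewrite -(JZ _ bC) -[leRHS]addr0 -(J_test_field t3) -(JD bLC be).
  apply: (le_J bE (bcsD bLC be)).
  move=> z; have [Ez|nE] := pselect (E z).
    by rewrite [\1_E z]indicE mem_set// mul1r lerDr mulr_ge0// indicE.
  rewrite [\1_E z]indicE memNset// mul0r.
  have [h|h] := pselect (sq x (2 * r) z); last first.
    rewrite indicE memNset; last by case.
    rewrite mulr0 add0r /e; have [-> -> ->] := out z h.
    by rewrite le_eqVlt; apply/orP; left; apply/eqP; ring.
  rewrite indicE mem_set// mulr1 -lerBlDr sub0r; apply: (le_trans (ler_norm _)); rewrite normrN.
  have [p1 p2] : `|f z| <= 1 /\ `|g z| <= 1.
    have [p' [q' [r' [s' [M' [_ _ _ _ fg1]]]]]] := tf; have := fg1 z.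
    have := sqr_ge0 (f z); have := sqr_ge0 (g z) => h1 h2 h3.
    by split; rewrite -ler_sqr ?nnegrE// expr1n real_normK ?num_real//; lra.
  have [/andP[n0 n1] [hp hq]] := b z.
  have h4 : 4 / (r / 2) = 8 / r by field; exact: lt0r_neq0.
  rewrite h4 in hp hq.
  have -> : M + 16 / r = 1 * M + (8 / r * 1 + 8 / r * 1) by ring.
  rewrite /e !subr0 mulr0 addr0; apply: (le_trans (ler_normD _ _)); apply: lerD.
    by rewrite normrM ger0_norm// ler_pM.
  by apply: (le_trans (ler_normD _ _)); apply: lerD; rewrite normrM ler_pM.
do 6 eexists; split; [exact: t1|exact: t2| | |].
- move=> z /out[e1 e2 e3]; split; rewrite ?e1 ?mul0r ?subr0 ?mul1r ?add0r//.
  by rewrite /d1' e1 e2 e3; ring.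
- move=> z /out[e1 e2 e3]; split; rewrite ?e1 ?mul0r ?subr0 ?mul1r ?add0r//.
  by rewrite /d2' e1 e2 e3; ring.
have -> : J (fun z => \1_F z * d1' z) + J (fun z => \1_(E `\` F) z * d2' z) =
  J (fun z => \1_F z * d1 z) + J (fun z => \1_(E `\` F) z * d2 z) +
  (J (fun z => \1_F z * w z) - J (fun z => \1_E z * e z)).
  have bFd' := bcsI mF bd1'; have bGd' := bcsI mG bd2'.
  rewrite -(JD bFd' bGd') -(JD bFd bGd) -(JB bFw bE) -(JD (bcsD bFd bGd) (bcsB bFw bE)).
  congr J; apply/funext => z; rewrite E1 E2 !indicE in_setD.
  have [Fz|nF] := boolP (z \in F).
    have -> : z \in E by apply/mem_set/FE/set_mem.
    by rewrite /=; ring.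
  by case: (z \in E); rewrite /=; ring.
by rewrite lerD2l; lra.
Qed.

Section family.
Variables (E F : set P) (a b eps k M : R) (f g d : R * R -> R).
Hypotheses (mE : measurable E) (mF : measurable F) (FE : F `<=` E).
Hypotheses (hF : per_le F a) (hG : per_le (E `\` F) b) (k0 : 0 < k).
Hypotheses (tf : test_field f g d) (dM : forall z, `|d z| <= M).
Hypothesis opt : a + b - eps <= J (fun z => \1_E z * d z).

(** The constants leave half of the gain: [M * r <= 1] bounds [M * r + 16] by 17, so the loss in
    [replace_step] with [tau = k / 64] is at most [17/64 k r]. *)
Definition candidate (x : R * R) (r : R) := [/\ 0 < r, M * r <= 1,
  exists u v w, [/\ test_field u v w, (forall z, ~ sq x r z -> u z = 0 /\ v z = 0) &
    k * r <= J (fun z => \1_F z * w z)] &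
  J \1_(sq x (2 * r) `\` E) <= k / 64 * r ^+ 2].

Lemma candidate_sum (X : nat -> R * R) (r : nat -> R) n :
  (forall i, r i = 0 \/ candidate (X i) (r i)) ->
  (forall i j, (i < j)%N -> 0 < r i -> 0 < r j -> sq (X i) (2 * r i) `&` sq (X j) (2 * r j) = set0) ->
  \sum_(i < n) r i <= 2 * eps / k.
Proof.
move=> hr dj.
suff [f1 [g1 [d1 [f2 [g2 [d2 [t1 t2 _ _ h]]]]]]] :
  exists f1 g1 d1 f2 g2 d2, [/\ test_field f1 g1 d1, test_field f2 g2 d2,
    same_on [set z | forall i, (i < n)%N -> 0 < r i -> ~ sq (X i) (2 * r i) z] f1 g1 d1 f g d,
    same_on [set z | forall i, (i < n)%N -> 0 < r i -> ~ sq (X i) (2 * r i) z] f2 g2 d2 f g d &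
    a + b - eps + k / 2 * \sum_(i < n) r i <=
    J (fun z => \1_F z * d1 z) + J (fun z => \1_(E `\` F) z * d2 z)].
  have := hF t1; have := hG t2 => h1 h2.
  rewrite ler_pdivlMr//; lra.
elim: n => [|n [f1 [g1 [d1 [f2 [g2 [d2 [t1 t2 s1 s2 h]]]]]]]].
  exists f, g, d, f, g, d; split => //.
  rewrite big_ord0 mulr0 addr0; apply: (le_trans opt).
  have [_ _ bd] := test_field_bcs tf; have mG : measurable (E `\` F) by exact: measurableD.
  rewrite -(JD (bcsI mF bd) (bcsI mG bd)) le_eqVlt; apply/orP; left; apply/eqP; congr J.
  apply/funext => z; rewrite !indicE in_setD; have [Fz|nF] := boolP (z \in F).
    have -> : z \in E by apply/mem_set/FE/set_mem.
    by rewrite /=; ring.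
  by case: (z \in E); rewrite /=; ring.
rewrite big_ord_recr /=; have [r0|[r0 Mr [u [v [w [tu uv0 hk]]]] ht]] := hr n.
  exists f1, g1, d1, f2, g2, d2; split => //.
  - by move=> z hz; apply: s1 => i lin; apply: hz; exact: ltnW.
  - by move=> z hz; apply: s2 => i lin; apply: hz; exact: ltnW.
  by rewrite r0 addr0.
have sub z : sq (X n) (2 * r n) z -> forall i, (i < n)%N -> 0 < r i -> ~ sq (X i) (2 * r i) z.
  move=> hz i lin ri hi.
  have : (sq (X i) (2 * r i) `&` sq (X n) (2 * r n)) z by [].
  by rewrite dj.
have M0 : 0 <= M by exact: le_trans (normr_ge0 _) (dM 0).
have [|z hz|f1' [g1' [d1' [f2' [g2' [d2' [t1' t2' s1' s2' h']]]]]]] :=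
  replace_step mE mF FE r0 M0 tf t1 t2 tu _ _ dM uv0 hk ht.
- by move=> z hz; apply: s1; exact: sub.
- by apply: s2; exact: sub.
exists f1', g1', d1', f2', g2', d2'; split => //.
- move=> z hz; have [e1 e2 e3] := s1' z (hz n (ltnSn n) r0).
  rewrite e1 e2 e3; apply: s1 => i lin; apply: hz; exact: ltnW.
- move=> z hz; have [e1 e2 e3] := s2' z (hz n (ltnSn n) r0).
  rewrite e1 e2 e3; apply: s2 => i lin; apply: hz; exact: ltnW.
apply: le_trans h'; rewrite mulrDr addrA; apply: lerD => //.
have kr : 0 <= k * r n by rewrite mulr_ge0 ?ltW.
have : (M * r n + 16) * (k / 64 * r n) <= 17 * (k / 64 * r n).
  by apply: ler_wpM2r; lra.
lra.
Qed.

(** Vitali's greedy selection: each chosen radius is at least half of any admissible one. A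
    candidate of radius r whose double square first meets that of [y m] has [r <= 2 r_m], so its
    centre is within [2 r_m + 2 r <= 6 r_m]. *)
Lemma candidate_cover (S : set (R * R)) rho : 0 < rho -> 0 <= eps ->
  (forall x, S x -> forall e, 0 < e -> exists2 r, r < e & candidate x r) ->
  exists (X : nat -> R * R) (r : nat -> R), [/\ forall i, 0 <= r i <= rho,
    S `<=` \bigcup_i sq (X i) (6 * r i) & forall n, \sum_(i < n) r i <= 2 * eps / k].
Proof.
move=> rho0 eps0 hS.
pose Q (s : seq (R * R * R)) (y : R * R * R) := [/\ candidate y.1 y.2, y.2 <= rho &
  forall y', y' \in s -> 0 < y'.2 -> sq y'.1 (2 * y'.2) `&` sq y.1 (2 * y.2) = set0].
have pick s : exists y, ((forall y', ~ Q s y') /\ y = (0, 0)) \/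
    (Q s y /\ forall y', Q s y' -> y'.2 <= 2 * y.2).
  have [ex|nex] := pselect (exists y, Q s y); last first.
    by exists (0, 0); left; split => // y' Qy; apply: nex; exists y'.
  have [|y Qy] := @near_max R _ (Q s) snd rho ex.
    by move=> y [[y0 _ _ _] yr _]; rewrite yr ltW.
  by exists y; right.
pose pk s := sval (cid (pick s)).
have pkP s := svalP (cid (pick s)).
pose st n := iter n (fun s => pk s :: s) [::].
pose y n := pk (st n).
have yP n : ((forall y', ~ Q (st n) y') /\ y n = (0, 0)) \/
  (Q (st n) (y n) /\ forall y', Q (st n) y' -> y'.2 <= 2 * (y n).2) := pkP (st n).
have stP n z : z \in st n <-> exists2 i, (i < n)%N & z = y i.
  elim: n => [|n ih]; first by split => // -[].
  rewrite (_ : st n.+1 = y n :: st n)// in_cons; split.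
    by move=> /predU1P[->|/ih[i lin ->]]; [exists n|exists i => //; exact: ltnW].
  move=> [i + e]; rewrite ltnS leq_eqVlt => /predU1P[ei|lin]; first by rewrite e ei eqxx.
  by apply/orP; right; apply/ih; exists i.
have hy n : (y n).2 = 0 \/ candidate (y n).1 (y n).2.
  by have [[_ ->]|[[]]] := yP n; [left|right].
have y0 n : 0 <= (y n).2 by have [->|[/ltW]] := hy n.
have yr n : (y n).2 <= rho by have [[_ ->]|[[]]] := yP n; [exact: ltW|].
have dj i j : (i < j)%N -> 0 < (y i).2 -> 0 < (y j).2 ->
    sq (y i).1 (2 * (y i).2) `&` sq (y j).1 (2 * (y j).2) = set0.
  move=> ij i0 j0; have [[_ e]|[[_ _ h] _]] := yP j.
    by move: j0; rewrite e ltxx.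
  by apply: h => //; apply/stP; exists i.
have sum n := @candidate_sum (fun i => (y i).1) (fun i => (y i).2) n hy dj.
exists (fun i => (y i).1), (fun i => (y i).2); split => //.
  by move=> i; rewrite y0 yr.
move=> x Sx; have [r rr cx] := hS x Sx rho rho0; have [r0 _ _ _] := cx.
(* A candidate admissible forever would keep all chosen radii above [r / 2], against the bound on
   their sum. *)
have [n meet] : exists n, ~ Q (st n) (x, r).
  apply: contrapT => H; have {}H n : Q (st n) (x, r) by apply: contrapT => h; apply: H; exists n.
  have big n : r / 2 <= (y n).2.
    have [[/(_ _ (H n))//]|[_ /(_ _ (H n))/=]] := yP n; lra.
  have bs n : n%:R * (r / 2) <= 2 * eps / k.
    apply: le_trans (sum n); rewrite mulr_natl -[n in leLHS]card_ord -sumr_const.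
    by apply: ler_sum => i _.
  have r2 : 0 < r / 2 by rewrite divr_gt0.
  pose N := Num.Def.archi_bound (2 * eps / k / (r / 2)).
  have : 2 * eps / k / (r / 2) < N%:R.
    by apply: archi_boundP; rewrite divr_ge0 ?(ltW r2)// divr_ge0 ?(ltW k0)// mulr_ge0.
  by rewrite ltr_pdivrMr// => h; have := bs N; lra.
have [m [Qm nQ]] : exists m, Q (st m) (x, r) /\ ~ Q (st m.+1) (x, r).
  elim: n meet => [|n ih] h.
    by exfalso; apply: h; split => //=; exact: ltW.
  by have [h'|/ih//] := pselect (Q (st n) (x, r)); exists n.
have [_ _ hm] := Qm.
exists m => //; have [[/(_ _ Qm)//]|[Qy /(_ _ Qm)/= big]] := yP m.
have : exists z, sq (y m).1 (2 * (y m).2) z /\ sq x (2 * r) z.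
  apply: contrapT => H; apply: nQ; split => //=; first exact: ltW.
  move=> y'; rewrite in_cons => /predU1P[->|y's]; last exact: hm.
  by move=> _; apply/seteqP; split => // z hz; apply: H; exists z.
move=> [z [/sqP z1 /sqP z2]]; apply/sqP.
have -> : x - (y m).1 = (z - (y m).1) - (z - x) by pair_ring.
by apply: (le_trans (ler_normB _ _)); lra.
Qed.

End family.
End Vitali.

(** * Covers and null sets of one-dimensional Hausdorff measure *)

Section Hausdorff.
Context {R : realType}.
Local Notation P := (measurableTypeR R * measurableTypeR R)%type.
Local Notation J := (@J R).

Lemma ediam_ge0 (A : set (R * R)) : (0 <= ediam A)%E.
Proof. by rewrite /ediam le_max lexx. Qed.

Lemma ediam_sq x (r : R) : 0 <= r -> (ediam (sq x r) <= (4 * r)%:E)%E.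
Proof.
move=> r0; rewrite /ediam ge_max lee_fin mulr_ge0//=.
apply: ge_ereal_sup => _ [[p q] [/= /sqP hp /sqP hq] <-]; rewrite lee_fin.
apply: (le_trans (enorm_le _)).
have -> : p - q = (p - x) - (q - x) by rewrite opprB addrA subrK.
by have := ler_normB (p - x) (q - x); lra.
Qed.

Definition small_cover (S : set (R * R)) := forall d e : R, 0 < d -> 0 < e ->
  exists C : (set (R * R))^nat, [/\ S `<=` \bigcup_i C i,
    forall i, (ediam (C i) <= d%:E)%E & (\sum_(i <oo) ediam (C i) <= e%:E)%E].

Lemma small_cover_hausdorff S : small_cover S -> hausdorff1 S = 0%E.
Proof.
move=> hS.
have pre d : (0 < d)%R -> hausdorff1_pre d S = 0%E.
  move=> d0; apply/eqP; rewrite eq_le; apply/andP; split; last first.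
    apply: le_ereal_inf_tmp => _ [C _ <-]; apply: nneseries_ge0 => n _ _; exact: ediam_ge0.
  apply/lee_addgt0Pr => e e0; rewrite add0e.
  have [C [SC Cd Ce]] := hS d e d0 e0; apply: le_trans Ce.
  by apply: ereal_inf_lbound; exists C.
apply/eqP; rewrite eq_le; apply/andP; split.
  by apply: ge_ereal_sup => _ [d /= d0 <-]; rewrite pre.
by apply: ereal_sup_ubound; exists 1; [exact: ltr01|exact: pre].
Qed.

Lemma small_coverS (S S' : set (R * R)) : S `<=` S' -> small_cover S' -> small_cover S.
Proof.
move=> SS h d e d0 e0; have [C [SC Cd Ce]] := h d e d0 e0.
by exists C; split => //; exact: subset_trans SC.
Qed.

(** Countable subadditivity: the n-th set gets the budget [e / 2^(n+1)], and the double family of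
    covers is enumerated through a bijection between naturals and pairs. *)
Lemma small_cover_bigcup (S : (set (R * R))^nat) : (forall n, small_cover (S n)) ->
  small_cover (\bigcup_n S n).
Proof.
move=> hS d e d0 e0.
pose Q n (C : (set (R * R))^nat) := [/\ S n `<=` \bigcup_i C i,
    forall i, (ediam (C i) <= d%:E)%E & (\sum_(i <oo) ediam (C i) <= (e / (2 ^ n.+1)%:R)%:E)%E].
have [G PG] : {G : ((set (R * R))^nat)^nat & forall n, Q n (G n)}.
  by apply: (@choice _ _ Q) => n; apply: hS => //; rewrite divr_gt0// ltr0n expn_gt0.
have d_ge0 x : (0 <= (@ediam R \o uncurry G) x)%E by exact: ediam_ge0.
have /card_esym/ppcard_eqP[f] := card_nat2.
exists (uncurry G \o f); split.
- move=> t [n _ Snt]; have [h _ _] := PG n; have [j _ Gj] := h t Snt.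
  by exists (f^-1%FUN (n, j)) => //=; rewrite invK ?inE.
- by move=> i /=; have [_ h _] := PG (f i).1; rewrite /uncurry; case: (f i) h.
rewrite (_ : (\sum_(i <oo) ediam ((uncurry G \o f) i))%E = (\esum_(i in setT) (@ediam R \o uncurry G) i)%E); last first.
  rewrite -(esum_pred_image (@ediam R \o uncurry G) _ xpredT) ?[fun=> _]set_true//.
  by rewrite image_eq.
rewrite (_ : esum _ _ = \sum_(i <oo) \sum_(j <oo) ediam (G i j))%E; last first.
  pose I : nat -> set (nat * nat) := fun i => [set (i, j) | j in setT].
  rewrite (_ : setT = \bigcup_k I k); last first.
    by rewrite predeqE => -[a b]; split => // _; exists a => //; exists b.
  rewrite esum_bigcupT /=; last 2 first.
    - apply/trivIsetP => i j _ _ ij.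
      rewrite predeqE => -[n m] /=; split => //= -[] [_] _ [<-{n} _].
      by move=> [m' _] [] /esym/eqP; rewrite (negbTE ij).
    - by move=> n; exact: ediam_ge0.
  rewrite -(image_id [set: nat]) -fun_true esum_pred_image//; last first.
    by move=> n _; apply: esum_ge0 => ? _; exact: ediam_ge0.
  apply: eq_eseriesr => /= j _.
  rewrite -(esum_pred_image (@ediam R \o uncurry G) (pair j) predT)//=; last 2 first.
  - by move=> n _; exact: ediam_ge0.
  - by move=> ? ? _ _; exact: (@can_inj _ _ _ snd).
  by congr esum; rewrite predeqE => -[a b]; split; move=> [i _ <-]; exists i.
apply: le_trans (epsilon_trick0 xpredT (ltW e0)).
apply: lee_nneseries => [n *|n *]; last by have [_ _] := PG n.
by apply: nneseries_ge0 => m _ _; exact: ediam_ge0.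
Qed.

Lemma small_cover_squares (S : set (R * R)) :
  (forall rho e, 0 < rho -> 0 < e -> exists (X : nat -> R * R) (r : nat -> R),
    [/\ forall i, 0 <= r i <= rho, S `<=` \bigcup_i sq (X i) (6 * r i) &
      forall n, \sum_(i < n) r i <= e]) -> small_cover S.
Proof.
move=> hS d e d0 e0.
(* A square of half-side [6 r] has Euclidean diameter at most [24 r]. *)
have [X [r [hr SX sum]]] := hS (d / 24) (e / 24) (divr_gt0 d0 (ltr0Sn _ _)) (divr_gt0 e0 (ltr0Sn _ _)).
have dm i : (ediam (sq (X i) (6 * r i)) <= (24 * r i)%:E)%E.
  have /andP[r0 _] := hr i; apply: (le_trans (ediam_sq _ _)); first by rewrite mulr_ge0.
  by rewrite lee_fin; lra.
exists (fun i => sq (X i) (6 * r i)); split => //.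
  by move=> i; apply: (le_trans (dm i)); rewrite lee_fin; have /andP[] := hr i; lra.
apply: lime_le; first by apply: is_cvg_nneseries => n _ _; exact: ediam_ge0.
apply: nearW => n; apply: (@le_trans _ _ (\sum_(0 <= i < n) (24 * r i)%:E)%E).
  by apply: lee_sum => i _.
rewrite sumEFin lee_fin big_mkord -mulr_sumr; have := sum n; lra.
Qed.

End Hausdorff.

(** * Densities, and the boundary of a piece *)

Section Density.
Context {R : realType}.
Local Notation P := (measurableTypeR R * measurableTypeR R)%type.
Local Notation J := (@J R).

Lemma leb2_ar (S : set (R * R)) (B : set P) (x : R * R) r : measurable B -> null_eq S B ->
  leb2 (S `&` sq x r) = (ar B r x)%:E.
Proof.
move=> mB SB; rewrite (leb2_null_eq (null_eqI SB (null_eq_refl (sq x r)))).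
apply: (@leb2_J _ _ (`|x| + r)).
  by apply: measurableI => //; exact: measurable_sq.
by move=> z [_ /sq_in_box].
Qed.

Lemma eball_sq (x : R * R) r : eball x r `<=` sq x r.
Proof. by move=> z h; apply/sqP; apply: (le_trans (le_enorm _)); exact: ltW. Qed.

Lemma sq_eball (x : R * R) r s : 2 * r < s -> sq x r `<=` eball x s.
Proof.
move=> rs z /sqP h; rewrite /eball /=; apply: (le_lt_trans (enorm_le _)); lra.
Qed.

Lemma leb2_sq (x : R * R) (r : R) : 0 <= r -> leb2 (sq x r) = (4 * r ^+ 2)%:E.
Proof. by move=> r0; rewrite (leb2_J (measurable_sq x r) (@sq_in_box _ x r)) J_sq. Qed.

(** Discs and squares are compared only up to constants, which is enough since the boundary depends
    on positivity of upper densities alone. The lower bound is the area of the inscribed square of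
    half-side [r / 4]. *)
Lemma leb2_eball (x : R * R) (r : R) : 0 < r -> exists v : R,
  [/\ leb2 (eball x r) = v%:E, r ^+ 2 / 4 <= v & v <= 4 * r ^+ 2].
Proof.
move=> r0.
have h1 : (leb2 (eball x r) <= (4 * r ^+ 2)%:E)%E.
  by rewrite -(leb2_sq x (ltW r0)); apply: le_leb2; exact: eball_sq.
have h2 : ((r ^+ 2 / 4)%:E <= leb2 (eball x r))%E.
  have r4 : 0 <= r / 4 by rewrite divr_ge0// ltW.
  have -> : r ^+ 2 / 4 = 4 * (r / 4) ^+ 2 by field.
  rewrite -(leb2_sq x r4); apply: le_leb2; apply: sq_eball; lra.
have f : (leb2 (eball x r) \is a fin_num)%E.
  by rewrite ge0_fin_numE ?measure_ge0//; exact: le_lt_trans h1 (ltry _).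
exists (fine (leb2 (eball x r))); rewrite fineK//; split => //.
  by rewrite -lee_fin fineK.
by rewrite -lee_fin fineK.
Qed.

Lemma upper_density_pos (S : set (R * R)) (B : set P) (x : R * R) : measurable B -> null_eq S B ->
  (0 < upper_density S x)%E -> exists2 kap : R, 0 < kap & forall rho, 0 < rho ->
    exists r, [/\ 0 < r, r < rho & kap * r ^+ 2 <= ar B r x].
Proof.
move=> mB SB up; apply: contrapT => H; move: up; apply/negP; rewrite -leNgt.
apply/lee_addgt0Pr => k k0; rewrite add0e.
have [rho rho0 hrho] : exists2 rho : R, 0 < rho & forall r, 0 < r -> r < rho -> ar B r x < k / 4 * r ^+ 2.
  apply: contrapT => H'; apply: H; exists (k / 4); first by rewrite divr_gt0.
  move=> rho rho0; apply: contrapT => H; apply: H'; exists rho => // r r0 rr.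
  by rewrite ltNge; apply/negP => h; apply: H; exists r.
rewrite /upper_density /limf_esup.
apply: (@le_trans _ _ (ereal_sup ((fun r : R => (leb2 (S `&` eball x r) / leb2 (eball x r))%E) @` `]0, rho[%classic))).
  apply: ereal_inf_lbound; exists `]0, rho[%classic => //.
  near=> u; rewrite /= in_itv/=; apply/andP; split; first by near: u; exact: nbhs_right_gt.
  by near: u; exact: nbhs_right_lt.
apply: ge_ereal_sup => _ [r /= + <-]; rewrite in_itv/= => /andP[r0 rr].
have [v [-> v1 v2]] := leb2_eball x r0.
have r2 : 0 < r ^+ 2 by rewrite exprn_gt0.
have v0 : 0 < v by lra.
rewrite inver gt_eqF// lee_pdivrMr//.
apply: (@le_trans _ _ (leb2 (S `&` sq x r))).
  by apply: le_leb2 => z [Sz ez]; split => //; exact: eball_sq.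
rewrite (leb2_ar _ _ mB SB) -EFinM lee_fin; apply: (le_trans (ltW (hrho r r0 rr))).
by have := ler_wpM2l (ltW k0) v1; lra.
Unshelve. all: by end_near. Qed.

Lemma upper_density_zero (S : set (R * R)) (B : set P) (x : R * R) : measurable B -> null_eq S B ->
  ~ (0 < upper_density S x)%E -> forall tau : R, 0 < tau ->
  exists2 rho : R, 0 < rho & forall r, 0 < r -> r < rho -> ar B r x <= tau * r ^+ 2.
Proof.
move=> mB SB /negP; rewrite -leNgt => h tau tau0.
(* The square of half-side r lies in the disc of radius [3 r], of area at most
   [4 (3 r)^2 = 36 r^2]. *)
have : (upper_density S x < (tau / 36)%:E)%E by apply: (le_lt_trans h); rewrite lte_fin divr_gt0.
rewrite /upper_density /limf_esup => /ereal_inf_lt[_ [V nV <-] hV].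
have [e /= e0 eV] := nV.
exists (e / 3); first by rewrite divr_gt0.
move=> r r0 re; have r3 : 0 < 3 * r by rewrite mulr_gt0.
have V3 : V (3 * r).
  by apply: eV => //; rewrite /ball /= sub0r normrN gtr0_norm//; lra.
have [v [ev v1 v2]] := leb2_eball x r3.
have h3 : (leb2 (S `&` eball x (3 * r)) / leb2 (eball x (3 * r)) <= (tau / 36)%:E)%E.
  by apply: le_trans (ltW hV); apply: ereal_sup_ubound; exists (3 * r).
have r2 : 0 < r ^+ 2 by rewrite exprn_gt0.
have e9 : (3 * r) ^+ 2 = 9 * r ^+ 2 by ring.
rewrite e9 in v1 v2.
have v0 : 0 < v by lra.
rewrite ev inver gt_eqF// lee_pdivrMr// in h3.
rewrite -lee_fin -(leb2_ar x r mB SB); apply: (@le_trans _ _ (leb2 (S `&` eball x (3 * r)))).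
  apply: le_leb2 => z [Sz zs]; split => //; move: zs; apply: sq_eball; lra.
apply: (le_trans h3); rewrite -EFinM lee_fin.
have := ler_wpM2l (ltW tau0) v2; lra.
Qed.

(** Suppose no radius is mixed. Where psi is large, phi is small, and this propagates downwards:
    [phi s <= phi (2 s) < 4 k s^2 <= s^2 / 4] forces [psi s] to be large, hence [phi s < k s^2]. So
    phi is small at all smaller radii, against its positive upper density. The cap [1/16] is what
    makes halving work. *)
Lemma mixed_radius (phi psi : R -> R) kap : 0 < kap ->
  (forall r, 0 < r -> phi r + psi r = 4 * r ^+ 2) ->
  (forall r s, 0 < r -> r <= s -> phi r <= phi s) ->
  (forall rho, 0 < rho -> exists r, [/\ 0 < r, r < rho & kap * r ^+ 2 <= phi r]) ->
  (forall rho, 0 < rho -> exists r, [/\ 0 < r, r < rho & kap * r ^+ 2 <= psi r]) ->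
  forall rho, 0 < rho -> exists r, [/\ 0 < r, r < rho, Num.min kap 1 / 16 * r ^+ 2 <= phi r &
    Num.min kap 1 / 16 * r ^+ 2 <= psi r].
Proof.
move=> k0 sum mono h1 h2 rho rho0; apply: contrapT => H.
set k := Num.min kap 1 / 16 in H.
have kk : 0 < k <= kap /\ k <= 1 / 16.
  by rewrite /k; case: (leP kap 1) => h; split; [apply/andP; split|lra|apply/andP; split|lra]; lra.
have [/andP[kp kle] k16] := kk.
have dich r : 0 < r -> r < rho -> k * r ^+ 2 <= psi r -> phi r < k * r ^+ 2.
  by move=> r0 rr hp; rewrite ltNge; apply/negP => h; apply: H; exists r.
have sq0 (r : R) : 0 < r -> 0 < r ^+ 2 by move=> r0; rewrite exprn_gt0.
have [r1 [r10 r1r hr1]] := h2 rho rho0.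
have p1 : phi r1 < k * r1 ^+ 2.
  apply: dich => //; apply: le_trans hr1; rewrite ler_wpM2r// ltW//; exact: sq0.
have key n : forall s : R, 0 < s -> r1 <= 2 ^+ n * s -> s <= r1 -> phi s < k * s ^+ 2.
  elim: n => [|n ih] s s0.
    by rewrite expr0 mul1r => a b; have -> : s = r1 by apply/le_anti; rewrite a b.
  move=> rs sr.
  pose t := Num.min (2 * s) r1.
  have t0 : 0 < t by rewrite lt_min r10 mulr_gt0.
  have st : s <= t by rewrite le_min sr andbT; lra.
  have ts : t <= 2 * s by rewrite ge_min lexx.
  have ht : phi t < k * t ^+ 2.
    apply: ih => //; last by rewrite ge_min lexx orbT.
    rewrite /t; case: (leP (2 * s) r1) => h; first by move: rs; rewrite exprSr -mulrA.
    by rewrite ler_peMl ?(ltW r10)// exprn_ege1// ler1n.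
  have t2 : t ^+ 2 <= 4 * s ^+ 2.
    have -> : 4 * s ^+ 2 = (2 * s) ^+ 2 by ring.
    by rewrite ler_sqr ?nnegrE ?(ltW t0)// mulr_ge0// ltW.
  have s2 := sq0 s s0.
  have h3 : phi s < 4 * (k * s ^+ 2).
    apply: (le_lt_trans (mono s t s0 st)); apply: (lt_le_trans ht).
    by have := ler_wpM2l (ltW kp) t2; lra.
  have h4 : k * s ^+ 2 <= s ^+ 2 / 16.
    by have := ler_wpM2r (ltW s2) k16; lra.
  apply: dich => //; first exact: le_lt_trans sr r1r.
  by have := sum s s0; lra.
have [r2 [r20 r2r hr2]] := h1 r1 r10.
have [n hn] : exists n : nat, r1 / r2 <= 2 ^+ n.
  exists (Num.Def.archi_bound (r1 / r2)); apply: ltW.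
  apply: (@lt_trans _ _ (Num.Def.archi_bound (r1 / r2))%:R).
    by apply: archi_boundP; rewrite divr_ge0// ltW.
  by rewrite -natrX ltr_nat; exact: ltn_expl.
have := key n r2 r20; rewrite -ler_pdivrMr// => /(_ hn (ltW r2r)).
by have := ler_wpM2r (ltW (sq0 r2 r20)) kle; lra.
Qed.

Lemma ar_mono (B : set P) (x : R * R) r s : measurable B -> r <= s -> ar B r x <= ar B s x.
Proof.
move=> mB rs; apply: le_J; [exact: ar_bcs|exact: ar_bcs|].
move=> z; rewrite !indicE.
have [/set_mem [Bz /sqP zr]|_] := boolP (z \in B `&` sq x r); last by rewrite ler0n.
by rewrite mem_set//; split => //; apply/sqP; exact: le_trans rs.
Qed.

Lemma boundary_piece_null (E F F' : set (R * R)) : piece E F -> null_eq F F' ->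
  hausdorff1 (mt_boundary F' `\` mt_boundary E) = 0%E.
Proof.
move=> pF FF'; have [fF fG FE _] := pF; have fE := piece_fp pF.
have pe := piece_eq pF.
have [BE [mE eE]] := ex_borel (fp_lebm fE); have [B0 [mB0 eB0]] := ex_borel (fp_lebm fF).
pose BF : set P := B0 `&` BE.
have mF : measurable BF by exact: measurableI.
have BFE : BF `<=` BE by exact: subIsetr.
have eF : null_eq F BF by have := null_eqI eB0 eE; rewrite (setIidl FE).
have eG : null_eq (E `\` F) (BE `\` BF : set P) by exact: null_eqD.
have mG : measurable (BE `\` BF : set P) by exact: measurableD.
have hF : per_le BF (per F) by apply/(Per_leP _ mF eF); rewrite -Per_fin.
have hG : per_le (BE `\` BF : set P) (per (E `\` F)) by apply/(Per_leP _ mG eG); rewrite -Per_fin.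
have mC : measurable (~` BE : set P) by exact: measurableC.
have mFC : measurable (~` BF : set P) by exact: measurableC.
have eF' : null_eq F' BF by exact: null_eq_trans (null_eq_sym FF') eF.
pose K m := (m.+1%:R : R)^-1.
(* Points of density 0 for the complement of E, sorted by a lower bound [1/(m+1)] on the mixed
   density of F. Countably many classes suffice, and each gets its own constant [k]. *)
pose S m := [set x : R * R | (forall tau, 0 < tau -> exists2 rho, 0 < rho &
     forall r, 0 < r -> r < rho -> ar (~` BE) r x <= tau * r ^+ 2) /\
   forall rho, 0 < rho -> exists r, [/\ 0 < r, r < rho, K m * r ^+ 2 <= ar BF r x &
     K m * r ^+ 2 <= ar (~` BF) r x]].
have arC r x : 0 <= r -> ar (~` BF) r x = 4 * r ^+ 2 - ar BF r x.
  by move=> r0; rewrite -(ar_C x mF r0) /ar setIC -setDE.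
apply: small_cover_hausdorff; apply: (@small_coverS _ _ (\bigcup_m S m)).
  move=> x [[up1 up2] nE].
  have [k1 k10 h1] := upper_density_pos mF eF' up1.
  (* F lies in E, so E has positive upper density at x; off the boundary of E this leaves none for
     the complement. *)
  have out : ~ (0 < upper_density (~` E) x)%E.
    move=> h; apply: nE; split; last exact: h.
    apply: contrapT => nup.
    have k12 : 0 < k1 / 2 by rewrite divr_gt0.
    have [rho rho0 hrho] := upper_density_zero mE eE nup k12.
    have [r [r0 rr hr]] := h1 rho rho0.
    have le : ar BF r x <= ar BE r x.
      apply: le_J; [exact: ar_bcs|exact: ar_bcs|move=> z].
      rewrite !indicE; have [/set_mem [Bz sz]|_] := boolP (z \in BF `&` sq x r); last by rewrite ler0n.
      rewrite mem_set; first exact: lexx.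
      by split; [exact: BFE|exact: sz].
    have r2 : 0 < r ^+ 2 by rewrite exprn_gt0.
    have k1r : 0 < k1 * r ^+ 2 by rewrite mulr_gt0.
    by have := hrho r r0 rr; lra.
  have [k2 k20 h2] := upper_density_pos mFC (null_eqC eF') up2.
  have out0 := upper_density_zero mC (null_eqC eE) out.
  move: {up1 up2 nE out} h1 h2 out0 => h1 h2 out0.
  pose k := Num.min k1 k2; have k0 : 0 < k by rewrite lt_min k10.
  have sq2 (r : R) : 0 <= r ^+ 2 := sqr_ge0 r.
  have [m hm] : exists m, K m < Num.min k 1 / 16.
    by apply: small_inv; rewrite divr_gt0// lt_min k0 ltr01.
  exists m; first by []. split; first exact: out0.
  move=> rho rho0.
  have sum r : 0 < r -> ar BF r x + ar (~` BF) r x = 4 * r ^+ 2.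
    by move=> r0; rewrite (arC _ _ (ltW r0)) addrC subrK.
  have g1 u : 0 < u -> exists r, [/\ 0 < r, r < u & k * r ^+ 2 <= ar BF r x].
    move=> u0; have [r [r0 ru h]] := h1 u u0; exists r; split; rewrite ?r0 ?ru//.
    by apply: le_trans h; rewrite ler_wpM2r// ge_min lexx.
  have g2 u : 0 < u -> exists r, [/\ 0 < r, r < u & k * r ^+ 2 <= ar (~` BF) r x].
    move=> u0; have [r [r0 ru h]] := h2 u u0; exists r; split; rewrite ?r0 ?ru//.
    by apply: le_trans h; rewrite ler_wpM2r// ge_min lexx orbT.
  have mono r s : 0 < r -> r <= s -> ar BF r x <= ar BF s x by move=> _; exact: ar_mono.
  have [r [r0 rr a1 a2]] := mixed_radius k0 sum mono g1 g2 rho0.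
  have le r' : K m * r' ^+ 2 <= Num.min k 1 / 16 * r' ^+ 2 by rewrite ler_wpM2r// ltW.
  by exists r; split; [exact: r0|exact: rr|exact: le_trans (le r) a1|exact: le_trans (le r) a2].
apply: small_cover_bigcup => m; apply: small_cover_squares => rho e rho0 e0.
have Km : 0 < K m by rewrite invr_gt0 ltr0n.
(* If no field on [sq x (4 * t)] reached [4 k t], [rel_poincare] would bound the product of the two
   areas by [256 k t^4], half of the lower bound [(K m * t^2)^2]. *)
pose k := K m ^+ 2 / 512; have k0 : 0 < k by apply: divr_gt0; [exact: exprn_gt0|exact: ltr0Sn].
pose eps := k * e / 2; have eps0 : 0 < eps by rewrite divr_gt0// mulr_gt0.
have [f [g [d [tf opt]]]] : exists f g d, test_field f g d /\
    per F + per (E `\` F) - eps <= J (fun z => \1_BE z * d z).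
  apply: contrapT => H.
  have h : (Per E <= (per E - eps)%:E)%E.
    apply/(Per_leP _ mE eE) => f g d tf; rewrite -pe; apply/ltW; rewrite ltNge.
    by apply/negP => h; apply: H; exists f, g, d.
  by move: h; rewrite Per_fin// lee_fin; lra.
have [M dM] : exists M, forall z, `|d z| <= M.
  by have [_ _ [_ [M [h _]]]] := test_field_bcs tf; exists M.
have M0 : 0 <= M by exact: le_trans (normr_ge0 _) (dM 0).
have cand x : S m x -> forall e, 0 < e -> exists2 r, r < e & candidate BE BF k M x r.
  move=> [hE hM] e1 e10; have [rt rt0 hrt] := hE (k / 256) (divr_gt0 k0 (ltr0Sn _ _)).
  (* The candidate radius is [4 t]; the three bounds give [4 t < e1], a double square of half-side
     [8 t < rt], and [M * (4 t) <= 1]. *)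
  pose u := Num.min (e1 / 4) (Num.min (rt / 8) (1 / (4 * (M + 1)))).
  have M4 : 0 < 4 * (M + 1) by lra.
  have u0 : 0 < u by rewrite !lt_min !divr_gt0.
  have [t [t0 tu a1 a2]] := hM u u0.
  move: tu; rewrite !lt_min => /and3P[t1 t2]; rewrite ltr_pdivlMr// => t3.
  exists (4 * t); first by lra.
  have t4 : 0 < 4 * t by lra.
  split.
  - exact: t4.
  - have := mulr_ge0 M0 (ltW t0); lra.
  - apply: contrapT => H.
    have ho : per_le_on (sq x (4 * t)) BF (k * (4 * t)).
      move=> f1 g1 d1 tf1 v1; apply/ltW; rewrite ltNge; apply/negP => h.
      by apply: H; exists f1, g1, d1.
    have kt : 0 <= k * (4 * t) by rewrite mulr_ge0// ltW.
    have hp : ar BF t x * ar (~` BF) t x <= 64 * t ^+ 3 * (k * (4 * t)).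
      rewrite (arC _ _ (ltW t0)) -(ar_C x mF (ltW t0)).
      exact: rel_poincare mF ho t0 kt (@subset_refl _ _).
    move: hp; rewrite leNgt => /negP; apply.
    have kt2 : 0 < K m * t ^+ 2 by rewrite mulr_gt0// exprn_gt0.
    apply: (@lt_le_trans _ _ (K m * t ^+ 2 * (K m * t ^+ 2))); last by apply: ler_pM => //; exact: ltW.
    have -> : 64 * t ^+ 3 * (k * (4 * t)) = K m * t ^+ 2 * (K m * t ^+ 2) / 2.
      by rewrite /k; field.
    have := mulr_gt0 kt2 kt2; lra.
  - have t8 : 0 < 2 * (4 * t) by lra.
    have := hrt _ t8; rewrite {1}/ar setIC -setDE => /(_ ltac:(lra)) h.
    apply: (le_trans h); rewrite (_ : k / 256 * _ = k / 64 * (4 * t) ^+ 2); first exact: lexx.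
    by field.
have [X [r [hr SX sum]]] :=
  candidate_cover mE mF BFE hF hG k0 tf dM opt rho0 (ltW eps0) cand.
exists X, r; split => // n; apply: (le_trans (sum n)).
by rewrite le_eqVlt; apply/orP; left; apply/eqP; rewrite /eps; field; exact: lt0r_neq0.
Qed.

End Density.

(** * Oscillation of measurable sets on a line *)

Section Line.
Context {R : realType}.
Local Notation T := (measurableTypeR R).
Local Notation leb1 := (@lebesgue_measure R).
Implicit Types (S : set T) (a b c x h : R).

(** Half-open intervals concatenate exactly, so lengths add without treating endpoints. *)
Definition len S a b : R := fine (leb1 (S `&` `]a, b]%classic)).

Lemma mlen S a b : measurable S -> measurable (S `&` `]a, b]%classic : set T).
Proof. by move=> mS; apply: measurableI. Qed.

Lemma lenE S a b : measurable S -> leb1 (S `&` `]a, b]%classic) = (len S a b)%:E.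
Proof.
move=> mS; rewrite /len fineK// ge0_fin_numE ?measure_ge0//.
apply: (@le_lt_trans _ _ (leb1 `[a, b]%classic)); last exact: leb1_itv_lty.
apply: le_measure; rewrite ?inE//; first exact: mlen.
move=> x [_] /=; rewrite !in_itv/= => /andP[ax ->]; by rewrite ltW.
Qed.

Lemma len_ge0 S a b : 0 <= len S a b.
Proof. by rewrite fine_ge0// measure_ge0. Qed.

Lemma len_le S S' a b a' b' : measurable S -> measurable S' ->
  (forall x, S x -> a < x <= b -> S' x /\ a' < x <= b') -> len S a b <= len S' a' b'.
Proof.
move=> mS mS' h; rewrite -lee_fin -!lenE//; apply: le_measure; rewrite ?inE//.
- exact: mlen.
- exact: mlen.
- by move=> x [Sx] /=; rewrite !in_itv/= => /(h _ Sx).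
Qed.

Lemma lenT a b : a <= b -> len setT a b = b - a.
Proof.
move=> ab; rewrite /len setTI lebesgue_measure_itv /= lte_fin.
by case: ltP => // ba; rewrite (_ : a = b) ?subrr//; apply/le_anti; rewrite ab.
Qed.

Lemma len_add S a b c : measurable S -> a <= b -> b <= c -> len S a c = len S a b + len S b c.
Proof.
move=> mS ab bc; apply: EFin_inj; rewrite EFinD -!lenE//.
rewrite -measureU; [|exact: mlen|exact: mlen|].
  congr leb1; rewrite -setIUr; congr (S `&` _); apply/seteqP; split => x /=; rewrite !in_itv/=.
    by move=> /andP[ax xc]; case: (leP x b) => xb; [left; rewrite ax|right; rewrite xc].
  by move=> [/andP[ax xb]|/andP[bx xc]]; apply/andP; split; lra.
apply/seteqP; split => // x [[_ /= +] [_ /= +]]; rewrite !in_itv/= => /andP[_ xb] /andP[bx _].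
by move: bx; rewrite ltNge xb.
Qed.

Lemma len_C S a b : measurable S -> a <= b -> len S a b + len (~` S) a b = b - a.
Proof.
move=> mS ab; have mC : measurable (~` S) by exact: measurableC.
rewrite -lenT//; apply: EFin_inj; rewrite EFinD -!lenE//.
rewrite -measureU; [|exact: mlen|exact: mlen|].
  by congr leb1; rewrite -setIUl setUv.
by rewrite setIACA setICr set0I.
Qed.

Lemma len_tr S t a b : measurable S -> len (tr t S) a b = len S (a + t) (b + t).
Proof.
move=> mS; rewrite /len -(leb1_tr t (mlen (a + t) (b + t) mS)); congr (fine (leb1 _)).
by apply/seteqP; split => x [Sx] /=; rewrite !in_itv/= ?ltrD2r ?lerD2r => h; split => //=;
  rewrite in_itv/= ?ltrD2r ?lerD2r // ; move: h; rewrite ltrD2r lerD2r.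
Qed.

Definition sdiff (A B : set T) : set T := (A `\` B) `|` (B `\` A).

Lemma measurable_sdiff A B : measurable A -> measurable B -> measurable (sdiff A B).
Proof. by move=> mA mB; apply: measurableU; exact: measurableD. Qed.

Lemma sdiffC A B : sdiff A B = sdiff B A.
Proof. by rewrite /sdiff setUC. Qed.

Lemma len_diff A B a b : measurable A -> measurable B ->
  len A a b <= len B a b + len (sdiff A B) a b.
Proof.
move=> mA mB; have mD := measurable_sdiff mA mB.
rewrite -lee_fin EFinD -!lenE//.
apply: le_trans (measureU2 _ (mlen a b mB) (mlen a b mD)).
apply: le_measure; rewrite ?inE; [exact: mlen|by apply: measurableU; exact: mlen|].
by move=> x [Ax xab]; have [Bx|Bx] := pselect (B x); [left|right; split => //; left].
Qed.

Definition dense1 S x := forall tau : R, 0 < tau -> exists2 r0 : R, 0 < r0 &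
  forall r, 0 < r -> r < r0 -> len (~` S) (x - r) (x + r) <= tau * r.

Lemma dense1_ae S : measurable S -> exists N : set T, [/\ measurable N, leb1 N = 0%E &
  forall x, S x -> ~ N x -> dense1 S x].
Proof.
move=> mS; have mC : measurable (~` S) by exact: measurableC.
have [N [mN N0 hN]] := lebesgue_density mC.
exists N; split => // x Sx nN tau tau0.
have := contra_not (hN x) nN => /contrapT /=.
rewrite indicE memNset; last by apply.
move=> cv.
have t4 : 0 < tau / 4 by rewrite divr_gt0.
have : \forall r \near (0 : R)^'+, (leb1 (~` S `&` ball x r) * (leb1 (ball x r))^-1 < (tau / 4)%:E)%E.
  apply: (cv [set y | (y < (tau / 4)%:E)%E]); apply: open_nbhs_nbhs; split.
    exact: open_ereal_lt_ereal.
  by rewrite /= lte_fin.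
move=> [e /= e0 he]; exists (e / 2); first by rewrite divr_gt0.
(* The open ball of radius [2 r] contains the half-open interval with its endpoint; its length [4 r]
   accounts for [tau / 4]. *)
move=> r r0 re; have r2 : 0 < 2 * r by rewrite mulr_gt0.
have := he (2 * r); rewrite /ball_ /= sub0r normrN gtr0_norm// => /(_ (ltac:(lra)) r2).
rewrite (lebesgue_measure_ball _ (ltW r2)).
have e4 : 2 * r *+ 2 = 4 * r by rewrite -mulr_natr; ring.
have r4 : 0 < 4 * r by lra.
rewrite e4 inver gt_eqF// lte_pdivrMr// => h.
rewrite -lee_fin -lenE//; apply: (@le_trans _ _ (leb1 (~` S `&` ball x (2 * r)))).
  apply: le_measure; rewrite ?inE; [exact: mlen|by apply: measurableI => //; exact: measurable_ball|].
  move=> y [Sy /=]; rewrite in_itv/= => /andP[y1 y2]; split => //.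
  by rewrite ball_itv /= in_itv/=; apply/andP; split; lra.
apply: (le_trans (ltW h)); rewrite -EFinM lee_fin; lra.
Qed.

Lemma dense1_pos S a b : measurable S -> 0 < len S a b ->
  exists x, [/\ S x, dense1 S x & a < x <= b].
Proof.
move=> mS l0; have [N [mN N0 hN]] := dense1_ae mS; apply: contrapT => H.
have : (leb1 (S `&` `]a, b]%classic) <= leb1 N)%E.
  apply: le_measure; rewrite ?inE//; first exact: mlen.
  move=> x [Sx /=]; rewrite in_itv/= => xab; apply: contrapT => nN; apply: H.
  by exists x; split => //; exact: hN.
by rewrite N0 lenE// lee_fin leNgt l0.
Qed.

Lemma dense1_pick S x r : measurable S -> dense1 S x -> 0 < r ->
  (exists y, [/\ S y, dense1 S y & x < y < x + r]) /\
  (exists y, [/\ S y, dense1 S y & x - r < y < x]).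
Proof.
move=> mS dS r0; have [r1 r10 h] := dS 2^-1 (ltac:(by rewrite invr_gt0)).
have mC : measurable (~` S) by exact: measurableC.
pose s := Num.min r r1 / 2.
have s0 : 0 < s by rewrite divr_gt0// lt_min r0.
have mr : Num.min r r1 <= r by rewrite ge_min lexx.
have mr1 : Num.min r r1 <= r1 by rewrite ge_min lexx orbT.
have sr : s < r by rewrite /s; lra.
have sr1 : s < r1 by rewrite /s; lra.
have hs := h s s0 sr1.
have e11 := @len_add (~` S) (x - s) (x - s / 4) (x + s) mC ltac:(lra) ltac:(lra).
have e12 := @len_add (~` S) (x - s / 4) x (x + s) mC ltac:(lra) ltac:(lra).
have p1 := len_ge0 (~` S) (x - s) (x - s / 4).
have p2 := len_ge0 (~` S) (x - s / 4) x.
have p3 := len_ge0 (~` S) x (x + s).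
split.
  have e2 : len S x (x + s) + len (~` S) x (x + s) = s by rewrite len_C//; [ring|lra].
  have [|y [Sy dy /andP[y1 y2]]] := @dense1_pos S x (x + s) mS; first by lra.
  by exists y; split => //; rewrite y1/=; lra.
(* Stopping at [x - s / 4] excludes x itself; the complement, of length at most [s / 2], cannot fill
   the remaining [3 s / 4]. *)
have e2 : len S (x - s) (x - s / 4) + len (~` S) (x - s) (x - s / 4) = s - s / 4 by rewrite len_C//; [ring|lra].
have [|y [Sy dy /andP[y1 y2]]] := @dense1_pos S (x - s) (x - s / 4) mS; first by lra.
by exists y; split => //; apply/andP; split; lra.
Qed.

(** Moving the window from u to v changes its content by the integral, from [u - h] to [v - h], of
    the indicator of S at [x + 2 h] minus that at x. *)
Lemma len_window S (u v h : R) : measurable S -> u <= v -> 0 < h ->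
  `|len S (v - h) (v + h) - len S (u - h) (u + h)| <= len (sdiff S (tr (2 * h) S)) (u - h) (v - h).
Proof.
move=> mS uv h0; have mt := measurable_tr (2 * h) mS.
have l1 := len_diff (u - h) (v - h) mS mt.
have l2 := len_diff (u - h) (v - h) mt mS.
rewrite sdiffC in l2.
have tE : len (tr (2 * h) S) (u - h) (v - h) = len S (u + h) (v + h).
  by rewrite len_tr//; congr len; ring.
have e1 := @len_add S (u - h) (u + h) (v + h) mS ltac:(lra) ltac:(lra).
have e2 := @len_add S (u - h) (v - h) (v + h) mS ltac:(lra) ltac:(lra).
by rewrite tE in l1 l2; rewrite ler_norml; apply/andP; split; lra.
Qed.

Lemma dense1_len S x : measurable S -> dense1 S x -> exists2 r0 : R, 0 < r0 &
  forall r, 0 < r -> r < r0 -> 3 / 2 * r <= len S (x - r) (x + r).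
Proof.
move=> mS dS; have [r0 r00 h] := dS 2^-1 (ltac:(by rewrite invr_gt0)).
exists r0 => // r rp rr; have := h r rp rr.
have : len S (x - r) (x + r) + len (~` S) (x - r) (x + r) = (x + r) - (x - r) by rewrite len_C//; lra.
lra.
Qed.

Lemma len_two S (a b c d e f : R) : measurable S -> a <= b -> b <= c -> c <= d -> d <= e -> e <= f ->
  len S b c + len S d e <= len S a f.
Proof.
move=> mS ab bc cd de ef.
have af : [/\ a <= c, c <= e & c <= f] by split; lra.
have [ac ce cf] := af.
apply: (@le_trans _ _ (len S a c + len S c f)); last by rewrite -len_add.
by apply: lerD; apply: (len_le mS mS) => x Sx /andP[x1 x2]; split => //; apply/andP; split; lra.
Qed.

(** Density points of S accumulate at x, and between each of them and x there are density points of
    the complement. Every alternation adds at least h to the difference at scale [2 h]; induction on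
    smaller neighbourhoods of x produces any number of them. *)
Lemma oscillation S x : measurable S -> ~ S x -> dense1 (~` S) x ->
  (forall e : R, 0 < e -> 0 < len S (x - e) (x + e)) ->
  forall (k : nat) (e : R), 0 < e -> exists2 h0 : R, 0 < h0 & forall h, 0 < h -> h < h0 ->
    k%:R * h <= len (sdiff S (tr (2 * h) S)) (x - e) (x + e).
Proof.
move=> mS nSx dx pos; have mC : measurable (~` S) by exact: measurableC.
have small y : dense1 (~` S) y -> exists2 r0 : R, 0 < r0 &
    forall r, 0 < r -> r < r0 -> len S (y - r) (y + r) <= 2^-1 * r.
  by move=> dy; have := dy 2^-1 (ltac:(by rewrite invr_gt0)); rewrite setCK.
elim=> [|k ih] e e0.
  by exists 1 => // h _ _; rewrite mul0r len_ge0.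
have e2 : 0 < e / 2 by rewrite divr_gt0.
have [y [Sy dy /andP[y1 y2]]] := dense1_pos mS (pos _ e2).
have [r1 r10 h1] := dense1_len mS dy.
have yx : y != x by apply/eqP => yx; rewrite yx in Sy.
have mD h : measurable (sdiff S (tr (2 * h) S)).
  by apply: measurable_sdiff => //; exact: measurable_tr.
have [xy|yx'|e'] := ltgtP x y; last by rewrite e' eqxx in yx.
  have yx0 : 0 < y - x by lra.
  have [[z [nSz dz /andP[z1 z2]]] _] := dense1_pick mC dx yx0.
  have [r2 r20 h2] := small z dz.
  have d0 : 0 < (z - x) / 2 by lra.
  have [h0 h00 hh] := ih _ d0.
  exists (Num.min (Num.min h0 r1) (Num.min r2 (Num.min ((z - x) / 2) (e / 2)))).
    by rewrite !lt_min h00 r10 r20 d0 e2.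
  move=> h hp; rewrite !lt_min => /andP[/andP[a1 a2] /and3P[a3 a4 a5]].
  have b4 := hh h hp a1; have b3 := h1 h hp a2; have b2 := h2 h hp a3.
  (* The window at [y] contains at least [3/2 h] of S and the window at [z] at most [1/2 h], so this
     stretch contributes h; it is disjoint from the interval used by induction. *)
  have b1 := @len_window S z y h mS ltac:(lra) hp.
  rewrite -[k.+1%:R]natr1 mulrDl mul1r.
  have := ler_norm (len S (y - h) (y + h) - len S (z - h) (z + h)) => b5.
  have [c1 c2 c3 c4 c5] : [/\ x - e <= x - (z - x) / 2, x - (z - x) / 2 <= x + (z - x) / 2,
    x + (z - x) / 2 <= z - h, z - h <= y - h & y - h <= x + e] by clear - e0 z1 z2 y2 hp a4 a5; split; lra.
  apply: le_trans (len_two (mD h) c1 c2 c3 c4 c5); clear - b1 b2 b3 b4 b5; lra.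
have yx0 : 0 < x - y by lra.
have [_ [z [nSz dz /andP[z1 z2]]]] := dense1_pick mC dx yx0.
have [r2 r20 h2] := small z dz.
have d0 : 0 < (x - z) / 2 by lra.
have [h0 h00 hh] := ih _ d0.
exists (Num.min (Num.min h0 r1) (Num.min r2 (Num.min ((x - z) / 2) (e / 2)))).
  by rewrite !lt_min h00 r10 r20 d0 e2.
move=> h hp; rewrite !lt_min => /andP[/andP[a1 a2] /and3P[a3 a4 a5]].
have b4 := hh h hp a1; have b3 := h1 h hp a2; have b2 := h2 h hp a3.
have b1 := @len_window S y z h mS ltac:(lra) hp.
rewrite -[k.+1%:R]natr1 mulrDl mul1r.
have := ler_norm (- (len S (z - h) (z + h) - len S (y - h) (y + h))); rewrite normrN => b5.
have [c1 c2 c3 c4 c5] : [/\ x - e <= y - h, y - h <= z - h, z - h <= x - (x - z) / 2,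
  x - (x - z) / 2 <= x + (x - z) / 2 & x + (x - z) / 2 <= x + e].
  by clear - e0 z1 z2 y1 hp a4 a5; split; lra.
apply: le_trans (len_two (mD h) c1 c2 c3 c4 c5); clear - b1 b2 b3 b4 b5; lra.
Qed.

(** Otherwise [oscillation] with more than [2 |K|] alternations contradicts the bound on difference
    quotients; infinitely many n suffice, since only one small displacement is needed. *)
Lemma regular_line S x (N K : R) : measurable S -> ~ S x -> dense1 (~` S) x -> - N < x < N ->
  (forall n0, exists2 n, (n0 <= n)%N & n.+1%:R * len (sdiff S (tr n.+1%:R^-1 S)) (- N) N <= K) ->
  exists2 e : R, 0 < e & len S (x - e) (x + e) = 0.
Proof.
move=> mS nSx dx /andP[x1 x2] hK; apply: contrapT => H.
have pos (e : R) : 0 < e -> 0 < len S (x - e) (x + e).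
  move=> e0; rewrite lt_neqAle len_ge0 andbT; apply/eqP => h; apply: H; exists e => //.
pose e := Num.min (x + N) (N - x).
have e0 : 0 < e by rewrite lt_min; apply/andP; split; lra.
have eN1 : e <= x + N by rewrite ge_min lexx.
have eN2 : e <= N - x by rewrite ge_min lexx orbT.
have [n0 kn] : exists n0 : nat, 2 * `|K| < n0%:R.
  by exists (Num.Def.archi_bound (2 * `|K|)); apply: archi_boundP; rewrite mulr_ge0.
have [h0 h00 hh] := oscillation mS nSx dx pos n0 e0.
have [n1 hn1] := small_inv h00.
have [n nn hn] := hK n1.
have n0' : (0 : R) < n.+1%:R by rewrite ltr0n.
have i0 : (0 : R) < n.+1%:R^-1 by rewrite invr_gt0.
(* Windows of half-width h compare translates by [2 h], which must be one of the displacements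
   [1/(n+1)]. *)
pose h : R := n.+1%:R^-1 / 2.
have hp : 0 < h by rewrite divr_gt0.
have hlt : h < h0.
  have : n.+1%:R^-1 <= n1.+1%:R^-1 :> R by rewrite lef_pV2 ?posrE ?ltr0n// ler_nat.
  by move=> le1; have l2 := le_lt_trans le1 hn1; apply: le_lt_trans l2; rewrite /h ler_pdivrMr// ler_peMr ?(ltW i0)// ler1n.
have := hh h hp hlt; have -> : 2 * h = n.+1%:R^-1 by rewrite /h; field; exact: lt0r_neq0.
have mD : measurable (sdiff S (tr n.+1%:R^-1 S)).
  by apply: measurable_sdiff => //; exact: measurable_tr.
have le1 : len (sdiff S (tr n.+1%:R^-1 S)) (x - e) (x + e) <= len (sdiff S (tr n.+1%:R^-1 S)) (- N) N.
  apply: len_le => // z Sz /andP[z1 z2]; split => //; apply/andP; split; lra.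
move=> g; have {}g := le_trans g le1.
have : n.+1%:R * (n0%:R * h) <= K by apply: le_trans hn; rewrite ler_wpM2l// ltW.
have -> : n.+1%:R * (n0%:R * h) = n0%:R / 2 :> R by rewrite /h; field; exact: lt0r_neq0.
have := ler_norm K; lra.
Qed.

End Line.

(** * Horizontal slices of sets of finite perimeter *)

Section Slices.
Context {R : realType}.
Local Notation T := (measurableTypeR R).
Local Notation P := (T * T)%type.
Local Notation leb1 := (@lebesgue_measure R).
Local Notation lam2 := (@lam2 R).
Local Notation J := (@J R).

(** A Fatou-type argument. By Markov, [f n > k + 1] on a set of measure at most [c / (k + 1)]; the
    points where this holds for all large n form an increasing union under the same bound, and k
    tends to infinity. *)
Lemma frequently_bounded (f : nat -> T -> R) (c : R) :
  (forall n, measurable_fun setT (f n)) -> (forall n y, 0 <= f n y) ->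
  (forall n, (\int[leb1]_y (f n y)%:E <= c%:E)%E) ->
  exists Z : set T, [/\ measurable Z, leb1 Z = 0%E &
    forall y, ~ Z y -> exists K, forall n0, exists2 n, (n0 <= n)%N & f n y <= K].
Proof.
move=> mf f0 fc.
pose G n (k : nat) : set T := f n @^-1` `]k.+1%:R, +oo[%classic.
have mG n k : measurable (G n k) by rewrite -[G n k]setTI; exact: mf.
have GE n k y : G n k y <-> k.+1%:R < f n y.
  by rewrite /G /= in_itv/= andbT.
have mk n k : (leb1 (G n k) <= (c / k.+1%:R)%:E)%E.
  have k0 : (0 : R) < k.+1%:R by rewrite ltr0n.
  rewrite EFinM lee_pdivlMr//.
  apply: le_trans (fc n); rewrite muleC -(integral_cst _ (mG n k)).
  apply: (@le_trans _ _ (\int[leb1]_(y in G n k) (f n y)%:E)%E).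
    apply: ge0_le_integral => //.
    - by move=> y /= _; rewrite lee_fin.
    - by apply/measurable_EFinP; exact: measurable_funTS.
    - by move=> y /GE h; rewrite /= lee_fin ltW.
  apply: ge0_subset_integral => //; first by apply/measurable_EFinP; exact: mf.
  by move=> y _; rewrite lee_fin.
pose H k n0 : set T := \bigcap_(n in [set n | (n0 <= n)%N]) G n k.
have mH k n0 : measurable (H k n0) by apply: bigcap_measurable => [|n _]; [exists n0 => /=|exact: mG].
pose Z : set T := \bigcap_k \bigcup_n0 H k n0.
have mU k : measurable (\bigcup_n0 H k n0) by exact: bigcupT_measurable.
have mZ : measurable Z by exact: bigcapT_measurable.
have leU k : (leb1 (\bigcup_n0 H k n0) <= (c / k.+1%:R)%:E)%E.
  have nd : nondecreasing_seq (H k).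
    move=> n m nm; apply/subsetPset => y h j /= mj; apply: h => /=; exact: leq_trans mj.
  have cv := nondecreasing_cvg_mu (mu := leb1) (mH k) (mU k) nd.
  rewrite -(cvg_lim _ cv)//; apply: lime_le; first by apply/cvg_ex; eexists; exact: cv.
  apply: nearW => n; apply: le_trans (mk n k); apply: le_measure; rewrite ?inE//.
  by move=> y; apply => /=.
exists Z; split => //.
  apply/eqP; rewrite eq_le measure_ge0 andbT; apply/lee_addgt0Pr => e e0; rewrite add0e.
  have c0 : 0 <= `|c| by [].
  have [k hk] : exists k : nat, `|c| / e < k%:R.
    by exists (Num.Def.archi_bound (`|c| / e)); apply: archi_boundP; rewrite divr_ge0// ltW.
  apply: (@le_trans _ _ (leb1 (\bigcup_n0 H k n0))).
    by apply: le_measure; rewrite ?inE// => y; exact.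
  apply: (le_trans (leU k)); rewrite lee_fin ler_pdivrMr ?ltr0n//.
  rewrite ltr_pdivrMr// in hk; have := ler_norm c; rewrite -natr1 mulrDr mulr1 [e * _]mulrC; lra.
move=> y /existsNP[k /not_implyP[_ hk]]; exists k.+1%:R => n0.
apply: contrapT => h; apply: hk; exists n0 => // n /= nn; apply/GE.
by rewrite ltNge; apply/negP => le; apply: h; exists n.
Qed.

Definition slice (C : set P) (y : R) : set T := [set x | C (x, y)].

Lemma measurable_slice (C : set P) y : measurable C -> measurable (slice C y).
Proof.
by move=> mC; have := measurable_pair2 (T1 := T) (T2 := T) y measurableT mC; rewrite setTI.
Qed.

Lemma lam2_slices (X : set P) : measurable X -> lam2 X = (\int[leb1]_y leb1 (slice X y))%E.
Proof.
move=> mX.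
have := @integral_indic _ _ R lam2 setT measurableT X mX; rewrite setIT => <-.
have mi : measurable_fun (setT : set P) (EFin \o (\1_X : P -> R)).
  by apply/measurable_EFinP; exact: measurable_indic.
rewrite (@fubini_tonelli2 _ _ T T R leb1 leb1 _ mi); last by move=> z; rewrite lee_fin indicE.
apply: eq_integral => y _.
have := @integral_indic _ _ R leb1 setT measurableT (slice X y) (measurable_slice y mX).
by rewrite setIT => <-.
Qed.

Lemma measurable_fun_slice (X : set P) : measurable X ->
  measurable_fun (setT : set T) (fun y => leb1 (slice X y)).
Proof.
move=> mX; have := @measurable_fun_ysection _ _ T T R leb1 X mX.
congr measurable_fun; apply/funext => y /=; congr leb1; apply/seteqP.
by split => x; rewrite /ysection /= ?inE.
Qed.

Lemma null_slices (X : set P) (Z : set T) : measurable X -> measurable Z -> leb1 Z = 0%E ->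
  (forall y, ~ Z y -> leb1 (slice X y) = 0%E) -> lam2 X = 0%E.
Proof.
move=> mX mZ Z0 hX; rewrite lam2_slices//.
rewrite -[RHS](@integral0 _ _ R leb1 setT); apply: ge0_ae_eq_integral => //.
- exact: measurable_fun_slice.
- exists Z; split => // y /= h; apply: contrapT => nZ; apply: h => _; exact: hX.
Qed.

Lemma J_slices (f : P -> R) : bcs f -> (forall z, 0 <= f z) ->
  (\int[leb1]_y (Rintegral leb1 setT (fun x => f (x, y)))%:E)%E = (J f)%:E.
Proof.
move=> bf f0; rewrite (EFinJ bf).
rewrite -(@integral21_prod_meas1 _ _ T T R leb1 leb1 (EFin \o f)); last exact: bcs_integrable.
apply: eq_integral => y _; rewrite /fubini_G /= /Rintegral fineK//.
by apply: integrable_fin_num => //; exact: line_integrable.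
Qed.

Lemma slice_len (C : set P) M y p q : measurable C -> (forall z, C z -> in_box M z) ->
  len (slice C y) p q <= Rintegral leb1 setT (fun x => \1_C (x, y)).
Proof.
move=> mC CM; have bC := bcs_indic mC CM.
rewrite -lee_fin -lenE; last exact: measurable_slice.
rewrite /Rintegral fineK; last by apply: integrable_fin_num => //; exact: line_integrable.
have := @integral_indic _ _ R leb1 setT measurableT (slice C y) (measurable_slice y mC).
rewrite setIT => e; rewrite [leRHS]e; apply: le_measure; rewrite ?inE.
- by apply: mlen; exact: measurable_slice.
- exact: measurable_slice.
- by move=> x [].
Qed.

Lemma len_U (A B : set T) (p q : R) : measurable A -> measurable B ->
  len (A `|` B) p q <= len A p q + len B p q.
Proof.
move=> mA mB; rewrite -lee_fin EFinD -!lenE//; last exact: measurableU.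
by rewrite setIUl; apply: measureU2; exact: mlen.
Qed.

Lemma indic_ge0 (X : Type) (S : set X) z : 0 <= \1_S z :> R.
Proof. by rewrite indicE. Qed.

(** The translation estimate for the horizontal displacement [1/(n+1)], used for C and for its
    complement, bounds by [2 c] the integral over heights of the difference quotients;
    [frequently_bounded] then applies. *)
Lemma regular_slices (C : set P) c (N : nat) : measurable C -> per_le C c ->
  exists Z : set T, [/\ measurable Z, leb1 Z = 0%E & forall y, ~ Z y -> - N%:R <= y <= N%:R ->
   exists K, forall n0, exists2 n, (n0 <= n)%N &
    n.+1%:R * len (sdiff (slice C y) (tr n.+1%:R^-1 (slice C y))) (- N%:R) N%:R <= K].
Proof.
move=> mC hC; have hC' := per_leC mC hC; have mC' : measurable (~` C) by exact: measurableC.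
pose t n : R * R := (n.+1%:R^-1, 0).
pose X n : set P := (C `&` box N%:R) `&` [set z | (~` C) (z + t n)].
pose Y n : set P := (~` C `&` box N%:R) `&` [set z | C (z + t n)].
have mbox : measurable (box N%:R : set P) by exact: measurableX.
have mt (B : set P) n : measurable B -> measurable [set z : P | B (z + t n)].
  by move=> mB; have := @measurable_fun_translate2 R (t n) measurableT B mB; rewrite setTI.
have mX n : measurable (X n) by apply: measurableI; [exact: measurableI|exact: mt].
have mY n : measurable (Y n) by apply: measurableI; [exact: measurableI|exact: mt].
have boxM (z : P) : box N%:R z -> in_box N%:R z by move=> [] /=; rewrite !in_itv/= -!ler_norml.
have XM n z : X n z -> in_box N%:R z by move=> [[_ /boxM]].
have YM n z : Y n z -> in_box N%:R z by move=> [[_ /boxM]].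
have tn n : enorm (t n) = n.+1%:R^-1.
  by rewrite /enorm /= expr0n/= addr0 sqrtr_sqr ger0_norm// invr_ge0.
have JX n : J \1_(X n) <= n.+1%:R^-1 * c.
  have -> : \1_(X n) = (fun z => \1_(C `&` box N%:R) z * \1_(~` C) (z + t n)) :> (P -> R).
    by apply/funext => z; rewrite /X indicI.
  rewrite -tn.
  exact: (@shift_le _ C setT (C `&` box N%:R) (~` C) c (t n) N%:R 1 mC (per_le_onT hC)
    (measurableI _ _ mC mbox) mC' (@subIsetl _ _ _) (setICl C) (fun z h => boxM z (proj2 h)) ltr01
    (fun _ _ _ _ _ _ => I)).
have JY n : J \1_(Y n) <= n.+1%:R^-1 * c.
  have -> : \1_(Y n) = (fun z => \1_(~` C `&` box N%:R) z * \1_C (z + t n)) :> (P -> R).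
    by apply/funext => z; rewrite /Y indicI.
  rewrite -tn.
  exact: (@shift_le _ (~` C) setT (~` C `&` box N%:R) C c (t n) N%:R 1 mC' (per_le_onT hC')
    (measurableI _ _ mC' mbox) mC (@subIsetl _ _ _) (setICr C) (fun z h => boxM z (proj2 h)) ltr01
    (fun _ _ _ _ _ _ => I)).
have bX n := bcs_indic (mX n) (@XM n); have bY n := bcs_indic (mY n) (@YM n).
pose F n (z : P) : R := n.+1%:R * (\1_(X n) z + \1_(Y n) z).
have bF n : bcs (F n) by apply: bcsZ; exact: bcsD.
have F0 n z : 0 <= F n z by rewrite mulr_ge0// addr_ge0// indic_ge0.
pose f n (y : T) := Rintegral leb1 setT (fun x => F n (x, y)).
have f0 n y : 0 <= f n y by rewrite fine_ge0// integral_ge0// => x _; rewrite lee_fin.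
have mf n : measurable_fun setT (f n) by exact: measurable_line_integral.
have fc n : (\int[leb1]_y (f n y)%:E <= (2 * c)%:E)%E.
  rewrite (J_slices (bF n) (F0 n)) lee_fin /F JZ; last exact: bcsD.
  rewrite JD//; have n0 : (0 : R) < n.+1%:R by rewrite ltr0n.
  rewrite mulrC -ler_pdivlMr// (_ : 2 * c / _ = n.+1%:R^-1 * c + n.+1%:R^-1 * c); last by ring.
  exact: lerD.
have [Z [mZ Z0 hZ]] := frequently_bounded mf f0 fc.
exists Z; split => // y nZ yN; have [K hK] := hZ y nZ; exists K => n0.
have [n nn hn] := hK n0; exists n => //; apply: le_trans hn.
have e : f n y = n.+1%:R * (Rintegral leb1 setT (fun x => \1_(X n) (x, y)) +
                            Rintegral leb1 setT (fun x => \1_(Y n) (x, y))).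
  have iX := line_integrable y (bX n); have iY := line_integrable y (bY n).
  have iD := line_integrable y (bcsD (bX n) (bY n)).
  by rewrite -RintegralD// -RintegralZl.
rewrite e ler_wpM2l//.
apply: le_trans (lerD (slice_len y (- N%:R) N%:R (mX n) (@XM n)) (slice_len y (- N%:R) N%:R (mY n) (@YM n))).
have mS := measurable_slice y mC.
have mXs := measurable_slice y (mX n); have mYs := measurable_slice y (mY n).
apply: le_trans (len_U _ _ mXs mYs).
apply: len_le; [|exact: measurableU|].
  by apply: measurable_sdiff => //; exact: measurable_tr.
have add0 x : (x, y) + t n = (x + n.+1%:R^-1, y) by rewrite /t; pair_ring.
move=> x hx /andP[x1 x2]; split; last by rewrite x1.
have bx : box N%:R (x, y) by split; rewrite /= in_itv/=; [rewrite (ltW x1)|].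
case: hx => -[h1 h2]; [left|right]; split.
- by split.
- by rewrite /mkset add0.
- by split.
- by rewrite /mkset add0.
Qed.

End Slices.

(** * Cutting along rectangles whose sides almost miss the set *)

Section Rectangles.
Context {R : realType}.
Local Notation T := (measurableTypeR R).
Local Notation P := (T * T)%type.
Local Notation leb1 := (@lebesgue_measure R).
Local Notation lam2 := (@lam2 R).
Local Notation J := (@J R).

Lemma null_bigcup1 (N : nat -> set T) : (forall n, measurable (N n)) -> (forall n, leb1 (N n) = 0%E) ->
  measurable (\bigcup_n N n) /\ leb1 (\bigcup_n N n) = 0%E.
Proof.
move=> mN N0; have mU : measurable (\bigcup_n N n) by exact: bigcupT_measurable.
split => //; apply: (iffLR (@negligibleP _ T R leb1 _ mU)); apply: negligible_bigcup => n.
exact: (iffRL (@negligibleP _ T R leb1 _ (mN n)) (N0 n)).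
Qed.

Lemma measurable_null_line (C : set P) p q : measurable C ->
  measurable [set y : T | len (slice C y) p q = 0].
Proof.
move=> mC; pose X : set P := C `&` (`]p, q]%classic `*` setT).
have mX : measurable X by apply: measurableI => //; exact: measurableX.
have mf := measurable_fun_slice mX.
rewrite (_ : [set y | _] = (fun y => leb1 (slice X y)) @^-1` [set 0%E]); last first.
  have e y : leb1 (slice X y) = (len (slice C y) p q)%:E.
    rewrite -lenE; last exact: measurable_slice.
    by congr leb1; apply/seteqP; split => x; [move=> [? []]|move=> [? ?]; split].
  apply/seteqP; split => y /=; rewrite e; first by move=> ->.
  by move=> [].
rewrite -[X in measurable X]setTI; apply: mf => //; exact: emeasurable_set1.
Qed.

(** Rational endpoints leave countably many intervals, so the density theorem can be applied to all
    the corresponding sets of heights outside one null set. *)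
Lemma horizontal_lines (C : set P) c : measurable C -> per_le C c ->
  exists X : set P, [/\ measurable X, lam2 X = 0%E & forall z : R * R, ~ C z -> ~ X z ->
    exists (p q : R) (H : set T), [/\ p < z.1 < q, measurable H, dense1 H z.2 &
      forall y, H y -> len (slice C y) p q = 0]].
Proof.
move=> mC hC.
(* The default pair gives an empty open interval, which adds nothing to [W]. *)
pose idx (n : nat) : rat * rat := odflt (0, 0) (unpickle n).
pose p n : R := ratr (idx n).1; pose q n : R := ratr (idx n).2.
pose H n : set T := [set y | len (slice C y) (p n) (q n) = 0].
have mH n : measurable (H n) by exact: measurable_null_line.
pose N n := sval (cid (dense1_ae (mH n))).
have NP n : [/\ measurable (N n), leb1 (N n) = 0%E & forall x, H n x -> ~ N n x -> dense1 (H n) x] :=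
  svalP (cid (dense1_ae (mH n))).
pose Z n := sval (cid (regular_slices n mC hC)).
have ZP n : [/\ measurable (Z n), leb1 (Z n) = 0%E & forall y, ~ Z n y -> - n%:R <= y <= n%:R ->
   exists K, forall n0, exists2 k, (n0 <= k)%N &
    k.+1%:R * len (sdiff (slice C y) (tr k.+1%:R^-1 (slice C y))) (- n%:R) n%:R <= K] :=
  svalP (cid (regular_slices n mC hC)).
have [mNU NU0] : measurable (\bigcup_n N n) /\ leb1 (\bigcup_n N n) = 0%E.
  by apply: null_bigcup1 => n; case: (NP n).
have [mZU ZU0] : measurable (\bigcup_n Z n) /\ leb1 (\bigcup_n Z n) = 0%E.
  by apply: null_bigcup1 => n; case: (ZP n).
pose W : set P := \bigcup_n (`]p n, q n[%classic `*` H n).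
have mW : measurable W by apply: bigcupT_measurable => n; exact: measurableX.
have mC' : measurable (~` C) by exact: measurableC.
pose X0 : set P := ~` C `\` W.
have mX0 : measurable X0 by exact: measurableD.
pose X1 : set P := setT `*` \bigcup_n N n.
have mX1 : measurable X1 by exact: measurableX.
(* On a good line, almost every point off C is a density point of the complement and has by
   [regular_line] an interval almost free of C; shrinking it to rational endpoints puts the point in
   [W]. *)
have X00 : lam2 X0 = 0%E.
  apply: (null_slices mX0 mZU ZU0) => y nZ.
  have mS := measurable_slice y mC; have mSC : measurable (~` slice C y) by exact: measurableC.
  have [M [mM M0 hM]] := dense1_ae mSC.
  apply/eqP; rewrite eq_le measure_ge0 andbT -M0; apply: le_measure; rewrite ?inE//.
    exact: measurable_slice.
  move=> x [nCx nW]; apply: contrapT => nM.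
  have dx := hM x nCx nM.
  pose n := Num.Def.archi_bound (`|x| + `|y|).
  have hn : `|x| + `|y| < n%:R by apply: archi_boundP; rewrite addr_ge0.
  have xn : - n%:R < x < n%:R by rewrite -ltr_norml; apply: le_lt_trans hn; rewrite lerDl.
  have yn : - n%:R <= y <= n%:R by rewrite -ler_norml; apply/ltW; apply: le_lt_trans hn; rewrite lerDr.
  have nZn : ~ Z n y by move=> h; apply: nZ; exists n.
  have [_ _ /(_ y nZn yn)[K hK]] := ZP n.
  have [e e0 he] := regular_line mS nCx dx xn hK.
  have /rat_in_itvoo[r1] : x - e < x by lra.
  rewrite in_itv/= => /andP[r1a r1b].
  have /rat_in_itvoo[r2] : x < x + e by lra.
  rewrite in_itv/= => /andP[r2a r2b].
  apply: nW; exists (pickle (r1, r2)) => //.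
  rewrite /p /q /H /idx pickleK /=; split; rewrite /= ?in_itv/= ?r1b ?r2a//.
  apply/le_anti; rewrite len_ge0 andbT /q /p /idx pickleK /= -he.
  by apply: len_le => // u Su /andP[u1 u2]; split => //; apply/andP; split; lra.
have X10 : lam2 X1 = 0%E by rewrite lam2X// NU0 mule0.
exists (X0 `|` X1); split.
- exact: measurableU.
- by apply/eqP; rewrite eq_le measure_ge0 andbT; apply: (le_trans (measureU2 lam2 mX0 mX1)); rewrite [X in (X + _ <= _)%E]X00 [X in (_ + X <= _)%E]X10 adde0.
- move=> z nC nX; have [n _ [/= h1 h2]] : W z.
    by apply: contrapT => nW; apply: nX; left; split.
  exists (p n), (q n), (H n); split => //.
  have [_ _ h] := NP n; apply: h => // Nz; apply: nX; right; split => //; exists n => //.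
Qed.

Lemma per_le_flip (C : set P) c : measurable C -> per_le C c -> per_le (flip C : set P) c.
Proof.
move=> mC hC f g d tf; have [_ _ bd] := test_field_bcs tf.
have := hC _ _ _ (test_field_swap tf).
have mF := measurable_flip mC.
rewrite -(J_swap (bcsI mF bd)); congr (_ <= _); congr J; apply/funext => z.
by rewrite indic_flip; congr (\1_C _ * _); case: z.
Qed.

Lemma lam2_flip (X : set P) : measurable X -> lam2 (flip X : set P) = lam2 X.
Proof. by move=> mX; exact: lam2_swap. Qed.

(** Heights in H contribute nothing; by density the others have measure at most [tau * r], and each
    carries a slice of length at most [q - p]. *)
Lemma band_bound (C : set P) (p q c0 : R) (H : set T) : measurable C -> p <= q -> measurable H ->
  dense1 H c0 -> (forall y, H y -> len (slice C y) p q = 0) ->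
  forall tau, 0 < tau -> exists2 r0 : R, 0 < r0 & forall r, 0 < r -> r < r0 ->
  J \1_(C `&` (`]p, q]%classic `*` `]c0 - r, c0 + r]%classic)) <= (q - p) * (tau * r).
Proof.
move=> mC pq mH dH hH tau tau0; have [r0 r00 hr] := dH tau tau0; exists r0 => // r rp rr.
set X : set P := C `&` _.
have mX : measurable X by apply: measurableI => //; exact: measurableX.
pose M := `|p| + `|q| + `|c0| + r.
have XM z : X z -> in_box M z.
  move=> [_ [/=]]; rewrite !in_itv/= => /andP[a1 a2] /andP[a3 a4].
  have := ler_norm q; have := ler_norm (- p); rewrite normrN => b1 b2.
  have := ler_norm c0; have := ler_norm (- c0); rewrite normrN => b3 b4.
  have := normr_ge0 p; have := normr_ge0 q; have := normr_ge0 c0 => b5 b6 b7.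
  by split; rewrite ler_norml /M; apply/andP; split; lra.
rewrite -lee_fin -(leb2_J mX XM) leb2_borel// lam2_slices//.
have mHC : measurable (~` H) by exact: measurableC.
have mB : measurable (~` H `&` `]c0 - r, c0 + r]%classic : set T) by exact: mlen.
apply: (@le_trans _ _ (\int[leb1]_y ((q - p) * \1_(~` H `&` `]c0 - r, c0 + r]%classic) y)%:E)%E).
  apply: ge0_le_integral => //.
  - exact: measurable_fun_slice.
  - apply/measurable_EFinP; apply: measurable_funM; first exact: measurable_cst.
    exact: measurable_indic.
  - move=> y _; have [yb|nyb] := pselect (`]c0 - r, c0 + r]%classic y); last first.
      rewrite (_ : slice X y = set0) ?measure0 ?lee_fin ?mulr_ge0 ?subr_ge0 ?indic_ge0//.
      by apply/seteqP; split => // x [_ [_ /nyb]].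
    have -> : slice X y = slice C y `&` `]p, q]%classic.
      by apply/seteqP; split => x; [move=> [? []]|move=> [? ?]; split].
    rewrite lenE; last exact: measurable_slice.
    rewrite lee_fin; have [Hy|nHy] := pselect (H y).
      by rewrite hH// mulr_ge0 ?subr_ge0 ?indic_ge0.
    rewrite indicE mem_set// mulr1 -lenT//; apply: len_le => //; exact: measurable_slice.
pose g : T -> R := \1_(~` H `&` `]c0 - r, c0 + r]%classic).
have mg : measurable_fun setT (EFin \o g) by apply/measurable_EFinP; exact: measurable_indic.
have g0 y : setT y -> (0 <= (EFin \o g) y)%E by move=> _; rewrite lee_fin indic_ge0.
have qp0 : 0 <= q - p by rewrite subr_ge0.
have e : (\int[leb1]_y ((q - p) * g y)%:E = (q - p)%:E * \int[leb1]_y (EFin \o g) y)%E.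
  by rewrite -ge0_integralZl_EFin.
have eg : (\int[leb1]_y (EFin \o g) y = (len (~` H) (c0 - r) (c0 + r))%:E)%E.
  by rewrite -lenE// (@integral_indic _ _ R leb1 setT measurableT _ mB) setIT.
rewrite [leLHS]e eg.
by rewrite -EFinM lee_fin ler_wpM2l ?subr_ge0// hr.
Qed.

Definition rect (a b c d : R) : set P := `[a, b]%classic `*` `[c, d]%classic.

Definition frame (a b c d r : R) : set P :=
  rect (a - r) (b + r) (c - r) (d + r) `\` (`]a, b[%classic `*` `]c, d[%classic).

Lemma measurable_frame a b c d r : measurable (frame a b c d r).
Proof. by apply: measurableD; exact: measurableX. Qed.

(** A cutoff of the rectangle glues the two fields into one. They interfere only in the frame, where
    the gradient of the cutoff is of order [1 / dl] while C has area [o(dl)]. *)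
Lemma rect_cut (C : set P) k (a b c d : R) : measurable C -> per_le C k -> a <= b -> c <= d ->
  (forall tau : R, 0 < tau -> exists2 r0 : R, 0 < r0 & forall r, 0 < r -> r < r0 ->
    J \1_(C `&` frame a b c d r) <= tau * r) ->
  forall f1 g1 d1 f2 g2 d2, test_field f1 g1 d1 -> test_field f2 g2 d2 ->
  J (fun z => \1_(C `&` rect a b c d) z * d1 z) + J (fun z => \1_(C `\` rect a b c d) z * d2 z) <= k.
Proof.
move=> mC hC ab cd hfr f1 g1 d1 f2 g2 d2 t1 t2.
have [_ _ bd1] := test_field_bcs t1; have [_ _ bd2] := test_field_bcs t2.
have [M [M0 dM _]] := bcs_common bd1 bd2.
apply/ler_addgt0Pl => e e0.
have M16 : 0 < 2 * M + 16 by lra.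
(* The interference is at most [(2 M + 16 / dl) * tau * dl], which for [dl <= 1] is at most
   [(2 M + 16) * tau]. *)
have [r0 r00 hr] := hfr (e / (2 * M + 16)) (divr_gt0 e0 M16).
pose dl := Num.min r0 1 / 2.
have dl0 : 0 < dl by rewrite divr_gt0// lt_min r00 ltr01.
have mr1 : Num.min r0 1 <= r0 by rewrite ge_min lexx.
have mr2 : Num.min r0 1 <= 1 by rewrite ge_min lexx orbT.
have dlr : dl < r0 by rewrite /dl; lra.
have dl1 : dl <= 1 by rewrite /dl; lra.
have [eta [p [q [ge bb i o [sp sq']]]]] := cutoff_rect ab cd dl0.
have e01 z : 0 <= eta z <= 1 by case: (bb z).
have t3 := test_field_mix t1 t2 ge e01.
set d3 := (X in test_field _ _ X) in t3.
have [_ _ bd3] := test_field_bcs t3.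
have mR : measurable (rect a b c d) by exact: measurableX.
have mI : measurable (C `&` rect a b c d) by exact: measurableI.
have mD : measurable (C `\` rect a b c d) by exact: measurableD.
have mF : measurable (C `&` frame a b c d dl) by apply: measurableI => //; exact: measurable_frame.
pose N := `|a| + `|b| + `|c| + `|d| + dl.
have FM z : (C `&` frame a b c d dl) z -> in_box N z.
  move=> [_ [[/= + +] _]]; rewrite !in_itv/= => /andP[x1 x2] /andP[y1 y2].
  have := ler_norm (- a); have := ler_norm b; have := ler_norm (- c); have := ler_norm d.
  rewrite !normrN => n1 n2 n3 n4.
  have := normr_ge0 a; have := normr_ge0 b; have := normr_ge0 c; have := normr_ge0 d.
  move=> m1 m2 m3 m4; clear - x1 x2 y1 y2 n1 n2 n3 n4 m1 m2 m3 m4 dl0.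
  by split; rewrite ler_norml /N; apply/andP; split; lra.
have bF := bcs_indic mF FM.
pose L := 2 * M + 16 / dl.
have L0 : 0 <= L by apply: addr_ge0; [rewrite mulr_ge0|rewrite divr_ge0// ltW].
have main := hC _ _ _ t3.
have small : L * J \1_(C `&` frame a b c d dl) <= e.
  apply: (@le_trans _ _ (L * (e / (2 * M + 16) * dl))); first by rewrite ler_wpM2l// hr.
  have -> : L * (e / (2 * M + 16) * dl) = (2 * M * dl + 16) * (e / (2 * M + 16)).
    by rewrite /L; field; rewrite !lt0r_neq0.
  have E0 : 0 <= e / (2 * M + 16) by rewrite divr_ge0// ltW.
  apply: (@le_trans _ _ ((2 * M + 16) * (e / (2 * M + 16)))).
    rewrite ler_wpM2r// lerD2r ler_piMr// mulr_ge0//.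
  by rewrite mulrC divfK// lt0r_neq0.
have bI := bcsI mI bd1; have bD := bcsI mD bd2; have bL := bcsZ L bF.
have b3 := bcsI mC bd3.
apply: le_trans (lerD small main).
rewrite -(JD bI bD) -(JZ _ bF) -(JD bL b3); apply: (le_J (bcsD bI bD) (bcsD bL b3)) => z.
have [Cz|nC] := pselect (C z); last first.
  have n1 : ~ (C `&` rect a b c d) z by case.
  have n2 : ~ (C `\` rect a b c d) z by case.
  have n3 : ~ (C `&` frame a b c d dl) z by case.
  by rewrite !indicE !memNset// !mul0r mulr0 addr0.
have [/mem_set Rz|nR] := pselect (rect a b c d z).
  have -> : \1_(C `&` rect a b c d) z = 1 :> R by rewrite indicE mem_set//; split => //; exact/set_mem.
  have -> : \1_(C `\` rect a b c d) z = 0 :> R by rewrite indicE memNset// => -[_]; apply; exact/set_mem.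
  have -> : \1_C z = 1 :> R by rewrite indicE mem_set.
  move/set_mem: Rz => [/=]; rewrite !in_itv/= => r1 r2.
  have [h1 h2 h3] := i z r1 r2.
  have -> : d3 z = d1 z by rewrite /d3 h1 h2 h3; ring.
  by rewrite mul0r addr0 mul1r lerDr mulr_ge0// indic_ge0.
have -> : \1_(C `&` rect a b c d) z = 0 :> R by rewrite indicE memNset// => -[].
have -> : \1_(C `\` rect a b c d) z = 1 :> R by rewrite indicE mem_set.
have -> : \1_C z = 1 :> R by rewrite indicE mem_set.
rewrite mul0r add0r !mul1r.
have [out|nout] := pselect (eta z != 0 \/ p z != 0 \/ q z != 0); last first.
  have h1 : eta z = 0 by apply/eqP; apply: contrapT => /negP h; apply: nout; left.
  have h2 : p z = 0 by apply/eqP; apply: contrapT => /negP h; apply: nout; right; left.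
  have h3 : q z = 0 by apply/eqP; apply: contrapT => /negP h; apply: nout; right; right.
  have -> : d3 z = d2 z by rewrite /d3 h1 h2 h3; ring.
  by rewrite lerDr mulr_ge0// indic_ge0.
have [u1 u2] := o z out.
have -> : \1_(C `&` frame a b c d dl) z = 1 :> R.
  rewrite indicE mem_set//; split => //; split; first by split; rewrite /= in_itv.
  move=> [/=]; rewrite !in_itv/= => /andP[x1 x2] /andP[y1 y2]; apply: nR.
  by split; rewrite /= in_itv/= !ltW.
rewrite mulr1 -lerBlDr; apply: (le_trans (ler_norm _)).
have -> : d2 z - d3 z = eta z * (d2 z - d1 z) - (p z * (f1 z - f2 z) + q z * (g1 z - g2 z)).
  by rewrite /d3; ring.
have bnd (f g dd : R * R -> R) : test_field f g dd -> `|f z| <= 1 /\ `|g z| <= 1.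
  move=> [p' [q' [r' [s' [M' [_ _ _ _ fg1]]]]]]; have := fg1 z.
  have := sqr_ge0 (f z); have := sqr_ge0 (g z) => h1 h2 h3; clear - h1 h2 h3.
  by split; rewrite -ler_sqr ?nnegrE// expr1n real_normK ?num_real//; lra.
have [a1 a2] := bnd _ _ _ t1; have [a3 a4] := bnd _ _ _ t2.
have [/andP[n0 n1] [hp hq]] := bb z.
have [m1 m2] := dM z.
have -> : L = 1 * (M + M) + (4 / dl * (1 + 1) + 4 / dl * (1 + 1)) by rewrite /L; field; exact: lt0r_neq0.
apply: (le_trans (ler_normB _ _)); apply: lerD.
  rewrite normrM (ger0_norm n0); apply: ler_pM => //.
  by apply: (le_trans (ler_normB _ _)); exact: lerD.
apply: (le_trans (ler_normD _ _)); apply: lerD; rewrite normrM; apply: ler_pM => //;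
  by apply: (le_trans (ler_normB _ _)); exact: lerD.
Qed.

End Rectangles.

(** * Closed representatives of indecomposable sets *)

Section ClosedRep.
Context {R : realType}.
Local Notation T := (measurableTypeR R).
Local Notation P := (T * T)%type.
Local Notation leb1 := (@lebesgue_measure R).
Local Notation lam2 := (@lam2 R).
Local Notation J := (@J R).
Local Notation lebm := (@lebesgue_measurable R).

Lemma lebm_rect (a b c d : R) : lebm (rect a b c d).
Proof. by apply: borel_lebesgue; exact: measurableX. Qed.

(** By [rect_cut] the part inside the rectangle is a piece, so it or the rest is null; the rest is
    not, the rectangle having less area than C. *)
Lemma rect_null (C : set (R * R)) (B : set P) (a b c d : R) : indecomposable C ->
  measurable B -> null_eq C B -> a <= b -> c <= d ->
  (forall tau : R, 0 < tau -> exists2 r0 : R, 0 < r0 & forall r, 0 < r -> r < r0 ->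
    J \1_(B `&` frame a b c d r) <= tau * r) ->
  (((b - a) * (d - c))%:E < leb2 C)%E -> leb2 (C `&` rect a b c d) = 0%E.
Proof.
move=> iC mB CB ab cd hfr area; have [/fpP fC _] := iC.
have hB : per_le B (per C) by apply/(Per_leP _ mB CB); rewrite -Per_fin.
have cut := rect_cut mB hB ab cd hfr.
set Q := rect a b c d in cut area *.
have mQ : measurable (Q : set P) by exact: measurableX.
have lC := fp_lebm fC.
have mI : measurable (B `&` Q : set P) by exact: measurableI.
have mD : measurable (B `\` Q : set P) by exact: measurableD.
have eI : null_eq (C `&` Q) (B `&` Q : set P) by apply: null_eqI => //; exact: null_eq_refl.
have eD : null_eq (C `\` Q) (B `\` Q : set P) by apply: null_eqD => //; exact: null_eq_refl.
have z0 (X : set P) : J (fun z => \1_X z * 0) = 0.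
  by rewrite (_ : (fun z => _) = fun=> 0) ?J0//; apply/funext => z; rewrite mulr0.
have [fI _] : fp (C `&` Q) /\ per (C `&` Q) <= per C.
  apply: fp_le; first by apply: lebmI => //; exact: lebm_rect.
  apply/(Per_leP _ mI eI) => f g dd tf.
  by have := cut _ _ _ _ _ _ tf (@test_field0 R); rewrite z0 addr0.
have [fD hD] : fp (C `\` Q) /\ per (C `\` Q) <= per C - per (C `&` Q).
  apply: fp_le; first by apply: lebmD => //; exact: lebm_rect.
  apply/(Per_leP _ mD eD) => f g dd tf.
  rewrite lerBrDl -lerBrDr -lee_fin -(Per_fin fI).
  apply/(Per_leP _ mI eI) => f1 g1 d1 t1.
  by rewrite lerBrDr; exact: cut t1 tf.
have CI : C `\` (C `&` Q) = C `\` Q by rewrite setDIr setDv set0U.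
have pI : piece C (C `&` Q).
  by split; rewrite ?CI//; lra.
have [//|] := (indecomposableP fC).1 iC _ pI.
rewrite CI => C0; exfalso; move: area; rewrite ltNge => /negP; apply.
have leQ : (leb2 Q <= ((b - a) * (d - c))%:E)%E.
  by rewrite leb2_borel// lam2X// !leb1_cc.
apply: le_trans leQ; apply: (@le_trans _ _ (leb2 (Q `|` (C `\` Q)))).
  by apply: le_leb2 => z Cz; have [?|?] := pselect (Q z); [left|right].
by apply: (le_trans (leb2U _ _)); rewrite C0 adde0.
Qed.

Lemma J_flip (X : set P) M : measurable X -> (forall z, X z -> in_box M z) ->
  J \1_(flip X : set P) = J \1_X.
Proof.
move=> mX XM; rewrite -(J_swap (bcs_indic mX XM)); by congr J.
Qed.

Definition band (p q c0 r : R) : set P := `]p, q]%classic `*` `]c0 - r, c0 + r]%classic.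

Lemma band_box p q c0 r (B : set P) z : (B `&` band p q c0 r) z -> in_box (`|p| + `|q| + `|c0| + `|r|) z.
Proof.
move=> [_ [/=]]; rewrite !in_itv/= => /andP[a1 a2] /andP[a3 a4].
have := ler_norm q; have := ler_norm (- p); rewrite normrN => b1 b2.
have := ler_norm c0; have := ler_norm (- c0); rewrite normrN => b3 b4.
have := normr_ge0 p; have := normr_ge0 q; have := normr_ge0 c0 => b5 b6 b7.
have := ler_norm r; have := normr_ge0 r => b8 b9.
by split; rewrite ler_norml; apply/andP; split; lra.
Qed.

Lemma measurable_band p q c0 r : measurable (band p q c0 r).
Proof. exact: measurableX. Qed.

Lemma frame_box (B : set P) (a b c d r : R) z : (B `&` frame a b c d r) z ->
  in_box (`|a - r| + `|b + r| + (`|c - r| + `|d + r|)) z.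
Proof.
move=> [_ [[/= + +] _]]; rewrite !in_itv/= => /andP[x1 x2] /andP[y1 y2].
have n1 := ler_norm (- (a - r)); have n2 := ler_norm (b + r).
have n3 := ler_norm (- (c - r)); have n4 := ler_norm (d + r).
rewrite !normrN in n1 n3.
have e1 := normr_ge0 (a - r); have e2 := normr_ge0 (b + r).
have e3 := normr_ge0 (c - r); have e4 := normr_ge0 (d + r).
by split; rewrite ler_norml; apply/andP; split; lra.
Qed.

(** Half-height [2 r] rather than r, because bands are open at their lower end while the frame is
    closed there. *)
Lemma frame_sub (p q p' q' a b c d r : R) z : 0 < r -> b + r <= q -> d + r <= q' -> p < a - r -> p' < c - r -> frame a b c d r z ->
  [\/ band p q c (2 * r) z, band p q d (2 * r) z, band p' q' a (2 * r) (swap_pair z) |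
      band p' q' b (2 * r) (swap_pair z)].
Proof.
move=> r0 bq dq pa pc [[/= + +] nin]; rewrite !in_itv/= => /andP[x1 x2] /andP[y1 y2].
have [xa|xa] := lerP z.1 a.
  by apply: Or43; split; rewrite /= in_itv/=; apply/andP; split; lra.
have [xb|xb] := lerP b z.1.
  by apply: Or44; split; rewrite /= in_itv/=; apply/andP; split; lra.
have [yc|yc] := lerP z.2 c.
  by apply: Or41; split; rewrite /= in_itv/=; apply/andP; split; lra.
have [yd|yd] := lerP d z.2.
  by apply: Or42; split; rewrite /= in_itv/=; apply/andP; split; lra.
by exfalso; apply: nin; split; rewrite /= in_itv/=; apply/andP; split.
Qed.

Lemma frame_bound (B : set P) (p q p' q' a b c d : R) (H V : set T) : measurable B ->
  p < a -> a <= b -> b < q -> p' < c -> c <= d -> d < q' -> measurable H -> measurable V ->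
  dense1 V a -> dense1 V b -> dense1 H c -> dense1 H d ->
  (forall y, H y -> len (slice B y) p q = 0) ->
  (forall x, V x -> len (slice (flip B : set P) x) p' q' = 0) ->
  forall tau : R, 0 < tau -> exists2 r0 : R, 0 < r0 & forall r, 0 < r -> r < r0 ->
    J \1_(B `&` frame a b c d r) <= tau * r.
Proof.
move=> mB pa ab bq pc cd dq mH mV Va Vb Hc Hd hH hV tau tau0.
have mfB := measurable_flip mB.
have pq : p <= q by lra. have pq' : p' <= q' by lra.
(* Each of the four bands contributes its length times [(tau / K) * (2 * r)]; together they give
   exactly [tau * r]. *)
pose K := 4 * ((q - p) + (q' - p')); have K0 : 0 < K by rewrite /K; lra.
have t0 : 0 < tau / K by rewrite divr_gt0.
have [r1 r10 h1] := band_bound mB pq mH Hc hH t0.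
have [r2 r20 h2] := band_bound mB pq mH Hd hH t0.
have [r3 r30 h3] := band_bound mfB pq' mV Va hV t0.
have [r4 r40 h4] := band_bound mfB pq' mV Vb hV t0.
pose m1 := Num.min (Num.min r1 r2) (Num.min r3 r4).
pose m2 := Num.min (Num.min (a - p) (q - b)) (Num.min (c - p') (q' - d)).
have m10 : 0 < m1 by rewrite !lt_min r10 r20 r30.
have m20 : 0 < m2 by rewrite !lt_min !subr_gt0 pa bq pc.
exists (Num.min m1 m2 / 2); first by rewrite divr_gt0// lt_min m10.
move=> r rp rr.
have {rr} : 2 * r < Num.min m1 m2 by lra.
rewrite !lt_min => /andP[/andP[/andP[k1 k2] /andP[k3 k4]] /andP[/andP[k5 k6] /andP[k7 k8]]].
have r2p : 0 < 2 * r by lra.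
have bqr : b + r <= q by lra.
have dqr : d + r <= q' by lra.
have par : p < a - r by lra.
have pcr : p' < c - r by lra.
pose X1 : set P := B `&` band p q c (2 * r); pose X2 : set P := B `&` band p q d (2 * r).
pose X3 : set P := flip B `&` band p' q' a (2 * r); pose X4 : set P := flip B `&` band p' q' b (2 * r).
have mX1 : measurable X1 by apply: measurableI => //; exact: measurable_band.
have mX2 : measurable X2 by apply: measurableI => //; exact: measurable_band.
have mX3 : measurable X3 by apply: measurableI => //; exact: measurable_band.
have mX4 : measurable X4 by apply: measurableI => //; exact: measurable_band.
have b1 := bcs_indic mX1 (@band_box p q c (2 * r) B).
have b2 := bcs_indic mX2 (@band_box p q d (2 * r) B).
have fbox c0 z : (flip (flip B `&` band p' q' c0 (2 * r)) : set P) z ->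
    in_box (`|p'| + `|q'| + `|c0| + `|2 * r|) z.
  by move=> /band_box[x1 x2]; split.
have b3 := bcs_indic (measurable_flip mX3) (@fbox a).
have b4 := bcs_indic (measurable_flip mX4) (@fbox b).
have J1 := h1 _ r2p k1; have J2 := h2 _ r2p k2; have J3 := h3 _ r2p k3; have J4 := h4 _ r2p k4.
rewrite -(J_flip mX3 (@band_box p' q' a (2 * r) (flip B))) in J3.
rewrite -(J_flip mX4 (@band_box p' q' b (2 * r) (flip B))) in J4.
have le1 : J \1_(B `&` frame a b c d r) <=
    (J \1_X1 + J \1_X2) + (J \1_(flip X3 : set P) + J \1_(flip X4 : set P)).
  rewrite -(JD b1 b2) -(JD b3 b4) -(JD (bcsD b1 b2) (bcsD b3 b4)).
  have mF : measurable (B `&` frame a b c d r) by apply: measurableI => //; exact: measurable_frame.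
  have ind1 (X : set P) z : X z -> \1_X z = 1 :> R by move=> Xz; rewrite indicE mem_set.
  have i1 := @indic_ge0 R _ X1; have i2 := @indic_ge0 R _ X2.
  have i3 := @indic_ge0 R _ (flip X3 : set P); have i4 := @indic_ge0 R _ (flip X4 : set P).
  apply: le_J.
  - exact: (bcs_indic mF (@frame_box B a b c d r)).
  - exact: bcsD (bcsD b1 b2) (bcsD b3 b4).
  move=> z; have [[Bz fz]|nz] := pselect ((B `&` frame a b c d r) z); last first.
    by rewrite [leLHS]indicE memNset// !addr_ge0.
  rewrite ind1; last by split.
  have Bz' : B (swap_pair (swap_pair z)) by case: (z) Bz.
  have p1 := addr_ge0 (i1 z) (i2 z); have p2 := addr_ge0 (i3 z) (i4 z).
  have [h|h|h|h] := frame_sub rp bqr dqr par pcr fz.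
  - by rewrite [\1_X1 z]ind1; [rewrite -addrA lerDl addr_ge0|split].
  - by rewrite [\1_X2 z]ind1; [rewrite [_ + 1]addrC -addrA lerDl addr_ge0|split].
  - by rewrite [\1_(flip X3 : set P) z]ind1; [rewrite addrCA lerDl addr_ge0|split].
  - by rewrite [\1_(flip X4 : set P) z]ind1; [rewrite addrA lerDr addr_ge0|split].
apply: (le_trans le1); apply: (le_trans (lerD (lerD J1 J2) (lerD J3 J4))).
rewrite le_eqVlt; apply/orP; left; apply/eqP; rewrite /K; field.
by apply: lt0r_neq0; clear - K0; move: K0; rewrite /K; lra.
Qed.

(** For almost every z off B, both coordinates are density points of sets of lines almost free of C
    near z. Such lines exist on either side of z, and the rectangle they bound satisfies
    [rect_null]. *)
Lemma null_neighbourhood (C : set (R * R)) (B : set P) : indecomposable C ->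
  measurable B -> null_eq C B -> (0 < leb2 C)%E -> exists X : set (R * R), leb2 X = 0%E /\
    forall z : R * R, ~ B z -> ~ X z -> exists a b c d : R,
      [/\ a < z.1 < b, c < z.2 < d & leb2 (C `&` rect a b c d) = 0%E].
Proof.
move=> iC mB CB C0; have [/fpP fC _] := iC.
have hB : per_le B (per C) by apply/(Per_leP _ mB CB); rewrite -Per_fin.
have mfB := measurable_flip mB.
have [X [mX X0 hX]] := horizontal_lines mB hB.
have [Y [mY Y0 hY]] := horizontal_lines mfB (per_le_flip mB hB).
have [m m0 mC] : exists2 m : R, 0 < m & (m%:E <= leb2 C)%E.
  case: (leb2 C) C0 => [m m0| |] //.
  - by exists m; rewrite ?lexx -?lte_fin.
  - by exists 1; rewrite ?leey.
exists (X `|` flip Y); split.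
  apply: leb2U0; first by rewrite leb2_borel.
  rewrite leb2_borel; last exact: measurable_flip.
  by rewrite lam2_flip.
move=> z nB nXY.
have [p [q [H [/andP[z1 z2] mH dH hH]]]] := hX z nB (fun h => nXY (or_introl h)).
have nB' : ~ (flip B : set P) (swap_pair z) by rewrite /flip /mkset; case: (z) nB.
have [p' [q' [V [/andP[z3 z4] mV dV hV]]]] := hY _ nB' (fun h => nXY (or_intror h)).
rewrite /= in z3 z4 dV.
(* The rectangle will have sides at most [2 e], so area at most [4 e^2 <= 4 e <= m / 2], less than
   the area of C. *)
have [e [e0 e1 em]] : exists e : R, [/\ 0 < e, e <= 1 & e <= m / 8].
  by exists (Num.min 1 (m / 8)); rewrite lt_min ltr01 divr_gt0// !ge_min !lexx orbT.
pose s := Num.min e (Num.min (z.1 - p) (q - z.1)).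
pose s' := Num.min e (Num.min (z.2 - p') (q' - z.2)).
have s0 : 0 < s by rewrite !lt_min e0 !subr_gt0 z1.
have s0' : 0 < s' by rewrite !lt_min e0 !subr_gt0 z3.
have [s1 s2 s3] : [/\ s <= e, s <= z.1 - p & s <= q - z.1].
  by rewrite /s !ge_min !lexx !orbT.
have [s4 s5 s6] : [/\ s' <= e, s' <= z.2 - p' & s' <= q' - z.2].
  by rewrite /s' !ge_min !lexx !orbT.
have [[b [Vb db /andP[b1 b2]]] [a [Va da /andP[a1 a2]]]] := dense1_pick mV dV s0.
have [[d [Hd dd /andP[d1 d2]]] [c [Hc dc /andP[c1 c2]]]] := dense1_pick mH dH s0'.
exists a, b, c, d; split; [by rewrite a2|by rewrite c2|].
have ab : a <= b := ltW (lt_trans a2 b1).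
have cd : c <= d := ltW (lt_trans c2 d1).
apply: (rect_null iC mB CB ab cd).
  have [pa bq pc dq] : [/\ p < a, b < q, p' < c & d < q'].
    by clear - a1 b2 c1 d2 s2 s3 s5 s6; split; lra.
  exact: (@frame_bound B p q p' q' a b c d H V).
apply: lt_le_trans mC; rewrite lte_fin.
have : (b - a) * (d - c) <= (2 * e) * (2 * e).
  by clear - a1 a2 b1 b2 c1 c2 d1 d2 s1 s4; apply: ler_pM; lra.
have : (2 * e) * (2 * e) <= 4 * e by clear - e0 e1; have := ltW e0; nra.
clear - em m0; lra.
Qed.

Lemma ratbox_open i : open (ratbox i : set (R * R)).
Proof.
rewrite (_ : ratbox i = (fst @^-1` ball (ratr i.1.1 : R) (ratr i.2)) `&` (snd @^-1` ball (ratr i.1.2 : R) (ratr i.2))).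
  apply: openI; apply: open_comp; try exact: ball_open.
    by move=> z _; exact: continuous_fst.
  by move=> z _; exact: continuous_snd.
by apply/seteqP; split => z [h1 h2]; split; rewrite /ball/= distrC.
Qed.

(** The measure theoretic support of C: remove every rational box that meets C in a null set.
    Countability makes the removed part of C null, and [null_neighbourhood] shows that almost every
    point off C is removed. *)
Lemma closed_representative (C : set (R * R)) : indecomposable C -> (0 < leb2 C)%E ->
  exists F, closed F /\ null_eq F C.
Proof.
move=> iC C0; have [/fpP fC _] := iC.
have [B [mB CB]] := ex_borel (fp_lebm fC).
have [X [X0 hX]] := null_neighbourhood iC mB CB C0.
pose box_of (n : nat) : set (R * R) := if unpickle n is Some i then ratbox i else set0.
pose U := \bigcup_(n in [set n | leb2 (C `&` box_of n) = 0%E]) box_of n.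
exists (~` U); split.
  apply: open_closedC; apply: bigcup_open => n _; rewrite /box_of.
  by case: (unpickle n) => [i|]; [exact: ratbox_open|exact: open0].
rewrite /null_eq; apply: (@leb2_sub0 _ _ ((C `&` U) `|` (X `|` (B `\` C)))).
  move=> z [[nU nC]|[Cz nnU]]; last by left; split => //; exact: contrapT.
  right; have [Bz|nB] := pselect (B z); first by right.
  left; apply: contrapT => nX; apply: nU.
  have [a [b [c [d [/andP[a1 b1] /andP[c1 d1] h]]]]] := hX z nB nX.
  pose e := Num.min (Num.min (z.1 - a) (b - z.1)) (Num.min (z.2 - c) (d - z.2)).
  have e0 : 0 < e by rewrite !lt_min !subr_gt0 a1 b1 c1.
  have [i [iz sub]] := ratbox_mem z e0.
  exists (pickle i); last by rewrite /box_of pickleK.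
  rewrite /= /box_of pickleK; apply: leb2_sub0 h => w [Cw /sub[w1 w2]]; split => //.
  move: w1 w2; rewrite !lt_min => /andP[/andP[u1 u2] _] /andP[_ /andP[u3 u4]].
  move: u1 u2 u3 u4; rewrite !ltr_norml => /andP[x1 x2] /andP[x3 x4] /andP[x5 x6] /andP[x7 x8].
  by clear - x1 x2 x3 x4 x5 x6 x7 x8; split; rewrite /= in_itv/=; apply/andP; split; lra.
apply: leb2U0.
  have h : leb2 (\bigcup_n (if `[< leb2 (C `&` box_of n) = 0%E >] then C `&` box_of n else set0)) = 0%E.
    by apply: leb2_bigcup0 => n; case: asboolP => // _; exact: leb20.
  apply: leb2_sub0 h => z [Cz [n /= hn bz]]; exists n => //.
  by case: asboolP.
apply: leb2U0 => //; apply: leb2_sub0 CB; exact: subsetUr.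
Qed.

End ClosedRep.

(** * The BV distance, and conclusion *)

Section Final.
Context {R : realType}.
Local Notation P := (measurableTypeR R * measurableTypeR R)%type.
Local Notation J := (@J R).
Local Notation lebm := (@lebesgue_measurable R).

(** Since U lies in E and F equals U almost everywhere, the difference of indicators is almost
    everywhere the indicator of [E \ U], and [total_var_ind] applies. *)
Lemma BVnorm_diff (E F U : set (R * R)) : lebm E -> null_eq F U -> U `<=` E -> fp (E `\` U) ->
  lebm F -> BVnorm (\1_E \- \1_F)%R = (leb2 (E `\` U) + Per (E `\` U))%E.
Proof.
move=> mE FU UE fD mF; have mD := fp_lebm fD; rewrite /BVnorm; congr (_ + _)%E.
  have eq_out z : ~ ((F `\` U) `|` (U `\` F)) z -> (\1_E \- \1_F)%R z = \1_(E `\` U) z :> R.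
    move=> nz; rewrite /= !indicE in_setD.
    have -> : (z \in F) = (z \in U).
      apply/idP/idP => /set_mem h; apply/mem_set; apply: contrapT => h'; apply: nz.
        by left.
      by right.
    have [Uz|nU] := boolP (z \in U); last by rewrite subr0 andbT.
    by rewrite (mem_set (UE _ (set_mem Uz))) subrr.
  transitivity (\int[leb2]_x (EFin \o (\1_(E `\` U : set (@lebplane R)) : @lebplane R -> R)) x)%E; last first.
    have := @integral_indic _ (@lebplane R) R leb2 setT measurableT (E `\` U : set (@lebplane R)) mD.
    by rewrite setIT.
  pose u (z : @lebplane R) : R := `|\1_(E : set (@lebplane R)) z - \1_(F : set (@lebplane R)) z|.
  have mi (X : set (@lebplane R)) : measurable X -> measurable_fun setT (\1_X : @lebplane R -> R).
    by move=> mX; exact: measurable_indic.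
  have m1 : measurable_fun setT (EFin \o u).
    apply/measurable_EFinP; apply: measurableT_comp; first exact: normr_measurable.
    by apply: measurable_funB; exact: mi.
  have m2 : measurable_fun setT (EFin \o (\1_(E `\` U : set (@lebplane R)) : @lebplane R -> R)).
    by apply/measurable_EFinP; exact: mi.
  have g1 (z : @lebplane R) : setT z -> (0 <= (EFin \o u) z)%E.
    by move=> _; rewrite /= lee_fin /u normr_ge0.
  have g2 (z : @lebplane R) : setT z ->
      (0 <= (EFin \o (\1_(E `\` U : set (@lebplane R)) : @lebplane R -> R)) z)%E.
    by move=> _; rewrite /= lee_fin; exact: indic_ge0.
  apply: (@ge0_ae_eq_integral _ (@lebplane R) R leb2 setT _ _ measurableT m1 m2 g1 g2).
  exists ((F `\` U) `|` (U `\` F)); split; [exact: null_lebesgue|exact: FU|].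
  move=> z /= h; apply: contrapT => nz; apply: h => _; congr EFin.
  by have := eq_out z nz; rewrite /u /= => ->; rewrite ger0_norm//; exact: indic_ge0.
have [B [mB DB]] := ex_borel mD.
rewrite (Per_borel mB DB); apply: (total_var_ind mB).
apply: leb2_sub0 (leb2U0 FU DB) => z /= h; apply: contrapT => /not_orP[n1 n2]; apply: h.
rewrite !indicE; have eF : (z \in F) = (z \in U).
  apply/idP/idP => /set_mem h; apply/mem_set; apply: contrapT => h'; apply: n1.
    by left.
  by right.
have eB : (z \in B) = (z \in E `\` U).
  apply/idP/idP => /set_mem h; apply/mem_set; apply: contrapT => h'; apply: n2.
    by right.
  by left.
rewrite eF eB in_setD; have [Uz|nU] := boolP (z \in U); last by rewrite subr0 andbT.
by rewrite (mem_set (UE _ (set_mem Uz))) subrr.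
Qed.

End Final.

Unset Implicit Arguments.
Set Strict Implicit.

(* MathComp-Analysis world.  Sets of finite perimeter are considered modulo null
   sets, so F being a subset of E is understood as F `\` E being null: if E is an
   open disc, no closed F included in E pointwise satisfies the other
   conclusions for small eps. *)
Theorem corollary2 (R : realType) (E : set (R * R))
    (hE : finite_perimeter E) (eps : R) (heps : 0 < eps) :
  exists F : set (R * R),
    [/\ closed F,
        leb2 (F `\` E) = 0%E,
        finitely_many_components F,
        hausdorff1 (mt_boundary F `\` mt_boundary E) = 0%E &
        (BVnorm (\1_E \- \1_F)%R < eps%:E)%E].
Proof.
have fE : fp E by exact/fpP.
(* The residue has perimeter [p < dl] and area at most [100 p^2]; as [p < 1], the sum is at most
   [101 p], below [eps]. *)
have [dl [dl0 dl1 dle]] : exists dl : R, [/\ 0 < dl, dl <= 1 & 102 * dl <= eps].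
  exists (Num.min 1 (eps / 102)); split.
  - by rewrite lt_min ltr01 divr_gt0.
  - by rewrite ge_min lexx.
  - by rewrite mulrC -ler_pdivlMr// ge_min lexx orbT.
have [C [N [hC tC C0 per_small leb_small]]] := greedy fE dl0.
set U := \bigcup_i C i in per_small leb_small.
(* Each piece is closed up separately; closedness survives because only the finitely many indices
   below N enter the union. *)
have rep i : exists G : set (R * R), closed G /\ null_eq G (C i).
  have [_ [->|[iC c0]]] := hC i; last exact: closed_representative.
  by exists set0; split; [exact: closed0|exact: null_eq_refl].
pose G i := sval (cid (rep i)).
have GP i : closed (G i) /\ null_eq (G i) (C i) := svalP (cid (rep i)).
pose F := \bigcup_(i in `I_N) G i.
have UN : U = \bigcup_(i in `I_N) C i.
  apply/seteqP; split => z [i _ Ciz]; exists i => //=.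
  by apply: contrapT => /negP; rewrite -leqNgt => /C0 Ci0; rewrite Ci0 in Ciz.
have pC i : piece E (C i) by have [] := hC i.
have [pU _] := piece_sum N fE pC tC; rewrite -UN in pU.
have [fU fD UE _] := pU.
have FU : null_eq F U.
  apply: leb2_sub0 (leb2_bigcup0 (fun i => (GP i).2)) => z [[[i iN Gz] nU]|[[i _ Cz] nF]]; exists i => //.
    by left; split => // Cz; apply: nU; exists i.
  right; split => // Gz; apply: nF; exists i => //=.
  by apply: contrapT => /negP; rewrite -leqNgt => /C0 Ci0; rewrite Ci0 in Cz.
have mF : lebesgue_measurable F by exact: lebm_null_eq (null_eq_sym FU) (fp_lebm fU).
exists F; split.
- by apply: closed_bigcup; [exact: finite_II|move=> i _; case: (GP i)].
- apply: leb2_sub0 FU => z [Fz nE]; left; split => // Uz; apply: nE; exact: UE.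
- exact: (finite_components fE hC tC C0 mF FU).
- exact: boundary_piece_null pU (null_eq_sym FU).
rewrite (BVnorm_diff (fp_lebm fE) FU UE fD mF) (Per_fin fD).
set p := per (E `\` U) in per_small leb_small *.
have p0 : 0 <= p by exact: per_ge0 (fp_lebm fD).
apply: (@le_lt_trans _ _ ((100 * p ^+ 2)%:E + p%:E)%E); first exact: leeD.
rewrite -EFinD lte_fin; nra.
Qed.
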